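(* Let $\omega:\mathbb{R}_+\to\mathbb{R}_+$ be a modulus of continuity. Then there exists a bounded smooth convex domain $\Omega\subset\mathbb{R}^2$ such that the unique minimizer $u$ of $$L[w;\Omega]=\int_\Omega\Bigl(\tfrac12|Dw-x|^2+w\Bigr)\,dx$$ over the class $\mathcal{K}(\Omega)$ of convex nonnegative functions $w:\overline\Omega\to\mathbb{R}$ satisfies $$\sup_{x\neq y\in\Omega}\frac{|Du(x)-Du(y)|}{\omega(|x-y|)}=+\infty.$$
   Context: A domain is an open set; smooth means that $\partial\Omega$ is $C^\infty$. $\mathcal{K}(\Omega):=\{w:\overline\Omega\to\mathbb{R} : w \text{ convex and nonnegative}\}$. The functional is strictly convex, so the minimizer is unique (as a function on $\Omega$), and $u\in C^1(\Omega)$. A modulus of continuity is understood in the usual sense: a nondecreasing function with $\omega(r)>0$ for $r>0$ and $\omega(r)\to0$ as $r\to0^+$. *)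

(* Defs.v *)
From HB Require Import structures.
From mathcomp Require Import all_boot all_order all_algebra.
From mathcomp Require Import all_classical all_reals all_analysis.

Set Implicit Arguments.
Unset Strict Implicit.
Unset Printing Implicit Defensive.

Import Order.TTheory GRing.Theory Num.Theory.
Import numFieldNormedType.Exports.

Local Open Scope classical_set_scope.
Local Open Scope ring_scope.

(* The canonical norm of the product [R * R] is the sup norm, so the Euclidean
   norm of the plane is written out. *)
Definition enorm (R : realType) (x : R * R) : R :=
  Num.sqrt (x.1 ^+ 2 + x.2 ^+ 2).

(* Only the values of [omega] on [0, +oo[ are meaningful. *)
Definition modulus_of_continuity (R : realType) (omega : R -> R) : Prop :=
  [/\ forall r : R, 0 <= r -> 0 <= omega r,
      forall r s : R, 0 <= r -> r <= s -> omega r <= omega s,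
      forall r : R, 0 < r -> 0 < omega r
    & omega r @[r --> 0^'+] --> 0].

Definition smooth_function (R : realType) (g : R -> R) : Prop :=
  forall (n : nat) (t : R), derivable (derive1n n g) t 1.

(* In a suitable orthonormal frame [((e.2, - e.1), e)], [Omega] is near each of
   its boundary points the strict epigraph of a smooth function. *)
Definition smooth_boundary (R : realType) (Omega : set (R * R)) : Prop :=
  forall p : R * R, (closure Omega `\` Omega°) p ->
  exists (e : R * R) (g : R -> R),
    [/\ enorm e = 1,
        smooth_function g
      & \forall x \near p,
          Omega x <-> g (x.1 * e.2 - x.2 * e.1) < x.1 * e.1 + x.2 * e.2].

Definition bounded_smooth_convex_domain (R : realType) (Omega : set (R * R)) :
    Prop :=
  [/\ open Omega, bounded_set Omega, convex_set Omega
    & smooth_boundary Omega].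

(* A convex function on an open set is differentiable almost everywhere; the
   value of ['D_] at the other points does not affect the integral below. *)
Definition gradient (R : realType) (w : R * R -> R) (x : R * R) : R * R :=
  ('D_(1, 0) w x, 'D_(0, 1) w x).

(* Functions on the closure of [Omega] are represented by functions on the
   plane whose values outside of the closure are irrelevant. *)
Definition admissible (R : realType) (Omega : set (R * R)) (w : R * R -> R) :
    Prop :=
  convex_function (closure Omega) w /\
  (forall x : R * R, closure Omega x -> 0 <= w x).

Definition energy (R : realType) (Omega : set (R * R)) (w : R * R -> R) :
    \bar R :=
  (\int[lebesgue_measure \x lebesgue_measure]_(x in Omega)
     (2^-1 * enorm (gradient w x - x) ^+ 2 + w x)%:E)%E.

Definition is_minimizer (R : realType) (Omega : set (R * R)) (u : R * R -> R) :
    Prop :=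
  admissible Omega u /\
  (forall w : R * R -> R,
     admissible Omega w -> (energy Omega u <= energy Omega w)%E).

Definition C1_on (R : realType) (Omega : set (R * R)) (u : R * R -> R) : Prop :=
  forall x : R * R, Omega x ->
    differentiable u x /\ {for x, continuous (gradient u)}.

(* Main.v *)
(* Minimizing sequences have Cauchy gradients in [L^2] by the parallelogram law, which gives the unique minimizer [u];
   it is C1 because at a kink one could gain energy by raising [u] to a steeper affine function on the section that
   this function cuts off.  The domain is a rounded diamond, symmetric in [x_2], translated far to the right; its
   left side is flat on a segment of length [L] and then bends away extremely slowly, as prescribed by [omega].
   The distance [a] to the axis is the area divided by [L], so that the natural Neumann slope
   [s - area(x_1 > s) / length(chord at s)] vanishes at the left side [s = a].  Near that side [u] depends only on
   [x_1] and [u_1] is a truncation of this slope.  When the length of the chord at [s] is [L + 2 g] the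
   slope is of order [a g / L] while [omega (s - a) <= g ^ 2], so that the quotient of the two is unbounded. *)
From HB Require Import structures.
Require Import Defs.
From mathcomp Require Import all_boot all_order all_algebra.
From mathcomp Require Import ring lra.
From mathcomp Require Import all_classical all_reals all_analysis.
From mathcomp Require Import measurable_realfun.
Set Implicit Arguments.
Unset Strict Implicit.
Unset Printing Implicit Defensive.
Import Order.TTheory GRing.Theory Num.Theory.
Import numFieldNormedType.Exports.
Local Open Scope classical_set_scope.
Local Open Scope ring_scope.

(** Competitors are finite on the closure, so a minimizer on the open set has to be bounded before
    it can be extended: u (p + (1 - d) (x - p)) as a competitor bounds the energy in a boundary
    layer of relative width d by a multiple of d, hence the increments of u along rays. Competitors
    are also convex, so u near the left side does not come from an Euler equation. It suffices to
    find one vertical chord on which u is constant with positive slope across it: a function of x_1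
    on its left and u plus a constant on its right glue to a convex function, and comparison with it
    determines u_1. The chord exists because a is huge. If u were nonconstant on all nearby chords,
    sections cut off over short intervals of the axis would stay inside the domain, and the
    quantitative form of the kink argument would bound the growth rate of u_1 along the axis by 96 *
    16, whereas energy comparisons force a rise from 3/5 a to 9/10 a over a distance below 3/10. In
    place of the gradient stand one-sided partial derivatives, which exist everywhere and agree off
    a null set. *)

(** * Convex functions of one variable and their one-sided derivatives *)

Definition cvx1 (R : realType) (I : set R) (g : R -> R) : Prop :=
  forall x y z, I x -> I z -> x < y -> y < z ->
    (z - x) * g y <= (z - y) * g x + (y - x) * g z.

(* [lra] is slow in large contexts, so it is first tried on the goal alone, then with the comparisons only. *)
Ltac clear_noncomparisons := repeat match goal with H : ?T |- _ =>
    lazymatch type of T with Prop =>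
      lazymatch T with
      | is_true (@Order.le ring_display _ _ _) => fail
      | is_true (@Order.lt ring_display _ _ _) => fail
      | @eq (_ -> _) _ _ => clear H
      | @eq (extended _) _ _ => clear H
      | @eq _ _ _ => fail
      | _ => clear H
      end
    end end.

Ltac plra := first [by clear; lra | clear_noncomparisons; lra | lra].

(* The right derivative of a convex function, as a limit of a sequence so
   that its measurability is immediate. *)
Definition rd (R : realType) (g : R -> R) (x : R) : R :=
  limn (fun n => n.+1%:R * (g (x + n.+1%:R^-1) - g x)).

Lemma invSn_small (R : realType) (e : R) : 0 < e ->
  \forall n \near \oo, (n.+1%:R^-1 : R) < e.
Proof.
move=> e0; near=> n.
rewrite invf_plt ?posrE//.
near: n; exists (Num.bound (e^-1)) => // n /= hn.
apply: (@lt_trans _ _ (Num.bound e^-1)%:R).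
  by apply: archi_boundP; rewrite ltW ?invr_gt0.
by rewrite ltr_nat ltnS.
Unshelve. all: by end_near. Qed.

(** Chord slopes increase with the right end, so the sequence is squeezed between the infimum of the
    slopes to the right of x and any single one of them. Slopes to the left of x are lower bounds of
    the same set, which gives the last clause. *)
Lemma rd_spec (R : realType) (I : set R) (g : R -> R) (x : R) :
  open I -> is_interval I -> cvx1 I g -> I x ->
  [/\ (fun n => n.+1%:R * (g (x + n.+1%:R^-1) - g x)) @ \oo --> rd g x,
      forall y, I y -> x < y -> rd g x * (y - x) <= g y - g x &
      forall y, I y -> y < x -> g x - g y <= rd g x * (x - y)].
Proof.
move=> oI iI cg Ix.
have [e e0 Ie] : exists2 e : R, 0 < e & forall y, `|x - y| < e -> I y.
  by have /nbhs_ballP[e /= e0 he] := oI _ Ix; exists e => // y; exact: he.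
pose S := [set s : R | exists y, [/\ I y, x < y & s = (g y - g x) / (y - x)]].
have lbl y : I y -> y < x -> lbound S ((g x - g y) / (x - y)).
  move=> Iy yx _ [z [Iz xz ->]].
  have := cg _ _ _ Iy Iz yx xz.
  rewrite ler_pdivrMr ?subr_gt0// mulrAC ler_pdivlMr ?subr_gt0//.
  by move=> h; nra.
have S0 : S !=set0.
  exists ((g (x + e / 2) - g x) / (x + e / 2 - x)); exists (x + e / 2); split => //.
    by apply: Ie; rewrite opprD addrA subrr sub0r normrN gtr0_norm; plra.
  by rewrite ltrDl; plra.
have Il : I (x - e / 2).
  by apply: Ie; rewrite opprB addrCA subrr addr0 gtr0_norm; plra.
have lS : has_lbound S by exists ((g x - g (x - e/2)) / (x - (x - e/2))); apply: lbl => //; plra.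
have hS : has_inf S by [].
have cv : (fun n => n.+1%:R * (g (x + n.+1%:R^-1) - g x)) @ \oo --> inf S.
  apply/cvgrPdist_lt => d d0.
  have [_ [y [Iy xy ->]] ysm] := inf_adherent d0 hS.
  near=> n.
  have n0 : (0:R) < n.+1%:R^-1 by rewrite invr_gt0.
  have ne : (n.+1%:R^-1 : R) < e by near: n; exact: invSn_small.
  have ny : (n.+1%:R^-1 : R) < y - x by near: n; apply: invSn_small; plra.
  set t := (n.+1%:R^-1 : R) in n0 ne ny *.
  have -> : n.+1%:R = t^-1 by rewrite /t invrK.
  have It : I (x + t) by apply: Ie; rewrite opprD addrA subrr sub0r normrN gtr0_norm.
  have h1 : inf S <= t^-1 * (g (x + t) - g x).
    apply: ge_inf => //; exists (x + t); split => //; first plra.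
    by rewrite mulrC addrAC subrr add0r.
  have h2 : t^-1 * (g (x + t) - g x) <= (g y - g x) / (y - x).
    have := cg x (x + t) y Ix Iy; rewrite ltrDl n0 => /(_ isT) /(_ ltac:(plra)) h.
    rewrite ler_pdivlMr ?subr_gt0// -mulrA ler_pdivrMl//. nra.
  rewrite ler0_norm ?subr_le0//; plra.
have rdE : rd g x = inf S by rewrite /rd; apply/cvg_lim.
rewrite rdE; split => // y Iy.
  move=> xy; rewrite -ler_pdivlMr ?subr_gt0//; apply: ge_inf => //.
  by exists y.
move=> yx; rewrite -ler_pdivrMr ?subr_gt0//.
by apply: lb_le_inf => //; exact: lbl.
Unshelve. all: by end_near. Qed.

Lemma le_div2n (R : realType) (x C : R) : (forall n, x <= C / 2 ^+ n) -> x <= 0.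
Proof.
move=> h; rewrite leNgt; apply/negP => x0.
have C0 : 0 < C by have := h 0%N; rewrite expr0 divr1; plra.
have [n hn] : exists n : nat, C / x < 2 ^+ n.
  exists (Num.bound (C / x)).
  apply: (@lt_trans _ _ (Num.bound (C / x))%:R); first by apply: archi_boundP; rewrite divr_ge0 // ltW.
  by rewrite -natrX ltr_nat ltn_expl.
have := h n; rewrite leNgt => /negP; apply.
by rewrite ltr_pdivrMr ?exprn_gt0 // mulrC -ltr_pdivrMr.
Qed.

Lemma bounded_integrable_oc (R : realType) (K : R -> R) (a b M : R) :
  measurable_fun `]a, b] K -> (forall x, a < x <= b -> `|K x| <= M) ->
  (@lebesgue_measure R).-integrable `]a, b] (EFin \o K).
Proof.
move=> mK KM; apply: measurable_bounded_integrable => //=.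
  by rewrite lebesgue_measure_itv /=; case: ifP => _; rewrite ?ltry // -EFinB ltry.
exists M; split; first exact: num_real.
 by move=> M' MM' x /=; rewrite in_itv/= => xab; apply: le_trans (KM _ xab) (ltW _).
Qed.

Lemma Rintegral_oc_split (R : realType) (K : R -> R) (a b c : R) :
  a <= c -> c <= b -> (@lebesgue_measure R).-integrable `]a, b] (EFin \o K) ->
  \int[@lebesgue_measure R]_(x in `]a, b]) K x =
  \int[@lebesgue_measure R]_(x in `]a, c]) K x + \int[@lebesgue_measure R]_(x in `]c, b]) K x.
Proof.
move=> ac cb iK.
have E : [set` `]a, b]] = [set` `]a, c]] `|` [set` `]c, b]] :> set R.
  apply/seteqP; split => x /=; rewrite !in_itv/=.
    by move=> /andP[ax xb]; case: (leP x c) => h; [left|right]; rewrite ?ax ?xb //.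
  by case=> /andP[h1 h2]; plra.
rewrite E Rintegral_setU //=; first by rewrite -E.
apply/disj_setPS => x /= []; rewrite !in_itv/= => /andP[_ h1] /andP[h2 _]; plra.
Qed.

(* Bisection: the error is additive in the interval and quadratic in its length. *)
Lemma FTC_bv (R : realType) (K F T : R -> R) (a b : R) :
  a <= b -> measurable_fun `]a, b] K ->
  (forall x z, a < x -> x <= z -> z <= b -> `|K z - K x| <= T z - T x) ->
  (forall x z, a <= x -> x <= z -> z <= b -> T x <= T z) ->
  (forall x z, a <= x -> x < z -> z <= b -> `|F z - F x - K z * (z - x)| <= (T z - T x) * (z - x)) ->
  (@lebesgue_measure R).-integrable `]a, b] (EFin \o K) /\
  \int[@lebesgue_measure R]_(x in `]a, b]) K x = F b - F a.
Proof.
move=> ab mK KT Tm FK.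
have iK : (@lebesgue_measure R).-integrable `]a, b] (EFin \o K).
  apply: (@bounded_integrable_oc _ _ _ _ (`|K b| + (T b - T a))) => // x /andP[ax xb].
  have h1 := KT x b ax xb (lexx b).
  have h2 := Tm a x (lexx a) (ltW ax) xb.
  have := ler_normB (K b) (K b - K x).
  rewrite opprB addrC subrK; plra.
split => //.
pose J x z := \int[@lebesgue_measure R]_(y in `]x, z]) K y.
suff H n : forall x z, a <= x -> x <= z -> z <= b -> `|J x z - (F z - F x)| <=
    2 * (T z - T x) * (z - x) / 2 ^+ n.
  apply/eqP; rewrite -subr_eq0 -normr_le0; apply: (@le_div2n _ _ (2 * (T b - T a) * (b - a))) => n.
  exact: H.
elim: n => [|n IH] x z ax xz zb.
  rewrite expr0 divr1.
  have iK' : (@lebesgue_measure R).-integrable `]x, z] (EFin \o K).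
    apply: integrableS iK => //= y /=; rewrite !in_itv/= => /andP[h1 h2].
    by rewrite (le_lt_trans ax h1) (le_trans h2 zb).
  move: xz; rewrite le_eqVlt => /predU1P[<-|xz].
    by rewrite /J set_itv_ge ?bnd_simp ?ltxx// Rintegral_set0 !subrr mulr0 normr0.
  have -> : J x z - (F z - F x) =
     \int[@lebesgue_measure R]_(y in `]x, z]) (K y - K z) - (F z - F x - K z * (z - x)).
    rewrite /J RintegralB //=; last first.
      apply: (@bounded_integrable_oc _ _ _ _ `|K z|) => //.
    rewrite Rintegral_cst //= lebesgue_measure_itv /= lte_fin xz /=.
    by ring.
  have h1 := FK x z ax xz zb.
  suff h2 : `|\int[@lebesgue_measure R]_(y in `]x, z]) (K y - K z)| <= (T z - T x) * (z - x).
    apply: le_trans (ler_normB _ _) _; apply: le_trans (lerD h2 h1) _.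
    by rewrite le_eqVlt; apply/orP; left; apply/eqP; ring.
  have iKz : (@lebesgue_measure R).-integrable `]x, z] (EFin \o (fun y => K y - K z)).
    apply: (@bounded_integrable_oc _ _ _ _ (T z - T x)).
      by apply: measurable_funB => //; apply/measurable_EFinP; exact: (measurable_int _ iK').
    move=> y /andP[xy yz]; rewrite distrC; apply: le_trans (KT _ _ _ yz zb) _.
      exact: le_lt_trans ax xy.
    by rewrite lerD2l lerN2; apply: Tm => //; [exact: ltW|exact: le_trans zb].
  apply: le_trans (le_normr_Rintegral _ iKz) _ => //.
  have -> : (T z - T x) * (z - x) = \int[@lebesgue_measure R]_(y in `]x, z]) (T z - T x).
    by rewrite Rintegral_cst //= lebesgue_measure_itv /= lte_fin xz /=.
  apply: le_Rintegral => //.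
    exact: integrable_norm.
    by apply: (@bounded_integrable_oc _ _ _ _ `|T z - T x|).
  move=> y /=; rewrite in_itv/= => /andP[xy yz]; rewrite distrC; apply: le_trans (KT _ _ _ yz zb) _.
    exact: le_lt_trans ax xy.
  by rewrite lerD2l lerN2; apply: Tm => //; [exact: ltW|exact: le_trans zb].
have iK' : (@lebesgue_measure R).-integrable `]x, z] (EFin \o K).
  apply: integrableS iK => //= y /=; rewrite !in_itv/= => /andP[h1 h2].
  by rewrite (le_lt_trans ax h1) (le_trans h2 zb).
set m := (x + z) / 2.
have xm : x <= m by rewrite /m; plra.
have mz : m <= z by rewrite /m; plra.
have -> : J x z = J x m + J m z by exact: (Rintegral_oc_split xm mz iK').
have h1 := IH x m ax xm (le_trans mz zb).
have h2 := IH m z (le_trans ax xm) mz zb.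
move: (J x m) (J m z) h1 h2 => A B h1 h2.
have -> : A + B - (F z - F x) = (A - (F m - F x)) + (B - (F z - F m)) by ring.
apply: le_trans (ler_normD _ _) _; apply: le_trans (lerD h1 h2) _.
rewrite exprS invfM.
have -> : m - x = (z - x) / 2 by rewrite /m; field.
have -> : z - m = (z - x) / 2 by rewrite /m; field.
set e := (2 ^+ n)^-1.
by rewrite le_eqVlt; apply/orP; left; apply/eqP; field.
Qed.

Lemma monotone_measurable_cc (R : realType) (f : R -> R) (a b : R) :
  a <= b ->
  (forall x z, a <= x -> x <= z -> z <= b -> f x <= f z) -> measurable_fun `]a, b] f.
Proof.
move=> ab fm.
pose f' x := f (Num.min (Num.max x a) b).
have mf' : measurable_fun `]a, b] f'.
  apply: measurable_funTS; apply: nondecreasing_measurable => // x y xy; apply: fm.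
  - by rewrite le_min le_max lexx orbT ab.
  - by rewrite le_min ge_min ge_min lexx orbT andbT ge_max !le_max xy lexx !orbT.
  - by rewrite ge_min lexx orbT.
apply: eq_measurable_fun mf' => x; rewrite inE /= in_itv/= => /andP[ax xb].
by rewrite /f' max_l ?ltW// min_l.
Qed.

(** An arbitrary selection of subgradients: monotonicity and integration are proved once for all
    selections and then apply to the right and to the left derivative. *)
Definition subgrad (R : realType) (I : set R) (g K : R -> R) : Prop :=
  forall x y, I x -> I y -> g x + K x * (y - x) <= g y.

Lemma rd_subgrad (R : realType) (I : set R) (g : R -> R) :
  open I -> is_interval I -> cvx1 I g -> subgrad I g (rd g).
Proof.
move=> oI iI cg x y Ix Iy; have [_ h1 h2] := rd_spec oI iI cg Ix.
case: (ltgtP x y) => [xy|yx|->]; last by rewrite subrr mulr0 addr0.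
  by have := h1 _ Iy xy; plra.
by have := h2 _ Iy yx; plra.
Qed.

Lemma sub_mono (R : realType) (I : set R) (g K : R -> R) (x y : R) :
  subgrad I g K -> I x -> I y -> x <= y -> K x <= K y.
Proof.
move=> sK Ix Iy; rewrite le_eqVlt => /predU1P[->//|xy].
have := sK _ _ Ix Iy; have := sK _ _ Iy Ix => h1 h2.
by rewrite -(ler_pM2r (x := y - x)) ?subr_gt0 //; plra.
Qed.

Lemma sub_measurable1 (R : realType) (I : set R) (g K : R -> R) (a b : R) :
  is_interval I -> subgrad I g K -> I a -> I b -> a <= b -> measurable_fun `]a, b] K.
Proof.
move=> iI sK Ia Ib ab; apply: monotone_measurable_cc => // x z ax xz zb.
by apply: (sub_mono sK _ _ xz); apply: (iI a b) => //; apply/andP; split; plra.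
Qed.

(** A selection of subgradients is nondecreasing, so it serves as its own variation function in
    [FTC_bv]; the inequalities at the two ends of an interval bound the remainder by the oscillation
    of K times the length. *)
Lemma sub_FTC (R : realType) (I : set R) (g K : R -> R) (a b : R) :
  is_interval I -> subgrad I g K -> I a -> I b -> a <= b ->
  (@lebesgue_measure R).-integrable `]a, b] (EFin \o K) /\
  \int[@lebesgue_measure R]_(x in `]a, b]) K x = g b - g a.
Proof.
move=> iI sK Ia Ib ab.
have Iab x : a <= x -> x <= b -> I x by move=> ax xb; apply: (iI a b) => //; rewrite ax xb.
apply: (@FTC_bv _ _ _ K) => //.
- exact: (sub_measurable1 iI sK Ia Ib ab).
- move=> x z ax xz zb; rewrite ger0_norm // subr_ge0.
  by apply: (sub_mono sK _ _ xz); apply: Iab; plra.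
- move=> x z ax xz zb.
  by apply: (sub_mono sK _ _ xz); apply: Iab; plra.
- move=> x z ax xz zb.
  have Ix : I x by apply: Iab; plra.
  have Iz : I z by apply: Iab; plra.
  have h1 := sK _ _ Ix Iz; have h2 := sK _ _ Iz Ix.
  by rewrite mulrBl ler_norml; apply/andP; split; plra.
Qed.

Lemma rd_mono (R : realType) (I : set R) (g : R -> R) (x y : R) :
  open I -> is_interval I -> cvx1 I g -> I x -> I y -> x <= y -> rd g x <= rd g y.
Proof. by move=> oI iI cg; apply: sub_mono (rd_subgrad oI iI cg). Qed.

Lemma rd_measurable1 (R : realType) (I : set R) (g : R -> R) (a b : R) :
  open I -> is_interval I -> cvx1 I g -> I a -> I b -> a <= b ->
  measurable_fun `]a, b] (rd g).
Proof. by move=> oI iI cg; apply: sub_measurable1 (rd_subgrad oI iI cg). Qed.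

Lemma rd_FTC (R : realType) (I : set R) (g : R -> R) (a b : R) :
  open I -> is_interval I -> cvx1 I g -> I a -> I b -> a <= b ->
  (@lebesgue_measure R).-integrable `]a, b] (EFin \o rd g) /\
  \int[@lebesgue_measure R]_(x in `]a, b]) rd g x = g b - g a.
Proof. by move=> oI iI cg; apply: sub_FTC (rd_subgrad oI iI cg). Qed.

Lemma rd_bound (R : realType) (I : set R) (g : R -> R) (a b B x y : R) :
  open I -> is_interval I -> cvx1 I g -> I a -> I b ->
  - B <= rd g a -> rd g b <= B -> a <= x -> x <= y -> y <= b ->
  `|rd g x| <= B /\ `|g y - g x| <= B * (y - x).
Proof.
move=> oI iI cg Ia Ib Ba Bb ax xy yb.
have Iab z : a <= z -> z <= b -> I z by move=> az zb; apply: (iI a b) => //; rewrite az zb.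
have Ix : I x by apply: Iab; plra.
have Iy : I y by apply: Iab; plra.
have h1 : rd g a <= rd g x by exact: (rd_mono oI iI cg).
have h2 : rd g x <= rd g y by exact: (rd_mono oI iI cg).
have h3 : rd g y <= rd g b by exact: (rd_mono oI iI cg).
split; first by rewrite ler_norml; apply/andP; split; plra.
move: xy; rewrite le_eqVlt => /predU1P[<-|xy]; first by rewrite !subrr mulr0 normr0.
have [_ k1 _] := rd_spec oI iI cg Ix.
have [_ _ k2] := rd_spec oI iI cg Iy.
have := k1 _ Iy xy; have := k2 _ Ix xy.
rewrite ler_norml => ? ?; apply/andP; split; nra.
Qed.

Lemma cvx1_integrable (R : realType) (I : set R) (g : R -> R) (a b : R) :
  open I -> is_interval I -> cvx1 I g -> I a -> I b -> a <= b ->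
  (@lebesgue_measure R).-integrable `]a, b] (EFin \o g).
Proof.
move=> oI iI cg Ia Ib ab.
pose B : R := `|rd g a| + `|rd g b|.
have Ba : - B <= rd g a by rewrite /B; have := ler_norm (- rd g a); rewrite normrN; have := normr_ge0 (rd g b); plra.
have Bb : rd g b <= B by rewrite /B; have := ler_norm (rd g b); have := normr_ge0 (rd g a); plra.
have H x y : a <= x -> x <= y -> y <= b -> `|g y - g x| <= B * (y - x).
  by move=> ax xy yb; have [] := rd_bound oI iI cg Ia Ib Ba Bb ax xy yb.
have B0 : 0 <= B by rewrite addr_ge0.
apply: (@bounded_integrable_oc _ _ _ _ (`|g a| + B * (b - a))).
  have : measurable_fun `]a, b] (fun x => (g x + B * x) + (- B) * x).
    apply: measurable_funD; last exact: measurable_funM.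
    apply: monotone_measurable_cc => // x z ax xz zb.
    have := H x z ax xz zb; rewrite ler_norml => /andP[h _]; plra.
  by apply: eq_measurable_fun => x _; ring.
move=> x /andP[ax xb]; have := H a x (lexx a) (ltW ax) xb => h.
have := ler_normD (g a) (g x - g a); rewrite [g a + _]addrC subrK => h2.
have : B * (x - a) <= B * (b - a) by rewrite ler_wpM2l// lerD2r.
plra.
Qed.

(** The primitive [(c - x) * g x] need not be convex, which is why [FTC_bv] is stated for bounded
    variation: [M * rd g x + 2 * B * x] controls the oscillation of its derivative. The formula
    later turns the mixed term of the chord estimate into boundary values and an integral of g. *)
Lemma rd_IBP (R : realType) (I : set R) (g : R -> R) (a b c : R) :
  open I -> is_interval I -> cvx1 I g -> I a -> I b -> a <= b ->
  (@lebesgue_measure R).-integrable `]a, b] (EFin \o (fun x => (c - x) * rd g x)) /\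
  \int[@lebesgue_measure R]_(x in `]a, b]) ((c - x) * rd g x) =
  (c - b) * g b - (c - a) * g a + \int[@lebesgue_measure R]_(x in `]a, b]) g x.
Proof.
move=> oI iI cg Ia Ib ab.
have Iab z : a <= z -> z <= b -> I z by move=> az zb; apply: (iI a b) => //; rewrite az zb.
pose B : R := `|rd g a| + `|rd g b|.
have Ba : - B <= rd g a by rewrite /B; have := ler_norm (- rd g a); rewrite normrN; have := normr_ge0 (rd g b); plra.
have Bb : rd g b <= B by rewrite /B; have := ler_norm (rd g b); have := normr_ge0 (rd g a); plra.
have H x y := @rd_bound _ _ _ a b B x y oI iI cg Ia Ib Ba Bb.
have B0 : 0 <= B by rewrite addr_ge0.
pose M : R := `|c - a| + `|c - b|.
have HM x : a <= x -> x <= b -> `|c - x| <= M.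
  move=> ax xb; rewrite /M; have := ler_norm (c - a); have := ler_norm (- (c - b)).
  rewrite normrN => h1 h2; have := normr_ge0 (c - a); have := normr_ge0 (c - b).
  by rewrite ler_norml => ? ?; apply/andP; split; plra.
have M0 : 0 <= M by rewrite addr_ge0.
have mrd := rd_measurable1 oI iI cg Ia Ib ab.
have ig := cvx1_integrable oI iI cg Ia Ib ab.
have mg : measurable_fun `]a, b] g by apply/measurable_EFinP; exact: (measurable_int _ ig).
have mcx : measurable_fun `]a, b] (fun x : R => c - x) by exact: measurable_funB.
have ir : (@lebesgue_measure R).-integrable `]a, b] (EFin \o (fun x => (c - x) * rd g x)).
  apply: (@bounded_integrable_oc _ _ _ _ (M * B)).
    exact: measurable_funM.
  move=> x /andP[ax xb]; rewrite normrM ler_pM //.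
    by apply: HM => //; exact: ltW.
  by have [] := H x x (ltW ax) (lexx x) xb.
split => //.
have [_ E] : (@lebesgue_measure R).-integrable `]a, b] (EFin \o (fun x => (c - x) * rd g x - g x)) /\
  \int[@lebesgue_measure R]_(x in `]a, b]) ((c - x) * rd g x - g x) =
  (c - b) * g b - (c - a) * g a.
  apply: (@FTC_bv R _ (fun x => (c - x) * g x) (fun x => M * rd g x + 2 * B * x)) => //.
  - by apply: measurable_funB => //; exact: measurable_funM.
  - move=> x z ax xz zb.
    have [r1 r2] := H x z (ltW ax) xz zb.
    have h0 : rd g x <= rd g z.
      by apply: (rd_mono oI iI cg _ _ xz); apply: Iab; plra.
    have hM := HM z (le_trans (ltW ax) xz) zb.
    have -> : (c - z) * rd g z - g z - ((c - x) * rd g x - g x) =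
      (c - z) * (rd g z - rd g x) - ((z - x) * rd g x + (g z - g x)) by ring.
    apply: le_trans (ler_normB _ _) _.
    have k1 : `|(c - z) * (rd g z - rd g x)| <= M * (rd g z - rd g x).
      by rewrite normrM (ger0_norm (x := rd g z - rd g x)) ?subr_ge0// ler_wpM2r// subr_ge0.
    have k2 : `|(z - x) * rd g x| <= B * (z - x).
      by rewrite normrM mulrC (ger0_norm (x := z - x)) ?subr_ge0// ler_wpM2r// subr_ge0.
    have k3 := ler_normD ((z - x) * rd g x) (g z - g x).
    plra.
  - move=> x z ax xz zb.
    have h0 : rd g x <= rd g z.
      by apply: (rd_mono oI iI cg _ _ xz); apply: Iab; plra.
    nra.
  - move=> x z ax xz zb.
    have Ix : I x by apply: Iab; plra.
    have Iz : I z by apply: Iab; plra.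
    have [r1 r2] := H x z ax (ltW xz) zb.
    have h0 : rd g x <= rd g z by apply: (rd_mono oI iI cg _ _ (ltW xz)).
    have [_ q1 _] := rd_spec oI iI cg Ix.
    have [_ _ q2] := rd_spec oI iI cg Iz.
    have hM := HM z (le_trans ax (ltW xz)) zb.
    have -> : (c - z) * g z - (c - x) * g x - ((c - z) * rd g z - g z) * (z - x) =
       (c - z) * (g z - g x - rd g z * (z - x)) + (z - x) * (g z - g x) by ring.
    apply: le_trans (ler_normD _ _) _.
    have k1 : `|(c - z) * (g z - g x - rd g z * (z - x))| <= M * ((rd g z - rd g x) * (z - x)).
      rewrite normrM ler_pM //.
      have := q1 _ Iz xz; have := q2 _ Ix xz.
      by rewrite ler_norml => ? ?; apply/andP; split; nra.
    have k2 : `|(z - x) * (g z - g x)| <= (z - x) * (B * (z - x)).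
      by rewrite normrM; apply: ler_pM => //; rewrite ger0_norm //; plra.
    have zx0 : 0 <= z - x by plra.
    have k3 : 0 <= (z - x) * (B * (z - x)) by rewrite !mulr_ge0.
    nra.
rewrite RintegralB // in E.
by rewrite -E; ring.
Qed.

(* The left derivative, by reflection. *)
Definition ld (R : realType) (g : R -> R) (x : R) : R := - rd (fun y => g (- y)) (- x).

Lemma cvx1N (R : realType) (I : set R) (g : R -> R) :
  open I -> is_interval I -> cvx1 I g ->
  [/\ open (-%R @^-1` I), is_interval (-%R @^-1` I) & cvx1 (-%R @^-1` I) (fun y => g (- y))].
Proof.
move=> oI iI cg; split.
- by apply: open_comp => // x _; exact: opp_continuous.
- by move=> x y Ix Iy z /andP[xz zy]; apply: (iI (- y) (- x)) => //; rewrite !lerN2 xz zy.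
- move=> x y z Ix Iz xy yz; have := cg (- z) (- y) (- x) Iz Ix.
  rewrite !ltrN2 => /(_ yz xy); plra.
Qed.

Lemma ld_spec (R : realType) (I : set R) (g : R -> R) (x : R) :
  open I -> is_interval I -> cvx1 I g -> I x ->
  (fun n => n.+1%:R * (g x - g (x - n.+1%:R^-1))) @ \oo --> ld g x.
Proof.
move=> oI iI cg Ix; have [oI' iI' cg'] := cvx1N oI iI cg.
have Ix' : (-%R @^-1` I) (- x) by rewrite /= opprK.
have [h _ _] := rd_spec oI' iI' cg' Ix'.
rewrite /ld.
rewrite (_ : (fun n => _) =
  (- (fun n : nat => n.+1%:R * (g (- (- x + n.+1%:R^-1)) - g (- - x))))).
  exact: cvgN h.
apply/funext => n.
rewrite -[RHS]/(- (n.+1%:R * (g (- (- x + n.+1%:R^-1)) - g (- - x)))).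
by rewrite -mulrN opprB (opprK x) (opprD (- x)) opprK.
Qed.

Lemma ld_subgrad (R : realType) (I : set R) (g : R -> R) :
  open I -> is_interval I -> cvx1 I g -> subgrad I g (ld g).
Proof.
move=> oI iI cg x y Ix Iy; have [oI' iI' cg'] := cvx1N oI iI cg.
have := rd_subgrad oI' iI' cg' (x := - x) (y := - y).
rewrite /= !opprK => /(_ Ix Iy); rewrite /ld; plra.
Qed.

Lemma le_ld_rd (R : realType) (I : set R) (g : R -> R) (x : R) :
  open I -> is_interval I -> cvx1 I g -> I x -> ld g x <= rd g x.
Proof.
move=> oI iI cg Ix.
have [e e0 Ie] : exists2 e : R, 0 < e & forall y, `|x - y| < e -> I y.
  by have /nbhs_ballP[e /= e0 he] := oI _ Ix; exists e => // y; exact: he.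
apply: (cvgr_to_le (ld_spec oI iI cg Ix)); near=> n.
have n0 : (0:R) < n.+1%:R^-1 by rewrite invr_gt0.
have ne : (n.+1%:R^-1 : R) < e by near: n; exact: invSn_small.
have In : I (x - n.+1%:R^-1) by apply: Ie; rewrite opprB addrCA subrr addr0 gtr0_norm.
have [_ _ h] := rd_spec oI iI cg Ix.
have := h _ In; rewrite ltrBlDr ltrDl n0 => /(_ isT).
by rewrite opprB addrCA subrr addr0 -ler_pdivrMr // invrK mulrC.
Unshelve. all: by end_near. Qed.

Lemma ld_eq_rd_derive (R : realType) (I : set R) (g : R -> R) (x : R) :
  open I -> is_interval I -> cvx1 I g -> I x -> ld g x = rd g x ->
  is_derive x 1 g (rd g x).
Proof.
move=> oI iI cg Ix E.
have [e e0 Ie] : exists2 e : R, 0 < e & forall y, `|x - y| < e -> I y.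
  by have /nbhs_ballP[e /= e0 he] := oI _ Ix; exists e => // y; exact: he.
suff cv : h^-1 *: ((g \o shift x) (h *: 1) - g x) @[h --> 0^'] --> rd g x.
  apply: DeriveDef; first by apply/cvg_ex; exists (rd g x).
  by apply/cvg_lim.
have [c1 h1 h2] := rd_spec oI iI cg Ix.
have c2 := ld_spec oI iI cg Ix; rewrite E in c2.
have sL := ld_subgrad oI iI cg.
apply/cvgrPdist_lt => d d0.
(* One step t on each side is enough: by convexity every quotient with a smaller step lies between
   the quotient of step t and [rd g x]. *)
have [N [N0 Ne Nd1 Nd2]] : exists N : nat, [/\ (0:R) < N.+1%:R^-1, (N.+1%:R^-1 : R) < e,
   N.+1%:R * (g (x + N.+1%:R^-1) - g x) < rd g x + d &
   rd g x - d < N.+1%:R * (g x - g (x - N.+1%:R^-1))].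
  near \oo => N; exists N; split.
  - by rewrite invr_gt0.
  - by near: N; exact: invSn_small.
  - by near: N; apply: (cvgr_lt _ c1); rewrite ltrDl.
  - by near: N; apply: (cvgr_gt _ c2); rewrite ltrBlDr ltrDl.
set t := (N.+1%:R^-1 : R) in N0 Ne Nd1 Nd2.
have tE : N.+1%:R = t^-1 by rewrite /t invrK.
rewrite tE ltr_pdivrMl // in Nd1; rewrite tE ltr_pdivlMl // in Nd2.
have It : I (x + t) by apply: Ie; rewrite opprD addrA subrr sub0r normrN gtr0_norm.
have It' : I (x - t) by apply: Ie; rewrite opprB addrCA subrr addr0 gtr0_norm.
near=> h.
have h0 : h != 0 by near: h; exact: nbhs_dnbhs_neq.
have ht : `|h| < t.
  by near: h; exact: dnbhs0_lt.
rewrite /= [h *: 1]mulr1 [h + x]addrC.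
have Ih : I (x + h) by apply: Ie; rewrite opprD addrA subrr sub0r normrN; plra.
have [hp|hn|h00] := ltgtP h 0; last by rewrite h00 eqxx in h0.
- rewrite ltr0_norm // in ht.
  have k1 : rd g x - d < h^-1 * (g (x + h) - g x).
    rewrite ltr_ndivlMl //.
    have := cg (x - t) (x + h) x It' Ix; rewrite ltrD2l => /(_ ltac:(plra)) /(_ ltac:(plra)).
    nra.
  have k2 : h^-1 * (g (x + h) - g x) <= rd g x.
    rewrite ler_ndivrMl //.
    by have := h2 _ Ih; rewrite gtrDl hp => /(_ isT); plra.
  by rewrite ltr_norml /=; apply/andP; split; rewrite /GRing.scale /=; plra.
- rewrite gtr0_norm // in ht.
  have k1 : h^-1 * (g (x + h) - g x) < rd g x + d.
    rewrite ltr_pdivrMl //.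
    have := cg x (x + h) (x + t) Ix It; rewrite ltrD2l ltrDl => /(_ ltac:(plra)) /(_ ltac:(plra)).
    nra.
  have k2 : rd g x <= h^-1 * (g (x + h) - g x).
    rewrite ler_pdivlMl //.
    by have := h1 _ Ih; rewrite ltrDl hn => /(_ isT); plra.
  by rewrite ltr_norml /=; apply/andP; split; rewrite /GRing.scale /=; plra.
Unshelve. all: by end_near. Qed.

Lemma derivable_ld_eq_rd (R : realType) (I : set R) (g : R -> R) (x : R) :
  open I -> is_interval I -> cvx1 I g -> I x -> derivable g x 1 -> ld g x = rd g x.
Proof.
move=> oI iI cg Ix dg.
have [e e0 Ie] : exists2 e : R, 0 < e & forall y, `|x - y| < e -> I y.
  by have /nbhs_ballP[e /= e0 he] := oI _ Ix; exists e => // y; exact: he.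
apply/eqP; rewrite eq_le (le_ld_rd oI iI cg Ix) /=; apply/ler_addgt0Pr => d d0.
have sR := rd_subgrad oI iI cg; have sL := ld_subgrad oI iI cg.
have d2 : 0 < d / 2 by plra.
have /cvgrPdist_lt/(_ _ d2)/nbhs_ballP[r /= r0 hr] := dg.
pose t := Num.min (r / 2) (e / 2).
have t0 : 0 < t by rewrite lt_min; apply/andP; split; plra.
have [tr te] : t < r /\ t < e.
  by split; rewrite gt_min; apply/orP; [left|right]; plra.
have It : I (x + t) by apply: Ie; rewrite opprD addrA subrr sub0r normrN gtr0_norm.
have It' : I (x - t) by apply: Ie; rewrite opprB addrCA subrr addr0 gtr0_norm.
have b1 : ball (0:R) r t by rewrite /ball /= sub0r normrN gtr0_norm.
have b2 : ball (0:R) r (- t) by rewrite /ball /= sub0r normrN normrN gtr0_norm.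
have := hr _ b1 (lt0r_neq0 t0).
have := hr _ b2; rewrite oppr_eq0 => /(_ (lt0r_neq0 t0)) /=.
set D := lim _; rewrite [t *: 1]mulr1 [(- t) *: 1]mulr1 !ltr_norml ![_ + x]addrC /GRing.scale /=.
have E1 : (- t)^-1 * (g (x - t) - g x) = t^-1 * (g x - g (x - t)).
  by rewrite invrN mulNr -mulrN opprB.
rewrite E1.
have k1 := sR _ _ Ix It; have k2 := sL _ _ Ix It'.
have j1 : rd g x <= t^-1 * (g (x + t) - g x) by rewrite ler_pdivlMl //; plra.
have j2 : t^-1 * (g x - g (x - t)) <= ld g x by rewrite ler_pdivrMl //; plra.
move=> /andP[_ ?] /andP[? _]; plra.
Qed.

Lemma cvgn_ex (R : realType) (u : nat -> R) :
  (forall e, 0 < e -> exists l, \forall n \near \oo, `|l - u n| < e) -> cvgn u.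
Proof.
move=> h; apply: cauchy_cvg; apply: cauchy_exP => e e0.
have [l hl] := h _ e0; exists l.
by near=> n; near: n; apply: filterS hl => n; rewrite -ball_normE.
Unshelve. all: by end_near. Qed.

(** Where g has no kink, a fixed step t makes both difference quotients of g nearly equal to
    [rd g x]. For large n they bracket [rd (g_ n) x], up to the errors of the values at the three
    points x - t, x, x + t. *)
Lemma cvx1_cvg_rd (R : realType) (I : set R) (g_ : nat -> R -> R) (g : R -> R) (x : R) :
  open I -> is_interval I -> (forall n, cvx1 I (g_ n)) -> cvx1 I g ->
  (forall y, I y -> g_ ^~ y @ \oo --> g y) -> I x -> ld g x = rd g x ->
  (fun n => rd (g_ n) x) @ \oo --> rd g x.
Proof.
move=> oI iI cg_ cg hc Ix E.
have [e e0 Ie] : exists2 e : R, 0 < e & forall y, `|x - y| < e -> I y.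
  by have /nbhs_ballP[e /= e0 he] := oI _ Ix; exists e => // y; exact: he.
have [c1 h1 h2] := rd_spec oI iI cg Ix.
have c2 := ld_spec oI iI cg Ix; rewrite E in c2.
apply/cvgrPdist_lt => d d0.
have [N [N0 Ne Nd1 Nd2]] : exists N : nat, [/\ (0:R) < N.+1%:R^-1, (N.+1%:R^-1 : R) < e,
   N.+1%:R * (g (x + N.+1%:R^-1) - g x) < rd g x + d / 2 &
   rd g x - d / 2 < N.+1%:R * (g x - g (x - N.+1%:R^-1))].
  near \oo => N; exists N; split.
  - by rewrite invr_gt0.
  - by near: N; exact: invSn_small.
  - by near: N; apply: (cvgr_lt _ c1); plra.
  - by near: N; apply: (cvgr_gt _ c2); plra.
set t := (N.+1%:R^-1 : R) in N0 Ne Nd1 Nd2.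
have tE : N.+1%:R = t^-1 by rewrite /t invrK.
rewrite tE ltr_pdivrMl // in Nd1; rewrite tE ltr_pdivlMl // in Nd2.
have It : I (x + t) by apply: Ie; rewrite opprD addrA subrr sub0r normrN gtr0_norm.
have It' : I (x - t) by apply: Ie; rewrite opprB addrCA subrr addr0 gtr0_norm.
have dt : 0 < d * t / 8 by rewrite divr_gt0 // mulr_gt0.
near=> n.
have k1 : `|g (x + t) - g_ n (x + t)| < d * t / 8.
  by near: n; move/cvgrPdist_lt: (hc _ It); apply.
have k2 : `|g (x - t) - g_ n (x - t)| < d * t / 8.
  by near: n; move/cvgrPdist_lt: (hc _ It'); apply.
have k3 : `|g x - g_ n x| < d * t / 8.
  by near: n; move/cvgrPdist_lt: (hc _ Ix); apply.
have s := rd_subgrad oI iI (cg_ n).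
have s1 := s _ _ Ix It; have s2 := s _ _ Ix It'.
move: k1 k2 k3; rewrite !ltr_norml => /andP[? ?] /andP[? ?] /andP[? ?].
have u1 : rd (g_ n) x < rd g x + d by rewrite -(ltr_pM2r N0); plra.
have u2 : rd g x - d < rd (g_ n) x by rewrite -(ltr_pM2r N0); plra.
by apply/andP; split; plra.
Unshelve. all: by end_near. Qed.

(** Convergence at two points on each side of x bounds the slopes near x uniformly in n. The
    resulting uniform Lipschitz bound carries convergence from a nearby point z over to x. *)
Lemma cvx1_cvg_dense (R : realType) (I : set R) (g_ : nat -> R -> R) (x : R) :
  open I -> is_interval I -> (forall n, cvx1 I (g_ n)) ->
  (forall y e, I y -> 0 < e -> exists d, [/\ I d, y < d, d < y + e & cvgn (g_ ^~ d)]) ->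
  I x -> cvgn (g_ ^~ x).
Proof.
move=> oI iI cg_ hd Ix.
have [e e0 Ie] : exists2 e : R, 0 < e & forall y, `|x - y| < e -> I y.
  by have /nbhs_ballP[e /= e0 he] := oI _ Ix; exists e => // y; exact: he.
have e4 : 0 < e / 8 by plra.
have Iu k : `|k| < 8 -> I (x + k * (e / 8)).
  move=> k4; apply: Ie; rewrite opprD addrA subrr sub0r normrN normrM (gtr0_norm e4).
  by rewrite -(ltr_pM2r e4) in k4; plra.
have [p0 [Ip0 p0l p0u c0]] := hd _ _ (Iu (-4) ltac:(rewrite normrN ger0_norm; plra)) e4.
have [p1 [Ip1 p1l p1u c1]] := hd _ _ (Iu (-2) ltac:(rewrite normrN ger0_norm; plra)) e4.
have [q1 [Iq1 q1l q1u cq1]] := hd _ _ (Iu 2 ltac:(rewrite ger0_norm; plra)) e4.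
have [q0 [Iq0 q0l q0u cq0]] := hd _ _ (Iu 4 ltac:(rewrite ger0_norm; plra)) e4.
pose A n := (g_ n p1 - g_ n p0) / (p1 - p0).
pose B n := (g_ n q0 - g_ n q1) / (q0 - q1).
have cA : cvgn A by apply: is_cvgMl; apply: is_cvgB.
have cB : cvgn B by apply: is_cvgMl; apply: is_cvgB.
pose C := `|limn A| + `|limn B| + 1.
have slope n z : x < z -> z < q1 -> A n * (z - x) <= g_ n z - g_ n x /\ g_ n z - g_ n x <= B n * (z - x).
  move=> xz zq; have Iz : I z by apply: (iI x q1) => //; apply/andP; split; plra.
  have s := rd_subgrad oI iI (cg_ n).
  have m1 : rd (g_ n) p1 <= rd (g_ n) x by apply: (sub_mono s) => //; plra.
  have m2 : rd (g_ n) z <= rd (g_ n) q1 by apply: (sub_mono s) => //; plra.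
  have a1 : A n <= rd (g_ n) p1.
    by rewrite /A ler_pdivrMr; [have := s _ _ Ip1 Ip0|]; plra.
  have a2 : rd (g_ n) q1 <= B n.
    by rewrite /B ler_pdivlMr; [have := s _ _ Iq1 Iq0|]; plra.
  have b1 := s _ _ Ix Iz; have b2 := s _ _ Iz Ix.
  have xz0 : 0 <= z - x by plra.
  have := ler_wpM2r xz0 (le_trans a1 m1); have := ler_wpM2r xz0 (le_trans m2 a2).
  by split; plra.
apply: cvgn_ex => d d0.
have C0 : 0 < C by rewrite /C; have := normr_ge0 (limn A); have := normr_ge0 (limn B); plra.
have r0 : 0 < Num.min (e / 8) (d / (4 * C)).
  by rewrite lt_min e4 /=; rewrite divr_gt0 // mulr_gt0.
have [z [Iz xz zr cz]] := hd _ _ Ix r0.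
exists (limn (g_ ^~ z)); near=> n.
have zr' : z - x < e / 8 /\ z - x < d / (4 * C).
  by apply/andP; rewrite -lt_min ltrBlDl.
have nA : `|limn A - A n| < 1 by near: n; move/cvgrPdist_lt: cA; apply.
have nB : `|limn B - B n| < 1 by near: n; move/cvgrPdist_lt: cB; apply.
have nz : `|limn (g_ ^~ z) - g_ n z| < d / 2.
  by near: n; move/cvgrPdist_lt: cz; apply; plra.
have zq1 : z < q1 by case: zr' => h _; clear - h q1l e4; lra.
have [s1 s2] := slope n z xz zq1.
have CA : - C <= A n.
  rewrite /C; move: nA; rewrite ltr_norml => /andP[_].
  have := ler_norm (- limn A); rewrite normrN; have := normr_ge0 (limn B).
  by set a := limn A; set b := limn B; clearbody a b; move: (A n) => An; clear; lra.
have CB : B n <= C.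
  rewrite /C; move: nB; rewrite ltr_norml => /andP[+ _].
  have := ler_norm (limn B); have := normr_ge0 (limn A).
  by set a := limn A; set b := limn B; clearbody a b; move: (B n) => Bn; clear; lra.
have xz0 : 0 <= z - x by rewrite subr_ge0 ltW.
have k1 := ler_wpM2r xz0 CA; have k2 := ler_wpM2r xz0 CB.
have [_ h] := zr'; rewrite ltr_pdivlMr ?mulr_gt0 // in h.
have {}h : C * (z - x) < d / 4 by clear - h; lra.
rewrite mulNr in k1; move: nz; rewrite !ltr_norml => /andP[n1 n2].
by clear - s1 s2 k1 k2 h n1 n2; apply/andP; split; plra.
Unshelve. all: by end_near. Qed.

Lemma le_subr_Rintegral (R : realType) (I : set R) (g h : R -> R) (a b : R) :
  open I -> is_interval I -> cvx1 I g -> cvx1 I h -> I a -> I b -> a <= b ->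
  (`|(g b - h b) - (g a - h a)|%:E <=
  \int[@lebesgue_measure R]_(x in `]a, b]) `|rd g x - rd h x|%:E)%E.
Proof.
move=> oI iI cg ch Ia Ib ab.
have [ig Eg] := rd_FTC oI iI cg Ia Ib ab.
have [ih Eh] := rd_FTC oI iI ch Ia Ib ab.
have igh : (@lebesgue_measure R).-integrable `]a, b] (EFin \o (fun x => rd g x - rd h x)).
  by apply: eq_integrable (integrableB _ ig ih) => //.
have -> : g b - h b - (g a - h a) = \int[@lebesgue_measure R]_(x in `]a, b]) (rd g x - rd h x).
  by rewrite RintegralB // Eg Eh; ring.
rewrite EFin_normr_Rintegral //.
by apply: le_abse_integral => //; exact: (measurable_int _ igh).
Qed.

(** * Measurability, convexity and sections in the plane *)

(** The sigma-algebra of the plane is the product one, so an open set is written as a countable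
    union of squares with rational centres. *)
Lemma open_measurable2 (R : realType) (A : set (R * R)) : open A -> measurable A.
Proof.
move=> oA.
pose D (p q : rat) (n : nat) : set (R * R) :=
  [set z | `|ratr p - z.1| < n.+1%:R^-1 /\ `|ratr q - z.2| < n.+1%:R^-1].
have mD p q n : measurable (D p q n).
  have -> : D p q n = (ball (ratr p : R) n.+1%:R^-1) `*` (ball (ratr q : R) n.+1%:R^-1).
    by apply/seteqP; split.
  by apply: measurableX; exact: measurable_ball.
have -> : A = \bigcup_p \bigcup_q \bigcup_n (if `[< D p q n `<=` A >] then D p q n else set0).
  apply/seteqP; split => [z Az|z [p _ [q _ [n _]]]]; last first.
    by case: ifPn => // /asboolP h; exact: h.
  have /nbhs_ballP[e /= e0 he] := oA _ Az.
  have e2 : 0 < e / 2 by plra.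
  near \oo => n.
  have n0 : (0:R) < n.+1%:R^-1 by rewrite invr_gt0.
  have ne : (n.+1%:R^-1 : R) < e / 2 by near: n; exact: invSn_small.
  set d := (n.+1%:R^-1 : R) in n0 ne.
  have [p pz] : exists p : rat, `|ratr p - z.1| < d.
    have : z.1 - d < z.1 + d by plra.
    move=> /rat_in_itvoo[p]; rewrite in_itv /= => /andP[h1 h2].
    by exists p; rewrite ltr_norml; apply/andP; split; plra.
  have [q qz] : exists q : rat, `|ratr q - z.2| < d.
    have : z.2 - d < z.2 + d by plra.
    move=> /rat_in_itvoo[q]; rewrite in_itv /= => /andP[h1 h2].
    by exists q; rewrite ltr_norml; apply/andP; split; plra.
  exists p => //; exists q => //; exists n => //.
  case: ifPn => [_|/asboolP]; first by split.
  case=> y [/= y1 y2]; apply: he; split => /=; rewrite /ball /=.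
    by move: pz y1; rewrite -/d !ltr_norml => /andP[? ?] /andP[? ?]; apply/andP; split; plra.
  by move: qz y2; rewrite -/d !ltr_norml => /andP[? ?] /andP[? ?]; apply/andP; split; plra.
apply: bigcupT_measurable_rat => p; apply: bigcupT_measurable_rat => q.
apply: bigcup_measurable => n _; case: ifPn => // _.
Unshelve. all: by end_near. Qed.

Lemma measurable_fun_gtr (d : measure_display) (T : measurableType d) (R : realType)
  (D : set T) (f : T -> R) :
  (forall r, measurable (D `&` [set x | r < f x])) -> measurable_fun D f.
Proof.
move=> h mD; apply: (measurability _ (RGenOInfty.measurableE R)) => //.
move=> _ [_ [r ->] <-]; have := h r; congr measurable.
by apply/seteqP; split => x /=; rewrite in_itv /= andbT.
Qed.

(** Convexity in coordinates, with the weight t on the second point. [convex_set] and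
    [convex_function] are reached from here through [convexE]. *)
Definition cset2 (R : realType) (A : set (R * R)) : Prop :=
  forall x y t, A x -> A y -> 0 <= t -> t <= 1 ->
    A (x.1 + t * (y.1 - x.1), x.2 + t * (y.2 - x.2)).

Definition cvx2 (R : realType) (A : set (R * R)) (w : R * R -> R) : Prop :=
  forall x y t, A x -> A y -> 0 <= t -> t <= 1 ->
    w (x.1 + t * (y.1 - x.1), x.2 + t * (y.2 - x.2)) <= w x + t * (w y - w x).

Definition row (R : realType) (A : set (R * R)) (t : R) : set R := [set s | A (s, t)].
Definition col (R : realType) (A : set (R * R)) (s : R) : set R := [set t | A (s, t)].

Lemma row_open (R : realType) (A : set (R * R)) t : open A -> open (row A t).
Proof.
move=> oA; rewrite openE => s As; have /nbhs_ballP[e /= e0 he] := oA _ As.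
by apply/nbhs_ballP; exists e => //= y sy; apply: he; split => //=; exact: ballxx.
Qed.

Lemma col_open (R : realType) (A : set (R * R)) t : open A -> open (col A t).
Proof.
move=> oA; rewrite openE => s As; have /nbhs_ballP[e /= e0 he] := oA _ As.
by apply/nbhs_ballP; exists e => //= y sy; apply: he; split => //=; exact: ballxx.
Qed.

Lemma row_itv (R : realType) (A : set (R * R)) t : cset2 A -> is_interval (row A t).
Proof.
move=> cA x y Ax Ay z /andP[xz zy].
have [xy|xy] := ltP x y; last first.
  by have -> : z = x by apply/eqP; rewrite eq_le xz (le_trans zy xy).
have := cA _ _ ((z - x) / (y - x)) Ax Ay.
rewrite /= divfK ?subr_eq0 ?gt_eqF // subrr mulr0 addr0 [x + _]addrC subrK /row /=.
by apply; [rewrite divr_ge0; plra|rewrite ler_pdivrMr; plra].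
Qed.

Lemma col_itv (R : realType) (A : set (R * R)) t : cset2 A -> is_interval (col A t).
Proof.
move=> cA x y Ax Ay z /andP[xz zy].
have [xy|xy] := ltP x y; last first.
  by have -> : z = x by apply/eqP; rewrite eq_le xz (le_trans zy xy).
have := cA _ _ ((z - x) / (y - x)) Ax Ay.
rewrite /= divfK ?subr_eq0 ?gt_eqF // subrr mulr0 addr0 [x + _]addrC subrK /col /=.
by apply; [rewrite divr_ge0; plra|rewrite ler_pdivrMr; plra].
Qed.

Lemma row_cvx (R : realType) (A : set (R * R)) w t : cvx2 A w -> cvx1 (row A t) (fun s => w (s, t)).
Proof.
move=> cw x y z Ax Az xy yz.
have zx : 0 < z - x by plra.
have := cw _ _ ((y - x) / (z - x)) Ax Az.
rewrite /= divfK ?gt_eqF // subrr mulr0 addr0 [x + _]addrC subrK.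
move=> h; have {}h := h ltac:(rewrite divr_ge0; plra) ltac:(rewrite ler_pdivrMr; plra).
have := ler_wpM2l (ltW zx) h.
rewrite mulrDr mulrA [(z - x) * (_ / _)]mulrCA mulfV ?gt_eqF // mulr1 => {}h; plra.
Qed.

Lemma col_cvx (R : realType) (A : set (R * R)) w t : cvx2 A w -> cvx1 (col A t) (fun s => w (t, s)).
Proof.
move=> cw x y z Ax Az xy yz.
have zx : 0 < z - x by plra.
have := cw _ _ ((y - x) / (z - x)) Ax Az.
rewrite /= divfK ?gt_eqF // subrr mulr0 addr0 [x + _]addrC subrK.
move=> h; have {}h := h ltac:(rewrite divr_ge0; plra) ltac:(rewrite ler_pdivrMr; plra).
have := ler_wpM2l (ltW zx) h.
rewrite mulrDr mulrA [(z - x) * (_ / _)]mulrCA mulfV ?gt_eqF // mulr1 => {}h; plra.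
Qed.

(** The corner values bound w from above on the square by K. With th = d / r, y lies between x and a
    point of the square 1 / th times as far out, and x lies between y and the opposite such point;
    convexity on these two segments gives the two one-sided bounds. *)
Lemma cvx2_lip (R : realType) (A : set (R * R)) (w : R * R -> R) (x : R * R) (r : R) :
  cset2 A -> cvx2 A w -> 0 < r ->
  (forall y : R * R, `|y.1 - x.1| <= r -> `|y.2 - x.2| <= r -> A y) ->
  exists2 M : R, 0 <= M & forall (y : R * R) (d : R), 0 <= d -> d <= r -> `|y.1 - x.1| <= d -> `|y.2 - x.2| <= d ->
     `|w y - w x| <= M * d.
Proof.
case: x => x1 x2 cA cw r0 /= hA.
have rn : `|r| <= r by rewrite gtr0_norm.
have rn' : `|- r| <= r by rewrite normrN gtr0_norm.
have r2 : 0 < r + r by plra.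
pose K : R := `|w (x1 - r, x2 - r)| + `|w (x1 + r, x2 - r)| + `|w (x1 - r, x2 + r)| + `|w (x1 + r, x2 + r)|.
have ub y1 y2 : `|y1 - x1| <= r -> `|y2 - x2| <= r -> w (y1, y2) <= K.
  rewrite !ler_norml => /andP[a1 a2] /andP[b1 b2].
  have side e : `|e| <= r -> w (y1, x2 + e) <= Num.max (w (x1 - r, x2 + e)) (w (x1 + r, x2 + e)).
    move=> er.
    have := cw (x1 - r, x2 + e) (x1 + r, x2 + e) ((y1 - (x1 - r)) / (r + r)).
    have -> : (x1 - r, x2 + e).1 + (y1 - (x1 - r)) / (r + r) * ((x1 + r, x2 + e).1 - (x1 - r, x2 + e).1) = y1.
      by rewrite /=; field; plra.
    rewrite /= subrr mulr0 addr0 => h.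
    have {}h := h _ _ _ _.
    have t0 : 0 <= (y1 - (x1 - r)) / (r + r) by rewrite divr_ge0; plra.
    have t1 : (y1 - (x1 - r)) / (r + r) <= 1 by rewrite ler_pdivrMr; plra.
    have /h : A (x1 - r, x2 + e) by apply: hA => /=; rewrite [_ + _ - _]addrC addrA addNr add0r.
    have g : A (x1 + r, x2 + e) by apply: hA => /=; rewrite [_ + _ - _]addrC addrA addNr add0r.
    move=> /(_ g t0 t1) {}h; apply: le_trans h _; rewrite le_max.
    set t := _ / _ in t0 t1 *; have [q|q] := leP (w (x1 + r, x2 + e)) (w (x1 - r, x2 + e)).
      by apply/orP; left; nra.
    by apply/orP; right; nra.
  have Ay e : `|e| <= r -> A (y1, x2 + e).
    by move=> er; apply: hA => /=; [rewrite ler_norml a1 a2|rewrite [_ + _ - _]addrC addrA addNr add0r].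
  have := cw (y1, x2 - r) (y1, x2 + r) ((y2 - (x2 - r)) / (r + r)) (Ay _ rn') (Ay _ rn).
  have -> : (y1, x2 - r).2 + (y2 - (x2 - r)) / (r + r) * ((y1, x2 + r).2 - (y1, x2 - r).2) = y2.
    by rewrite /=; field; plra.
  rewrite /= subrr mulr0 addr0 => h.
  have t0 : 0 <= (y2 - (x2 - r)) / (r + r) by rewrite divr_ge0; plra.
  have t1 : (y2 - (x2 - r)) / (r + r) <= 1 by rewrite ler_pdivrMr; plra.
  have {}h := h t0 t1; apply: le_trans h _.
  have B e : `|e| <= r -> Num.max (w (x1 - r, x2 + e)) (w (x1 + r, x2 + e)) <= `|w (x1 - r, x2 + e)| + `|w (x1 + r, x2 + e)|.
    by move=> _; rewrite ge_max; apply/andP; split; apply: le_trans (ler_norm _) _; rewrite ?lerDl ?lerDr.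
  have l1 := le_trans (side _ rn) (B _ rn); have l2 := le_trans (side _ rn') (B _ rn').
  have n1 := normr_ge0 (w (x1 - r, x2 + r)); have n2 := normr_ge0 (w (x1 + r, x2 + r)).
  have n3 := normr_ge0 (w (x1 - r, x2 - r)); have n4 := normr_ge0 (w (x1 + r, x2 - r)).
  have k1 : w (y1, x2 + r) <= K by rewrite /K; clear - l1 n3 n4; lra.
  have k2 : w (y1, x2 - r) <= K by rewrite /K; clear - l2 n1 n2; lra.
  set t := _ / _ in t0 t1 *; move: (w _) (w _) k1 k2 => u1 u2 k1 k2.
  by clearbody K t; clear - t0 t1 k1 k2; nra.
have Kw : 0 <= K - w (x1, x2) by rewrite subr_ge0; apply: ub; rewrite subrr normr0 ltW.
exists ((K - w (x1, x2)) / r); first by rewrite divr_ge0 // ltW.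
move=> [y1 y2] d /= d0 dr yd1 yd2.
move: d0; rewrite le_eqVlt => /predU1P[d0|d0].
  move: yd1 yd2; rewrite -d0 !normr_le0 !subr_eq0 => /eqP -> /eqP ->.
  by rewrite subrr normr0 mulr0.
pose th : R := d / r; have th0 : 0 < th by rewrite divr_gt0.
have th1 : th <= 1 by rewrite /th ler_pdivrMr; plra.
have rd : d = th * r by rewrite /th divfK ?gt_eqF.
have far z1 x' : `|z1 - x'| <= d -> `|(z1 - x') / th| <= r.
  by move=> h; rewrite normrM normfV (gtr0_norm th0) ler_pdivrMr // [r * _]mulrC -rd.
have up1 : w (y1, y2) <= w (x1, x2) + th * (K - w (x1, x2)).
  have a1 : `|x1 + (y1 - x1) / th - x1| <= r by rewrite addrAC subrr add0r far.
  have a2 : `|x2 + (y2 - x2) / th - x2| <= r by rewrite addrAC subrr add0r far.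
  have := cw (x1, x2) (x1 + (y1 - x1) / th, x2 + (y2 - x2) / th) th.
  rewrite /= => /(_ _ (hA (_, _) a1 a2) (ltW th0) th1).
  have g : A (x1, x2) by apply: hA => /=; rewrite subrr normr0 ltW.
  have E z1 x' : x' + th * (x' + (z1 - x') / th - x') = z1 by field; rewrite gt_eqF.
  rewrite !E => /(_ g) h; apply: le_trans h _.
  by rewrite lerD2l ler_pM2l // lerD2r; exact: ub.
have up2 : w (x1, x2) <= w (y1, y2) + th * (K - w (x1, x2)).
  have a1 : `|x1 - (y1 - x1) / th - x1| <= r by rewrite addrAC subrr add0r normrN far.
  have a2 : `|x2 - (y2 - x2) / th - x2| <= r by rewrite addrAC subrr add0r normrN far.
  have g : A (y1, y2) by apply: hA => /=; apply: le_trans dr.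
  have := cw (y1, y2) (x1 - (y1 - x1) / th, x2 - (y2 - x2) / th) (th / (1 + th)) g (hA (_, _) a1 a2).
  rewrite /=.
  have E z1 x' : z1 + th / (1 + th) * (x' - (z1 - x') / th - z1) = x' by field; rewrite !gt_eqF ?addr_gt0.
  rewrite !E => h.
  have {}h := h ltac:(by rewrite divr_ge0 ?ltW ?addr_gt0) ltac:(by rewrite ler_pdivrMr; plra).
  have k := ub _ _ a1 a2.
  have p1 : 0 < 1 + th by plra.
  have := ler_wpM2l (ltW p1) h.
  rewrite mulrDr mulrA [(1 + th) * (_ / _)]mulrC divfK ?gt_eqF // => {}h.
  clear - h k th0 Kw; nra.
have -> : (K - w (x1, x2)) / r * d = th * (K - w (x1, x2)).
  by rewrite rd; field; rewrite gt_eqF.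
by rewrite ler_norml; apply/andP; split; clear - up1 up2; lra.
Qed.

Lemma open_square (R : realType) (A : set (R * R)) (z : R * R) : open A -> A z ->
  exists2 r : R, 0 < r & forall y : R * R, `|y.1 - z.1| <= r -> `|y.2 - z.2| <= r -> A y.
Proof.
move=> oA Az; have /nbhs_ballP[e /= e0 he] := (oA : open A) _ Az.
exists (e / 2); first by plra.
move=> y y1 y2; apply: he; split => /=; rewrite /ball /= distrC.
  by apply: le_lt_trans y1 _; plra.
by apply: le_lt_trans y2 _; plra.
Qed.

Lemma cvx2_continuous (R : realType) (A : set (R * R)) (w : R * R -> R) (z : R * R) :
  open A -> cset2 A -> cvx2 A w -> A z -> {for z, continuous w}.
Proof.
move=> oA cA cw Az; have [r r0 hr] := open_square oA Az.
have [M M0 hM] := cvx2_lip cA cw r0 hr.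
apply/cvgrPdist_lt => e e0.
have d0 : 0 < Num.min r (e / (M + 1)) by rewrite lt_min r0 divr_gt0 //; plra.
have := nbhsx_ballx z _ d0; apply: filterS => y [/= y1 y2].
move: y1 y2; rewrite /ball /= !lt_min => /andP[a1 a2] /andP[b1 b2].
pose d : R := Num.max `|z.1 - y.1| `|z.2 - y.2|.
have dr : d <= r by rewrite ge_max !ltW.
have de : d < e / (M + 1) by rewrite gt_max a2 b2.
have d00 : 0 <= d by rewrite le_max normr_ge0.
have := hM y d d00 dr; rewrite (distrC y.1) (distrC y.2) !le_max !lexx orbT => /(_ isT isT).
rewrite distrC => h; apply: le_lt_trans h _.
by move: de; rewrite ltr_pdivlMr; [clear - d00; nra|clear - M0; lra].
Qed.

Lemma open_continuous_measurable2 (R : realType) (A : set (R * R)) (w : R * R -> R) :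
  open A -> (forall z, A z -> {for z, continuous w}) -> measurable_fun A w.
Proof.
move=> oA cw; apply: measurable_fun_gtr => r; apply: open_measurable2.
rewrite openE => z [Az rz].
apply: filterI; first exact: open_nbhs_nbhs.
exact: (cvgr_gt (w z) (cw _ Az) r rz).
Qed.

Lemma cvx2_measurable (R : realType) (A : set (R * R)) (w : R * R -> R) :
  open A -> cset2 A -> cvx2 A w -> measurable_fun A w.
Proof.
move=> oA cA cw; apply: open_continuous_measurable2 => // z Az.
exact: cvx2_continuous cw Az.
Qed.

Definition r1 (R : realType) (w : R * R -> R) (z : R * R) : R := rd (fun s => w (s, z.2)) z.1.
Definition r2 (R : realType) (w : R * R -> R) (z : R * R) : R := rd (fun t => w (z.1, t)) z.2.
Definition l1 (R : realType) (w : R * R -> R) (z : R * R) : R := ld (fun s => w (s, z.2)) z.1.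
Definition l2 (R : realType) (w : R * R -> R) (z : R * R) : R := ld (fun t => w (z.1, t)) z.2.

Lemma cvg_patch_diff (R : realType) (A : set (R * R)) (w : R * R -> R) (z : R * R)
  (p : nat -> R * R) (c d : R) (k l : R) :
  open A -> A z -> (forall n, `|(p n).1 - z.1| <= n.+1%:R^-1 /\ `|(p n).2 - z.2| <= n.+1%:R^-1) ->
  (fun n => n.+1%:R * (c * w (p n) + d * w z)) @ \oo --> l ->
  (fun n => n.+1%:R * (c * (w \_ A) (p n) + d * (w \_ A) z)) @ \oo --> l.
Proof.
move=> oA Az hp; have [r r0 hr] := open_square oA Az.
apply: cvg_trans; apply: near_eq_cvg; near=> n.
have Ap : A (p n).
  have nr : (n.+1%:R^-1 : R) < r by near: n; exact: invSn_small.
  by have [h1 h2] := hp n; apply: hr; [apply: le_trans h1 (ltW nr)|apply: le_trans h2 (ltW nr)].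
by rewrite !patchE !mem_set.
Unshelve. all: by end_near. Qed.

(** Each derivative is a pointwise limit of difference quotients. Extending w by zero outside the
    open set A makes its translates measurable on the whole plane and changes only finitely many
    quotients at each point of A. *)
Lemma partials_measurable (R : realType) (A : set (R * R)) (w : R * R -> R) :
  open A -> cset2 A -> cvx2 A w ->
  [/\ measurable_fun A (r1 w), measurable_fun A (r2 w), measurable_fun A (l1 w) & measurable_fun A (l2 w)].
Proof.
move=> oA cA cw.
have mA := open_measurable2 oA.
have mW : measurable_fun setT (w \_ A).
  by apply/(measurable_restrictT _ _).1 => //; exact: cvx2_measurable.
have mp (a b : R) : measurable_fun setT (fun z : R * R => (w \_ A) (z.1 + a, z.2 + b)).
  apply: (measurableT_comp mW).
  apply/measurable_fun_pairP; split; rewrite /comp /=; apply: measurable_funD => //.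
(* Here (a, b) is the direction of the step and c, d are the signs in the quotient. *)
have key (a b c d : R) (g : R * R -> R) : `|a| <= 1 -> `|b| <= 1 ->
   (forall z, A z -> (fun n => n.+1%:R * (c * w (z.1 + a * n.+1%:R^-1, z.2 + b * n.+1%:R^-1) + d * w z)) @ \oo --> g z) ->
   measurable_fun A g.
  move=> a1 b1 hg.
  refine (@measurable_fun_cvg _ _ _ A (fun n (z : R * R) => n.+1%:R * (c * (w \_ A) (z.1 + a * n.+1%:R^-1, z.2 + b * n.+1%:R^-1) + d * (w \_ A) z)) g _ _).
    move=> n; apply: measurable_funTS; apply: measurable_funM => //.
    by apply: measurable_funD; apply: measurable_funM.
  move=> z Az; apply: cvg_patch_diff => //; last exact: hg.
  move=> n.
  have n0 : (0:R) < n.+1%:R^-1 by rewrite invr_gt0.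
  rewrite /= ![_ + _ - _]addrC !addrA !addNr !add0r !normrM (gtr0_norm n0).
  by split; apply: ler_piMl => //; exact: ltW.
split.
- apply: (key 1 0 1 (-1)); rewrite ?normr1 ?normr0 // => -[s t] Az.
  have [h _ _] := rd_spec (row_open oA) (row_itv cA) (row_cvx cw) (Az : row A t s).
  by apply: cvg_trans h; apply: near_eq_cvg; near=> n; rewrite !mul1r mul0r addr0 mulN1r.
- apply: (key 0 1 1 (-1)); rewrite ?normr1 ?normr0 // => -[s t] Az.
  have [h _ _] := rd_spec (col_open oA) (col_itv cA) (col_cvx cw) (Az : col A s t).
  by apply: cvg_trans h; apply: near_eq_cvg; near=> n; rewrite !mul1r mul0r addr0 mulN1r.
- apply: (key (-1) 0 (-1) 1); rewrite ?normrN ?normr1 ?normr0 // => -[s t] Az.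
  have h := ld_spec (row_open oA) (row_itv cA) (row_cvx cw) (Az : row A t s).
  by apply: cvg_trans h; apply: near_eq_cvg; near=> n; rewrite !mul1r mul0r addr0 !mulN1r [- w _ + _]addrC.
- apply: (key 0 (-1) (-1) 1); rewrite ?normrN ?normr1 ?normr0 // => -[s t] Az.
  have h := ld_spec (col_open oA) (col_itv cA) (col_cvx cw) (Az : col A s t).
  by apply: cvg_trans h; apply: near_eq_cvg; near=> n; rewrite !mul1r mul0r addr0 !mulN1r [- w _ + _]addrC.
Unshelve. all: by end_near. Qed.

Lemma tonelli_sections (d1 d2 : measure_display) (T1 : measurableType d1) (T2 : measurableType d2)
  (R : realType) (m1 : {sigma_finite_measure set T1 -> \bar R})
  (m2 : {sigma_finite_measure set T2 -> \bar R}) (A : set (T1 * T2)) (f : T1 * T2 -> \bar R) :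
  measurable A -> measurable_fun A f -> (forall z, A z -> (0 <= f z)%E) ->
  ((\int[m1 \x m2]_(z in A) f z =
     \int[m2]_t \int[m1]_(s in [set s | A (s, t)]) f (s, t))
  /\ (\int[m1 \x m2]_(z in A) f z =
     \int[m1]_s \int[m2]_(t in [set t | A (s, t)]) f (s, t)))%E.
Proof.
move=> mA mf f0.
have mF : measurable_fun setT (f \_ A) by apply/(measurable_restrictT _ _).1.
have F0 : forall z, (0 <= (f \_ A) z)%E by move=> z; apply: erestrict_ge0.
split.
  rewrite integral_mkcond (fubini_tonelli2 _ mF F0); apply: eq_integral => t _.
  by rewrite [RHS]integral_mkcond; apply: eq_integral => s _; rewrite /= !patchE.
rewrite integral_mkcond (fubini_tonelli1 _ mF F0); apply: eq_integral => t _.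
by rewrite [RHS]integral_mkcond; apply: eq_integral => s _; rewrite /= !patchE.
Qed.

Lemma tonelli (R : realType) (A : set (R * R)) (f : R * R -> \bar R) :
  measurable A -> measurable_fun A f -> (forall z, A z -> (0 <= f z)%E) ->
  ((\int[lebesgue_measure \x lebesgue_measure]_(z in A) f z =
     \int[@lebesgue_measure R]_t \int[@lebesgue_measure R]_(s in row A t) f (s, t))
  /\ (\int[lebesgue_measure \x lebesgue_measure]_(z in A) f z =
     \int[@lebesgue_measure R]_s \int[@lebesgue_measure R]_(t in col A s) f (s, t)))%E.
Proof. move=> mA mf f0. have := (@tonelli_sections _ _ _ _ R lebesgue_measure lebesgue_measure A f mA mf f0). exact. Qed.

Lemma product_measure_null (d1 d2 : measure_display) (T1 : measurableType d1) (T2 : measurableType d2)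
  (R : realType) (m1 : {sigma_finite_measure set T1 -> \bar R})
  (m2 : {sigma_finite_measure set T2 -> \bar R}) (N : set (T1 * T2)) :
  measurable N ->
  (forall t, m1 [set s | N (s, t)] = 0%E) \/ (forall s, m2 [set t | N (s, t)] = 0%E) ->
  (m1 \x m2)%E N = 0%E.
Proof.
move=> mN h.
have : (\int[m1 \x m2]_(z in N) 1%:E = (m1 \x m2) N)%E.
  by rewrite integral_cst // mul1e.
have [E1 E2] := @tonelli_sections _ _ _ _ R m1 m2 N (cst 1%:E) mN ltac:(exact: measurable_cst) ltac:(by move=> ? ?; exact: lee01).
move=> <-; case: h => h.
  rewrite E1; apply: integral0_eq => t _; rewrite integral_cst; first by set k := (X in (_ * X)%E); rewrite (_ : k = 0%E) ?mule0 //; exact: h.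
  have := measurable_ysection t mN; congr measurable.
  by apply/seteqP; split => s; rewrite /ysection /= inE.
rewrite E2; apply: integral0_eq => t _; rewrite integral_cst; first by set k := (X in (_ * X)%E); rewrite (_ : k = 0%E) ?mule0 //; exact: h.
have := measurable_xsection t mN; congr measurable.
by apply/seteqP; split => s; rewrite /xsection /= inE.
Qed.

(** Both derivatives integrate to the same increment of g and they are ordered, so they agree almost
    everywhere on each interval with rational ends in I. *)
Lemma ld_neq_rd_null (R : realType) (I : set R) (g : R -> R) :
  open I -> is_interval I -> cvx1 I g ->
  (@lebesgue_measure R).-negligible (I `&` [set x | ld g x != rd g x]).
Proof.
move=> oI iI cg.
pose F (pq : rat * rat) : set R :=
  [set x | [/\ I (ratr pq.1), I (ratr pq.2), ratr pq.1 < x <= ratr pq.2 & ld g x != rd g x]].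
pose G (n : nat) : set R := if unpickle n is Some pq then F pq else set0.
suff hN : (@lebesgue_measure R).-negligible (\bigcup_n G n).
  apply: negligibleS hN.
  move=> x [Ix /= xn].
  have [e e0 Ie] : exists2 e : R, 0 < e & forall y, `|x - y| < e -> I y.
    by have /nbhs_ballP[e /= e0 he] := oI _ Ix; exists e => // y; exact: he.
  have : x - e < x by plra.
  move=> /rat_in_itvoo[p]; rewrite in_itv /= => /andP[p1 p2].
  have : x < x + e by plra.
  move=> /rat_in_itvoo[q]; rewrite in_itv /= => /andP[q1 q2].
  have GE : G (pickle (p, q)) = F (p, q) by rewrite /G pickleK.
  exists (pickle (p, q)); first by [].
  rewrite GE; split.
  - by apply: Ie; rewrite ltr_norml; apply/andP; split; plra.
  - by apply: Ie; rewrite ltr_norml; apply/andP; split; plra.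
  - by rewrite /= p2 ltW.
  - by [].
apply: negligible_bigcup => n; rewrite /G; case: (unpickle n) => [[p q]|]; last exact: negligible_set0.
have [pq|pq] := ltP (ratr p : R) (ratr q : R); last first.
  apply: (negligibleS _ (negligible_set0 (@lebesgue_measure R))).
  by move=> x [_ _ /andP[/= x1 x2] _]; have := lt_le_trans x1 x2; rewrite ltNge pq.
have [Ip|Ip] := pselect (I (ratr p)); last first.
  by apply: (negligibleS _ (negligible_set0 (@lebesgue_measure R))) => x [].
have [Iq|Iq] := pselect (I (ratr q)); last first.
  by apply: (negligibleS _ (negligible_set0 (@lebesgue_measure R))) => x [].
have [i1 E1] := sub_FTC iI (rd_subgrad oI iI cg) Ip Iq (ltW pq).
have [i2 E2] := sub_FTC iI (ld_subgrad oI iI cg) Ip Iq (ltW pq).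
have i3 : (@lebesgue_measure R).-integrable `]ratr p, ratr q] (EFin \o (fun x => rd g x - ld g x)).
  by apply: eq_integrable (integrableB _ i1 i2) => //.
have E3 : \int[@lebesgue_measure R]_(x in `]ratr p, ratr q]) (rd g x - ld g x) = 0.
  by rewrite RintegralB // E1 E2 subrr.
have E4 : (\int[@lebesgue_measure R]_(x in `]ratr p, ratr q]) `|(rd g x - ld g x)%:E| = 0)%E.
  transitivity (\int[@lebesgue_measure R]_(x in `]ratr p, ratr q]) (rd g x - ld g x)%:E)%E.
    apply: eq_integral => x; rewrite inE /= in_itv /= => /andP[x1 x2]; rewrite ger0_norm // subr_ge0.
    by apply: (le_ld_rd oI iI cg); apply: (iI _ _ Ip Iq); rewrite x2 ltW.
  by rewrite -[LHS]fineK ?(integrable_fin_num _ i3) //; congr EFin; exact: E3.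
move/(ae_eq_integral_abs _ _ (measurable_int _ i3)) : E4 => [//|N [mN N0 hN]].
exists N; split => //; apply: subset_trans hN => x [_ _ xpq xn] /= h.
have := h; rewrite /= in_itv /= => /(_ xpq) [] /eqP; rewrite subr_eq0 eq_sym => /eqP E.
by rewrite E eqxx in xn.
Qed.

(** The value 0 is the default of a limit that does not exist. *)
Lemma derive_ld_rd (R : realType) (I : set R) (g : R -> R) (x : R) :
  open I -> is_interval I -> cvx1 I g -> I x ->
  'D_1 g x = if ld g x == rd g x then rd g x else 0.
Proof.
move=> oI iI cg Ix; case: eqP => E.
  by have [_ ->] := ld_eq_rd_derive oI iI cg Ix E.
apply: dvgP => h; apply: E.
exact: (derivable_ld_eq_rd oI iI cg Ix).
Qed.

Lemma derive_slice1 (R : realType) (w : R * R -> R) (z : R * R) :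
  'D_(1, 0) w z = 'D_1 (fun s => w (s, z.2)) z.1.
Proof.
rewrite /derive; set F := (X in X @ _); set G := (X in _ = lim (X @ _)).
suff -> : F = G by [].
apply/funext => h; rewrite /F /G /=.
by case: z @F @G => s t _ _; rewrite /shift /= -[h *: (1, 0)]/(h *: 1, h *: 0) scaler0 -[X in w X]/(h *: 1 + s, 0 + t) add0r.
Qed.

Lemma derive_slice2 (R : realType) (w : R * R -> R) (z : R * R) :
  'D_(0, 1) w z = 'D_1 (fun t => w (z.1, t)) z.2.
Proof.
rewrite /derive; set F := (X in X @ _); set G := (X in _ = lim (X @ _)).
suff -> : F = G by [].
apply/funext => h; rewrite /F /G /=.
by case: z @F @G => s t _ _; rewrite /shift /= -[h *: (0, 1)]/(h *: 0, h *: 1) scaler0 -[X in w X]/(0 + s, h *: 1 + t) add0r.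
Qed.

(** * Integrals over plane sets and the energy density *)

Definition I2 (R : realType) (A : set (R * R)) (f : R * R -> R) : \bar R :=
  (\int[lebesgue_measure \x lebesgue_measure]_(z in A) (f z)%:E)%E.

Lemma I2_ext (R : realType) (A : set (R * R)) (f g : R * R -> R) :
  (forall z, A z -> f z = g z) -> I2 A f = I2 A g.
Proof. by move=> h; apply: eq_integral => z; rewrite inE => Az; rewrite h. Qed.

Lemma I2_ge0 (R : realType) (A : set (R * R)) (f : R * R -> R) :
  (forall z, A z -> 0 <= f z) -> (0 <= I2 A f)%E.
Proof. by move=> h; apply: integral_ge0 => z Az; rewrite lee_fin h. Qed.

Lemma I2_le (R : realType) (A : set (R * R)) (f g : R * R -> R) :
  measurable A -> measurable_fun A f -> measurable_fun A g ->
  (forall z, A z -> 0 <= f z) -> (forall z, A z -> f z <= g z) -> (I2 A f <= I2 A g)%E.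
Proof.
move=> mA mf mg f0 fg; by apply: ge0_le_integral => //; exact/measurable_EFinP.
Qed.

Lemma I2D (R : realType) (A : set (R * R)) (f g : R * R -> R) :
  measurable A -> measurable_fun A f -> measurable_fun A g ->
  (forall z, A z -> 0 <= f z) -> (forall z, A z -> 0 <= g z) ->
  (I2 A (fun z => f z + g z)%R = I2 A f + I2 A g)%E.
Proof.
move=> mA mf mg f0 g0; by rewrite /I2 -ge0_integralD //; exact/measurable_EFinP.
Qed.

Lemma I2Z (R : realType) (A : set (R * R)) (f : R * R -> R) (k : R) :
  measurable A -> measurable_fun A f -> 0 <= k ->
  (forall z, A z -> 0 <= f z) ->
  (I2 A (fun z => k * f z)%R = k%:E * I2 A f)%E.
Proof.
move=> mA mf k0 f0; by rewrite /I2 -ge0_integralZl //; exact/measurable_EFinP.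
Qed.

Lemma I2_subset (R : realType) (A B : set (R * R)) (f : R * R -> R) :
  measurable A -> measurable B -> measurable_fun B f -> A `<=` B ->
  (forall z, B z -> 0 <= f z) -> (I2 A f <= I2 B f)%E.
Proof.
move=> mA mB mf AB f0; by apply: ge0_subset_integral => //; exact/measurable_EFinP.
Qed.

Lemma I2_split (R : realType) (A S : set (R * R)) (f : R * R -> R) :
  measurable A -> measurable S -> measurable_fun A f ->
  I2 A f = (I2 (A `&` S) f + I2 (A `\` S) f)%E.
Proof.
move=> mA mS mf; rewrite /I2 -integral_setU.
- by congr (integral _ _ _); rewrite setUIDK.
- exact: measurableI.
- exact: measurableD.
- by rewrite setUIDK; exact/measurable_EFinP.
- by apply/disj_setPS => z [[_ ?] [_ ?]].
Qed.

Lemma I2_cst (R : realType) (A : set (R * R)) (k : R) :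
  measurable A -> I2 A (fun=> k) = (k%:E * (lebesgue_measure \x lebesgue_measure)%E A)%E.
Proof. by move=> mA; rewrite /I2 integral_cst. Qed.

Lemma I2_rows (R : realType) (A : set (R * R)) (f : R * R -> R) :
  measurable A -> measurable_fun A f -> (forall z, A z -> 0 <= f z) ->
  (I2 A f = \int[@lebesgue_measure R]_t \int[@lebesgue_measure R]_(s in row A t) (f (s, t))%:E)%E.
Proof.
move=> mA mf f0; have [E _] := @tonelli R A (EFin \o f) mA ltac:(exact/measurable_EFinP) ltac:(by move=> z Az; rewrite lee_fin f0).
exact: E.
Qed.

Lemma I2_cols (R : realType) (A : set (R * R)) (f : R * R -> R) :
  measurable A -> measurable_fun A f -> (forall z, A z -> 0 <= f z) ->
  (I2 A f = \int[@lebesgue_measure R]_s \int[@lebesgue_measure R]_(t in col A s) (f (s, t))%:E)%E.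
Proof.
move=> mA mf f0; have [_ E] := @tonelli R A (EFin \o f) mA ltac:(exact/measurable_EFinP) ltac:(by move=> z Az; rewrite lee_fin f0).
exact: E.
Qed.

(** The integrand of the energy with right derivatives in place of the gradient, so that no default
    value enters. *)
Definition den (R : realType) (w : R * R -> R) (z : R * R) : R :=
  2^-1 * ((r1 w z - z.1) ^+ 2 + (r2 w z - z.2) ^+ 2) + w z.

Lemma den_measurable (R : realType) (A : set (R * R)) (w : R * R -> R) :
  open A -> cset2 A -> cvx2 A w -> measurable_fun A (den w).
Proof.
move=> oA cA cw; have [m1 m2 _ _] := partials_measurable oA cA cw.
apply: measurable_funD; last exact: cvx2_measurable.
apply: measurable_funM => //; apply: measurable_funD; apply: measurable_funX.
  by apply: measurable_funB => //; apply: measurable_funTS.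
by apply: measurable_funB => //; apply: measurable_funTS.
Qed.

Lemma product_measure_nullU (d1 d2 : measure_display) (T1 : measurableType d1) (T2 : measurableType d2)
  (R : realType) (m1 : {sigma_finite_measure set T1 -> \bar R})
  (m2 : {sigma_finite_measure set T2 -> \bar R}) (N1 N2 : set (T1 * T2)) :
  measurable N1 -> measurable N2 ->
  (forall t, m1 [set s | N1 (s, t)] = 0%E) -> (forall s, m2 [set t | N2 (s, t)] = 0%E) ->
  (m1 \x m2)%E (N1 `|` N2) = 0%E.
Proof.
move=> mN1 mN2 h1 h2; rewrite measureU0 //; last by apply: product_measure_null => //; right.
by apply: product_measure_null => //; left.
Qed.

(** Kinks in the first variable form a set with null rows, kinks in the second variable one with
    null columns, by the one-variable result. *)
Lemma nondiff_null (R : realType) (A : set (R * R)) (w : R * R -> R) :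
  open A -> cset2 A -> cvx2 A w ->
  exists N : set (R * R), [/\ measurable N, (lebesgue_measure \x lebesgue_measure)%E N = 0%E,
    N `<=` A & forall z, A z -> ~ N z -> l1 w z = r1 w z /\ l2 w z = r2 w z].
Proof.
move=> oA cA cw; have [m1 m2 m3 m4] := partials_measurable oA cA cw.
have mA := open_measurable2 oA.
pose N1 := A `&` [set z | l1 w z != r1 w z].
pose N2 := A `&` [set z | l2 w z != r2 w z].
have mN1 : measurable N1.
  have := (measurable_fun_eqr m3 m1) mA [set false] ltac:(by []).
  by congr measurable; apply/seteqP; split => z [Az] /= h; split => //=; [rewrite h|exact: negbTE].
have mN2 : measurable N2.
  have := (measurable_fun_eqr m4 m2) mA [set false] ltac:(by []).
  by congr measurable; apply/seteqP; split => z [Az] /= h; split => //=; [rewrite h|exact: negbTE].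
exists (N1 `|` N2); split.
- exact: measurableU.
- apply: product_measure_nullU => // t.
    apply: (measure_negligible (mu := @lebesgue_measure R)).
      have := measurable_ysection t mN1; congr measurable.
      by apply/seteqP; split => s; rewrite /ysection /= inE.
    have := ld_neq_rd_null (row_open (t:=t) oA) (row_itv (t:=t) cA) (row_cvx (t:=t) cw).
    by apply: negligibleS => s [].
  apply: (measure_negligible (mu := @lebesgue_measure R)).
    have := measurable_xsection t mN2; congr measurable.
    by apply/seteqP; split => s; rewrite /xsection /= inE.
  have := ld_neq_rd_null (col_open (t:=t) oA) (col_itv (t:=t) cA) (col_cvx (t:=t) cw).
  by apply: negligibleS => s [].
- by move=> z [] [].
- move=> z Az Nz; split; apply/eqP; apply/negP => /negP h; apply: Nz; first by left.
  by right.
Qed.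

(** The components of [gradient] fall back to 0 exactly at the kinks; the kinks form a null set, off
    which the two integrands coincide. *)
Lemma energyE (R : realType) (A : set (R * R)) (w : R * R -> R) :
  open A -> cset2 A -> cvx2 A w -> (forall z, A z -> 0 <= w z) ->
  energy A w = I2 A (den w).
Proof.
move=> oA cA cw w0; have [m1 m2 m3 m4] := partials_measurable oA cA cw.
have mA := open_measurable2 oA.
have mw := cvx2_measurable oA cA cw.
have d1 z : A z -> 'D_(1, 0) w z = if l1 w z == r1 w z then r1 w z else 0.
  case: z => s t Az; rewrite derive_slice1.
  exact: (derive_ld_rd (row_open oA) (row_itv cA) (row_cvx cw) (Az : row A t s)).
have d2 z : A z -> 'D_(0, 1) w z = if l2 w z == r2 w z then r2 w z else 0.
  case: z => s t Az; rewrite derive_slice2.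
  exact: (derive_ld_rd (col_open oA) (col_itv cA) (col_cvx cw) (Az : col A s t)).
pose g1 z : R := if l1 w z == r1 w z then r1 w z else 0.
pose g2 z : R := if l2 w z == r2 w z then r2 w z else 0.
have mg1 : measurable_fun A g1.
  by apply: measurable_fun_if => //; [exact: measurable_fun_eqr|exact: measurable_funS m1].
have mg2 : measurable_fun A g2.
  by apply: measurable_fun_if => //; [exact: measurable_fun_eqr|exact: measurable_funS m2].
pose dg z : R := 2^-1 * ((g1 z - z.1) ^+ 2 + (g2 z - z.2) ^+ 2) + w z.
have mdg : measurable_fun A dg.
  apply: measurable_funD => //.
  apply: measurable_funM => //; apply: measurable_funD; apply: measurable_funX.
    by apply: measurable_funB => //; apply: measurable_funTS.
  by apply: measurable_funB => //; apply: measurable_funTS.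
transitivity (I2 A dg).
  apply: eq_integral => z; rewrite inE => Az; congr EFin.
  rewrite /dg /g1 /g2 -d1 // -d2 // /enorm sqr_sqrtr //.
  by rewrite addr_ge0 // sqr_ge0.
have sq (x y : R) : 0 <= 2^-1 * (x ^+ 2 + y ^+ 2).
  by rewrite mulr_ge0 ?invr_ge0 // addr_ge0 // sqr_ge0.
apply: ge0_ae_eq_integral => //.
- exact/measurable_EFinP.
- by apply/measurable_EFinP; exact: den_measurable.
- by move=> z Az; rewrite lee_fin /dg addr_ge0 ?w0.
- by move=> z Az; rewrite lee_fin /den addr_ge0 ?w0.
have [N [mN N0 _ hN]] := nondiff_null oA cA cw.
exists N; split => // z /= /not_implyP[Az] h; apply: contrapT => Nz; apply: h.
by have [E1 E2] := hN _ Az Nz; rewrite /dg /g1 /g2 E1 E2 !eqxx.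
Qed.

(** * Measurability along sections, changes of variables and Fatou's lemma *)

Lemma sections_measurable (d1 d2 : measure_display) (T1 : measurableType d1) (T2 : measurableType d2)
  (R : realType) (m1 : {sigma_finite_measure set T1 -> \bar R})
  (m2 : {sigma_finite_measure set T2 -> \bar R}) (A : set (T1 * T2)) (f : T1 * T2 -> \bar R) :
  measurable A -> measurable_fun A f -> (forall z, A z -> (0 <= f z)%E) ->
  (measurable_fun setT (fun t => \int[m1]_(s in [set s | A (s, t)]) f (s, t))
  /\ measurable_fun setT (fun s => \int[m2]_(t in [set t | A (s, t)]) f (s, t)))%E.
Proof.
move=> mA mf f0.
have mF : measurable_fun setT (f \_ A) by apply/(measurable_restrictT _ _).1.
have F0 : forall z, (0 <= (f \_ A) z)%E by move=> z; apply: erestrict_ge0.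
split.
  apply: (eq_measurable_fun (fubini_G m1 (f \_ A))); last exact: measurable_fun_fubini_tonelli_G.
  move=> t _.
  by rewrite /fubini_G [RHS]integral_mkcond; apply: eq_integral => s _; rewrite /= !patchE.
apply: (eq_measurable_fun (fubini_F m2 (f \_ A))); last exact: measurable_fun_fubini_tonelli_F.
move=> t _.
by rewrite /fubini_F [RHS]integral_mkcond; apply: eq_integral => s _; rewrite /= !patchE.
Qed.

Lemma rows_measurable (R : realType) (A : set (R * R)) (f : R * R -> \bar R) :
  measurable A -> measurable_fun A f -> (forall z, A z -> (0 <= f z)%E) ->
  measurable_fun setT (fun t => \int[@lebesgue_measure R]_(s in row A t) f (s, t))%E.
Proof.
move=> mA mf f0.
by have [h _] := @sections_measurable _ _ _ _ R lebesgue_measure lebesgue_measure A f mA mf f0.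
Qed.

Lemma cols_measurable (R : realType) (A : set (R * R)) (f : R * R -> \bar R) :
  measurable A -> measurable_fun A f -> (forall z, A z -> (0 <= f z)%E) ->
  measurable_fun setT (fun s => \int[@lebesgue_measure R]_(t in col A s) f (s, t))%E.
Proof.
move=> mA mf f0.
by have [_ h] := @sections_measurable _ _ _ _ R lebesgue_measure lebesgue_measure A f mA mf f0.
Qed.

Lemma row_measurable (R : realType) (A : set (R * R)) t : measurable A -> measurable (row A t).
Proof.
move=> mA; have := measurable_ysection t mA; congr measurable.
by apply/seteqP; split => s; rewrite /ysection /= inE.
Qed.

Lemma col_measurable (R : realType) (A : set (R * R)) t : measurable A -> measurable (col A t).
Proof.
move=> mA; have := measurable_xsection t mA; congr measurable.
by apply/seteqP; split => s; rewrite /xsection /= inE.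
Qed.

Lemma row_measurable_fun (R : realType) (A : set (R * R)) (f : R * R -> \bar R) t :
  measurable A -> measurable_fun A f -> measurable_fun (row A t) (fun s => f (s, t)).
Proof.
move=> mA mf.
have mF : measurable_fun setT (f \_ A) by apply/(measurable_restrictT _ _).1.
apply: (eq_measurable_fun (fun s => (f \_ A) (s, t))).
  by move=> s; rewrite inE /row /= => As; rewrite patchE mem_set.
by apply: measurable_funTS; apply: (measurableT_comp mF); exact: measurable_pair2.
Qed.

Lemma col_measurable_fun (R : realType) (A : set (R * R)) (f : R * R -> \bar R) s :
  measurable A -> measurable_fun A f -> measurable_fun (col A s) (fun t => f (s, t)).
Proof.
move=> mA mf.
have mF : measurable_fun setT (f \_ A) by apply/(measurable_restrictT _ _).1.
apply: (eq_measurable_fun (fun t => (f \_ A) (s, t))).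
  by move=> t; rewrite inE /row /= => As; rewrite patchE mem_set.
by apply: measurable_funTS; apply: (measurableT_comp mF); exact: measurable_pair1.
Qed.

Lemma good_rows (R : realType) (A : set (R * R)) (f : R * R -> \bar R) :
  measurable A -> measurable_fun A f -> (forall z, A z -> (0 <= f z)%E) ->
  (\int[lebesgue_measure \x lebesgue_measure]_(z in A) f z < +oo)%E ->
  {ae (@lebesgue_measure R), forall t, (\int[@lebesgue_measure R]_(s in row A t) f (s, t) < +oo)%E}.
Proof.
move=> mA mf f0 fi.
have [E _] := tonelli mA mf f0.
have G0 t : (0 <= \int[@lebesgue_measure R]_(s in row A t) f (s, t))%E.
  by apply: integral_ge0 => s As; exact: f0.
have iG : (@lebesgue_measure R).-integrable setT (fun t => \int[@lebesgue_measure R]_(s in row A t) f (s, t))%E.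
  apply/integrableP; split; first exact: rows_measurable.
  move: fi; rewrite E; congr (_ < _)%E.
  by apply: eq_integral => t _; rewrite gee0_abs.
have := integrable_ae _ iG => /(_ measurableT); apply: filterS => t /(_ ltac:(by [])).
by rewrite ge0_fin_numE.
Qed.

Lemma good_cols (R : realType) (A : set (R * R)) (f : R * R -> \bar R) :
  measurable A -> measurable_fun A f -> (forall z, A z -> (0 <= f z)%E) ->
  (\int[lebesgue_measure \x lebesgue_measure]_(z in A) f z < +oo)%E ->
  {ae (@lebesgue_measure R), forall s, (\int[@lebesgue_measure R]_(t in col A s) f (s, t) < +oo)%E}.
Proof.
move=> mA mf f0 fi.
have [_ E] := tonelli mA mf f0.
have G0 t : (0 <= \int[@lebesgue_measure R]_(s in col A t) f (t, s))%E.
  by apply: integral_ge0 => s As; exact: f0.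
have iG : (@lebesgue_measure R).-integrable setT (fun s => \int[@lebesgue_measure R]_(t in col A s) f (s, t))%E.
  apply/integrableP; split; first exact: cols_measurable.
  move: fi; rewrite E; congr (_ < _)%E.
  by apply: eq_integral => t _; rewrite gee0_abs.
have := integrable_ae _ iG => /(_ measurableT); apply: filterS => t /(_ ltac:(by [])).
by rewrite ge0_fin_numE.
Qed.

(** The image of Lebesgue measure under x -> c + k x, multiplied by k, gives half-open intervals
    their length, so it is Lebesgue measure. *)
Lemma lebesgue_scale (R : realType) (c k : R) (D : set R) (f : R -> \bar R) :
  0 < k -> measurable D -> measurable_fun D f -> (forall x, D x -> (0 <= f x)%E) ->
  (\int[@lebesgue_measure R]_(x in D) f x =
   k%:E * \int[@lebesgue_measure R]_(x in [set x | D (c + k * x)%R]) f (c + k * x)%R)%E.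
Proof.
move=> k0 mD mf f0.
pose phi (x : measurableTypeR R) : measurableTypeR R := c + k * x.
have mphi : measurable_fun setT phi by apply: measurable_funD => //; exact: measurable_funM.
pose phi' : {mfun measurableTypeR R >-> measurableTypeR R} :=
  HB.pack phi (isMeasurableFun.Build _ _ _ _ phi mphi).
have kn : k != 0 by rewrite gt_eqF.
pose nu' := mscale (NngNum (ltW k0)) (pushforward (@lebesgue_measure R) phi').
pose nu := nu' mphi.
have E A : measurable A -> (@lebesgue_measure R) A = nu A.
  apply: lebesgue_measure_unique => _ [[a b]] _ <-.
  rewrite -[RHS]/(k%:E * (@lebesgue_measure R) (phi @^-1` [set` `]a, b]]))%E.
  have -> : phi @^-1` [set` `]a, b]] = [set` `](a - c) / k, (b - c) / k]] :> set R.
    have hx (x : R) : (a < c + k * x <= b) = ((a - c) / k < x <= (b - c) / k).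
      by rewrite ltr_pdivrMr // ler_pdivlMr // ltrBlDl lerBrDl (mulrC x).
    by apply/seteqP; split => x; rewrite /= !in_itv /= -hx.
  rewrite !lebesgue_measure_itv /= !lte_fin ltr_pM2r ?invr_gt0 // ltrD2r.
  case: ifP => _; last by rewrite mule0.
  by rewrite -!EFinB -EFinM; congr EFin; field.
rewrite (eq_measure_integral nu); last by move=> A mA _; exact: E.
rewrite /nu ge0_integral_mscale //; congr (_ * _)%E.
rewrite ge0_integral_pushforward //.
by move=> x; rewrite inE; exact: f0.
Qed.

Lemma lebesgue_flip (R : realType) (D : set R) (f : R -> \bar R) :
  measurable D -> measurable_fun D f -> (forall x, D x -> (0 <= f x)%E) ->
  (\int[@lebesgue_measure R]_(x in D) f x =
   \int[@lebesgue_measure R]_(x in [set x | D (- x)%R]) f (- x)%R)%E.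
Proof.
move=> mD mf f0.
transitivity (\int[pushforward (@lebesgue_measure R) (-%R : _ -> measurableTypeR R)]_(x in D) f x)%E.
  by apply: eq_measure_integral => A mA _; exact/esym/lebesgue_measureN.
rewrite ge0_integral_pushforward //.
by move=> x; rewrite inE; exact: f0.
Qed.

Lemma I2_scale (R : realType) (c : R * R) (k : R) (A : set (R * R)) (f : R * R -> R) :
  0 < k -> measurable A -> measurable_fun A f -> (forall z, A z -> 0 <= f z) ->
  (I2 A f = (k * k)%:E * I2 [set z | A (c.1 + k * z.1, c.2 + k * z.2)%R]
               (fun z => f (c.1 + k * z.1, c.2 + k * z.2)%R))%E.
Proof.
move=> k0 mA mf f0.
have mphi : measurable_fun setT (fun z : R * R => (c.1 + k * z.1, c.2 + k * z.2) : R * R).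
  by apply/measurable_fun_pairP; split; apply: measurable_funD => //; apply: measurable_funM.
pose B := [set z : R * R | A (c.1 + k * z.1, c.2 + k * z.2)].
have mB : measurable B by rewrite -[B]setTI; exact: mphi.
have mfB : measurable_fun B (fun z => f (c.1 + k * z.1, c.2 + k * z.2)).
  apply: (measurable_comp mA _ mf); first by move=> _ [z Bz <-].
  exact: measurable_funTS.
have fB0 z : B z -> 0 <= f (c.1 + k * z.1, c.2 + k * z.2) by move=> Bz; exact: f0.
have mef : measurable_fun A (EFin \o f) by exact/measurable_EFinP.
have mefB : measurable_fun B (EFin \o (fun z => f (c.1 + k * z.1, c.2 + k * z.2))) by exact/measurable_EFinP.
have e0 : forall z, A z -> (0 <= (EFin \o f) z)%E by move=> z Az; rewrite lee_fin f0.
have eB0 : forall z, B z -> (0 <= (EFin \o (fun z => f (c.1 + k * z.1, c.2 + k * z.2)%R)) z)%E.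
  by move=> z Az; rewrite lee_fin fB0.
rewrite (I2_rows mA mf f0) (I2_rows mB mfB fB0).
rewrite (lebesgue_scale c.2 k0 measurableT); last 2 first.
- exact: (rows_measurable mA mef e0).
- by move=> t _; apply: integral_ge0 => s As; exact: e0.
rewrite EFinM -muleA; congr (_ * _)%E.
have H0 : forall t, setT t -> (0 <= \int[@lebesgue_measure R]_(s in row B t) (f (c.1 + k * s, c.2 + k * t)%R)%:E)%E.
  by move=> t _; apply: integral_ge0 => s As; exact: (eB0 (s, t)).
have k0' : (0 <= k%:E)%E by rewrite lee_fin ltW.
apply: (eq_trans _ (ge0_integralZl (@lebesgue_measure R) measurableT (rows_measurable mB mefB eB0) H0 k0')).
apply: eq_integral => t _.
rewrite (lebesgue_scale c.1 k0) //.
- exact: row_measurable.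
- exact: (@row_measurable_fun R A (EFin \o f) _ mA mef).
- by move=> s As; exact: (e0 (s, _)).
Qed.

Lemma I2_flip (R : realType) (A : set (R * R)) (f : R * R -> R) :
  measurable A -> measurable_fun A f -> (forall z, A z -> 0 <= f z) ->
  (I2 A f = I2 [set z | A (z.1, - z.2)%R] (fun z => f (z.1, - z.2)%R))%E.
Proof.
move=> mA mf f0.
have mphi : measurable_fun setT (fun z : R * R => (z.1, - z.2) : R * R).
  by apply/measurable_fun_pairP; split; [exact: measurable_fst|exact: (measurableT_comp (@oppr_measurable R setT) measurable_snd)].
pose B := [set z : R * R | A (z.1, - z.2)].
have mB : measurable B by rewrite -[B]setTI; exact: mphi.
have mfB : measurable_fun B (fun z => f (z.1, - z.2)).
  apply: (measurable_comp mA _ mf); first by move=> _ [z Bz <-].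
  exact: measurable_funTS.
have fB0 z : B z -> 0 <= f (z.1, - z.2) by move=> Bz; exact: f0.
have mef : measurable_fun A (EFin \o f) by exact/measurable_EFinP.
have e0 : forall z, A z -> (0 <= (EFin \o f) z)%E by move=> z Az; rewrite lee_fin f0.
rewrite (I2_cols mA mf f0) (I2_cols mB mfB fB0).
apply: eq_integral => s _; rewrite lebesgue_flip //.
- exact: col_measurable.
- exact: (@col_measurable_fun R A (EFin \o f) _ mA mef).
- by move=> t As; exact: (e0 (s, t)).
Qed.

Definition swp (R : realType) (z : R * R) : R * R := (z.2, z.1).

Lemma I2_swap (R : realType) (A : set (R * R)) (f : R * R -> R) :
  measurable A -> measurable_fun A f -> (forall z, A z -> 0 <= f z) ->
  (I2 A f = I2 [set z | A (swp z)] (fun z => f (swp z)))%E.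
Proof.
move=> mA mf f0.
have mphi : measurable_fun setT (@swp R).
  by apply/measurable_fun_pairP; split; [exact: measurable_snd|exact: measurable_fst].
pose B := [set z : R * R | A (swp z)].
have mB : measurable B by rewrite -[B]setTI; exact: mphi.
have mfB : measurable_fun B (fun z => f (swp z)).
  apply: (measurable_comp mA _ mf); first by move=> _ [z Bz <-].
  exact: measurable_funTS.
rewrite (I2_cols mA mf f0) (I2_rows mB mfB) //.
by move=> z Bz; exact: f0.
Qed.

Lemma fatou_cvg (d : measure_display) (T : measurableType d) (R : realType)
  (mu : {measure set T -> \bar R}) (A : set T) (f_ : nat -> T -> R) (f : T -> R) (M : \bar R) :
  measurable A -> (forall n, measurable_fun A (f_ n)) -> (forall n z, A z -> 0 <= f_ n z) ->
  (forall z, A z -> f_ ^~ z @ \oo --> f z) -> (forall n, (\int[mu]_(z in A) (f_ n z)%:E <= M)%E) ->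
  (\int[mu]_(z in A) (f z)%:E <= M)%E.
Proof.
move=> mA mf f0 cf hM.
have E : (\int[mu]_(z in A) (f z)%:E = \int[mu]_(z in A) limn_einf (fun n => (f_ n z)%:E))%E.
  apply: eq_integral => z; rewrite inE => Az.
  have h : (fun n => (f_ n z)%:E) @ \oo --> (f z)%:E by apply: cvg_EFin; [near=> n|exact: cf].
  by rewrite is_cvg_limn_einfE; [apply/esym/cvg_lim|apply/cvg_ex; exists (f z)%:E].
rewrite E; apply: (le_trans (fatou mu mA _ _)).
- by move=> n; apply/measurable_EFinP.
- by move=> n z Az; rewrite lee_fin f0.
rewrite limn_einf_lim; apply: lime_le; first exact: is_cvg_einfs.
near=> n; apply: le_trans (hM n); apply: ereal_inf_lbound => /=.
by exists n => //=.
Unshelve. all: by end_near. Qed.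

Lemma fatou_prod (d1 d2 : measure_display) (T1 : measurableType d1) (T2 : measurableType d2)
  (R : realType) (m1 : {sigma_finite_measure set T1 -> \bar R})
  (m2 : {sigma_finite_measure set T2 -> \bar R})
  (A : set (T1 * T2)) (f_ : nat -> T1 * T2 -> R) (f : T1 * T2 -> R) (M : \bar R) :
  measurable A -> (forall n, measurable_fun A (f_ n)) -> (forall n z, A z -> 0 <= f_ n z) ->
  (forall z, A z -> f_ ^~ z @ \oo --> f z) ->
  (forall n, (\int[m1 \x m2]_(z in A) (f_ n z)%:E <= M)%E) ->
  (\int[m1 \x m2]_(z in A) (f z)%:E <= M)%E.
Proof. exact: fatou_cvg. Qed.

Lemma I2_fatou (R : realType) (A : set (R * R)) (f_ : nat -> R * R -> R) (f : R * R -> R) (M : \bar R) :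
  measurable A -> (forall n, measurable_fun A (f_ n)) -> (forall n z, A z -> 0 <= f_ n z) ->
  (forall z, A z -> f_ ^~ z @ \oo --> f z) -> (forall n, (I2 A (f_ n) <= M)%E) ->
  (I2 A f <= M)%E.
Proof.
move=> mA mf f0 cf hM.
have := @fatou_prod _ _ _ _ R lebesgue_measure lebesgue_measure A f_ f M mA mf f0 cf hM.
exact.
Qed.

(** * Existence and uniqueness of the minimizer on the open set *)

(** Competitors on the open set alone; the closure returns only when the minimizer is extended to
    it. *)
Definition inK (R : realType) (A : set (R * R)) (w : R * R -> R) : Prop :=
  cvx2 A w /\ forall z, A z -> 0 <= w z.

Definition En (R : realType) (A : set (R * R)) (w : R * R -> R) : \bar R := I2 A (den w).

Lemma rd_lin (R : realType) (I : set R) (g h : R -> R) (a b x : R) :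
  open I -> is_interval I -> cvx1 I g -> cvx1 I h -> I x ->
  rd (fun y => a * g y + b * h y) x = a * rd g x + b * rd h x.
Proof.
move=> oI iI cg ch Ix; have [c1 _ _] := rd_spec oI iI cg Ix; have [c2 _ _] := rd_spec oI iI ch Ix.
apply/cvg_lim => //.
pose u (n : nat) : R := n.+1%:R * (g (x + n.+1%:R^-1) - g x).
pose v (n : nat) : R := n.+1%:R * (h (x + n.+1%:R^-1) - h x).
rewrite (_ : (fun n => _) = (fun n => a * u n + b * v n)).
  by apply: cvgD; apply: cvgM => //; exact: cvg_cst.
by apply/funext => n; rewrite /u /v; ring.
Qed.

Lemma rdDc (R : realType) (g : R -> R) (c x : R) : rd (fun y => g y + c) x = rd g x.
Proof. by rewrite /rd; congr (limn _); apply/funext => n; ring. Qed.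

Lemma r_lin (R : realType) (A : set (R * R)) (w v : R * R -> R) (a b : R) (z : R * R) :
  open A -> cset2 A -> cvx2 A w -> cvx2 A v -> A z ->
  r1 (fun y => a * w y + b * v y) z = a * r1 w z + b * r1 v z /\
  r2 (fun y => a * w y + b * v y) z = a * r2 w z + b * r2 v z.
Proof.
move=> oA cA cw cv; case: z => s t Az; split.
  exact: (rd_lin a b (row_open oA) (row_itv cA) (row_cvx cw) (row_cvx cv) (Az : row A t s)).
exact: (rd_lin a b (col_open oA) (col_itv cA) (col_cvx cw) (col_cvx cv) (Az : col A s t)).
Qed.

Lemma cvx2_comb (R : realType) (A : set (R * R)) (w v : R * R -> R) (a b : R) :
  0 <= a -> 0 <= b -> cvx2 A w -> cvx2 A v -> cvx2 A (fun z => a * w z + b * v z).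
Proof.
move=> a0 b0 cw cv x y t Ax Ay t0 t1.
have h1 := ler_wpM2l a0 (cw _ _ _ Ax Ay t0 t1); have h2 := ler_wpM2l b0 (cv _ _ _ Ax Ay t0 t1).
by apply: le_trans (lerD h1 h2) _; plra.
Qed.

Definition gd (R : realType) (w v : R * R -> R) (z : R * R) : R :=
  (r1 w z - r1 v z) ^+ 2 + (r2 w z - r2 v z) ^+ 2.

Lemma gd_measurable (R : realType) (A : set (R * R)) (w v : R * R -> R) :
  open A -> cset2 A -> cvx2 A w -> cvx2 A v -> measurable_fun A (gd w v).
Proof.
move=> oA cA cw cv; have [m1 m2 _ _] := partials_measurable oA cA cw.
have [n1 n2 _ _] := partials_measurable oA cA cv.
by apply: measurable_funD; apply: measurable_funX; exact: measurable_funB.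
Qed.

Lemma gd_ge0 (R : realType) (w v : R * R -> R) z : 0 <= gd w v z.
Proof. by rewrite addr_ge0 // sqr_ge0. Qed.

Lemma den_ge0 (R : realType) (w : R * R -> R) z : 0 <= w z -> 0 <= den w z.
Proof. by move=> w0; rewrite addr_ge0 // mulr_ge0 ?invr_ge0 // addr_ge0 // sqr_ge0. Qed.

(** The midpoint of w and v is a competitor, and the quadratic part of the density makes its energy
    smaller than the mean of the two energies by an eighth of the integral of [gd w v]. *)
Lemma parallelogram (R : realType) (A : set (R * R)) (w v : R * R -> R) (I e : R) :
  open A -> cset2 A -> inK A w -> inK A v ->
  (forall f, inK A f -> (I%:E <= En A f)%E) ->
  (En A w <= (I + e)%:E)%E -> (En A v <= (I + e)%:E)%E ->
  (I2 A (gd w v) <= (8 * e)%:E)%E.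
Proof.
move=> oA cA [cw w0] [cv v0] hI hw hv.
have mA := open_measurable2 oA.
pose m z : R := 2^-1 * w z + 2^-1 * v z.
have h2 : 0 <= 2^-1 :> R by rewrite invr_ge0.
have cm : cvx2 A m by exact: cvx2_comb.
have m0 z : A z -> 0 <= m z by move=> Az; rewrite addr_ge0 // mulr_ge0 // ?w0 ?v0.
have Em := hI m (conj cm m0).
have mg := gd_measurable oA cA cw cv.
have dw := den_measurable oA cA cw; have dv := den_measurable oA cA cv; have dm := den_measurable oA cA cm.
have id : (En A m + 8^-1%:E * I2 A (gd w v) = 2^-1%:E * En A w + 2^-1%:E * En A v)%E.
  rewrite /En -!I2Z // ?invr_ge0 //; last 3 first.
  - by move=> z Az; rewrite den_ge0 ?v0.
  - by move=> z Az; rewrite den_ge0 ?w0.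
  - by move=> z _; exact: gd_ge0.
  rewrite -!I2D //; try by [exact: measurable_funM|move=> z Az; rewrite ?mulr_ge0 ?invr_ge0 ?gd_ge0 ?den_ge0 ?w0 ?v0 ?m0].
  apply: I2_ext => z Az; have [E1 E2] := r_lin 2^-1 2^-1 oA cA cw cv Az.
  by rewrite /den /gd E1 E2 /m; field.
have g0 : (0 <= I2 A (gd w v))%E by apply: I2_ge0 => z _; exact: gd_ge0.
have f1 : (En A w) \is a fin_num.
  by rewrite ge0_fin_numE ?(le_lt_trans hw) ?ltry // I2_ge0 // => z Az; rewrite den_ge0 ?w0.
have f2 : (En A v) \is a fin_num.
  by rewrite ge0_fin_numE ?(le_lt_trans hv) ?ltry // I2_ge0 // => z Az; rewrite den_ge0 ?v0.
move: hw hv id; rewrite -(fineK f1) -(fineK f2) !lee_fin => hw hv.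
rewrite -!EFinM -EFinD => id.
have h8 : (I%:E + 8^-1%:E * I2 A (gd w v) <= (I + e)%:E)%E.
  apply: le_trans (leeD Em (lexx _)) _; rewrite id lee_fin; plra.
move: g0 h8; case: (I2 A (gd w v)) => [x||] //=; last by rewrite gt0_muley ?lte_fin ?invr_gt0 // addey.
by rewrite -EFinM -EFinD !lee_fin => _; plra.
Qed.

Lemma summable_cvg (R : realType) (d : nat -> R) (M : R) :
  (forall N, \sum_(0 <= n < N) `|d n - d n.+1| <= M) -> cvgn d.
Proof.
move=> h.
have c1 : cvgn [normed series (fun n => d n.+1 - d n)].
  apply: nondecreasing_is_cvgn.
    by apply: nondecreasing_series => n _ _ /=; exact: normr_ge0.
  exists M => _ [N _ <-] /=; rewrite /series /=.
  by under eq_bigr do rewrite distrC; exact: h.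
have c2 := normed_cvg c1.
have -> : d = (fun n => series (fun n => d n.+1 - d n) n + d 0%N).
  by apply/funext => n; rewrite /series /= telescope_sumr // subrK.
by apply: is_cvgD => //; exact: is_cvg_cst.
Qed.

(** S dominates the summed increments of the slopes, so its integral along the line bounds the
    summed increments of [g_ n b - g_ n a]. *)
Lemma line_cvg (R : realType) (I : set R) (g_ : nat -> R -> R) (S : R -> \bar R) (a b : R) :
  open I -> is_interval I -> (forall n, cvx1 I (g_ n)) -> measurable_fun I S ->
  (forall x N, I x -> ((\sum_(0 <= n < N) `|rd (g_ n) x - rd (g_ n.+1) x|)%:E <= S x)%E) ->
  (\int[@lebesgue_measure R]_(x in I) S x < +oo)%E -> I a -> I b ->
  cvgn (fun n => g_ n b - g_ n a).
Proof.
move=> oI iI cg mS hS iS.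
wlog ab : a b / a <= b.
  move=> H Ia Ib; have [ab|ba] := leP a b; first exact: H.
  rewrite (_ : (fun n => _) = - (fun n => g_ n a - g_ n b)).
    by apply: is_cvgN; exact: (H b a (ltW ba) Ib Ia).
  by apply/funext => n; rewrite -[RHS]/(- (g_ n a - g_ n b)) opprB.
move=> Ia Ib.
have S0 x : I x -> (0 <= S x)%E.
  by move=> Ix; apply: le_trans (hS x 0%N Ix); rewrite big_nil.
have Iab x : a < x <= b -> I x by move=> /andP[ax xb]; apply: (iI a b) => //; rewrite (ltW ax) xb.
have sI : `]a, b]%classic `<=` I by move=> x /=; rewrite in_itv /=; exact: Iab.
have f0 : (\int[@lebesgue_measure R]_(x in I) S x)%E \is a fin_num.
  by rewrite ge0_fin_numE //; apply: integral_ge0.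
have mI : measurable I by exact: open_measurable.
have mab n : measurable_fun `]a, b] (fun x => `|rd (g_ n) x - rd (g_ n.+1) x|).
  apply: measurableT_comp => //; apply: measurable_funB.
    exact: (rd_measurable1 oI iI (cg n) Ia Ib ab).
  exact: (rd_measurable1 oI iI (cg n.+1) Ia Ib ab).
apply: (@summable_cvg _ _ (fine (\int[@lebesgue_measure R]_(x in I) S x)%E)) => N.
rewrite -lee_fin fineK // -sumEFin.
apply: (@le_trans _ _ (\sum_(0 <= n < N) \int[@lebesgue_measure R]_(x in `]a, b]) `|rd (g_ n) x - rd (g_ n.+1) x|%:E)%E).
  apply: lee_sum => n _.
  apply: le_trans (le_subr_Rintegral oI iI (cg n) (cg n.+1) Ia Ib ab).
  by rewrite lee_fin le_eqVlt; apply/orP; left; apply/eqP; congr `|_|; ring.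
rewrite -ge0_integral_sum //; last first.
  by move=> n; apply/measurable_EFinP; exact: mab.
apply: (@le_trans _ _ (\int[@lebesgue_measure R]_(x in `]a, b]) S x)%E).
  apply: ge0_le_integral => //.
  - by move=> x _; apply: sume_ge0.
  - by apply: emeasurable_sum => n; apply/measurable_EFinP; exact: mab.
  - exact: measurable_funS mS.
  - by move=> x /=; rewrite in_itv /= => /Iab Ix; rewrite sumEFin; exact: hS.
exact: ge0_subset_integral.
Qed.

Lemma ae_itv (R : realType) (P : R -> Prop) (a b : R) :
  {ae (@lebesgue_measure R), forall x, P x} -> a < b -> exists x, [/\ a < x, x < b & P x].
Proof.
move=> [N [mN N0 hN]] ab; apply: contrapT => h.
have sub : `]a, b[%classic `<=` N.
  by move=> x /=; rewrite in_itv /= => /andP[xa xb]; apply: hN => /= Px; apply: h; exists x.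
have N0' : (@lebesgue_measure R) N = 0%E := N0.
have : ((@lebesgue_measure R) `]a, b[ <= (@lebesgue_measure R) N)%E.
  by apply: le_measure => //; rewrite inE.
by rewrite N0' lebesgue_measure_itv /= lte_fin ab -EFinB lee_fin subr_le0 leNgt ab.
Qed.

Lemma I2_1_fin (R : realType) (A : set (R * R)) (X : R) :
  measurable A -> (forall z, A z -> `|z.1| <= X /\ `|z.2| <= X) ->
  I2 A (fun=> 1) \is a fin_num.
Proof.
move=> mA hX; rewrite ge0_fin_numE; last by apply: I2_ge0.
pose B : set (R * R) := `[- X, X]%classic `*` `[- X, X]%classic.
have mB : measurable B by apply: measurableX.
apply: (@le_lt_trans _ _ (I2 B (fun=> 1))).
  apply: I2_subset => //.
  by move=> z Az; have [h1 h2] := hX _ Az; split; rewrite /= in_itv /= -ler_norml.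
have E : ((lebesgue_measure \x lebesgue_measure) B =
    (@lebesgue_measure R) `[(- X)%R, X]%classic * (@lebesgue_measure R) `[(- X)%R, X]%classic)%E.
  exact: product_measure1E.
rewrite (I2_cst _ mB) mul1e E lebesgue_measure_itv /= lte_fin.
by case: ifP => _; rewrite ?mule0 ?ltry // -EFinB -EFinM ltry.
Qed.

Lemma I2_le_cst (R : realType) (A : set (R * R)) (f : R * R -> R) (c m : R) :
  measurable A -> measurable_fun A f -> (forall z, A z -> 0 <= f z) ->
  (forall z, A z -> f z <= c) -> 0 <= c -> I2 A (fun=> 1) = m%:E -> (I2 A f <= (c * m)%:E)%E.
Proof.
move=> mA mf f0 fc c0 hm; rewrite EFinM -hm -I2Z //.
by apply: I2_le => // z Az; rewrite mulr1 fc.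
Qed.

Lemma rd_cst (R : realType) (c x : R) : rd (fun=> c) x = 0.
Proof.
rewrite /rd (_ : (fun n => _) = fun=> 0); first exact: lim_cst.
by apply/funext => n; rewrite subrr mulr0.
Qed.

Lemma infimum_En (R : realType) (A : set (R * R)) (X : R) :
  open A -> cset2 A -> (forall z, A z -> `|z.1| <= X /\ `|z.2| <= X) ->
  exists I : R, (forall f, inK A f -> (I%:E <= En A f)%E) /\
    forall e, 0 < e -> exists2 f, inK A f & (En A f <= (I + e)%:E)%E.
Proof.
move=> oA cA hX; have mA := open_measurable2 oA.
have En0 f : inK A f -> (0 <= En A f)%E.
  by move=> [_ f0]; apply: I2_ge0 => z Az; rewrite den_ge0 ?f0.
pose S := [set e : R | exists2 f, inK A f & En A f = e%:E].
have K0 : inK A (fun=> 0) by split => // x y t _ _ _ _; rewrite subrr mulr0 addr0.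
have S0 : S !=set0.
  suff : En A (fun=> 0) \is a fin_num.
    by move=> h; exists (fine (En A (fun=> 0))), (fun=> 0) => //; rewrite fineK.
  rewrite ge0_fin_numE; last exact: En0.
  apply: (@le_lt_trans _ _ (X ^+ 2 * fine (I2 A (fun=> 1)))%:E); last exact: ltry.
  apply: I2_le_cst; rewrite ?fineK ?(I2_1_fin mA hX) ?sqr_ge0 //.
  - by apply: den_measurable => //; case: K0.
  - by move=> z Az; rewrite den_ge0.
  move=> z Az; have [h1 h2] := hX _ Az; rewrite /den /r1 /r2 !rd_cst !sub0r !sqrrN addr0.
  have k1 : z.1 ^+ 2 <= X ^+ 2 by move: h1; rewrite ler_norml => /andP[? ?]; nra.
  have k2 : z.2 ^+ 2 <= X ^+ 2 by move: h2; rewrite ler_norml => /andP[? ?]; nra.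
  by plra.
have lS : has_lbound S by exists 0 => x [f Kf E]; have := En0 _ Kf; rewrite E lee_fin.
exists (inf S); split.
  move=> f Kf; have := En0 _ Kf; case E : (En A f) => [x||]; [|by move=> _; exact: leey|by []].
  by move=> _; rewrite lee_fin; apply: ge_inf => //; exists f.
move=> e e0; have [x [f Kf Ef] xe] := inf_adherent e0 (conj S0 lS).
by exists f => //; rewrite Ef lee_fin ltW.
Qed.

Lemma nneseries_prod (d1 d2 : measure_display) (T1 : measurableType d1) (T2 : measurableType d2)
  (R : realType) (m1 : {sigma_finite_measure set T1 -> \bar R})
  (m2 : {sigma_finite_measure set T2 -> \bar R})
  (A : set (T1 * T2)) (f_ : nat -> T1 * T2 -> \bar R) :
  measurable A -> (forall n, measurable_fun A (f_ n)) -> (forall n z, A z -> (0 <= f_ n z)%E) ->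
  (\int[m1 \x m2]_(z in A) \sum_(0 <= n <oo) f_ n z =
   \sum_(0 <= n <oo) \int[m1 \x m2]_(z in A) f_ n z)%E.
Proof. by move=> mA mf f0; apply: integral_nneseries. Qed.

Lemma minimizing_increments (R : realType) (A : set (R * R)) (X I : R) (w_ : nat -> R * R -> R) :
  open A -> cset2 A -> (forall z, A z -> `|z.1| <= X /\ `|z.2| <= X) ->
  (forall f, inK A f -> (I%:E <= En A f)%E) -> (forall n, inK A (w_ n)) ->
  (forall n, (En A (w_ n) <= (I + (4 ^+ n)^-1)%:E)%E) ->
  (\int[lebesgue_measure \x lebesgue_measure]_(z in A)
    \sum_(0 <= n <oo) (`|r1 (w_ n) z - r1 (w_ n.+1) z| + `|r2 (w_ n) z - r2 (w_ n.+1) z|)%:E < +oo)%E.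
Proof.
move=> oA cA hX hI Kw hw; have mA := open_measurable2 oA.
pose G n z : R := `|r1 (w_ n) z - r1 (w_ n.+1) z| + `|r2 (w_ n) z - r2 (w_ n.+1) z|.
have G0 n z : 0 <= G n z by rewrite addr_ge0.
have cw n : cvx2 A (w_ n) by case: (Kw n).
have mG n : measurable_fun A (G n).
  have [m1 m2 _ _] := partials_measurable oA cA (cw n).
  have [n1 n2 _ _] := partials_measurable oA cA (cw n.+1).
  by apply: measurable_funD; apply: measurableT_comp => //; apply: measurable_funB.
pose m := fine (I2 A (fun=> 1)).
have Em : I2 A (fun=> 1) = m%:E by rewrite /m fineK // (I2_1_fin mA hX).
have m0 : 0 <= m by rewrite -lee_fin -Em I2_ge0.
have GE n : (I2 A (G n) <= ((m + 4) / 2 ^+ n)%:E)%E.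
  have p2 : (0:R) < 2 ^+ n by rewrite exprn_gt0.
  have e1 : (4 ^+ n.+1)^-1 <= (4 ^+ n)^-1 :> R.
    by rewrite lef_pV2 ?posrE ?exprn_gt0 // ler_eXn2l //; plra.
  have hg : (I2 A (gd (w_ n) (w_ n.+1)) <= (8 * (4 ^+ n)^-1)%:E)%E.
    apply: (parallelogram oA cA (Kw n) (Kw n.+1) hI (hw n)).
    by apply: le_trans (hw n.+1) _; rewrite lee_fin lerD2l.
  have mg := gd_measurable oA cA (cw n) (cw n.+1).
  (* The parallelogram law only gives squares, of integral at most 8 / 4 ^ n. The
     arithmetic-geometric mean inequality with weight 2 ^ n, together with the finite area m, turns
     this into the summable bound (m + 4) / 2 ^ n for the absolute values. *)
  apply: (@le_trans _ _ (I2 A (fun z => (2 ^+ n)^-1 * 1 + (2 ^+ n / 2) * gd (w_ n) (w_ n.+1) z))).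
    apply: I2_le => //.
    - by apply: measurable_funD => //; apply: measurable_funM.
    move=> z _; rewrite /G /gd.
    move: (r1 _ z - _) (r2 _ z - _) => a b.
    have am (x : R) : `|x| <= (2 ^+ n)^-1 / 2 + 2 ^+ n / 2 * x ^+ 2.
      have : 0 <= (2 ^+ n) / 2 * (`|x| - (2 ^+ n)^-1) ^+ 2 by rewrite mulr_ge0 ?divr_ge0 ?sqr_ge0 // ltW.
      rewrite sqrrB real_normK ?num_real // => h.
      suff E : 2 ^+ n / 2 * (x ^+ 2 - `|x| * (2 ^+ n)^-1 *+ 2 + (2 ^+ n)^-1 ^+ 2) =
         (2 ^+ n)^-1 / 2 + 2 ^+ n / 2 * x ^+ 2 - `|x| by plra.
      by rewrite mulr2n; field; rewrite gt_eqF.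
    by have := am a; have := am b; plra.
  rewrite I2D //; [|exact: measurable_funM|by move=> z _; rewrite mulr_ge0 ?gd_ge0 // divr_ge0 // ltW].
  rewrite I2Z ?invr_ge0 ?(ltW p2) // Em I2Z ?divr_ge0 ?(ltW p2) //; last by move=> z _; exact: gd_ge0.
  have k0 : (0 <= (2 ^+ n / 2 : R)%R%:E)%E by rewrite lee_fin divr_ge0 // ltW.
  apply: le_trans (leeD2l _ (lee_wpmul2l k0 hg)) _.
  have E4 : 4 ^+ n = 2 ^+ n * 2 ^+ n :> R by rewrite -exprMn; congr (_ ^+ _); ring.
  rewrite -!EFinM -EFinD lee_fin E4 le_eqVlt; apply/orP; left; apply/eqP.
  by field; rewrite gt_eqF.
rewrite (@nneseries_prod _ _ _ _ R lebesgue_measure lebesgue_measure A (fun n z => (G n z)%:E)) //; first last.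
- by move=> n z _; rewrite lee_fin.
- by move=> n; apply/measurable_EFinP; exact: mG.
apply: (@le_lt_trans _ _ (2 * (m + 4))%:E); last exact: ltry.
apply: lime_le; first by apply: is_cvg_nneseries => n _ _; exact: I2_ge0.
near=> N; apply: (@le_trans _ _ (\sum_(0 <= n < N) ((m + 4) / 2 ^+ n)%R%:E)%E).
  by apply: lee_sum => n _; exact: GE.
rewrite sumEFin lee_fin.
suff -> : \sum_(0 <= n < N) (m + 4) / 2 ^+ n = (m + 4) * (2 - 2 / 2 ^+ N).
  have : 0 <= (m + 4) * (2 / 2 ^+ N) by rewrite mulr_ge0 ?divr_ge0 ?exprn_ge0 //; plra.
  by plra.
elim: (N : nat) => [|k IH]; first by rewrite big_nil expr0; plra.
have p2 : (0:R) < 2 ^+ k by rewrite exprn_gt0.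
by rewrite big_nat_recr //= IH exprS; field; rewrite gt_eqF.
Unshelve. all: by end_near. Qed.

(** By Tonelli the increments of the gradients are summable on almost every row and column, so
    differences of values converge there. The strip between T0 and T1 is crossed by every column and
    provides one good row, which links all good columns to each other; good columns are dense, and
    [cvx1_cvg_dense] extends the convergence to all points. *)
Lemma minimizing_cvg (R : realType) (A : set (R * R)) (X I T0 T1 : R) (w_ : nat -> R * R -> R) :
  open A -> cset2 A -> (forall z, A z -> `|z.1| <= X /\ `|z.2| <= X) ->
  T0 < T1 -> (forall t z, T0 < t -> t < T1 -> A z -> A (z.1, t)) -> A !=set0 ->
  (forall f, inK A f -> (I%:E <= En A f)%E) -> (forall n, inK A (w_ n)) ->
  (forall n, (En A (w_ n) <= (I + (4 ^+ n)^-1)%:E)%E) ->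
  exists2 z0, A z0 & forall z, A z -> cvgn (fun n => w_ n z - w_ n z0).
Proof.
move=> oA cA hX T01 hT [zA AzA] hI Kw hw; have mA := open_measurable2 oA.
have Sfin := minimizing_increments oA cA hX hI Kw hw.
pose G n z : R := `|r1 (w_ n) z - r1 (w_ n.+1) z| + `|r2 (w_ n) z - r2 (w_ n.+1) z|.
pose S (z : R * R) : \bar R := (\sum_(0 <= n <oo) (G n z)%:E)%E.
have G0 n z : 0 <= G n z by rewrite addr_ge0.
have S0 z : A z -> (0 <= S z)%E by move=> _; apply: nneseries_ge0 => n _ _; rewrite lee_fin.
have SG z N : ((\sum_(0 <= n < N) G n z)%:E <= S z)%E.
  by rewrite -sumEFin; apply: nneseries_lim_ge => n _ _; rewrite lee_fin.
have cw n : cvx2 A (w_ n) by case: (Kw n).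
have mG n : measurable_fun A (G n).
  have [m1 m2 _ _] := partials_measurable oA cA (cw n).
  have [n1 n2 _ _] := partials_measurable oA cA (cw n.+1).
  by apply: measurable_funD; apply: measurableT_comp => //; apply: measurable_funB.
have mS : measurable_fun A S.
  apply: (@ge0_emeasurable_sum _ _ R A (fun n z => (G n z)%:E) xpredT).
    by move=> n z _ _; rewrite lee_fin.
  by move=> n _; apply/measurable_EFinP; exact: mG.
have gr := good_rows mA mS S0 Sfin; have gc := good_cols mA mS S0 Sfin.
have row_ok t a b : (\int[@lebesgue_measure R]_(s in row A t) S (s, t) < +oo)%E ->
    A (a, t) -> A (b, t) -> cvgn (fun n => w_ n (b, t) - w_ n (a, t)).
  move=> ht Aa Ab.
  apply: (@line_cvg R (row A t) (fun n s => w_ n (s, t)) (fun s => S (s, t))) => //.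
  - exact: row_open.
  - exact: row_itv.
  - by move=> n; apply: row_cvx.
  - exact: row_measurable_fun.
  move=> x N Ax; apply: le_trans (SG (x, t) N); rewrite lee_fin; apply: ler_sum => n _.
  by rewrite /G lerDl.
have col_ok s a b : (\int[@lebesgue_measure R]_(t in col A s) S (s, t) < +oo)%E ->
    A (s, a) -> A (s, b) -> cvgn (fun n => w_ n (s, b) - w_ n (s, a)).
  move=> ht Aa Ab.
  apply: (@line_cvg R (col A s) (fun n t => w_ n (s, t)) (fun t => S (s, t))) => //.
  - exact: col_open.
  - exact: col_itv.
  - by move=> n; apply: col_cvx.
  - exact: col_measurable_fun.
  move=> x N Ax; apply: le_trans (SG (s, x) N); rewrite lee_fin; apply: ler_sum => n _.
  by rewrite /G lerDr.
have [t0 [T0t tT1 g0]] := ae_itv gr T01.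
pose z0 : R * R := (zA.1, t0).
have Az0 : A z0 by exact: hT.
exists z0 => //.
have good s t : A (s, t) -> (\int[@lebesgue_measure R]_(t in col A s) S (s, t) < +oo)%E ->
    cvgn (fun n => w_ n (s, t) - w_ n z0).
  move=> Ast gs; have Ast0 : A (s, t0) := hT _ _ T0t tT1 Ast.
  rewrite (_ : (fun n => _) = (fun n => (w_ n (s, t) - w_ n (s, t0)) + (w_ n (s, t0) - w_ n z0))).
    by apply: is_cvgD; [exact: col_ok|exact: row_ok].
  by apply/funext => n; rewrite addrA subrK.
move=> [s t] Ast.
apply: (@cvx1_cvg_dense R (row A t) (fun n s => w_ n (s, t) - w_ n z0)) => //.
- exact: row_open.
- exact: row_itv.
- by move=> n x y z Ax Az xy yz; have := row_cvx (cw n) Ax Az xy yz; plra.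
move=> y e Ay e0.
have [r r0 hr] := open_square oA Ay.
have yr : y < y + Num.min r e by rewrite ltrDl lt_min r0.
have [x [yx xr gx]] := ae_itv gc yr.
have xr' : x - y < r /\ x - y < e by apply/andP; rewrite -lt_min ltrBlDl.
have Ax : A (x, t).
  apply: hr => /=; last by rewrite subrr normr0 ltW.
  by rewrite gtr0_norm ?subr_gt0 // ltW; case: xr'.
exists x; split => //; first by case: xr' => _; rewrite ltrBlDl.
exact: good.
Qed.

Lemma null_prod (d1 d2 : measure_display) (T1 : measurableType d1) (T2 : measurableType d2)
  (R : realType) (m1 : {sigma_finite_measure set T1 -> \bar R})
  (m2 : {sigma_finite_measure set T2 -> \bar R}) (A N : set (T1 * T2)) (f : T1 * T2 -> \bar R) :
  measurable A -> measurable N -> (m1 \x m2)%E N = 0%E -> measurable_fun A f ->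
  (\int[m1 \x m2]_(z in A `&` N) f z = 0)%E.
Proof.
move=> mA mN N0 mf; apply: null_set_integral; first exact: measurableI.
  by apply: measurable_funS mf => // z [].
by apply: (subset_measure0 (measurableI _ _ mA mN) mN _ N0) => z [].
Qed.

Lemma I2_null (R : realType) (A N : set (R * R)) (f : R * R -> R) :
  measurable A -> measurable N -> (lebesgue_measure \x lebesgue_measure)%E N = 0%E ->
  measurable_fun A f -> I2 (A `\` N) f = I2 A f.
Proof.
move=> mA mN N0 mf; rewrite (I2_split mA mN mf).
have mef : measurable_fun A (EFin \o f) by exact/measurable_EFinP.
have -> : I2 (A `&` N) f = 0%E.
  exact: (@null_prod _ _ _ _ R lebesgue_measure lebesgue_measure A N (EFin \o f) mA mN N0 mef).
by rewrite add0e.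
Qed.

Lemma I2_box (R : realType) (a b c d : R) : a <= b -> c <= d ->
  I2 (`]a, b[%classic `*` `]c, d[%classic) (fun=> 1) = ((b - a) * (d - c))%:E.
Proof.
move=> ab cd; have mB : measurable (`]a, b[%classic `*` `]c, d[%classic : set (R * R)).
  by apply: measurableX.
have E : ((lebesgue_measure \x lebesgue_measure) (`]a, b[%classic `*` `]c, d[%classic) =
    (@lebesgue_measure R) `]a, b[%classic * (@lebesgue_measure R) `]c, d[%classic)%E.
  exact: product_measure1E.
rewrite (I2_cst _ mB) mul1e E !lebesgue_measure_itv /= !lte_fin !lt_neqAle ab cd !andbT.
case: eqVneq => [->|_]; first by rewrite subrr mul0r mul0e.
case: eqVneq => [->|_]; first by rewrite subrr mulr0 mule0.
by rewrite -!EFinB -EFinM.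
Qed.

Lemma cvg_max0 (R : realType) (u : nat -> R) (l : R) :
  u @ \oo --> l -> (fun n => Num.max (u n) 0) @ \oo --> Num.max l 0.
Proof.
move/cvgrPdist_lt => h; apply/cvgrPdist_lt => e /h; apply: filterS => n; apply: le_lt_trans.
have := ler_norm (l - u n); have := ler_norm (- (l - u n)); rewrite normrN.
rewrite ler_norml; case: (leP l 0); case: (leP (u n) 0) => ? ? ? ?; apply/andP; split; plra.
Qed.

(** Only differences of the minimizing sequence are known to converge, so its limit v is determined
    up to an additive constant. The constant must be large enough for a nonnegative sum and small
    enough for the energy to stay at the infimum. *)
Lemma exists_min (R : realType) (A : set (R * R)) (X T0 T1 : R) :
  open A -> cset2 A -> (forall z, A z -> `|z.1| <= X /\ `|z.2| <= X) ->
  T0 < T1 -> (forall t z, T0 < t -> t < T1 -> A z -> A (z.1, t)) -> A !=set0 ->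
  exists u : R * R -> R, [/\ inK A u, En A u \is a fin_num & forall f, inK A f -> (En A u <= En A f)%E].
Proof.
move=> oA cA hX T01 hT A0; have mA := open_measurable2 oA.
have [I [hI hinf]] := infimum_En oA cA hX.
have /choice[w_ hw_] : forall n, exists f, inK A f /\ (En A f <= (I + (4 ^+ n)^-1)%:E)%E.
  by move=> n; have [|f Kf Ef] := hinf (4 ^+ n)^-1; [rewrite invr_gt0 exprn_gt0|exists f].
have Kw n : inK A (w_ n) by case: (hw_ n).
have hw n : (En A (w_ n) <= (I + (4 ^+ n)^-1)%:E)%E by case: (hw_ n).
have [z0 Az0 cvw] := minimizing_cvg oA cA hX T01 hT A0 hI Kw hw.
have cw n : cvx2 A (w_ n) by case: (Kw n).
have w0 n z : A z -> 0 <= w_ n z by case: (Kw n) => _; exact.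
pose c n := w_ n z0.
pose v z := limn (fun n => w_ n z - c n).
have cv z : A z -> (fun n => w_ n z - c n) @ \oo --> v z by move=> Az; exact: cvw.
have cxv : cvx2 A v.
  move=> x y t Ax Ay t0 t1; have Axy := cA _ _ _ Ax Ay t0 t1.
  pose d n := (w_ n (x.1 + t * (y.1 - x.1), x.2 + t * (y.2 - x.2)) - c n) -
     ((w_ n x - c n) + t * ((w_ n y - c n) - (w_ n x - c n))).
  have cd : d @ \oo --> v (x.1 + t * (y.1 - x.1), x.2 + t * (y.2 - x.2)) - (v x + t * (v y - v x)).
    apply: cvgB; first exact: cv.
    apply: cvgD; first exact: cv.
    by apply: cvgM; [exact: cvg_cst|apply: cvgB; exact: cv].
  rewrite -subr_le0; apply: (cvgr_to_le cd); near=> n.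
  by rewrite /d; have := cw n x y t Ax Ay t0 t1; plra.
have [N [mN N0 NA hN]] := nondiff_null oA cA cxv.
pose D := A `\` N.
have mD : measurable D by exact: measurableD.
have cr z : D z -> (fun n => r1 (w_ n) z) @ \oo --> r1 v z /\ (fun n => r2 (w_ n) z) @ \oo --> r2 v z.
  case: z => s t [Ast Nst]; have [E1 E2] := hN _ Ast Nst; split.
    have := @cvx1_cvg_rd R (row A t) (fun n x => w_ n (x, t) - c n) (fun x => v (x, t)) s
      (row_open oA) (row_itv cA) _ (row_cvx cxv) _ Ast E1.
    under eq_fun do rewrite rdDc.
    apply; last by move=> y Ay; exact: cv.
    by move=> n x y z Ax Az xy yz; have := row_cvx (cw n) Ax Az xy yz; plra.
  have := @cvx1_cvg_rd R (col A s) (fun n x => w_ n (s, x) - c n) (fun x => v (s, x)) t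
      (col_open oA) (col_itv cA) _ (col_cvx cxv) _ Ast E2.
  under eq_fun do rewrite rdDc.
  apply; last by move=> y Ay; exact: cv.
  by move=> n x y z Ax Az xy yz; have := col_cvx (cw n) Ax Az xy yz; plra.
have mdv : measurable_fun A (den v) by exact: den_measurable.
(* The supremum of K is the lower limit of the constants [c n]; it is the constant that gets added
   to v. *)
pose K := [set k : R | 0 <= k /\ \forall n \near \oo, k <= c n].
have K0 : K 0 by split => //; near=> n; exact: w0.
(* The truncation at 0 makes Fatou's lemma applicable, since [den v z + k] may be negative. *)
pose h k z : R := Num.max (den v z + k) 0.
have h0 k z : 0 <= h k z by rewrite le_max lexx orbT.
have mh k : measurable_fun A (h k).
  by apply: measurable_maxr => //; apply: measurable_funD.
have Ih k : K k -> (I2 A (h k) <= I%:E)%E.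
  move=> [k0 kc]; rewrite -(I2_null mA mN N0 (mh k)).
  apply/lee_addgt0Pr => e e0.
  have [n0 hn0] : exists n0, forall n, (n0 <= n)%N -> k <= c n /\ (4 ^+ n)^-1 <= e.
    have [n1 _ h1] := kc.
    exists (maxn n1 (Num.bound e^-1)) => n; rewrite geq_max => /andP[n1n bn]; split; first exact: h1.
    rewrite invf_ple ?posrE ?exprn_gt0 //.
    apply: (@le_trans _ _ (Num.bound e^-1)%:R); first by apply/ltW/archi_boundP; rewrite invr_ge0 ltW.
    by rewrite -natrX ler_nat; apply: leq_trans bn _; apply: ltnW; apply: ltn_expl.
  pose f n z : R := Num.max (2^-1 * ((r1 (w_ (n + n0)%N) z - z.1) ^+ 2 + (r2 (w_ (n + n0)%N) z - z.2) ^+ 2)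
     + (w_ (n + n0)%N z - c (n + n0)%N) + k) 0.
  have mf n : measurable_fun A (f n).
    apply: measurable_maxr => //; apply: measurable_funD => //.
    rewrite (_ : (fun z => _) = (fun z => den (w_ (n + n0)%N) z - c (n + n0)%N)).
      by apply: measurable_funB => //; exact: den_measurable.
    by apply/funext => z; rewrite /den addrA.
  apply: (@I2_fatou R D f (h k)) => //.
  - by move=> n; apply: measurable_funS (mf n) => // z [].
  - by move=> n z _; rewrite le_max lexx orbT.
  - move=> z Dz; have [c1 c2] := cr z Dz; have Az : A z by case: Dz.
    apply: cvg_max0.
    rewrite /den; apply: cvgD; last exact: cvg_cst.
    have sh (g : nat -> R) (l : R) : g @ \oo --> l -> (fun n => g (n + n0)%N) @ \oo --> l.
      by move=> hg; rewrite -(cvg_shiftn n0) in hg.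
    have s1 := sh (fun n => r1 (w_ n) z) _ c1; have s2 := sh (fun n => r2 (w_ n) z) _ c2.
    have s3 := sh (fun n => w_ n z - c n) _ (cv z Az).
    apply: cvgD; last exact: s3.
    apply: cvgM; first exact: cvg_cst.
    rewrite !expr2; apply: cvgD; apply: cvgM; apply: cvgB; try exact: cvg_cst; by [exact: s1|exact: s2].
  move=> n; have [kn en] := hn0 (n + n0)%N (leq_addl _ _).
  apply: (@le_trans _ _ (En A (w_ (n + n0)%N))); last first.
    by apply: le_trans (hw _) _; rewrite -EFinD lee_fin lerD2l.
  rewrite (I2_null mA mN N0 (mf n)); apply: I2_le => //.
  - exact: den_measurable.
  - by move=> z _; rewrite le_max lexx orbT.
  move=> z Az; rewrite ge_max den_ge0 ?w0 // andbT /den.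
  by have := kn; plra.
have [r r0 hr] := open_square oA Az0.
have [M M0 hM] := cvx2_lip cA cxv r0 hr.
(* On a square around z0 the limit v is at least - B, so a large k in K would carry more energy than
   I on that square. *)
have ubK : has_ubound K.
  pose B : R := M * r + `|v z0|.
  exists (I / (4 * (r * r)) + B) => k Kk.
  rewrite leNgt; apply/negP => kB.
  have kB0 : 0 <= k - B.
    have : 0 <= I / (4 * (r * r)).
      rewrite divr_ge0 ?mulr_ge0 ?(ltW r0) // -lee_fin.
      by apply: le_trans (Ih 0 K0); apply: I2_ge0 => z _; exact: h0.
    by move: kB; plra.
  pose Q : set (R * R) := `](z0.1 - r), (z0.1 + r)[%classic `*` `](z0.2 - r), (z0.2 + r)[%classic.
  have mQ : measurable Q by apply: measurableX.
  have Qr z : Q z -> `|z.1 - z0.1| <= r /\ `|z.2 - z0.2| <= r.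
    move=> [] /=; rewrite !in_itv /= => /andP[? ?] /andP[? ?].
    by split; rewrite ler_norml; apply/andP; split; plra.
  have QA : Q `<=` A by move=> z /Qr[]; exact: hr.
  have mhQ : measurable_fun Q (h k) by exact: measurable_funS (mh k).
  have : (I2 Q (fun=> (k - B) * 1)%R <= I%:E)%E.
    apply: le_trans (Ih k Kk); apply: (@le_trans _ _ (I2 Q (h k))).
      apply: I2_le => // z Qz; first by rewrite mulr1.
      rewrite mulr1 le_max; apply/orP; left.
      have [q1 q2] := Qr z Qz; have := hM z r (ltW r0) (lexx r) q1 q2.
      rewrite ler_norml => /andP[q _]; have := ler_norm (- v z0); rewrite normrN => q3.
      have : 0 <= 2^-1 * ((r1 v z - z.1) ^+ 2 + (r2 v z - z.2) ^+ 2).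
        by rewrite mulr_ge0 ?invr_ge0 // addr_ge0 // sqr_ge0.
      by rewrite /den /B; clear - q q3; lra.
    exact: I2_subset.
  rewrite I2Z // I2_box; [|plra|plra].
  rewrite -EFinM lee_fin => kI.
  have : (k - B) * (4 * (r * r)) <= I by move: kI; plra.
  have rr : 0 < 4 * (r * r) by rewrite !mulr_gt0.
  rewrite -ler_pdivlMr // => ?; move: kB; plra.
have sK : has_sup K by split => //; exists 0.
pose cc := sup K.
have cc0 : 0 <= cc by apply: sup_upper_bound.
exists (fun z => v z + cc).
have cxu : cvx2 A (fun z => v z + cc).
  by move=> x y t Ax Ay t0 t1; have := cxv _ _ _ Ax Ay t0 t1; plra.
(* As [w_ n z] is nonnegative, a negative value of v + cc at z would force [c n] to exceed cc by a
   fixed amount for all large n, against the choice of cc. *)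
have Ku : inK A (fun z => v z + cc).
  split => // z Az; rewrite leNgt; apply/negP => neg.
  have : K (cc - (v z + cc) / 2).
    split; first by move: neg cc0; plra.
    have e0 : 0 < - (v z + cc) / 2 by plra.
    near=> n.
    have : `|v z - (w_ n z - c n)| < - (v z + cc) / 2.
      by near: n; move/cvgrPdist_lt: (cv z Az); apply.
    by rewrite ltr_norml => /andP[? _]; have := w0 n z Az; plra.
  by move/(sup_upper_bound sK); rewrite -/cc; move: neg; plra.
have denE z : den (fun z => v z + cc) z = den v z + cc.
  by rewrite /den /r1 /r2 !rdDc addrA.
pose m := fine (I2 A (fun=> 1)).
have Em : I2 A (fun=> 1) = m%:E by rewrite /m fineK // (I2_1_fin mA hX).
have m0 : 0 <= m by rewrite -lee_fin -Em I2_ge0.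
have EI : (En A (fun z => v z + cc)%R <= I%:E)%E.
  apply/lee_addgt0Pr => e e0.
  have e1 : 0 < e / (m + 1) by rewrite divr_gt0 //; plra.
  have [k Kk kc] := sup_adherent e1 sK.
  apply: (@le_trans _ _ (I2 A (fun z => h k z + e / (m + 1) * 1)%R)).
    apply: I2_le => //.
    - exact: den_measurable.
    - by apply: measurable_funD.
    - by move=> z Az; rewrite den_ge0 //; case: Ku => _; exact.
    move=> z Az; rewrite denE /h mulr1.
    have : den v z + k <= Num.max (den v z + k) 0 by rewrite le_max lexx.
    by move: (Num.max _ _) kc; rewrite -/cc => ? ?; plra.
  rewrite I2D //; last by move=> z _; rewrite mulr1 ltW.
  rewrite (I2Z mA) ?(ltW e1) // Em; apply: leeD; first exact: Ih.
  rewrite -EFinM lee_fin mulrAC -mulrA ler_piMr ?(ltW e0) // ler_pdivrMr; plra.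
split => //.
  rewrite ge0_fin_numE; last by apply: I2_ge0 => z Az; rewrite den_ge0 //; case: Ku => _; exact.
  by apply: le_lt_trans EI (ltry _).
by move=> f Kf; apply: le_trans EI (hI f Kf).
Unshelve. all: by end_near. Qed.

Lemma min_unique (R : realType) (A : set (R * R)) (X T0 T1 : R) (u v : R * R -> R) :
  open A -> cset2 A -> (forall z, A z -> `|z.1| <= X /\ `|z.2| <= X) ->
  T0 < T1 -> (forall t z, T0 < t -> t < T1 -> A z -> A (z.1, t)) ->
  inK A u -> inK A v -> En A u \is a fin_num ->
  (forall f, inK A f -> (En A u <= En A f)%E) -> (forall f, inK A f -> (En A v <= En A f)%E) ->
  forall z, A z -> u z = v z.
Proof.
move=> oA cA hX T01 hT Ku Kv fu mu mv z1 Az1; have mA := open_measurable2 oA.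
have A0 : A !=set0 by exists z1.
have Euv : En A u = En A v by apply/eqP; rewrite eq_le mu // mv.
(* Applied to the alternating sequence [u, v, u, ...], convergence means equality up to a constant. *)
pose w_ n := if odd n then u else v.
have [z0 Az0 cvw] := @minimizing_cvg R A X (fine (En A u)) T0 T1 w_ oA cA hX T01 hT A0
  ltac:(by move=> f Kf; rewrite fineK ?mu) ltac:(by move=> n; rewrite /w_; case: odd)
  ltac:(by move=> n; rewrite EFinD fineK // /w_ -?Euv; case: odd; rewrite -?Euv leeDl // lee_fin invr_ge0 exprn_ge0).
have Ez z : A z -> u z = v z + (u z0 - v z0).
  move=> Az; have c := cvw z Az; set l := limn _ in c.
  have c1 : (fun n => w_ n.*2.+1 z - w_ n.*2.+1 z0) @ \oo --> l.
    apply: (cvg_comp (fun n => n.*2.+1) (fun n => w_ n z - w_ n z0)) c => //.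
    move=> P [N _ hN]; exists N => // n /= Nn; apply: hN => /=.
    by apply: leq_trans (leqnSn _); rewrite -addnn; apply: leq_trans (leq_addr _ _).
  have c2 : (fun n => w_ n.*2 z - w_ n.*2 z0) @ \oo --> l.
    apply: (cvg_comp (fun n => n.*2) (fun n => w_ n z - w_ n z0)) c => //.
    move=> P [N _ hN]; exists N => // n /= Nn; apply: hN => /=.
    by rewrite -addnn; apply: leq_trans (leq_addr _ _).
  have E1 : l = u z - u z0.
    rewrite (_ : (fun n => _) = fun=> u z - u z0) in c1; last by apply/funext => n; rewrite /w_ /= odd_double.
    by rewrite -(cvg_lim _ c1) // lim_cst.
  have E2 : l = v z - v z0.
    rewrite (_ : (fun n => _) = fun=> v z - v z0) in c2; last by apply/funext => n; rewrite /w_ odd_double.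
    by rewrite -(cvg_lim _ c2) // lim_cst.
  by have := E1; rewrite E2; plra.
have Ez' z : A z -> v z = u z + (v z0 - u z0) by move=> /Ez ->; ring.
(* Adding a constant c >= 0 raises the energy by c times the area m, which is positive; equal
   energies leave only c = 0. *)
have shift (f g : R * R -> R) (c : R) : inK A f -> inK A g -> En A g \is a fin_num -> 0 <= c ->
    En A f = En A g -> (forall z, A z -> f z = g z + c) -> c = 0.
  move=> [cf f0] [cg g0] fg c0 Efg hfg.
  pose m := fine (I2 A (fun=> 1)).
  have Em : I2 A (fun=> 1) = m%:E by rewrite /m fineK // (I2_1_fin mA hX).
  have [r r0 hr] := open_square oA Az1.
  have m0 : 0 < m.
    rewrite -lte_fin -Em.
    apply: (@lt_le_trans _ _ (I2 (`](z1.1 - r), (z1.1 + r)[%classic `*` `](z1.2 - r), (z1.2 + r)[%classic) (fun=> 1))).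
      by rewrite I2_box ?lte_fin ?mulr_gt0; plra.
    apply: I2_subset => //; first by apply: measurableX.
    move=> z [] /=; rewrite !in_itv /= => /andP[? ?] /andP[? ?]; apply: hr; rewrite ler_norml; apply/andP; split; plra.
  have dE z : A z -> den f z = den g z + c * 1.
    case: z => s t Ast; rewrite /den (hfg _ Ast) mulr1 addrA; congr (_ + _ + _).
    have E1 : r1 f (s, t) = r1 g (s, t).
      rewrite -[RHS](rdDc _ c); apply/cvg_lim => //.
      have [h _ _] := rd_spec (row_open oA) (row_itv cA) (row_cvx cg) (Ast : row A t s).
      have [e e0 he] := open_square oA Ast.
      rewrite rdDc; apply: cvg_trans h; apply: near_eq_cvg; near=> n.
      rewrite !hfg //=; first by ring.
      apply: he => /=; last by rewrite subrr normr0 ltW.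
      by rewrite addrAC subrr add0r ger0_norm ?invr_ge0 // ltW //; near: n; exact: invSn_small.
    have E2 : r2 f (s, t) = r2 g (s, t).
      rewrite -[RHS](rdDc _ c); apply/cvg_lim => //.
      have [h _ _] := rd_spec (col_open oA) (col_itv cA) (col_cvx cg) (Ast : col A s t).
      have [e e0 he] := open_square oA Ast.
      rewrite rdDc; apply: cvg_trans h; apply: near_eq_cvg; near=> n.
      rewrite !hfg //=; first by ring.
      apply: he => /=; first by rewrite subrr normr0 ltW.
      by rewrite addrAC subrr add0r ger0_norm ?invr_ge0 // ltW //; near: n; exact: invSn_small.
    by rewrite E1 E2.
  have : En A f = (En A g + (c * m)%:E)%E.
    rewrite EFinM -Em -I2Z // -I2D //; last 3 first.
    - exact: den_measurable.
    - by move=> z Az; rewrite den_ge0 ?g0.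
    - by move=> z _; rewrite mulr1.
    exact: I2_ext.
  rewrite Efg -(fineK fg) -EFinD => -[] h.
  have /eqP : c * m = 0 by move: h; set y := fine _; clear; lra.
  by rewrite mulf_eq0 (gt_eqF m0) orbF => /eqP.
have [d0|d0] := leP 0 (u z0 - v z0).
  by rewrite (Ez _ Az1) (shift u v _ Ku Kv _ d0 Euv Ez) ?addr0 // -Euv.
have d1 : 0 <= v z0 - u z0 by plra.
by rewrite (Ez' _ Az1) (shift v u _ Kv Ku fu d1 (esym Euv) Ez') addr0.
Unshelve. all: by end_near. Qed.

Lemma inK_ext (R : realType) (A : set (R * R)) (u v : R * R -> R) :
  cset2 A -> (forall z, A z -> u z = v z) -> inK A u -> inK A v.
Proof.
move=> cA uv [cu u0]; split; last by move=> z Az; rewrite -uv ?u0.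
by move=> x y t Ax Ay t0 t1; rewrite -!uv //; [exact: cu|exact: cA].
Qed.

Lemma square_open (R : realType) (A : set (R * R)) :
  (forall z, A z -> exists2 r : R, 0 < r & forall y : R * R, `|y.1 - z.1| < r -> `|y.2 - z.2| < r -> A y) ->
  open A.
Proof.
move=> h; rewrite openE => z /h[r r0 hr]; apply/nbhs_ballP; exists r => //= y [/= y1 y2].
by apply: hr; rewrite distrC.
Qed.

Lemma En_swap (R : realType) (A : set (R * R)) (u : R * R -> R) :
  open A -> cset2 A -> inK A u ->
  [/\ open [set z | A (swp z)], cset2 [set z | A (swp z)], inK [set z | A (swp z)] (fun z => u (swp z)) &
    En [set z | A (swp z)] (fun z => u (swp z)) = En A u].
Proof.
move=> oA cA [cu u0]; split.
- apply: square_open => z Az; have [r r0 hr] := open_square oA Az.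
  by exists r => // y y1 y2; apply: hr; exact: ltW.
- by move=> x y t Ax Ay t0 t1; exact: (cA _ _ _ Ax Ay t0 t1).
- split; first by move=> x y t Ax Ay t0 t1; exact: (cu _ _ _ Ax Ay t0 t1).
  by move=> z Az; exact: u0.
rewrite /En (I2_swap (open_measurable2 oA)).
- by apply: I2_ext => -[s t] Ast; rewrite /den /r1 /r2 /swp /= [X in _ * X]addrC.
- exact: den_measurable.
- by move=> z Az; rewrite den_ge0 ?u0.
Qed.

(** The reflection turns the right derivative in x_2 into minus the left one, so the densities agree
    only off the null set of kinks. *)
Lemma En_flip (R : realType) (A : set (R * R)) (u : R * R -> R) :
  open A -> cset2 A -> (forall z, A z -> A (z.1, - z.2)) -> inK A u ->
  inK A (fun z => u (z.1, - z.2)) /\ En A (fun z => u (z.1, - z.2)) = En A u.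
Proof.
move=> oA cA sA [cu u0]; have mA := open_measurable2 oA.
have cv : cvx2 A (fun z => u (z.1, - z.2)).
  move=> x y t Ax Ay t0 t1; have := cu _ _ _ (sA _ Ax) (sA _ Ay) t0 t1.
  by rewrite /= (_ : - x.2 + t * (- y.2 - - x.2) = - (x.2 + t * (y.2 - x.2))) //; ring.
have v0 z : A z -> 0 <= u (z.1, - z.2) by move=> Az; exact: u0 (sA _ Az).
split; first by split.
have [N [mN N0 NA hN]] := nondiff_null oA cA cv.
have mdv := den_measurable oA cA cv.
have md := den_measurable oA cA cu.
have AE : [set z | A (z.1, - z.2)] = A.
  apply/seteqP; split => z /=; last exact: sA.
  by move=> /sA /=; rewrite opprK; case: z.
have mphi : measurable_fun setT (fun z : R * R => (z.1, - z.2) : R * R).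
  by apply/measurable_fun_pairP; split; [exact: measurable_fst|exact: (measurableT_comp (@oppr_measurable R setT) measurable_snd)].
rewrite /En [RHS](I2_flip mA md) ?AE; last by move=> z Az; rewrite den_ge0 ?u0.
rewrite -(I2_null mA mN N0 mdv) -(I2_null mA mN N0 (f := fun z => den u (z.1, - z.2))); last first.
  apply: (measurable_comp mA _ md); first by move=> _ [z Bz <-]; exact: sA.
  exact: measurable_funTS.
apply: I2_ext => -[s t] [Ast Nst]; have [_ E2] := hN _ Ast Nst.
rewrite /den /= -E2; congr (_ * (_ + _) + _).
rewrite /l2 /r2 /ld /=; under [X in (- rd X _ - _) ^+ 2]eq_fun do rewrite opprK.
by rewrite opprK -[LHS]sqrrN opprB opprK addrC.
Qed.

(** * First-order expansions and supporting planes *)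

Lemma smooth_eps (R : realType) (I : set R) (g : R -> R) (x e : R) :
  open I -> is_interval I -> cvx1 I g -> I x -> ld g x = rd g x -> 0 < e ->
  exists2 d : R, 0 < d & forall h, `|h| <= d -> I (x + h) /\ g (x + h) <= g x + rd g x * h + e * `|h|.
Proof.
move=> oI iI cg Ix E e0.
have [r r0 Ir] : exists2 r : R, 0 < r & forall y, `|x - y| < r -> I y.
  by have /nbhs_ballP[r /= r0 hr] := oI _ Ix; exists r => // y; exact: hr.
have [c1 _ _] := rd_spec oI iI cg Ix.
have c2 := ld_spec oI iI cg Ix; rewrite E in c2.
have [N [N0 Ne Nd1 Nd2]] : exists N : nat, [/\ (0:R) < N.+1%:R^-1, (N.+1%:R^-1 : R) < r,
   N.+1%:R * (g (x + N.+1%:R^-1) - g x) < rd g x + e &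
   rd g x - e < N.+1%:R * (g x - g (x - N.+1%:R^-1))].
  near \oo => N; exists N; split.
  - by rewrite invr_gt0.
  - by near: N; exact: invSn_small.
  - by near: N; apply: (cvgr_lt _ c1); rewrite ltrDl.
  - by near: N; apply: (cvgr_gt _ c2); rewrite ltrBlDr ltrDl.
set t := (N.+1%:R^-1 : R) in N0 Ne Nd1 Nd2.
have tE : N.+1%:R = t^-1 by rewrite /t invrK.
rewrite tE ltr_pdivrMl // in Nd1; rewrite tE ltr_pdivlMl // in Nd2.
have It : I (x + t) by apply: Ir; rewrite opprD addrA subrr sub0r normrN gtr0_norm.
have It' : I (x - t) by apply: Ir; rewrite opprB addrCA subrr addr0 gtr0_norm.
exists (t / 2) => [|h ht]; first by plra.
have Ih : I (x + h) by apply: Ir; rewrite opprD addrA subrr sub0r normrN; plra.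
split => //; have [hp|hn|->] := ltgtP h 0; last by rewrite normr0 !mulr0 !addr0.
- move: ht; rewrite ltr0_norm // => ht.
  have := cg (x - t) (x + h) x It' Ix; rewrite ltrD2l => /(_ ltac:(plra)) /(_ ltac:(plra)) k.
  rewrite -(ler_pM2l N0); clear - k Nd2 hp; nra.
- move: ht; rewrite gtr0_norm // => ht.
  have := cg x (x + h) (x + t) Ix It; rewrite ltrD2l ltrDl => /(_ ltac:(plra)) /(_ ltac:(plra)) k.
  rewrite -(ler_pM2l N0); clear - k Nd1 hn; nra.
Unshelve. all: by end_near. Qed.

(** The point z + h is the midpoint of z + (2 h1, 0) and z + (0, 2 h2), so expansions along the axes
    bound u from above. Since z is the midpoint of z + h and z - h, the upper bound at z - h gives
    the lower bound at z + h. *)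
Lemma partials_diff (R : realType) (A : set (R * R)) (u : R * R -> R) (z : R * R) (e : R) :
  open A -> cset2 A -> cvx2 A u -> A z -> l1 u z = r1 u z -> l2 u z = r2 u z -> 0 < e ->
  exists2 d : R, 0 < d & forall h1 h2, `|h1| <= d -> `|h2| <= d -> A (z.1 + h1, z.2 + h2) /\
    `|u (z.1 + h1, z.2 + h2) - (u z + r1 u z * h1 + r2 u z * h2)| <= e * (`|h1| + `|h2|).
Proof.
case: z => s t oA cA cu Az E1 E2 e0 /=.
have [d1 d10 H1] := smooth_eps (row_open oA) (row_itv cA) (row_cvx cu) (Az : row A t s) E1 e0.
have [d2 d20 H2] := smooth_eps (col_open oA) (col_itv cA) (col_cvx cu) (Az : col A s t) E2 e0.
have d0 : 0 < Num.min d1 d2 / 2 by rewrite divr_gt0 // lt_min d10.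
have up h1 h2 : `|h1| <= Num.min d1 d2 / 2 -> `|h2| <= Num.min d1 d2 / 2 ->
    A (s + h1, t + h2) /\ u (s + h1, t + h2) <= u (s, t) + r1 u (s, t) * h1 + r2 u (s, t) * h2 + e * (`|h1| + `|h2|).
  rewrite !ler_pdivlMr // !le_min => /andP[a1 a2] /andP[b1 b2].
  have n1 : `|2 * h1| <= d1 by rewrite normrM ger0_norm // mulrC.
  have n2 : `|2 * h2| <= d2 by rewrite normrM ger0_norm // mulrC.
  have [I1 k1] := H1 _ n1; have [I2 k2] := H2 _ n2.
  have half0 : 0 <= 2^-1 :> R by rewrite invr_ge0.
  have half1 : 2^-1 <= 1 :> R by plra.
  have EE : ((s + 2 * h1, t).1 + 2^-1 * ((s, t + 2 * h2).1 - (s + 2 * h1, t).1),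
       (s + 2 * h1, t).2 + 2^-1 * ((s, t + 2 * h2).2 - (s + 2 * h1, t).2)) = (s + h1, t + h2).
    by rewrite /=; congr (_, _); field.
  have := cA _ _ _ I1 I2 half0 half1; rewrite EE => Ah; split => //.
  have := cu _ _ _ I1 I2 half0 half1; rewrite EE => k3.
  move: k1 k2; rewrite !normrM ger0_norm // => k1 k2.
  by rewrite /r1 /r2 /=; move: k1 k2 k3; set a := rd _ _; set b := rd _ _; clear; lra.
exists (Num.min d1 d2 / 2) => // h1 h2 a b; have [Ah k] := up _ _ a b; split => //.
have [Ah' k'] : A (s + - h1, t + - h2) /\ u (s + - h1, t + - h2) <= u (s, t) + r1 u (s, t) * - h1 + r2 u (s, t) * - h2 + e * (`|- h1| + `|- h2|).
  by apply: up; rewrite normrN.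
have half0 : 0 <= 2^-1 :> R by rewrite invr_ge0.
have half1 : 2^-1 <= 1 :> R by plra.
have := cu _ _ _ Ah Ah' half0 half1.
rewrite /= (_ : s + h1 + 2^-1 * (s + - h1 - (s + h1)) = s); last by field.
rewrite (_ : t + h2 + 2^-1 * (t + - h2 - (t + h2)) = t); last by field.
rewrite !normrN in k' => k''.
by rewrite ler_norml; apply/andP; split; clear - k k' k''; lra.
Qed.

(** On the segment from z to y the chord bounds u from above, and near z the expansion bounds it
    from below; at a small parameter t the comparison holds up to t e. *)
Lemma grad_subgrad (R : realType) (A : set (R * R)) (u : R * R -> R) (z y : R * R) :
  open A -> cset2 A -> cvx2 A u -> A z -> l1 u z = r1 u z -> l2 u z = r2 u z -> A y ->
  u z + r1 u z * (y.1 - z.1) + r2 u z * (y.2 - z.2) <= u y.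
Proof.
move=> oA cA cu Az E1 E2 Ay.
set b1 := y.1 - z.1; set b2 := y.2 - z.2.
pose B : R := `|b1| + `|b2| + 1.
have n1 := normr_ge0 b1; have n2 := normr_ge0 b2.
have B0 : 0 < B by rewrite /B; clear - n1 n2; lra.
apply/ler_addgt0Pr => e e0.
have eB : 0 < e / B by rewrite divr_gt0.
have [d d0 hd] := partials_diff oA cA cu Az E1 E2 eB.
pose t : R := Num.min 1 (d / B).
have t0 : 0 < t by rewrite lt_min ltr01 divr_gt0.
have t1 : t <= 1 by rewrite ge_min lexx.
have td : t * B <= d by rewrite -ler_pdivlMr // ge_min lexx orbT.
have m1 : `|t * b1| <= d by rewrite normrM gtr0_norm //; apply: le_trans td; rewrite ler_pM2l // /B; clear -n1 n2; lra.
have m2 : `|t * b2| <= d by rewrite normrM gtr0_norm //; apply: le_trans td; rewrite ler_pM2l // /B; clear -n1 n2; lra.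
have [_] := hd _ _ m1 m2; rewrite ler_norml => /andP[k _].
have := cu z y t Az Ay (ltW t0) t1; rewrite -/b1 -/b2 => k2.
rewrite !normrM (gtr0_norm t0) -mulrDr in k.
have k3 : e / B * (t * (`|b1| + `|b2|)) <= t * e.
  rewrite mulrCA ler_pM2l // mulrAC ler_pdivrMr // ler_pM2l // /B; clear; lra.
rewrite -(ler_pM2l t0); clear - k k2 k3; lra.
Qed.

Lemma rd_glb (R : realType) (I : set R) (g : R -> R) (x d : R) :
  open I -> is_interval I -> cvx1 I g -> I x ->
  (forall y, I y -> x < y -> d * (y - x) <= g y - g x) -> d <= rd g x.
Proof.
move=> oI iI cg Ix h; have [c _ _] := rd_spec oI iI cg Ix.
have [e e0 Ie] : exists2 e : R, 0 < e & forall y, `|x - y| < e -> I y.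
  by have /nbhs_ballP[e /= e0 he] := oI _ Ix; exists e => // y; exact: he.
apply: (cvgr_to_ge c); near=> n.
have n0 : (0:R) < n.+1%:R^-1 by rewrite invr_gt0.
have ne : (n.+1%:R^-1 : R) < e by near: n; exact: invSn_small.
have := h (x + n.+1%:R^-1); rewrite ltrDl n0 [x + _ - x]addrAC subrr add0r => k.
rewrite -ler_pdivrMl // mulrC; apply: k => //.
by apply: Ie; rewrite opprD addrA subrr sub0r normrN gtr0_norm.
Unshelve. all: by end_near. Qed.

(** The steps 1 / (n + 1) in the definition are not invariant under scaling, so both inequalities go
    through [rd_glb]: the right derivative is the largest slope that supports the function to the
    right. *)
Lemma rd_scale (R : realType) (I : set R) (g : R -> R) (c k x : R) :
  open I -> is_interval I -> cvx1 I g -> 0 < k -> I (c + k * x) ->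
  rd (fun s => g (c + k * s)) x = k * rd g (c + k * x).
Proof.
move=> oI iI cg k0 Ix.
pose J : set R := [set s | I (c + k * s)].
have oJ : open J.
  apply: (open_comp (f := fun s : R => c + k * s)) => // s _.
  by apply: cvgD; [exact: cvg_cst|apply: cvgM; [exact: cvg_cst|exact: cvg_id]].
have iJ : is_interval J.
  by move=> a b Ja Jb y /andP[ay yb]; apply: (iI _ _ Ja Jb); rewrite !lerD2l !ler_pM2l // ay.
have cJ : cvx1 J (fun s => g (c + k * s)).
  move=> a b d Ja Jd ab bd.
  have := cg (c + k * a) (c + k * b) (c + k * d) Ja Jd.
  rewrite !ltrD2l !ltr_pM2l // => /(_ ab bd) h; rewrite -(ler_pM2l k0); plra.
apply/eqP; rewrite eq_le; apply/andP; split.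
  rewrite -ler_pdivrMl // mulrC; apply: (rd_glb oI iI cg Ix) => y Iy xy.
  have Jy : J ((y - c) / k) by rewrite /J /= mulrCA mulfV ?gt_eqF // mulr1 addrC subrK.
  have [_ h _] := rd_spec oJ iJ cJ (Ix : J x).
  have xy' : x < (y - c) / k by rewrite ltr_pdivlMr //; plra.
  have := h _ Jy xy'; rewrite (_ : c + k * ((y - c) / k) = y); last by field; rewrite gt_eqF.
  move=> {}h; rewrite (_ : _ / k * _ = rd (fun s => g (c + k * s)) x * ((y - c) / k - x)) //.
  by field; rewrite gt_eqF.
apply: (rd_glb oJ iJ cJ (Ix : J x)) => y Iy xy.
have [_ h _] := rd_spec oI iI cg Ix.
have := h _ Iy; rewrite ltrD2l ltr_pM2l // => /(_ xy); plra.
Qed.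

(** * Boundedness of the minimizer and extension to the closure *)

(** The image of A under the homothety with centre p and ratio l, written as a preimage. *)
Definition dilate (R : realType) (p : R * R) (l : R) (A : set (R * R)) : set (R * R) :=
  [set y | A ((p.1 - p.1 / l) + l^-1 * y.1, (p.2 - p.2 / l) + l^-1 * y.2)].

(** The competitor V is u restricted to the dilate B of ratio 1 - d and stretched to A. Its energy
    is that of u on B up to a factor 1 + 6 d and an error of order d, so minimality leaves only
    order d for the energy of u on the rest of A. *)
Lemma layer (R : realType) (A : set (R * R)) (X : R) (p : R * R) (u : R * R -> R) :
  open A -> cset2 A -> (forall z, A z -> `|z.1| <= X /\ `|z.2| <= X) -> A p ->
  inK A u -> En A u \is a fin_num -> (forall f, inK A f -> (En A u <= En A f)%E) ->
  exists2 C : R, 0 <= C & forall d, 0 < d -> d <= 2^-1 ->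
   (I2 (A `\` dilate p (1 - d)%R A) (den u) <= (C * d)%:E)%E.
Proof.
move=> oA cA hX Ap [cu u0] fu mu; have mA := open_measurable2 oA.
pose m := fine (I2 A (fun=> 1)).
have Em : I2 A (fun=> 1) = m%:E by rewrite /m fineK // (I2_1_fin mA hX).
have m0 : 0 <= m by rewrite -lee_fin -Em I2_ge0.
have mdu := den_measurable oA cA cu.
have du0 z : A z -> 0 <= den u z by move=> Az; rewrite den_ge0 ?u0.
pose E : R := fine (En A u).
have EE : En A u = E%:E by rewrite fineK.
have E0 : 0 <= E by rewrite -lee_fin -EE I2_ge0.
have X0 : 0 <= X by have [h _] := hX _ Ap; exact: le_trans h.
exists (6 * E + 36 * X ^+ 2 * m); first by rewrite !addr_ge0 ?mulr_ge0 ?sqr_ge0 //.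
move=> d d0 d2; pose l : R := 1 - d.
have l0 : 0 < l by rewrite /l; plra.
have l1' : l <= 1 by rewrite /l; plra.
rewrite -/l; pose k : R := l^-1.
have k0 : 0 < k by rewrite invr_gt0.
pose c : R * R := (p.1 - p.1 / l, p.2 - p.2 / l).
pose c' : R * R := (p.1 - l * p.1, p.2 - l * p.2).
set B := dilate _ _ _.
have BE y : B y = A (c.1 + k * y.1, c.2 + k * y.2) by [].
have BA : B `<=` A.
  move=> y; rewrite BE => By; have := cA _ _ _ Ap By (ltW l0) l1'.
  rewrite /= (_ : p.1 + _ = y.1); last by rewrite /k; field; rewrite gt_eqF.
  by rewrite (_ : p.2 + _ = y.2); [case: y By|rewrite /k; field; rewrite gt_eqF].
have AB y : A y -> B (c'.1 + l * y.1, c'.2 + l * y.2).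
  rewrite BE /= (_ : p.1 - p.1 / l + k * _ = y.1); last by rewrite /k; field; rewrite gt_eqF.
  rewrite (_ : p.2 - p.2 / l + k * _ = y.2); last by rewrite /k; field; rewrite gt_eqF.
  by case: y.
have AB' : [set z | B (c'.1 + l * z.1, c'.2 + l * z.2)] = A.
  apply/seteqP; split => y; last exact: AB.
  rewrite /= BE /= (_ : p.1 - p.1 / l + k * _ = y.1); last by rewrite /k; field; rewrite gt_eqF.
  rewrite (_ : p.2 - p.2 / l + k * _ = y.2); last by rewrite /k; field; rewrite gt_eqF.
  by case: y.
have oB : open B.
  apply: square_open => z Bz; have [r r0 hr] := open_square oA Bz.
  exists (l * r) => [|y y1 y2]; first by rewrite mulr_gt0.
  by apply: hr => /=; rewrite opprD addrACA subrr add0r -mulrBr normrM (gtr0_norm k0) ler_pdivrMl // ltW.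
have mB := open_measurable2 oB.
pose V (z : R * R) : R := u (c'.1 + l * z.1, c'.2 + l * z.2).
have KV : inK A V.
  split; last by move=> z /AB /BA; exact: u0.
  move=> x y t Ax Ay t0 t1; have := cu _ _ _ (BA _ (AB _ Ax)) (BA _ (AB _ Ay)) t0 t1.
  rewrite /V /=; congr (u (_, _) <= _); ring.
have [cV V0] := KV.
pose f (y : R * R) : R := 2^-1 * ((l * r1 u y - (c.1 + k * y.1)) ^+ 2 + (l * r2 u y - (c.2 + k * y.2)) ^+ 2) + u y.
have sq0 (a b : R) : 0 <= 2^-1 * (a ^+ 2 + b ^+ 2) by rewrite mulr_ge0 ?invr_ge0 // addr_ge0 // sqr_ge0.
have f0 y : B y -> 0 <= f y by move=> /BA Ay; rewrite addr_ge0 ?u0.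
have [mr1 mr2 _ _] := partials_measurable oA cA cu.
have mf : measurable_fun B f.
  apply: (measurable_funS mA BA); apply: measurable_funD; last exact: cvx2_measurable.
  apply: measurable_funM => //; apply: measurable_funD; apply: measurable_funX; apply: measurable_funB.
  + exact: measurable_funM.
  + by apply: measurable_funD => //; apply: measurable_funM => //; exact: measurable_funTS.
  + exact: measurable_funM.
  + by apply: measurable_funD => //; apply: measurable_funM => //; exact: measurable_funTS.
have fV : I2 B f = ((l * l)%:E * En A V)%E.
  rewrite (I2_scale c' l0 mB mf f0) AB'; congr (_ * _)%E; apply: I2_ext => -[s t] Ast.
  have Bst := BA _ (AB _ Ast).
  rewrite /den /V /f /=.
  have -> : r1 V (s, t) = l * r1 u (c'.1 + l * s, c'.2 + l * t).
    exact: (@rd_scale R (row A (c'.2 + l * t)) (fun x => u (x, c'.2 + l * t)) c'.1 l s (row_open oA) (row_itv cA) (row_cvx cu) l0 Bst).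
  have -> : r2 V (s, t) = l * r2 u (c'.1 + l * s, c'.2 + l * t).
    exact: (@rd_scale R (col A (c'.1 + l * s)) (fun x => u (c'.1 + l * s, x)) c'.2 l t (col_open oA) (col_itv cA) (col_cvx cu) l0 Bst).
  rewrite (_ : p.1 - p.1 / l + k * _ = s); last by rewrite /k; field; rewrite gt_eqF.
  by rewrite (_ : p.2 - p.2 / l + k * _ = t); last by rewrite /k; field; rewrite gt_eqF.
have fle y : B y -> f y <= den u y + 9 * X ^+ 2 * d * 1.
  move=> By; have Ay := BA _ By.
  have [y1 y2] := hX _ Ay; have [p1 p2] := hX _ Ap; have [b1 b2] := hX _ (By : A (c.1 + k * y.1, c.2 + k * y.2)).
  rewrite /f /den.
  (* Here P stands for a partial derivative at y, and a, b, e for the coordinates of y, of p and of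
     the preimage of y. The difference l P - e is a convex combination of P - a and b - a - e with
     weights l and d, so convexity of the square gives an error of order d without a factor P. *)
  have key (P a b e : R) : `|a| <= X -> `|b| <= X -> `|e| <= X -> e = (b - b / l) + k * a ->
      (l * P - e) ^+ 2 <= (P - a) ^+ 2 + 9 * X ^+ 2 * d.
    rewrite !ler_norml => /andP[? ?] /andP[? ?] /andP[? ?] eE.
    have E1 : l * P - e = l * (P - a) + d * (b - a - e).
      have : a = b + l * (e - b) by rewrite eE /k; field; rewrite gt_eqF.
      by rewrite /l => ->; ring.
    have q : (b - a - e) ^+ 2 <= 9 * X ^+ 2 by nra.
    have cs : (l * (P - a) + d * (b - a - e)) ^+ 2 <= l * (P - a) ^+ 2 + d * (b - a - e) ^+ 2.
      rewrite -subr_ge0 (_ : _ - _ = l * d * ((P - a) - (b - a - e)) ^+ 2); last by rewrite /l; ring.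
      by apply: mulr_ge0; [apply: mulr_ge0; exact: ltW|exact: sqr_ge0].
    rewrite E1; apply: le_trans cs _; apply: lerD.
      by rewrite ler_piMl // sqr_ge0.
    by rewrite mulrC ler_pM2r.
  have k1 := key (r1 u y) y.1 p.1 (c.1 + k * y.1) y1 p1 b1 erefl.
  have k2 := key (r2 u y) y.2 p.2 (c.2 + k * y.2) y2 p2 b2 erefl.
  by move: k1 k2; move: (_ ^+ 2) (_ ^+ 2) (_ ^+ 2) (_ ^+ 2); clear; move=> *; plra.
have mduB : measurable_fun B (den u) by exact: measurable_funS mdu.
have EV : (En A V = (k * k)%:E * I2 B f)%E.
  rewrite fV muleA -EFinM (_ : (k * k * (l * l))%R = 1) ?mul1e //.
  by rewrite /k; field; rewrite gt_eqF.
have fIB : I2 B (den u) \is a fin_num.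
  rewrite ge0_fin_numE; last by apply: I2_ge0 => y /BA; exact: du0.
  by apply: (@le_lt_trans _ _ (En A u)); [apply: I2_subset|rewrite EE ltry].
pose b := fine (I2 B (den u)).
have bE : I2 B (den u) = b%:E by rewrite fineK.
have bEu : b <= E by rewrite -lee_fin -bE -EE; apply: I2_subset.
have b0 : 0 <= b by rewrite -lee_fin -bE I2_ge0 // => y /BA; exact: du0.
have hf : (I2 B f <= (b + 9 * X ^+ 2 * d * m)%:E)%E.
  apply: (@le_trans _ _ (I2 B (fun y => den u y + 9 * X ^+ 2 * d * 1)%R)).
    by apply: I2_le => //; apply: measurable_funD.
  have c0 : 0 <= 9 * X ^+ 2 * d by rewrite !mulr_ge0 ?sqr_ge0 // ltW.
  rewrite I2D //; [|by move=> y /BA; exact: du0|by move=> y _; rewrite mulr1].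
  rewrite (I2Z mB) // bE EFinD leeD2l // [X in (_ <= X)%E]EFinM lee_wpmul2l ?lee_fin // -Em.
  exact: I2_subset.
have spl : (En A u = b%:E + I2 (A `\` B) (den u))%E.
  rewrite {1}/En (I2_split mA mB mdu) (_ : A `&` B = B) ?bE //.
  by apply/seteqP; split => [z []//|z Bz]; split => //; exact: BA.
have kk : k * k <= 1 + 6 * d.
  have ll : 0 < l * l by rewrite mulr_gt0.
  rewrite -(ler_pM2r ll) (_ : k * k * (l * l) = 1); last by rewrite /k; field; rewrite gt_eqF.
  rewrite /l (_ : (1 + 6 * d) * _ = 1 + d * ((1 - 2 * d) * (4 - 3 * d))); last by ring.
  clear - d0 d2; have a1 : 0 <= 1 - 2 * d by plra.
  have a2 : 0 <= 4 - 3 * d by plra.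
  by rewrite lerDl mulr_ge0 // ?(ltW d0) // mulr_ge0.
have fin : (b%:E + I2 (A `\` B) (den u) <= ((1 + 6 * d) * b + 36 * X ^+ 2 * d * m)%:E)%E.
  rewrite -spl; apply: le_trans (mu V KV) _; rewrite EV.
  have kk0 : (0 <= (k * k)%:E)%E by rewrite lee_fin mulr_ge0 // ltW.
  apply: le_trans (lee_wpmul2l kk0 hf) _.
  rewrite -EFinM lee_fin mulrDr; apply: lerD; first by rewrite ler_wpM2r.
  have k4 : k * k <= 4 by plra.
  have : 0 <= 9 * X ^+ 2 * d * m by rewrite !mulr_ge0 ?sqr_ge0 // ltW.
  by move: (k * k) k4 => q; clear; nra.
have sg0 : (0 <= I2 (A `\` B) (den u))%E by apply: I2_ge0 => y [Ay _]; exact: du0.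
move: sg0 fin; case: (I2 (A `\` B) (den u)) => [x||] //.
rewrite -EFinD !lee_fin => _ h.
have : d * b <= d * E by rewrite ler_pM2l.
by move: h; clear; lra.
Qed.

Ltac nneg := repeat match goal with
  | |- is_true (0 <= _ ^+ 2) => exact: sqr_ge0
  | |- is_true (0 <= _ * _) => apply: mulr_ge0
  | |- is_true (0 <= _ + _) => apply: addr_ge0
  | |- is_true (0 <= _^-1) => rewrite invr_ge0
  | |- _ => first [done | exact: ltW]
  end.

Lemma sqr_le_abs (R : realType) (a X : R) : `|a| <= X -> a ^+ 2 <= X ^+ 2.
Proof. by move=> aX; rewrite -real_normK ?num_real // lerXn2r // nnegrE; apply: le_trans aX. Qed.

Lemma mul_lt_conv (R : realType) (a b t c : R) : a < c -> b < c -> 0 <= t -> t <= 1 -> a + t * (b - a) < c.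
Proof. move=> ac bc t0 t1; have [ab|ab] := leP a b; nra. Qed.

(** Otherwise each of the four squares of side h with corner x contains a point of smaller value.
    Joining left to right gives such points above and below x on its vertical line, and x would be a
    convex combination of them. *)
Lemma quadrant (R : realType) (A : set (R * R)) (u : R * R -> R) (x : R * R) (h : R) :
  cset2 A -> cvx2 A u -> 0 < h ->
  (forall y : R * R, `|y.1 - x.1| <= h -> `|y.2 - x.2| <= h -> A y) ->
  exists e1 e2 : R, [/\ 0 <= e1 <= 1, 0 <= e2 <= 1 &
    forall y : R * R, x.1 - e1 * h < y.1 < x.1 - e1 * h + h -> x.2 - e2 * h < y.2 < x.2 - e2 * h + h ->
      u x <= u y].
Proof.
move=> cA cu h0 hA; apply: contrapT => H.
have pt e1 e2 : 0 <= e1 <= 1 -> 0 <= e2 <= 1 -> exists y : R * R,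
    [/\ x.1 - e1 * h < y.1 < x.1 - e1 * h + h, x.2 - e2 * h < y.2 < x.2 - e2 * h + h & u y < u x].
  move=> h1 h2; apply: contrapT => K; apply: H; exists e1, e2; split => // y y1 y2.
  by rewrite leNgt; apply/negP => uy; apply: K; exists y.
have p0 : 0 <= (0:R) <= 1 by rewrite lexx ler01.
have p1 : 0 <= (1:R) <= 1 by rewrite ler01 lexx.
have inA y : x.1 - h < y.1 < x.1 + h -> x.2 - h < y.2 < x.2 + h -> A y.
  by move=> /andP[? ?] /andP[? ?]; apply: hA; rewrite ler_norml; apply/andP; split; plra.
have vert e2 : 0 <= e2 <= 1 -> exists s, [/\ x.2 - e2 * h < s < x.2 - e2 * h + h, A (x.1, s) & u (x.1, s) < u x].
  move=> h2; have [a [a1 a2 ua]] := pt 0 e2 p0 h2; have [b [b1 b2 ub]] := pt 1 e2 p1 h2.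
  rewrite mul0r subr0 in a1; rewrite mul1r subrK in b1.
  have e2h : 0 <= e2 * h <= h.
    by case/andP: h2 => k1 k2; rewrite mulr_ge0 ?(ltW h0) //= ler_piMl // ltW.
  move: a1 b1 a2 b2 e2h => /andP[a1 a1'] /andP[b1 b1'] /andP[a2 a2'] /andP[b2 b2'] /andP[g1 g2].
  have Aa : A a by apply: inA; apply/andP; split; plra.
  have Ab : A b by apply: inA; apply/andP; split; plra.
  pose t := (a.1 - x.1) / (a.1 - b.1).
  have t0 : 0 <= t by rewrite divr_ge0; plra.
  have t1 : t <= 1 by rewrite ler_pdivrMr; plra.
  have E : a.1 + t * (b.1 - a.1) = x.1 by rewrite /t; field; plra.
  exists (a.2 + t * (b.2 - a.2)).
  have := cA a b t Aa Ab t0 t1; rewrite E => A3.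
  have := cu a b t Aa Ab t0 t1; rewrite E => k.
  split => //; last by apply: le_lt_trans k _; exact: mul_lt_conv.
  have := mul_lt_conv a2' b2' t0 t1 => ->; rewrite andbT.
  have k1 : - a.2 < - (x.2 - e2 * h) by plra.
  have k2 : - b.2 < - (x.2 - e2 * h) by plra.
  by have := mul_lt_conv k1 k2 t0 t1; plra.
have [s [/andP[s1 s1'] As us]] := vert 0 p0; have [r [/andP[r1 r1'] Ar ur]] := vert 1 p1.
rewrite mul0r subr0 in s1 s1'; rewrite mul1r subrK in r1 r1'.
have := col_cvx cu (x := r) (y := x.2) (z := s) Ar As r1' s1.
rewrite -surjective_pairing; clear - us ur s1 r1'; nra.
Qed.

(** If u rises by D between two points of the ray at distance of order d, then on a square of side
    proportional to d, where u is at least its value at the upper point, all subgradients have size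
    at least of order D / d. The square has energy of order D ^ 2 up to lower order terms, and it
    lies in the boundary layer, where the energy is of order d. *)
Lemma ray_increment (R : realType) (A : set (R * R)) (X rho : R) (p : R * R) (u : R * R -> R) :
  open A -> cset2 A -> (forall z, A z -> `|z.1| <= X /\ `|z.2| <= X) -> 0 < rho ->
  (forall y : R * R, `|y.1 - p.1| <= rho -> `|y.2 - p.2| <= rho -> A y) ->
  inK A u -> En A u \is a fin_num -> (forall f, inK A f -> (En A u <= En A f)%E) ->
  exists2 C : R, 0 <= C & forall (zb : R * R) (d : R),
    ~ A zb -> (forall r, 0 <= r -> r < 1 -> A (p.1 + r * (zb.1 - p.1), p.2 + r * (zb.2 - p.2))) ->
    0 < d -> d <= 4^-1 ->
    0 <= u (p.1 + (1 - d) * (zb.1 - p.1), p.2 + (1 - d) * (zb.2 - p.2)) -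
         u (p.1 + (1 - 4 * d) * (zb.1 - p.1), p.2 + (1 - 4 * d) * (zb.2 - p.2)) ->
    (u (p.1 + (1 - d) * (zb.1 - p.1), p.2 + (1 - d) * (zb.2 - p.2)) -
      u (p.1 + (1 - 4 * d) * (zb.1 - p.1), p.2 + (1 - 4 * d) * (zb.2 - p.2))) ^+ 2 <= C * d.
Proof.
move=> oA cA hX rho0 hp Ku fu mu; have [cu u0] := Ku; have mA := open_measurable2 oA.
have Ap : A p by apply: hp; rewrite subrr normr0 ltW.
have [C C0 hC] := layer oA cA hX Ap Ku fu mu.
have X0 : 0 <= X by have [h _] := hX _ Ap; exact: le_trans h.
pose K : R := 12 * X + rho.
have K0 : 0 < K by rewrite /K; plra.
exists (32 * K ^+ 2 * (2 * C + X ^+ 2 * rho ^+ 2) / rho ^+ 2).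
  by nneg.
move=> zb d nA ray d0 d4.
pose pt (r : R) : R * R := (p.1 + r * (zb.1 - p.1), p.2 + r * (zb.2 - p.2)).
rewrite -[(p.1 + (1 - d) * _, _)]/(pt (1 - d)) -[(p.1 + (1 - 4 * d) * _, _)]/(pt (1 - 4 * d)).
set x := pt (1 - d); set x4 := pt (1 - 4 * d).
have zbX : `|zb.1 - p.1| <= 4 * X /\ `|zb.2 - p.2| <= 4 * X.
  have [a1 a2] := hX _ (ray 2^-1 ltac:(plra) ltac:(plra)); have [b1 b2] := hX _ Ap.
  move: a1 a2 b1 b2; rewrite !ler_norml /= => /andP[? ?] /andP[? ?] /andP[? ?] /andP[? ?].
  by split; apply/andP; split; plra.
(* Points within h of x in both coordinates lie in A and, as zb does not, outside the dilate of
   ratio 1 - 2 d, hence in the boundary layer. *)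
pose h : R := rho * d / 2.
have h0 : 0 < h by rewrite /h divr_gt0 // mulr_gt0.
have sqA (y : R * R) : `|y.1 - x.1| <= h -> `|y.2 - x.2| <= h -> A y.
  move=> y1 y2; pose t := d / 2.
  have t0 : 0 < t by rewrite /t; plra.
  have t1 : t < 1 by rewrite /t; plra.
  have A1 : A (pt ((1 - d) / (1 - t))).
    apply: ray; first by rewrite divr_ge0 /t; plra.
    by rewrite ltr_pdivrMr /t; plra.
  have nb a b : `|a - b| <= h -> `|(a - b) / t| <= rho.
    move=> k; rewrite normrM normfV (gtr0_norm t0) ler_pdivrMr //.
    by apply: le_trans k _; rewrite /h /t; plra.
  have A2 : A (p.1 + (y.1 - x.1) / t, p.2 + (y.2 - x.2) / t).
    by apply: hp => /=; rewrite addrAC subrr add0r; exact: nb.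
  have := cA _ _ t A1 A2 (ltW t0) (ltW t1); rewrite /=.
  rewrite (_ : _ + t * _ = y.1); last by rewrite /x /=; field; rewrite gt_eqF //=; plra.
  rewrite (_ : p.2 + _ + t * _ = y.2); first by case: y {y1 y2 A2}.
  by rewrite /x /=; field; rewrite gt_eqF //=; plra.
have sqD (y : R * R) : `|y.1 - x.1| <= h -> `|y.2 - x.2| <= h -> ~ dilate p (1 - 2 * d) A y.
  move=> y1 y2 Dy; apply: nA; pose t := (1 - 2 * d) / (1 - d).
  have t0 : 0 <= t by rewrite /t divr_ge0; plra.
  have t1 : t <= 1 by rewrite /t ler_pdivrMr; plra.
  have nb a b : `|a - b| <= h -> `|(b - a) / d| <= rho.
    rewrite distrC => k; rewrite normrM normfV (gtr0_norm d0) ler_pdivrMr //.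
    by apply: le_trans k _; rewrite /h; clear - rho0 d0; have := mulr_gt0 rho0 d0; plra.
  have A2 : A (p.1 + (x.1 - y.1) / d, p.2 + (x.2 - y.2) / d).
    by apply: hp => /=; rewrite addrAC subrr add0r; exact: nb.
  have := cA _ _ t A2 Dy t0 t1; rewrite /=.
  rewrite (_ : _ + t * _ = zb.1); last by rewrite /x /t /=; field; rewrite ?gt_eqF //=; plra.
  rewrite (_ : p.2 + _ + t * _ = zb.2); first by case: (zb).
  by rewrite /x /t /=; field; rewrite ?gt_eqF //=; plra.
have [e1 [e2 [/andP[e10 e11] /andP[e20 e21] hq]]] := quadrant cA cu h0 sqA.
pose Q : set (R * R) := `](x.1 - e1 * h), (x.1 - e1 * h + h)[%classic `*` `](x.2 - e2 * h), (x.2 - e2 * h + h)[%classic.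
have mQ : measurable Q by apply: measurableX.
have Qh y : Q y -> [/\ `|y.1 - x.1| <= h, `|y.2 - x.2| <= h & u x <= u y].
  move=> [] /=; rewrite !in_itv /= => q1 q2.
  have f1 : 0 <= e1 * h by rewrite mulr_ge0 // ltW.
  have f1' : e1 * h <= h by rewrite ler_piMl // ltW.
  have f2 : 0 <= e2 * h by rewrite mulr_ge0 // ltW.
  have f2' : e2 * h <= h by rewrite ler_piMl // ltW.
  split; last exact: hq.
    by move: q1 => /andP[? ?]; rewrite ler_norml; apply/andP; split; plra.
  by move: q2 => /andP[? ?]; rewrite ler_norml; apply/andP; split; plra.
have QA : Q `<=` A by move=> y /Qh[y1 y2 _]; exact: sqA.
have [N [mN N0 NA hN]] := nondiff_null oA cA cu.
have Ax4 : A x4 by apply: ray; plra.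
move=> D0; set D := u x - u x4 in D0 *.
(* A lower bound for the density on Q: there [|r1 u y| + |r2 u y|] is at least D / (d K), because u
   y >= u x and x4 is within d K of y in each coordinate. *)
pose c : R := D ^+ 2 / (8 * d ^+ 2 * K ^+ 2) - X ^+ 2.
have [cneg|cpos] := leP c 0.
  rewrite subr_le0 ler_pdivrMr in cneg; last by rewrite !mulr_gt0 ?exprn_gt0.
  apply: le_trans cneg _.
  rewrite (_ : 32 * _ * _ / _ * d = 64 * K ^+ 2 * C / rho ^+ 2 * d + (4 * d) * (8 * K ^+ 2 * X ^+ 2)); last first.
    by field; rewrite gt_eqF.
  have k1 : 0 <= 64 * K ^+ 2 * C / rho ^+ 2 * d.
    by nneg.
  have k2 : X ^+ 2 * (8 * d ^+ 2 * K ^+ 2) <= (4 * d) * (8 * K ^+ 2 * X ^+ 2).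
    have : 0 <= K ^+ 2 * X ^+ 2 by nneg.
    have : d ^+ 2 <= d by rewrite expr2 ler_piMl //; plra.
    by move: (K ^+ 2) (X ^+ 2) (d ^+ 2) => a b e; clear - d0; move=> *; nra.
  by plra.
have gbound y : (Q `\` N) y -> c * 1 <= den u y.
  move=> [Qy Ny]; have [y1 y2 uy] := Qh _ Qy; have Ay := QA _ Qy.
  have [E1 E2] := hN _ Ay Ny.
  have := grad_subgrad oA cA cu Ay E1 E2 Ax4 => sg.
  have [Y1 Y2] := hX _ Ay.
  have bd (a b e q : R) : `|a - b| <= h -> `|q| <= 4 * X -> b - e = 3 * d * q -> `|a - e| <= d * K.
    move=> k1 k2 k3; have -> : a - e = (a - b) + 3 * d * q by rewrite -k3; ring.
    apply: le_trans (ler_normD _ _) _; rewrite !normrM (gtr0_norm d0) ger0_norm //.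
    apply: le_trans (lerD k1 (ler_wpM2l _ k2)) _; first by rewrite mulr_ge0 // ltW.
    by rewrite /h /K; clear - rho0 d0; have := mulr_gt0 rho0 d0; plra.
  have B1 : `|y.1 - x4.1| <= d * K.
    by apply: (bd _ x.1 _ (zb.1 - p.1)) => //; [case: zbX|rewrite /x /x4 /=; ring].
  have B2 : `|y.2 - x4.2| <= d * K.
    by apply: (bd _ x.2 _ (zb.2 - p.2)) => //; [case: zbX|rewrite /x /x4 /=; ring].
  have dK : 0 < d * K by rewrite mulr_gt0.
  have DS : D <= (`|r1 u y| + `|r2 u y|) * (d * K).
    have m1 := ler_norm (r1 u y * (y.1 - x4.1)); have m2 := ler_norm (r2 u y * (y.2 - x4.2)).
    rewrite !normrM in m1 m2.
    have m3 := ler_wpM2l (normr_ge0 (r1 u y)) B1; have m4 := ler_wpM2l (normr_ge0 (r2 u y)) B2.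
    rewrite /D mulrDl; move: sg uy m1 m2 m3 m4.
    by move: (`|r1 u y| * `|_|) (`|r2 u y| * `|_|) (`|r1 u y| * _) (`|r2 u y| * _) => q1 q2 q3 q4; clear; plra.
  have DS2 : D ^+ 2 <= (`|r1 u y| + `|r2 u y|) ^+ 2 * (d * K) ^+ 2.
    by rewrite -exprMn lerXn2r // nnegrE // mulr_ge0 ?addr_ge0 // ltW.
  have Pk : (`|r1 u y| + `|r2 u y|) ^+ 2 <= 8 * (den u y + X ^+ 2).
    rewrite /den; have uy0 := u0 _ Ay; have yy1 := sqr_le_abs Y1; have yy2 := sqr_le_abs Y2.
    have s1 : (`|r1 u y| + `|r2 u y|) ^+ 2 <= 2 * (r1 u y ^+ 2 + r2 u y ^+ 2).
      rewrite -(real_normK (num_real (r1 u y))) -(real_normK (num_real (r2 u y))).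
      have := sqr_ge0 (`|r1 u y| - `|r2 u y|); move: `|_| `|_| => a b; clear; nra.
    have s2 (a b : R) : a ^+ 2 <= 2 * (a - b) ^+ 2 + 2 * b ^+ 2.
      by have := sqr_ge0 (a - 2 * b); clear; nra.
    have := s2 (r1 u y) y.1; have := s2 (r2 u y) y.2; move: yy1 yy2 s1 uy0.
    move: (_ ^+ 2) (_ ^+ 2) (_ ^+ 2) (_ ^+ 2) (_ ^+ 2) (_ ^+ 2) (_ ^+ 2) (_ ^+ 2); clear; move=> *; plra.
  rewrite mulr1 /c lerBlDr ler_pdivrMr; last by rewrite !mulr_gt0 ?exprn_gt0.
  apply: le_trans DS2 _; rewrite exprMn.
  rewrite (_ : _ * (8 * d ^+ 2 * K ^+ 2) = 8 * (den u y + X ^+ 2) * (d ^+ 2 * K ^+ 2)); last by ring.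
  by apply: ler_wpM2r => //; nneg.
have mdu := den_measurable oA cA cu.
have du0 z : A z -> 0 <= den u z by move=> Az; rewrite den_ge0 ?u0.
have oDil : open (dilate p (1 - 2 * d) A).
  have l0 : 0 < 1 - 2 * d by plra.
  have k0 : 0 < (1 - 2 * d)^-1 by rewrite invr_gt0.
  apply: square_open => z Bz; have [r r0 hr] := open_square oA Bz.
  exists ((1 - 2 * d) * r) => [|y y1 y2]; first by rewrite mulr_gt0.
  by apply: hr => /=; rewrite opprD addrACA subrr add0r -mulrBr normrM (gtr0_norm k0) ler_pdivrMl // ltW.
have mDil := open_measurable2 oDil.
have : (I2 Q (fun=> c * 1)%R <= (C * (2 * d))%:E)%E.
  rewrite -(I2_null mQ mN N0) //.
  have d22 : 2 * d <= 2^-1 by plra.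
  have d20 : 0 < 2 * d by plra.
  apply: le_trans (hC _ d20 d22).
  have sub : Q `\` N `<=` A `\` dilate p (1 - 2 * d) A.
    by move=> y [/Qh[y1 y2 _] _]; split; [exact: sqA|exact: sqD].
  have mAD : measurable (A `\` dilate p (1 - 2 * d) A) by exact: measurableD.
  have mQN : measurable (Q `\` N) by exact: measurableD.
  have mdAD : measurable_fun (A `\` dilate p (1 - 2 * d) A) (den u).
    by apply: measurable_funS mdu => // y [].
  apply: (@le_trans _ _ (I2 (Q `\` N) (den u))).
    by apply: I2_le => //; [exact: measurable_funS mdAD|move=> y _; rewrite mulr1 ltW].
  by apply: I2_subset => // y [Ay _]; exact: du0.
rewrite I2Z ?(ltW cpos) // I2_box; [|by rewrite lerDl ltW|by rewrite lerDl ltW].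
rewrite -EFinM lee_fin (_ : _ + h - _ = h); last by ring.
rewrite (_ : _ + h - _ = h); last by ring.
move=> fin.
have rd0 : 0 < rho ^+ 2 / (32 * K ^+ 2) by rewrite divr_gt0 ?mulr_gt0 ?exprn_gt0.
rewrite -(ler_pM2l rd0).
rewrite (_ : _ * (_ * d) = (2 * C + X ^+ 2 * rho ^+ 2) * d); last first.
  by field; rewrite !gt_eqF // ?mulr_gt0 // exprn_gt0.
have e1' : rho ^+ 2 / (32 * K ^+ 2) * D ^+ 2 = c * (h * h) + X ^+ 2 * (rho ^+ 2 * d ^+ 2 / 4).
  by rewrite /c /h; field; rewrite !gt_eqF.
rewrite e1'; have : X ^+ 2 * (rho ^+ 2 * d ^+ 2 / 4) <= X ^+ 2 * (rho ^+ 2 * d).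
  apply: ler_wpM2l; first exact: sqr_ge0.
  rewrite -mulrA; apply: ler_wpM2l; first exact: sqr_ge0.
  by rewrite expr2; clear - d0 d4; nra.
by move: fin; clear; plra.
Qed.

Lemma add_sub_cancel (R : zmodType) (a b : R) : a + b - a = b.
Proof. by rewrite addrAC subrr add0r. Qed.

Lemma ray_exit (R : realType) (A : set (R * R)) (X : R) (p z : R * R) :
  open A -> cset2 A -> (forall z, A z -> `|z.1| <= X /\ `|z.2| <= X) -> A p -> A z -> z != p ->
  exists (zb : R * R) (r : R), [/\ ~ A zb, 0 <= r, r < 1,
    (forall r, 0 <= r -> r < 1 -> A (p.1 + r * (zb.1 - p.1), p.2 + r * (zb.2 - p.2))) &
    z = (p.1 + r * (zb.1 - p.1), p.2 + r * (zb.2 - p.2))].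
Proof.
move=> oA cA hX Ap Az zp.
pose pt (t : R) : R * R := (p.1 + t * (z.1 - p.1), p.2 + t * (z.2 - p.2)).
pose S := [set t : R | 0 <= t /\ A (pt t)].
pose N : R := `|z.1 - p.1| + `|z.2 - p.2|.
have N0 : 0 < N.
  rewrite lt0r addr_ge0 // andbT paddr_eq0 // !normr_eq0 !subr_eq0; apply: contra zp => /andP[/eqP h1 /eqP h2].
  by apply/eqP; case: (z) (p) h1 h2 => z1 z2 [p1 p2] /= -> ->.
have S1 : S 1 by split => //; rewrite /pt !mul1r ![_ + (_ - _)]addrC !subrK; case: (z) Az.
have uS : has_ubound S.
  exists (4 * X / N) => t [t0 At]; rewrite ler_pdivlMr // /N mulrDr -(ger0_norm t0) -!normrM.
  have [a1 a2] := hX _ At; have [b1 b2] := hX _ Ap.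
  have := ler_normB (p.1 + t * (z.1 - p.1)) p.1; have := ler_normB (p.2 + t * (z.2 - p.2)) p.2.
  rewrite !add_sub_cancel; move: a1 a2 b1 b2; rewrite /pt /=; plra.
have sS : has_sup S by split => //; exists 1.
pose T := sup S.
have T1 : 1 <= T by apply: sup_upper_bound.
have T0 : 0 < T by plra.
have inS t : 0 <= t -> t < T -> A (pt t).
  move=> t0 tT; have e0 : 0 < T - t by plra.
  have [s [s0 As] st] := sup_adherent e0 sS.
  have ts : t < s by move: st; rewrite -/T; plra.
  have s00 : 0 < s by plra.
  have := cA _ _ (t / s) Ap As; rewrite /= !add_sub_cancel !mulrA divfK ?gt_eqF //.
  by apply; [rewrite divr_ge0 // ltW|rewrite ler_pdivrMr // mul1r ltW].
have nT : ~ A (pt T).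
  move=> AT; have [r r0 hr] := open_square oA AT.
  have e0 : 0 < r / N by rewrite divr_gt0.
  have : S (T + r / N).
    split; first by plra.
    have bd (a : R) : `|a| <= N -> `|r / N * a| <= r.
      by move=> aN; rewrite normrM (gtr0_norm e0) mulrAC ler_pdivrMr // ler_pM2l.
    apply: hr; rewrite /pt /= opprD addrACA subrr add0r -mulrBl addrAC subrr add0r; apply: bd; by rewrite /N ?lerDl ?lerDr.
  by move/(sup_upper_bound sS); rewrite -/T; plra.
have Tn1 : T != 1 by apply: contra_notN nT => /eqP ->; case: S1.
exists (pt T), T^-1; split => //.
- by rewrite invr_ge0 ltW.
- by rewrite invf_lt1 // lt_neqAle eq_sym Tn1.
- move=> r r0 r1; have := inS (r * T); rewrite /pt /= !add_sub_cancel !mulrA.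
  by apply; [rewrite mulr_ge0 // ltW|rewrite gtr_pMl].
by rewrite /pt /= !add_sub_cancel !mulKf ?gt_eqF // ![_ + (_ - _)]addrC !subrK; case: (z).
Qed.

(** With d = 4 ^ - (j + 1) the increments along a ray are at most K / 2 ^ (j + 1), a geometric
    series; K = C + 1 is taken so that C <= K ^ 2. A point of the ray between two of these
    parameters is handled by convexity. *)
Lemma min_bounded (R : realType) (A : set (R * R)) (X rho : R) (p : R * R) (u : R * R -> R) :
  open A -> cset2 A -> (forall z, A z -> `|z.1| <= X /\ `|z.2| <= X) -> 0 < rho ->
  (forall y : R * R, `|y.1 - p.1| <= rho -> `|y.2 - p.2| <= rho -> A y) ->
  inK A u -> En A u \is a fin_num -> (forall f, inK A f -> (En A u <= En A f)%E) ->
  exists M, forall z, A z -> u z <= M.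
Proof.
move=> oA cA hX rho0 hp Ku fu mu; have [cu u0] := Ku.
have Ap : A p by apply: hp; rewrite subrr normr0 ltW.
have [C C0 hC] := ray_increment oA cA hX rho0 hp Ku fu mu.
pose K : R := C + 1.
exists (u p + K) => z Az.
have K0 : 0 < K by rewrite /K; plra.
have [->|zp] := eqVneq z p; first by rewrite lerDl ltW.
have [zb [r [nA r0 r1 ray zE]]] := ray_exit oA cA hX Ap Az zp.
pose pt (t : R) : R * R := (p.1 + t * (zb.1 - p.1), p.2 + t * (zb.2 - p.2)).
have p4 j : (0:R) < 4 ^+ j by rewrite exprn_gt0.
have p2 j : (0:R) < 2 ^+ j by rewrite exprn_gt0.
have E4 n : 4 ^+ n = 2 ^+ n * 2 ^+ n :> R by rewrite -exprMn; congr (_ ^+ _); ring.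
have step j : u (pt (1 - (4 ^+ j.+1)^-1)) - u (pt (1 - (4 ^+ j)^-1)) <= K / 2 ^+ j.+1.
  set D := _ - _; have [D0|D0] := leP D 0; first by apply: le_trans D0 _; rewrite divr_ge0 // ltW.
  have d0 : 0 < (4 ^+ j.+1)^-1 :> R by rewrite invr_gt0.
  have d4 : (4 ^+ j.+1)^-1 <= 4^-1 :> R.
    rewrite lef_pV2 ?posrE // exprS ler_peMr // exprn_ege1 //; plra.
  have E : 4 * (4 ^+ j.+1)^-1 = (4 ^+ j)^-1 :> R by rewrite exprS; field; rewrite gt_eqF.
  have := hC zb _ nA ray d0 d4; rewrite E => /(_ (ltW D0)).
  rewrite -[X in X ^+ 2]/D E4 => h.
  have KK0 : 0 <= K / 2 ^+ j.+1 by rewrite divr_ge0 // ltW.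
  rewrite -(@ler_pXn2r _ 2) ?nnegrE ?(ltW D0) //; apply: le_trans h _.
  rewrite expr_div_n (expr2 (2 ^+ _)); apply: ler_wpM2r; first by rewrite invr_ge0 mulr_ge0 // ltW.
  by rewrite /K; clear - C0; nra.
have gj j : u (pt (1 - (4 ^+ j)^-1)) <= u p + K * (1 - (2 ^+ j)^-1).
  elim: j => [|j IH].
    by rewrite !expr0 invr1 subrr mulr0 addr0 /pt !mul0r !addr0 -surjective_pairing.
  have := step j; have : K / 2 ^+ j = K / 2 ^+ j.+1 + K / 2 ^+ j.+1.
    by rewrite exprS; field; rewrite gt_eqF.
  move: IH; rewrite !mulrBr mulr1.
  move: (u _) (u _) (u _) (K / _) (K / _) => *; plra.
have [j hj] : exists j, r <= 1 - (4 ^+ j)^-1.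
  have r10 : 0 < 1 - r by plra.
  exists (Num.bound (1 - r)^-1).
  suff : (4 ^+ Num.bound (1 - r)^-1)^-1 <= 1 - r by plra.
  rewrite invf_ple ?posrE //.
  apply: (@le_trans _ _ (Num.bound (1 - r)^-1)%:R); first by apply/ltW/archi_boundP; rewrite invr_ge0 ltW.
  by rewrite -natrX ler_nat; apply: ltnW; apply: ltn_expl.
set s := 1 - _ in hj; have s1 : s < 1 by rewrite /s ltrBlDr ltrDl invr_gt0.
have [s0|s0] := leP s 0.
  have r00 : r = 0 by plra.
  by move: zE zp; rewrite r00 !mul0r !addr0 -surjective_pairing => ->; rewrite eqxx.
have As : A (pt s) by apply: ray => //; exact: ltW.
have := cu _ _ (r / s) Ap As; rewrite /= !add_sub_cancel !mulrA divfK ?gt_eqF // -zE.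
move=> /(_ ltac:(by rewrite divr_ge0 // ltW)) /(_ ltac:(by rewrite ler_pdivrMr // mul1r)).
have g := gj j; rewrite -/s in g.
have : (2 ^+ j)^-1 > 0 :> R by rewrite invr_gt0.
have t0 : 0 <= r / s by rewrite divr_ge0 // ltW.
have t1 : r / s <= 1 by rewrite ler_pdivrMr // mul1r.
move: (r / s) t0 t1 (u (pt s)) (u p) (u z) ((2 ^+ j)^-1) g => t t0 t1 a b e q g q0 h.
apply: le_trans h _.
have : K * (1 - q) <= K by rewrite ler_piMr ?(ltW K0) //; plra.
move=> k; have ab : a - b <= K by plra.
have := ler_wpM2l t0 ab; have : t * K <= K by rewrite ler_piMl // ltW.
by clear; plra.
Qed.

Lemma closure_ray (R : realType) (A : set (R * R)) (rho : R) (p z : R * R) (l : R) :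
  cset2 A -> 0 < rho -> (forall y : R * R, `|y.1 - p.1| <= rho -> `|y.2 - p.2| <= rho -> A y) ->
  closure A z -> 0 <= l -> l < 1 -> A (p.1 + l * (z.1 - p.1), p.2 + l * (z.2 - p.2)).
Proof.
move=> cA rho0 hp cz l0 l1.
have e0 : 0 < rho * (1 - l) by rewrite mulr_gt0 //; plra.
have [y [Ay [/= y1 y2]]] := cz _ (nbhsx_ballx z _ e0).
have l10 : 0 < 1 - l by plra.
have nb (a b : R) : ball a (rho * (1 - l)) b -> `|l * (a - b) / (1 - l)| <= rho.
  rewrite /ball /= => h; rewrite !normrM normfV (gtr0_norm l10) ler_pdivrMr // (ger0_norm l0).
  by apply: le_trans (ltW h); rewrite ler_piMl // ltW.
have A1 : A (p.1 + l * (z.1 - y.1) / (1 - l), p.2 + l * (z.2 - y.2) / (1 - l)).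
  by apply: hp => /=; rewrite add_sub_cancel; exact: nb.
have := cA _ _ l A1 Ay l0 (ltW l1); congr (A (_, _)).
  by rewrite /=; field; rewrite gt_eqF.
by rewrite /=; field; rewrite gt_eqF.
Qed.

(** The index n + 2 keeps the ratios at least 1/2. *)
Definition lam (R : realType) (n : nat) : R := 1 - n.+2%:R^-1.

Lemma lam_itv (R : realType) n : 0 < lam R n < 1.
Proof.
by rewrite /lam subr_gt0 invf_lt1 // ltr1n /= ltrBlDr ltrDl invr_gt0.
Qed.

Lemma lam_cvg (R : realType) : @lam R @ \oo --> (1 : R).
Proof.
rewrite -[X in _ --> X](subr0 (1 : R)); apply: cvgB; first exact: cvg_cst.
apply/cvgrPdist_lt => e e0; near=> n; rewrite sub0r normrN ger0_norm ?invr_ge0 //.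
apply: (@le_lt_trans _ _ n.+1%:R^-1); first by rewrite lef_pV2 ?posrE // ler_nat.
by near: n; exact: invSn_small.
Unshelve. all: by end_near. Qed.

(** Along a ray from p the slopes measured from p increase and the bound M keeps them bounded, so
    the radial limits exist; convexity and sign pass to the limit, and by continuity the limits are
    the old values inside A. *)
Lemma closure_extension (R : realType) (A : set (R * R)) (rho M : R) (p : R * R) (u : R * R -> R) :
  open A -> cset2 A -> 0 < rho -> (forall y : R * R, `|y.1 - p.1| <= rho -> `|y.2 - p.2| <= rho -> A y) ->
  inK A u -> (forall z, A z -> u z <= M) ->
  exists U : R * R -> R, [/\ forall z, A z -> U z = u z, inK (closure A) U &
    forall z, closure A z -> (fun n => u (p.1 + lam R n * (z.1 - p.1), p.2 + lam R n * (z.2 - p.2))) @ \oo --> U z].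
Proof.
move=> oA cA rho0 hp [cu u0] hM.
pose x n z : R * R := (p.1 + lam R n * (z.1 - p.1), p.2 + lam R n * (z.2 - p.2)).
have Ax n z : closure A z -> A (x n z).
  by move=> cz; have /andP[l0 l1] := lam_itv R n; apply: (closure_ray cA rho0 hp cz) => //; exact: ltW.
have Ap : A p by apply: hp; rewrite subrr normr0 ltW.
have cv z : closure A z -> cvgn (fun n => u (x n z)).
  move=> cz; pose s n := (u (x n z) - u p) / lam R n.
  rewrite (_ : (fun n => _) = (fun n => s n * lam R n + u p)); last first.
    apply/funext => n; rewrite /s divfK ?subrK // gt_eqF //.
    by have /andP[] := lam_itv R n.
  apply: is_cvgD; last exact: is_cvg_cst.
  apply: is_cvgM; last by apply/cvg_ex; exists 1; exact: lam_cvg.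
  apply: nondecreasing_is_cvgn.
    apply/nondecreasing_seqP => n; rewrite /s.
    have /andP[a0 a1] := lam_itv R n; have /andP[b0 b1] := lam_itv R n.+1.
    have ab : lam R n < lam R n.+1 by rewrite /lam ltrD2l ltrN2 ltf_pV2 ?posrE // ltr_nat.
    rewrite ler_pdivrMr //.
    have t0 : 0 <= lam R n / lam R n.+1 by rewrite divr_ge0 // ltW.
    have t1 : lam R n / lam R n.+1 <= 1 by rewrite ler_pdivrMr // mul1r ltW.
    have := cu _ _ _ Ap (Ax n.+1 z cz) t0 t1.
    rewrite /= !add_sub_cancel !mulrA divfK ?gt_eqF // -/(x n z).
    rewrite [(u (x n.+1 z) - u p) / _ * _]mulrAC [(u (x n.+1 z) - u p) * _ / _]mulrAC -mulrA [_ / _ * _]mulrC.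
    by rewrite [_^-1 * _]mulrC -lerBlDl.
  exists (2 * (`|M| + `|u p|)) => _ [n _ <-]; rewrite /s.
  have /andP[a0 a1] := lam_itv R n.
  rewrite ler_pdivrMr //.
  have half : 2^-1 <= lam R n.
    rewrite /lam; have : n.+2%:R^-1 <= 2^-1 :> R by rewrite lef_pV2 ?posrE // ler_nat.
    by move: (_.+2%:R^-1) => q; clear; plra.
  have h1 := hM _ (Ax n z cz); have h2 := ler_norm M; have h3 := ler_norm (- u p); rewrite normrN in h3.
  have h4 := normr_ge0 M; have h5 := normr_ge0 (u p).
  have : 2 * (`|M| + `|u p|) * 2^-1 <= 2 * (`|M| + `|u p|) * lam R n.
    by apply: ler_wpM2l => //; rewrite mulr_ge0 // addr_ge0.
  by move=> h6; clear - h1 h2 h3 h4 h5 h6; lra.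
exists (fun z => limn (fun n => u (x n z))); split.
- move=> z Az; apply/cvg_lim => //.
  suff xz : (fun n => x n z) @ \oo --> z.
    exact: (cvg_comp _ _ xz (cvx2_continuous oA cA cu Az)).
  have cc (a b : R) : (fun n => a + lam R n * (b - a)) @ \oo --> b.
    rewrite -[X in _ --> X](subrK a b) [X in _ --> X]addrC -[X in _ --> _ + X]mul1r.
    by apply: cvgD; [exact: cvg_cst|apply: cvgM; [exact: lam_cvg|exact: cvg_cst]].
  move=> B /nbhs_ballP[e /= e0 hB]; near=> n; apply: hB; split => /=.
    by near: n; move/cvgrPdist_lt: (cc p.1 z.1); exact.
  by near: n; move/cvgrPdist_lt: (cc p.2 z.2); exact.
- split; last first.
    by move=> z cz; apply: limr_ge; [exact: cv|near=> n; apply: u0; exact: Ax].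
  move=> a b t ca cb t0 t1.
  set c := (X in limn (fun n => u (x n X)) <= _).
  have cc : closure A c.
    move=> B /nbhs_ballP[e /= e0 hB]; have [a' [Aa' [a1 a2]]] := ca _ (nbhsx_ballx a _ e0).
    have [b' [Ab' [b1 b2]]] := cb _ (nbhsx_ballx b _ e0).
    exists (a'.1 + t * (b'.1 - a'.1), a'.2 + t * (b'.2 - a'.2)); split; first exact: cA.
    have nb (x1 y1 x2 y2 : R) : ball x1 e x2 -> ball y1 e y2 ->
        ball (x1 + t * (y1 - x1)) e (x2 + t * (y2 - x2)).
      rewrite /ball /= => h1 h2.
      rewrite (_ : _ - _ = (1 - t) * (x1 - x2) + t * (y1 - y2)); last by ring.
      apply: le_lt_trans (ler_normD _ _) _; rewrite !normrM (ger0_norm t0) (@ger0_norm _ (1 - t)); last by plra.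
      rewrite [X in X < _]addrC (_ : _ + _ = `|x1 - x2| + t * (`|y1 - y2| - `|x1 - x2|)); last by ring.
      exact: mul_lt_conv.
    by apply: hB; split => /=; exact: nb.
  have E n : x n c = ((x n a).1 + t * ((x n b).1 - (x n a).1), (x n a).2 + t * ((x n b).2 - (x n a).2)).
    by rewrite /x /c /=; congr (_, _); ring.
  have cd : (fun n => u (x n c) - (u (x n a) + t * (u (x n b) - u (x n a)))) @ \oo -->
     limn (fun n => u (x n c)) - (limn (fun n => u (x n a)) + t * (limn (fun n => u (x n b)) - limn (fun n => u (x n a)))).
    apply: cvgB; first exact: cv.
    apply: cvgD; first exact: cv.
    by apply: cvgM; [exact: cvg_cst|apply: cvgB; exact: cv].
  rewrite -subr_le0; apply: (cvgr_to_le cd); near=> n.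
  by rewrite E subr_le0; apply: cu => //; exact: Ax.
- by move=> z cz; exact: cv.
Unshelve. all: by end_near. Qed.

Lemma convexE (R : realType) (x y : R * R) (t : {i01 R}) :
  conv t (x : convex_lmodType (R * R)%type) (y : convex_lmodType (R * R)%type) =
  (y.1 + t%:inum * (x.1 - y.1), y.2 + t%:inum * (x.2 - y.2)) :> R * R.
Proof.
case: x y => x1 x2 [y1 y2]; rewrite /conv /=.
rewrite /unstable.onem.
change ((t%:num * x1 + (1 - t%:num) * y1, t%:num * x2 + (1 - t%:num) * y2) =
  (y1 + t%:num * (x1 - y1), y2 + t%:num * (x2 - y2))).
by congr (_, _); ring.
Qed.

Lemma convex_set_cset2 (R : realType) (A : set (R * R)) : cset2 A -> convex_set A.
Proof.
move=> cA x y t; rewrite !inE => Ax Ay; rewrite convexE; apply: cA => //.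
Qed.

Lemma convex_function_cvx2 (R : realType) (A : set (R * R)) (w : R * R -> R) :
  convex_function A w -> cvx2 A w.
Proof.
move=> cw x y t Ax Ay t0 t1.
have ht : 0 <= t <= 1 by rewrite t0 t1.
have := cw (Itv01 t0 t1) y x.
rewrite !inE convexE /= => /(_ Ay Ax) h; apply: le_trans h _.
by rewrite convRE /= /unstable.onem; rewrite le_eqVlt; apply/orP; left; apply/eqP; ring.
Qed.

Lemma cvx2_convex_function (R : realType) (A : set (R * R)) (w : R * R -> R) :
  cvx2 A w -> convex_function A w.
Proof.
move=> cw t x y; rewrite !inE convexE => Ax Ay.
apply: le_trans (cw _ _ _ Ay Ax _ _) _ => //.
by rewrite convRE /= /unstable.onem; rewrite le_eqVlt; apply/orP; left; apply/eqP; ring.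
Qed.

Lemma r_ext (R : realType) (A : set (R * R)) (u v : R * R -> R) (z : R * R) :
  open A -> cset2 A -> cvx2 A v -> (forall z, A z -> u z = v z) -> A z ->
  r1 u z = r1 v z /\ r2 u z = r2 v z.
Proof.
case: z => s t oA cA cv uv Az; have [e e0 he] := open_square oA Az; split; apply/cvg_lim => //.
  have [h _ _] := rd_spec (row_open oA) (row_itv cA) (row_cvx cv) (Az : row A t s).
  apply: cvg_trans h; apply: near_eq_cvg; near=> n; rewrite !uv //.
  apply: he => /=; last by rewrite subrr normr0 ltW.
  by rewrite add_sub_cancel ger0_norm ?invr_ge0 // ltW //; near: n; exact: invSn_small.
have [h _ _] := rd_spec (col_open oA) (col_itv cA) (col_cvx cv) (Az : col A s t).
apply: cvg_trans h; apply: near_eq_cvg; near=> n; rewrite !uv //.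
apply: he => /=; first by rewrite subrr normr0 ltW.
by rewrite add_sub_cancel ger0_norm ?invr_ge0 // ltW //; near: n; exact: invSn_small.
Unshelve. all: by end_near. Qed.

Lemma En_ext (R : realType) (A : set (R * R)) (u v : R * R -> R) :
  open A -> cset2 A -> cvx2 A v -> (forall z, A z -> u z = v z) -> En A u = En A v.
Proof.
move=> oA cA cv uv; apply: I2_ext => z Az; have [E1 E2] := r_ext oA cA cv uv Az.
by rewrite /den E1 E2 uv.
Qed.

Lemma En_ge0 (R : realType) (A : set (R * R)) (u : R * R -> R) : inK A u -> (0 <= En A u)%E.
Proof. by move=> [_ u0]; apply: I2_ge0 => z Az; rewrite den_ge0 ?u0. Qed.

(** The extension U has the energy of u, and every admissible function restricts to a competitor on
    A, so minimality and uniqueness carry over. *)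
Lemma exists_minimizer (R : realType) (A : set (R * R)) (X T0 T1 rho : R) (p : R * R) :
  open A -> cset2 A -> (forall z, A z -> `|z.1| <= X /\ `|z.2| <= X) ->
  T0 < T1 -> (forall t z, T0 < t -> t < T1 -> A z -> A (z.1, t)) ->
  0 < rho -> (forall y : R * R, `|y.1 - p.1| <= rho -> `|y.2 - p.2| <= rho -> A y) ->
  exists u : R * R -> R,
    [/\ is_minimizer A u, forall v, is_minimizer A v -> forall x, A x -> v x = u x,
        inK A u /\ En A u \is a fin_num, forall f, inK A f -> (En A u <= En A f)%E &
        forall z, closure A z -> (fun n => u (p.1 + lam R n * (z.1 - p.1), p.2 + lam R n * (z.2 - p.2))) @ \oo --> u z].
Proof.
move=> oA cA hX T01 hT rho0 hp.
have Ap : A p by apply: hp; rewrite subrr normr0 ltW.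
have A0 : A !=set0 by exists p.
have [u [Ku fu mu]] := exists_min oA cA hX T01 hT A0.
have [M hM] := min_bounded oA cA hX rho0 hp Ku fu mu.
have [U [hU [cU U0] cvU]] := closure_extension oA cA rho0 hp Ku hM.
have sA : A `<=` closure A := @subset_closure _ A.
have adm w : admissible A w -> inK A w.
  move=> [cw w0]; split; last by move=> z Az; apply: w0; exact: sA.
  move=> x y t Ax Ay; apply: (convex_function_cvx2 cw); exact: sA.
have EnU : En A U = En A u by apply: (En_ext oA cA) => //; case: Ku.
have KU : inK A U by apply: (inK_ext cA _ Ku) => z Az; rewrite hU.
have fU : En A U \is a fin_num by rewrite EnU.
have mU f : inK A f -> (En A U <= En A f)%E by rewrite EnU; exact: mu.
have eE w : inK A w -> energy A w = En A w by move=> [cw w0]; exact: energyE.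
have minU : is_minimizer A U.
  split; first by split => //; exact: cvx2_convex_function.
  by move=> w /adm Kw; rewrite !eE //; exact: mU.
exists U; split => //.
- move=> v [/adm Kv mv] x Ax.
  apply: (min_unique oA cA hX T01 hT Kv KU _ _ mU) => //.
    rewrite ge0_fin_numE ?En_ge0 // -eE //; apply: le_lt_trans (mv U (proj1 minU)) _.
    by rewrite eE // -ge0_fin_numE ?En_ge0.
  by move=> f Kf; rewrite -eE //; apply: le_trans (mv U (proj1 minU)) _; rewrite eE //; exact: mU.
- move=> z cz; have h := cvU z cz.
  set F := (X in X @ _ --> _); rewrite (_ : F = fun n => u (p.1 + lam R n * (z.1 - p.1), p.2 + lam R n * (z.2 - p.2))) //.
  apply/funext => n; rewrite /F.
  have /andP[l0 l1] := lam_itv R n.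
  by rewrite hU //; apply: (closure_ray cA rho0 hp cz) => //; exact: ltW.
Qed.

(** * Raising the minimizer to an affine function: absence of kinks *)

(** The one-step Hahn-Banach argument: by convexity the quotients required by points below the row
    of x0 never exceed those allowed by points above it, and n is the infimum of the latter. *)
Lemma plane_ext (R : realType) (A : set (R * R)) (u : R * R -> R) (x0 : R * R) (b : R) :
  open A -> cset2 A -> cvx2 A u -> A x0 ->
  (forall s, A (s, x0.2) -> u x0 + b * (s - x0.1) <= u (s, x0.2)) ->
  exists n : R, forall z, A z -> u x0 + b * (z.1 - x0.1) + n * (z.2 - x0.2) <= u z.
Proof.
move=> oA cA cu A0 hb.
pose g (z : R * R) := u z - u x0 - b * (z.1 - x0.1).
have [r r0 hr] := open_square oA A0.
pose S := [set q : R | exists z, [/\ A z, x0.2 < z.2 & q = g z / (z.2 - x0.2)]].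
have lb y : A y -> y.2 < x0.2 -> lbound S (g y / (y.2 - x0.2)).
  move=> Ay y2 _ [z [Az z2 ->]].
  pose t := (x0.2 - y.2) / (z.2 - y.2).
  have zy : 0 < z.2 - y.2 by plra.
  have t0 : 0 <= t by rewrite divr_ge0; plra.
  have t1 : t <= 1 by rewrite ler_pdivrMr; plra.
  have E : y.2 + t * (z.2 - y.2) = x0.2 by rewrite /t divfK ?gt_eqF // addrC subrK.
  have := cA _ _ _ Ay Az t0 t1; rewrite E => Am.
  have := cu _ _ _ Ay Az t0 t1; rewrite E => h1.
  have h2 := hb _ Am.
  have h3 : 0 <= (1 - t) * g y + t * g z by rewrite /g; clear - h1 h2; lra.
  have tE : t * (z.2 - y.2) = x0.2 - y.2 by rewrite /t divfK ?gt_eqF.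
  have h4 : 0 <= (z.2 - x0.2) * g y + (x0.2 - y.2) * g z.
    have : 0 <= (z.2 - y.2) * ((1 - t) * g y + t * g z) by rewrite mulr_ge0 // ltW.
    have e1 : z.2 - x0.2 = (z.2 - y.2) * (1 - t) by rewrite mulrBr mulr1 [_ * t]mulrC tE; ring.
    rewrite e1 -tE (_ : _ + t * _ * _ = (z.2 - y.2) * ((1 - t) * g y + t * g z)) //; ring.
  have yn : y.2 - x0.2 < 0 by plra.
  have zp : 0 < z.2 - x0.2 by plra.
  by rewrite ler_pdivlMr // mulrAC ler_ndivrMr //; clear - h4; lra.
have S0 : S !=set0.
  exists (g (x0.1, x0.2 + r) / (r)); exists (x0.1, x0.2 + r); split => //=; last by rewrite add_sub_cancel.
    by apply: hr => /=; rewrite ?subrr ?normr0 ?add_sub_cancel ?gtr0_norm // ltW.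
  by rewrite ltrDl.
have lS : has_lbound S.
  exists (g (x0.1, x0.2 - r) / (x0.2 - r - x0.2)); apply: (lb (x0.1, x0.2 - r)).
    by apply: hr => /=; rewrite ?subrr ?normr0 ?add_sub_cancel ?normrN ?gtr0_norm // ltW.
  by rewrite /= ltrBlDr ltrDl.
exists (inf S) => z Az; have [z2|z2|E] := ltgtP z.2 x0.2.
- have : g z / (z.2 - x0.2) <= inf S by apply: lb_le_inf => //; exact: lb.
  by rewrite ler_ndivrMr /g; plra.
- have : inf S <= g z / (z.2 - x0.2) by apply: ge_inf => //; exists z.
  by rewrite ler_pdivlMr /g; plra.
by rewrite E subrr mulr0 addr0; case: z Az E => s t Az /= E; rewrite E in Az *; exact: hb.
Qed.

Lemma rd_touch (R : realType) (I : set R) (g h : R -> R) (x : R) :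
  open I -> is_interval I -> cvx1 I g -> cvx1 I h -> I x -> (forall y, I y -> g y <= h y) -> g x = h x ->
  ld g x = rd g x -> ld h x = rd h x -> rd g x = rd h x.
Proof.
move=> oI iI cg ch Ix gh E Eg Eh.
have [c1 _ _] := rd_spec oI iI cg Ix; have c2 := ld_spec oI iI ch Ix.
have sg := rd_subgrad oI iI cg; have shl := ld_subgrad oI iI ch.
apply/eqP; rewrite eq_le; apply/andP; split.
  apply: (rd_glb oI iI ch Ix) => y Iy xy.
  by have := sg _ _ Ix Iy; have := gh _ Iy; rewrite -E; plra.
have [e e0 Ie] : exists2 e : R, 0 < e & forall y, `|x - y| < e -> I y.
  by have /nbhs_ballP[e /= e0 he] := oI _ Ix; exists e => // y; exact: he.
rewrite -Eh; apply: (cvgr_to_le c2); near=> n.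
have n0 : (0:R) < n.+1%:R^-1 by rewrite invr_gt0.
have ne : (n.+1%:R^-1 : R) < e by near: n; exact: invSn_small.
have In : I (x - n.+1%:R^-1) by apply: Ie; rewrite opprB addrCA subrr addr0 gtr0_norm.
have := sg _ _ Ix In; have := gh _ In; rewrite -E.
set t := (n.+1%:R^-1 : R) in n0 *; have -> : n.+1%:R = t^-1 by rewrite /t invrK.
by move=> h1 h2; rewrite ler_pdivrMl //; clear - h1 h2; lra.
Unshelve. all: by end_near. Qed.

Definition aff (R : realType) (c m n : R) (z : R * R) : R := c + m * z.1 + n * z.2.

Lemma rd_aff (R : realType) (c m x : R) : rd (fun s => c + m * s) x = m.
Proof.
rewrite /rd (_ : (fun k => _) = fun=> m); first exact: lim_cst.
by apply/funext => k; rewrite (_ : _ - _ = m * k.+1%:R^-1) 1?mulrCA ?mulfV ?mulr1 //; ring.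
Qed.

Lemma aff_cvx2 (R : realType) (A : set (R * R)) (c m n : R) : cvx2 A (aff c m n).
Proof. by move=> x y t _ _ _ _; rewrite /aff /= le_eqVlt; apply/orP; left; apply/eqP; ring. Qed.

Lemma max_cvx2 (R : realType) (A : set (R * R)) (u v : R * R -> R) :
  cvx2 A u -> cvx2 A v -> cvx2 A (fun z => Num.max (u z) (v z)).
Proof.
move=> cu cv x y t Ax Ay t0 t1; rewrite ge_max; apply/andP; split.
  apply: le_trans (cu _ _ _ Ax Ay t0 t1) _.
  have : u x <= Num.max (u x) (v x) by rewrite le_max lexx.
  have : u y <= Num.max (u y) (v y) by rewrite le_max lexx.
  by move: (Num.max _ _) (Num.max _ _) => p q; clear - t0 t1; move=> ? ?; nra.
apply: le_trans (cv _ _ _ Ax Ay t0 t1) _.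
have : v x <= Num.max (u x) (v x) by rewrite le_max lexx orbT.
have : v y <= Num.max (u y) (v y) by rewrite le_max lexx orbT.
by move: (Num.max _ _) (Num.max _ _) => p q; clear - t0 t1; move=> ? ?; nra.
Qed.

Lemma r_loc (R : realType) (A S : set (R * R)) (u v : R * R -> R) (z : R * R) :
  open A -> cset2 A -> cvx2 A v -> A z -> open S -> S z -> (forall z, A z -> S z -> u z = v z) ->
  r1 u z = r1 v z /\ r2 u z = r2 v z.
Proof.
case: z => s t oA cA cv Az oS Sz uv; have [e e0 he] := open_square oA Az.
have [d d0 hd] := open_square oS Sz; split; apply/cvg_lim => //.
  have [h _ _] := rd_spec (row_open oA) (row_itv cA) (row_cvx cv) (Az : row A t s).
  apply: cvg_trans h; apply: near_eq_cvg; near=> n.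
  have n1 : `|s + n.+1%:R^-1 - s| <= Num.min e d.
    by rewrite add_sub_cancel ger0_norm ?invr_ge0 // ltW //; near: n; apply: invSn_small; rewrite lt_min e0.
  move: n1; rewrite le_min => /andP[n1 n2].
  by rewrite !uv //; [apply: he|apply: hd] => //=; rewrite subrr normr0 ltW.
have [h _ _] := rd_spec (col_open oA) (col_itv cA) (col_cvx cv) (Az : col A s t).
apply: cvg_trans h; apply: near_eq_cvg; near=> n.
have n1 : `|t + n.+1%:R^-1 - t| <= Num.min e d.
  by rewrite add_sub_cancel ger0_norm ?invr_ge0 // ltW //; near: n; apply: invSn_small; rewrite lt_min e0.
move: n1; rewrite le_min => /andP[n1 n2].
by rewrite !uv //; [apply: he|apply: hd] => //=; rewrite subrr normr0 ltW.
Unshelve. all: by end_near. Qed.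

(* Comparison with a competitor [V >= u]: only the set where [V > u] matters. *)
Lemma compare_above (R : realType) (A S : set (R * R)) (u V : R * R -> R) :
  open A -> cset2 A -> inK A u -> En A u \is a fin_num -> (forall f, inK A f -> (En A u <= En A f)%E) ->
  inK A V -> (forall z, A z -> u z <= V z) -> measurable S -> S `<=` A ->
  (forall z, A z -> ~ S z -> u z = V z) ->
  (I2 S (den u) <= I2 S (den V))%E.
Proof.
move=> oA cA Ku fu mu KV uV mS SA SE; have [cu u0] := Ku; have [cV V0] := KV.
have mA := open_measurable2 oA.
have [N1 [mN1 N10 _ h1]] := nondiff_null oA cA cu.
have [N2 [mN2 N20 _ h2]] := nondiff_null oA cA cV.
have mdu := den_measurable oA cA cu; have mdV := den_measurable oA cA cV.
have mAS : measurable (A `\` S) by exact: measurableD.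
have mduS : measurable_fun (A `\` S) (den u) by apply: measurable_funS mdu => // z [].
have mdVS : measurable_fun (A `\` S) (den V) by apply: measurable_funS mdV => // z [].
(* Off S the functions touch, with u below V, so their derivatives agree wherever neither has a
   kink. *)
have E : I2 (A `\` S) (den u) = I2 (A `\` S) (den V).
  rewrite -(I2_null mAS mN1 N10 mduS) -(I2_null mAS mN1 N10 mdVS).
  have mB : measurable ((A `\` S) `\` N1) by exact: measurableD.
  have mduB : measurable_fun ((A `\` S) `\` N1) (den u) by apply: measurable_funS mduS => // z [].
  have mdVB : measurable_fun ((A `\` S) `\` N1) (den V) by apply: measurable_funS mdVS => // z [].
  rewrite -(I2_null mB mN2 N20 mduB) -(I2_null mB mN2 N20 mdVB).
  apply: I2_ext => -[s t] [[[Az nS] n1] n2].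
  have [a1 a2] := h1 _ Az n1; have [b1 b2] := h2 _ Az n2.
  have q1 : r1 u (s, t) = r1 V (s, t).
    by apply: (rd_touch (row_open oA) (row_itv cA) (row_cvx cu) (row_cvx cV) (Az : row A t s)) => //;
      [move=> y; exact: uV|exact: SE].
  have q2 : r2 u (s, t) = r2 V (s, t).
    by apply: (rd_touch (col_open oA) (col_itv cA) (col_cvx cu) (col_cvx cV) (Az : col A s t)) => //;
      [move=> y; exact: uV|exact: SE].
  by rewrite /den q1 q2 SE.
have AS : A `&` S = S by apply/seteqP; split => [z []//|z Sz]; split => //; exact: SA.
have := mu V KV; rewrite /En (I2_split mA mS mdu) (I2_split mA mS mdV) AS E.
have fin : I2 (A `\` S) (den V) \is a fin_num.
  rewrite -E ge0_fin_numE; last by apply: I2_ge0 => z [Az _]; rewrite den_ge0 ?u0.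
  apply: le_lt_trans (_ : (En A u < +oo)%E); last by rewrite -ge0_fin_numE ?En_ge0.
  by apply: I2_subset => // z Az; rewrite den_ge0 ?u0.
by rewrite leeD2rE.
Qed.

(** Derivatives may be unbounded at the ends of J, so estimates are made on compact subintervals and
    passed to J by Fatou's lemma. *)
Lemma integral_exhaust (R : realType) (J : set R) (X : R) (f : R -> R) (M : \bar R) :
  open J -> is_interval J -> (forall x, J x -> `|x| <= X) -> measurable_fun J f ->
  (forall x, J x -> 0 <= f x) -> (0 <= M)%E ->
  (forall a b, J a -> J b -> a <= b -> (\int[@lebesgue_measure R]_(x in `]a, b]) (f x)%:E <= M)%E) ->
  (\int[@lebesgue_measure R]_(x in J) (f x)%:E <= M)%E.
Proof.
move=> oJ iJ hX mf f0 M0 h.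
have [->|/set0P[c Jc]] := eqVneq J set0; first by rewrite integral_set0.
have mJ : measurable J by exact: open_measurable.
have uJ : has_sup J by split; [exists c|exists X => x /hX; rewrite ler_norml => /andP[]].
have lJ : has_inf J by split; [exists c|exists (- X) => x /hX; rewrite ler_norml => /andP[]].
have [e e0 he] : exists2 e : R, 0 < e & forall y, `|c - y| < e -> J y.
  by have /nbhs_ballP[e /= e0 he] := oJ _ Jc; exists e => // y; exact: he.
pose al := inf J; pose be := sup J.
have alc : al < c.
  apply: (@le_lt_trans _ _ (c - e / 2)); last by plra.
  apply: ge_inf; first by case: lJ.
  by apply: he; rewrite opprB addrCA subrr addr0 gtr0_norm; plra.
have cbe : c < be.
  apply: (@lt_le_trans _ _ (c + e / 2)); first by plra.
  apply: ub_le_sup; first by case: uJ.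
  by apply: he; rewrite opprD addrA subrr sub0r normrN gtr0_norm; plra.
have Jin x : al < x -> x < be -> J x.
  move=> ax xb; have [y Jy yx] := inf_lt (proj1 lJ) ax; have [z Jz xz] := sup_gt (proj1 uJ) xb.
  by apply: (iJ y z) => //; rewrite !ltW.
pose a n := al + (c - al) * n.+1%:R^-1.
pose b n := be - (be - c) * n.+1%:R^-1.
have n1 n : (n.+1%:R^-1 : R) <= 1 by rewrite invf_le1 // ler1n.
have n0 n : 0 < (n.+1%:R^-1 : R) by rewrite invr_gt0.
have ac n : al < a n <= c.
  rewrite /a ltrDl mulr_gt0 ?subr_gt0 //= -lerBrDl ler_piMr // subr_ge0 ltW //.
have cb n : c <= b n < be.
  rewrite /b ltrBlDr ltrDl mulr_gt0 ?subr_gt0 // andbT lerBrDr -lerBrDl ler_piMr // subr_ge0 ltW //.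
have Ja n : J (a n) by case/andP: (ac n) => *; apply: Jin => //; plra.
have Jb n : J (b n) by case/andP: (cb n) => *; apply: Jin => //; plra.
have ab n : a n <= b n by case/andP: (ac n) => _ h1; case/andP: (cb n) => h2 _; exact: le_trans h2.
have sub n : `]a n, b n]%classic `<=` J.
  move=> x /=; rewrite in_itv /= => /andP[h1 h2]; apply: (iJ _ _ (Ja n) (Jb n)); rewrite h2 ltW //.
pose f_ n x : R := if x \in `]a n, b n] then f x else 0.
apply: (@fatou_cvg _ _ R (@lebesgue_measure R) J f_ f M) => //.
- move=> n; apply: (eq_measurable_fun (f \_ `]a n, b n])).
    by move=> x _; rewrite patchE /f_ mem_setE.
  by apply: measurable_funTS; apply/(measurable_restrictT _ _).1 => //; apply: measurable_funS mf.
- by move=> n x Jx; rewrite /f_; case: ifP => // _; exact: f0.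
- move=> x Jx.
  have ax : al < x.
    have [d d0 hd] : exists2 e : R, 0 < e & forall y, `|x - y| < e -> J y.
      by have /nbhs_ballP[d /= d0 hd] := oJ _ Jx; exists d => // y; exact: hd.
    apply: (@le_lt_trans _ _ (x - d / 2)); last by plra.
    apply: ge_inf; first by case: lJ.
    by apply: hd; rewrite opprB addrCA subrr addr0 gtr0_norm; plra.
  have xb : x < be.
    have [d d0 hd] : exists2 e : R, 0 < e & forall y, `|x - y| < e -> J y.
      by have /nbhs_ballP[d /= d0 hd] := oJ _ Jx; exists d => // y; exact: hd.
    apply: (@lt_le_trans _ _ (x + d / 2)); first by plra.
    apply: ub_le_sup; first by case: uJ.
    by apply: hd; rewrite opprD addrA subrr sub0r normrN gtr0_norm; plra.
  apply: (@cvg_trans _ ((fun=> f x) @ \oo)); last exact: cvg_cst.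
  apply: near_eq_cvg; near=> n; rewrite /f_ ifT // in_itv /=; apply/andP; split.
    have : (n.+1%:R^-1 : R) < (x - al) / (c - al) by near: n; apply: invSn_small; rewrite divr_gt0 ?subr_gt0.
    by rewrite ltr_pdivlMr ?subr_gt0 // /a mulrC ltrBrDl.
  have : (n.+1%:R^-1 : R) < (be - x) / (be - c) by near: n; apply: invSn_small; rewrite divr_gt0 ?subr_gt0.
  by rewrite ltr_pdivlMr ?subr_gt0 // /b mulrC => q; apply: ltW; rewrite ltrBrDl -ltrBrDr.
move=> n; apply: le_trans (h _ _ (Ja n) (Jb n) (ab n)).
have JE : J `&` `]a n, b n] = `]a n, b n]%classic.
  by apply/seteqP; split => x; [case|move=> hx; split => //; exact: (sub n)].
suff E : (\int[@lebesgue_measure R]_(x in `]a n, b n]) (f x)%:E =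
  \int[@lebesgue_measure R]_(x in J) (f_ n x)%:E)%E by rewrite E.
rewrite -[in LHS]JE integral_mkcondr; apply: eq_integral => x _.
by rewrite patchE /f_ mem_setE; case: ifP.
Unshelve. all: by end_near. Qed.

Lemma rd_bounded_oc (R : realType) (I : set R) (g : R -> R) (a b : R) :
  open I -> is_interval I -> cvx1 I g -> I a -> I b -> a <= b ->
  exists2 B : R, 0 <= B & forall x, a < x <= b -> `|rd g x| <= B.
Proof.
move=> oI iI cg Ia Ib ab; exists (`|rd g a| + `|rd g b|); first by rewrite addr_ge0.
move=> x /andP[ax xb]; have Ix : I x by apply: (iI a b) => //; rewrite xb ltW.
have h1 := rd_mono oI iI cg Ia Ix (ltW ax); have h2 := rd_mono oI iI cg Ix Ib xb.
have := ler_norm (- rd g a); have := ler_norm (rd g b); rewrite normrN.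
have := normr_ge0 (rd g a); have := normr_ge0 (rd g b).
by rewrite ler_norml => *; apply/andP; split; plra.
Qed.

Lemma interval_mono_measurable (R : realType) (I : set R) (f : R -> R) :
  is_interval I -> (forall x y, I x -> I y -> x <= y -> f x <= f y) -> measurable_fun I f.
Proof.
move=> iI fm; apply: measurable_fun_gtr => r; apply: is_interval_measurable.
move=> x y [Ix /= fx] [Iy _] z /andP[xz zy].
have Iz : I z by apply: (iI x y) => //; rewrite xz.
by split => //=; apply: lt_le_trans fx _; exact: fm.
Qed.

Lemma cvx1_continuous (R : realType) (I : set R) (g : R -> R) (x : R) :
  open I -> is_interval I -> cvx1 I g -> I x -> {for x, continuous g}.
Proof.
move=> oI iI cg Ix.
have [e e0 Ie] : exists2 e : R, 0 < e & forall y, `|x - y| < e -> I y.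
  by have /nbhs_ballP[e /= e0 he] := oI _ Ix; exists e => // y; exact: he.
have e2 : 0 < e / 2 by plra.
have I1 : I (x - e / 2) by apply: Ie; rewrite opprB addrCA subrr addr0 gtr0_norm; plra.
have I2 : I (x + e / 2) by apply: Ie; rewrite opprD addrA subrr sub0r normrN gtr0_norm; plra.
pose B : R := `|rd g (x - e / 2)| + `|rd g (x + e / 2)| + 1.
have Ba : - B <= rd g (x - e / 2).
  by rewrite /B; have := ler_norm (- rd g (x - e / 2)); rewrite normrN; have := normr_ge0 (rd g (x + e / 2)); plra.
have Bb : rd g (x + e / 2) <= B.
  by rewrite /B; have := ler_norm (rd g (x + e / 2)); have := normr_ge0 (rd g (x - e / 2)); plra.
have B0 : 0 < B by rewrite /B; have := normr_ge0 (rd g (x - e / 2)); have := normr_ge0 (rd g (x + e / 2)); plra.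
have L y : `|x - y| < e / 2 -> `|g x - g y| <= B * `|x - y|.
  rewrite ltr_norml => /andP[h1 h2].
  have [xy|yx] := leP x y.
    rewrite distrC [`|x - y|]distrC (@ger0_norm _ (y - x)) ?subr_ge0 //.
    have ax : x - e / 2 <= x by plra.
    have yb : y <= x + e / 2 by plra.
    by case: (rd_bound oI iI cg I1 I2 Ba Bb ax xy yb).
  rewrite (@ger0_norm _ (x - y)) ?subr_ge0 ?(ltW yx) //.
  have ay : x - e / 2 <= y by plra.
  have xb : x <= x + e / 2 by plra.
  by case: (rd_bound oI iI cg I1 I2 Ba Bb ay (ltW yx) xb).
apply/cvgrPdist_lt => d d0.
have m0 : 0 < Num.min (e / 2) (d / B) by rewrite lt_min e2 divr_gt0.
have := nbhsx_ballx x _ m0; apply: filterS => y; rewrite /ball /= lt_min => /andP[h1 h2].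
by apply: le_lt_trans (L _ h1) _; rewrite mulrC -ltr_pdivlMr.
Qed.

(* Replacing [g] by a chord [m s + c] on the interval [J] where the chord is above. *)
Lemma chord_ineq (R : realType) (I J : set R) (g : R -> R) (m c X Y kap : R) :
  open I -> is_interval I -> cvx1 I g -> open J -> is_interval J -> J `<=` I ->
  (forall x, I x -> `|x| <= X) -> (forall x, I x -> `|m - x| <= Y) ->
  (forall x, J x -> 0 <= c + m * x - g x) -> 0 <= kap -> J !=set0 ->
  (forall a b, J a -> J b -> a <= b -> exists a' b', [/\ J a', J b', a' <= a, b <= b' &
     (c + m * a' - g a') + (c + m * b' - g b') <= kap]) ->
  (\int[@lebesgue_measure R]_(x in J) (2^-1 * (m - x) ^+ 2 + 2^-1 * (m - rd g x) ^+ 2)%:E <=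
   \int[@lebesgue_measure R]_(x in J) (2^-1 * (rd g x - x) ^+ 2 + (c + m * x - g x))%:E + (Y * kap)%:E)%E.
Proof.
move=> oI iI cg oJ iJ JI hX hY q0 k0 [c0 Jc0] ends.
have mJ : measurable J by exact: open_measurable.
have oc a b : J a -> J b -> `]a, b]%classic `<=` J.
  by move=> Ja Jb x /=; rewrite in_itv /= => /andP[ax xb]; apply: (iJ a b) => //; rewrite xb ltW.
have mrd : measurable_fun J (rd g).
  by apply: (interval_mono_measurable iJ) => x y Jx Jy xy; apply: (rd_mono oI iI cg) => //; exact: JI.
have mg : measurable_fun J g.
  apply: open_continuous_measurable_fun => // x; rewrite inE => Jx.
  exact: (cvx1_continuous oI iI cg (JI _ Jx)).
pose G x := 2^-1 * (rd g x - x) ^+ 2 + (c + m * x - g x).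
pose F x := 2^-1 * (m - x) ^+ 2 + 2^-1 * (m - rd g x) ^+ 2.
have F0 x : 0 <= F x by rewrite /F; nneg.
have G0 x : J x -> 0 <= G x by move=> Jx; rewrite /G addr_ge0 ?q0 //; nneg.
have mF : measurable_fun J F.
  by apply: measurable_funD; apply: measurable_funM => //; apply: measurable_funX; apply: measurable_funB.
have mG : measurable_fun J G.
  apply: measurable_funD.
    by apply: measurable_funM => //; apply: measurable_funX; apply: measurable_funB.
  by apply: measurable_funB => //; apply: measurable_funD => //; apply: measurable_funM.
have iG0 : (0 <= \int[@lebesgue_measure R]_(x in J) (G x)%:E)%E by apply: integral_ge0 => x Jx; rewrite lee_fin G0.
have Y0 : 0 <= Y by apply: le_trans (hY _ (JI _ Jc0)).
apply: (integral_exhaust oJ iJ (X := X)) => //.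
- by move=> x Jx; exact: hX (JI _ Jx).
- by move=> x _; exact: F0.
- by rewrite adde_ge0 // lee_fin mulr_ge0.
move=> a b Ja Jb ab; have [a' [b' [Ja' Jb' aa bb kk]]] := ends a b Ja Jb ab.
have ab' : a' <= b' by apply: le_trans aa (le_trans ab bb).
have Ia := JI _ Ja'; have Ib := JI _ Jb'.
have sJ := oc _ _ Ja' Jb'.
apply: (@le_trans _ _ (\int[@lebesgue_measure R]_(x in `]a', b']) (F x)%:E)%E).
  apply: ge0_subset_integral => //; first by apply/measurable_EFinP; exact: measurable_funS mF.
  - by move=> x _; rewrite lee_fin; exact: F0.
  - by move=> x /=; rewrite !in_itv /= => /andP[h1 h2]; rewrite (le_lt_trans aa h1) (le_trans h2 bb).
have [B B0 hB] := rd_bounded_oc oI iI cg Ia Ib ab'.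
have X0 : 0 <= X by apply: le_trans (hX _ Ia).
have iD2 : (@lebesgue_measure R).-integrable `]a', b'] (EFin \o (fun x => 2^-1 * (rd g x - x) ^+ 2)).
  apply: (@bounded_integrable_oc _ _ _ _ (2^-1 * (B + X) ^+ 2)).
    apply: measurable_funM => //; apply: measurable_funX; apply: measurable_funB => //.
    exact: measurable_funS mrd.
  move=> x xab; rewrite ger0_norm; last by nneg.
  rewrite ler_pM2l ?invr_gt0 //; apply: sqr_le_abs; apply: le_trans (ler_normB _ _) _; apply: lerD; first exact: hB.
  by apply: hX; apply: JI; apply: sJ; rewrite /= in_itv.
have [i1 E1] := rd_IBP m oI iI cg Ia Ib ab'.
have cl : cvx1 I (fun x => c + m * x) by move=> x y z _ _ _ _; rewrite le_eqVlt; apply/orP; left; apply/eqP; ring.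
have [i2 E2] := rd_IBP m oI iI cl Ia Ib ab'.
have ig := cvx1_integrable oI iI cg Ia Ib ab'.
have il := cvx1_integrable oI iI cl Ia Ib ab'.
have i3 : (@lebesgue_measure R).-integrable `]a', b'] (EFin \o (fun x => (m - x) * rd (fun y => c + m * y) x - (m - x) * rd g x)).
  by apply: eq_integrable (integrableB _ i2 i1).
have i4 : (@lebesgue_measure R).-integrable `]a', b'] (EFin \o (fun x => (c + m * x) - g x)).
  by apply: eq_integrable (integrableB _ il ig).
have i5 : (@lebesgue_measure R).-integrable `]a', b'] (EFin \o F).
  by apply: eq_integrable (integrableD _ iD2 i3) => // x _ /=; congr EFin; rewrite /F rd_aff; field.
have i6 : (@lebesgue_measure R).-integrable `]a', b'] (EFin \o G).
  by apply: eq_integrable (integrableD _ iD2 i4).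
(* With r = [rd g x] one has (m - x) ^ 2 + (m - r) ^ 2 = (r - x) ^ 2 + 2 (m - x) (m - r). The mixed
   term integrates by parts to the integral of c + m x - g plus boundary values of it, weighted by
   at most Y, and these are bounded by kap. *)
have EF : \int[@lebesgue_measure R]_(x in `]a', b']) F x <=
    \int[@lebesgue_measure R]_(x in `]a', b']) G x + Y * kap.
  have -> : \int[@lebesgue_measure R]_(x in `]a', b']) F x =
     \int[@lebesgue_measure R]_(x in `]a', b']) (2^-1 * (rd g x - x) ^+ 2 +
      ((m - x) * rd (fun y => c + m * y) x - (m - x) * rd g x)).
    by apply: eq_Rintegral => y _; rewrite /F rd_aff; field.
  rewrite RintegralD //.
  rewrite [in X in _ <= X]RintegralD // [X in _ + X <= _]RintegralB // [X in _ <= _ + X + _]RintegralB // E1 E2.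
  have ha := hY _ Ia; have hb := hY _ Ib; have qa := q0 _ Ja'; have qb := q0 _ Jb'.
  have : Y * ((c + m * a' - g a') + (c + m * b' - g b')) <= Y * kap by rewrite ler_wpM2l.
  move: ha hb; rewrite !ler_norml => /andP[h1 h2] /andP[h3 h4].
  have k1 : (m - b') * (c + m * b' - g b') <= Y * (c + m * b' - g b') by rewrite ler_wpM2r.
  have k2 : - ((m - a') * (c + m * a' - g a')) <= Y * (c + m * a' - g a') by rewrite -mulNr ler_wpM2r //; plra.
  move: (Rintegral _ _ _) (Rintegral _ _ _) (Rintegral _ _ _) => I1 I2 I3.
  by clear - k1 k2; lra.
have fF := integrable_fin_num _ i5; have fG := integrable_fin_num _ i6.
apply: (@le_trans _ _ (\int[@lebesgue_measure R]_(x in `]a', b']) (G x)%:E + (Y * kap)%:E)%E).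
  rewrite -(fineK (fF _)) // -(fineK (fG _)) // -EFinD lee_fin; exact: EF.
apply: leeD2r; apply: ge0_subset_integral => //; first by apply/measurable_EFinP.
Qed.

Lemma right_end (R : realType) (J : set R) (q : R -> R) (b kap : R) :
  open J -> has_sup J -> (J (sup J) -> False) -> {for (sup J), continuous q} -> q (sup J) <= 0 ->
  J b -> 0 < kap -> is_interval J -> exists b', [/\ J b', b <= b' & q b' <= kap].
Proof.
move=> oJ sJ nJ cq q0 Jb k0 iJ.
have : \forall y \near sup J, q y < kap by apply: (cvgr_lt _ cq); exact: le_lt_trans k0.
move=> /nbhs_ballP[e /= e0 he].
have [j Jj je] := sup_adherent e0 sJ.
exists (Num.max b j); split; last 2 first.
- by rewrite le_max lexx.
- apply/ltW/he; rewrite /ball /=.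
  have h1 : Num.max b j <= sup J by rewrite ge_max !sup_upper_bound.
  rewrite ger0_norm ?subr_ge0 // ltrBlDr -ltrBlDl; apply: lt_le_trans je _; by rewrite le_max lexx orbT.
by case: leP.
Qed.

Lemma left_end (R : realType) (J : set R) (q : R -> R) (b kap : R) :
  open J -> has_inf J -> (J (inf J) -> False) -> {for (inf J), continuous q} -> q (inf J) <= 0 ->
  J b -> 0 < kap -> is_interval J -> exists b', [/\ J b', b' <= b & q b' <= kap].
Proof.
move=> oJ sJ nJ cq q0 Jb k0 iJ.
have : \forall y \near inf J, q y < kap by apply: (cvgr_lt _ cq); exact: le_lt_trans k0.
move=> /nbhs_ballP[e /= e0 he].
have [j Jj je] := inf_adherent e0 sJ.
have lb x : J x -> inf J <= x by move=> Jx; apply: ge_inf => //; case: sJ.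
exists (Num.min b j); split; last 2 first.
- by rewrite ge_min lexx.
- apply/ltW/he; rewrite /ball /= distrC.
  have h1 : inf J <= Num.min b j by rewrite le_min !lb.
  rewrite ger0_norm ?subr_ge0 // ltrBlDr; apply: le_lt_trans (_ : j < _); first by rewrite ge_min lexx orbT.
  by rewrite addrC.
by case: leP.
Qed.

Definition under (R : realType) (A : set (R * R)) (u P : R * R -> R) : set (R * R) :=
  [set z | A z /\ u z < P z].

Lemma under_open (R : realType) (A : set (R * R)) (u : R * R -> R) (c m n : R) :
  open A -> cset2 A -> cvx2 A u -> open (under A u (aff c m n)).
Proof.
move=> oA cA cu; rewrite openE => z [Az uz]; apply: filterI; first exact: open_nbhs_nbhs.
have cv : (fun y => aff c m n y - u y) @ z --> aff c m n z - u z.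
  by apply: cvgB; [exact: (cvx2_continuous oA cA (@aff_cvx2 R A c m n) Az)|exact: (cvx2_continuous oA cA cu Az)].
have : \forall y \near z, 0 < aff c m n y - u y by apply: (cvgr_gt _ cv); rewrite subr_gt0.
by apply: filterS => y; rewrite subr_gt0.
Qed.

Lemma under_cset2 (R : realType) (A : set (R * R)) (u : R * R -> R) (c m n : R) :
  cset2 A -> cvx2 A u -> cset2 (under A u (aff c m n)).
Proof.
move=> cA cu x y t [Ax ux] [Ay uy] t0 t1; split; first exact: cA.
apply: le_lt_trans (cu _ _ _ Ax Ay t0 t1) _; rewrite /aff /=.
rewrite -subr_gt0 (_ : _ - _ = (1 - t) * (aff c m n x - u x) + t * (aff c m n y - u y)); last by rewrite /aff; ring.
rewrite (_ : _ + _ = - (- (aff c m n x - u x) + t * (- (aff c m n y - u y) - - (aff c m n x - u x)))); last by ring.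
by rewrite oppr_gt0; apply: mul_lt_conv => //; rewrite oppr_lt0 subr_gt0.
Qed.

(** On a row whose section has its ends inside A the difference q of the affine function and u tends
    to 0 at both ends, so the boundary terms can be made arbitrarily small. Rows with heights in U
    may end at the boundary of A, where q <= e bounds the two terms by Y * (2 * e). *)
Lemma rows_chord (R : realType) (A : set (R * R)) (u : R * R -> R) (c m n X Y e : R) (U : set R) :
  open A -> cset2 A -> cvx2 A u -> (forall z, A z -> `|z.1| <= X) -> (forall z, A z -> `|m - z.1| <= Y) ->
  0 <= Y -> 0 <= e -> (forall z, under A u (aff c m n) z -> aff c m n z - u z <= e) ->
  measurable U -> (forall z, closure (under A u (aff c m n)) z -> ~ U z.2 -> A z) ->
  (I2 (under A u (aff c m n)) (fun z => 2^-1 * (m - z.1) ^+ 2 + 2^-1 * (m - r1 u z) ^+ 2)%R <=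
   I2 (under A u (aff c m n)) (fun z => 2^-1 * (r1 u z - z.1) ^+ 2 + (aff c m n z - u z))%R +
    (Y * (2 * e))%:E * (@lebesgue_measure R) U)%E.
Proof.
move=> oA cA cu hX hY Y0 e0 he mU hU.
set S := under _ _ _.
have oS : open S by exact: under_open.
have cS : cset2 S by exact: under_cset2.
have mS := open_measurable2 oS.
have SA : S `<=` A by move=> z [].
have cuS : cvx2 S u by move=> x y t /SA Ax /SA Ay; exact: cu.
have mA := open_measurable2 oA.
have [mr _ _ _] := partials_measurable oA cA cu.
have mrS : measurable_fun S (r1 u) by exact: measurable_funS mr.
have muS := cvx2_measurable oS cS cuS.
have maS := cvx2_measurable oS cS (@aff_cvx2 R S c m n).
have mF : measurable_fun S (fun z => 2^-1 * (m - z.1) ^+ 2 + 2^-1 * (m - r1 u z) ^+ 2).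
  apply: measurable_funD; apply: measurable_funM => //; apply: measurable_funX; apply: measurable_funB => //.
  exact: measurable_funTS.
have mG : measurable_fun S (fun z => 2^-1 * (r1 u z - z.1) ^+ 2 + (aff c m n z - u z)).
  apply: measurable_funD; last exact: measurable_funB.
  apply: measurable_funM => //; apply: measurable_funX; apply: measurable_funB => //; exact: measurable_funTS.
have q0 z : S z -> 0 <= aff c m n z - u z by move=> [_ h]; rewrite subr_ge0 ltW.
have F0 z : S z -> 0 <= 2^-1 * (m - z.1) ^+ 2 + 2^-1 * (m - r1 u z) ^+ 2 by move=> _; nneg.
have G0 z : S z -> 0 <= 2^-1 * (r1 u z - z.1) ^+ 2 + (aff c m n z - u z).
  by move=> Sz; rewrite addr_ge0 ?q0 //; nneg.
have mEG : measurable_fun S (fun z => (2^-1 * (r1 u z - z.1) ^+ 2 + (aff c m n z - u z))%:E) by exact/measurable_EFinP.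
have mEF : measurable_fun S (fun z => (2^-1 * (m - z.1) ^+ 2 + 2^-1 * (m - r1 u z) ^+ 2)%:E) by exact/measurable_EFinP.
have EG0 z : S z -> (0 <= (2^-1 * (r1 u z - z.1) ^+ 2 + (aff c m n z - u z))%:E)%E by move=> Sz; rewrite lee_fin G0.
have EF0 z : S z -> (0 <= (2^-1 * (m - z.1) ^+ 2 + 2^-1 * (m - r1 u z) ^+ 2)%:E)%E by move=> Sz; rewrite lee_fin F0.
rewrite (I2_rows mS mF F0) (I2_rows mS mG G0).
pose k : R := Y * (2 * e).
have k0 : 0 <= k by rewrite /k !mulr_ge0.
pose ku (t : R) : \bar R := ((cst k%:E) \_ U) t.
have ku0 t : (0 <= ku t)%E by rewrite /ku patchE; case: ifP => // _; rewrite lee_fin.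
have mku : measurable_fun setT ku by apply/(measurable_restrictT _ _).1.
have -> : ((Y * (2 * e))%:E * (@lebesgue_measure R) U = \int[@lebesgue_measure R]_t ku t)%E.
  by rewrite -integral_mkcond integral_cst.
rewrite -ge0_integralD //; last 2 first.
- by move=> t _; apply: integral_ge0 => s Ss; exact: (EG0 (s, t)).
- exact: (rows_measurable mS mEG EG0).
apply: ge0_le_integral => //.
- by move=> t _; apply: integral_ge0 => s Ss; exact: (EF0 (s, t)).
- exact: (rows_measurable mS mEF EF0).
- by apply: emeasurable_funD => //; exact: (rows_measurable mS mEG EG0).
move=> t _; have [E0|/set0P J0] := eqVneq (row S t) set0.
  by rewrite !E0 !integral_set0 add0e.
have oJ := row_open (t := t) oS; have iJ := row_itv (t := t) cS.
have oI := row_open (t := t) oA; have iI := row_itv (t := t) cA.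
have cg := row_cvx (t := t) cu.
have JI : row S t `<=` row A t by move=> s; exact: SA.
have affE s : aff c m n (s, t) = (c + n * t) + m * s by rewrite /aff /=; ring.
have step kap : 0 <= kap ->
  (forall a b, row S t a -> row S t b -> a <= b -> exists a' b', [/\ row S t a', row S t b', a' <= a, b <= b' &
     ((c + n * t) + m * a' - u (a', t)) + ((c + n * t) + m * b' - u (b', t)) <= kap]) ->
  (\int[@lebesgue_measure R]_(s in row S t) (2^-1 * (m - (s, t).1) ^+ 2 + 2^-1 * (m - r1 u (s, t)) ^+ 2)%:E <=
   \int[@lebesgue_measure R]_(s in row S t) (2^-1 * (r1 u (s, t) - (s, t).1) ^+ 2 + (aff c m n (s, t) - u (s, t)))%:E
    + (Y * kap)%:E)%E.
  move=> kap0 ends; under [X in (_ <= X + _)%E]eq_integral do rewrite affE.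
  apply: (@chord_ineq R (row A t) (row S t) (fun s => u (s, t)) m (c + n * t) X Y kap) => //.
  - by move=> s As; exact: (hX (s, t)).
  - by move=> s As; exact: (hY (s, t)).
  - by move=> s Ss; have := q0 (s, t) Ss; rewrite affE.
have [Ut|Ut] := pselect (U t).
  rewrite /ku patchE mem_set //; apply: step => [|a b Ja Jb _]; first by rewrite mulr_ge0.
  exists a, b; split => //; have := he _ Ja; have := he _ Jb; rewrite !affE; plra.
rewrite /ku patchE memNset // adde0; apply/lee_addgt0Pr => d d0.
have kp0 : 0 < d / (Y + 1) by rewrite divr_gt0 //; plra.
apply: (@le_trans _ _ (\int[@lebesgue_measure R]_(s in row S t) (2^-1 * (r1 u (s, t) - (s, t).1) ^+ 2 + (aff c m n (s, t) - u (s, t)))%:E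
    + (Y * (d / (Y + 1)))%:E)%E); last first.
  by apply: leeD2l; rewrite lee_fin mulrCA ler_piMr ?(ltW d0) // ler_pdivrMr; plra.
apply: step => [|a b Ja Jb ab]; first exact: ltW.
have bdJ s : row S t s -> `|s| <= X by move=> /JI As; exact: (hX (s, t)).
have sJ : has_sup (row S t) by split => //; exists X => s /bdJ; rewrite ler_norml => /andP[].
have lJ : has_inf (row S t) by split => //; exists (- X) => s /bdJ; rewrite ler_norml => /andP[].
have clS x : (forall d, 0 < d -> exists2 s, row S t s & `|x - s| < d) -> closure S (x, t).
  move=> h B /nbhs_ballP[r /= r0 hB]; have [s Ss xs] := h _ r0.
  by exists (s, t); split => //; apply: hB; split => //=; exact: ballxx.
have Asup : A (sup (row S t), t).
  apply: hU => //; apply: clS => r r0; have [s Ss hs] := sup_adherent r0 sJ; exists s => //.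
  have := sup_upper_bound sJ Ss => h; rewrite ger0_norm ?subr_ge0 //; plra.
have Ainf : A (inf (row S t), t).
  apply: hU => //; apply: clS => r r0; have [s Ss hs] := inf_adherent r0 lJ; exists s => //.
  have h : inf (row S t) <= s by apply: ge_inf => //; case: lJ.
  by rewrite distrC ger0_norm ?subr_ge0 //; plra.
have contq x : row A t x -> {for x, continuous (fun s => c + n * t + m * s - u (s, t))}.
  move=> Ax; apply: cvgB; last exact: (cvx1_continuous oI iI cg Ax).
  by apply: cvgD; [exact: cvg_cst|apply: cvgM; [exact: cvg_cst|exact: cvg_id]].
have nsup : row S t (sup (row S t)) -> False.
  move=> h; have /nbhs_ballP[r /= r0 hr] := (oJ : open (row S t)) _ h.
  have : row S t (sup (row S t) + r / 2).
    by apply: hr; rewrite /ball /= opprD addrA subrr sub0r normrN gtr0_norm; plra.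
  by move/(sup_upper_bound sJ); plra.
have ninf : row S t (inf (row S t)) -> False.
  move=> h; have /nbhs_ballP[r /= r0 hr] := (oJ : open (row S t)) _ h.
  have : row S t (inf (row S t) - r / 2).
    by apply: hr; rewrite /ball /= opprB addrCA subrr addr0 gtr0_norm; plra.
  by move=> h2; have : inf (row S t) <= inf (row S t) - r / 2 by [apply: ge_inf => //; case: lJ]; plra.
have qn x : row A t x -> (row S t x -> False) -> c + n * t + m * x - u (x, t) <= 0.
  by move=> Ax nS; rewrite leNgt; apply/negP => h; apply: nS; split => //; rewrite -subr_gt0 affE.
have kp2 : 0 < d / (Y + 1) / 2 by plra.
have [b' [Jb' bb' qb]] := right_end oJ sJ nsup (contq _ Asup) (qn _ Asup nsup) Jb kp2 iJ.
have [a' [Ja' aa' qa]] := left_end oJ lJ ninf (contq _ Ainf) (qn _ Ainf ninf) Ja kp2 iJ.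
by exists a', b'; split => //; plra.
Qed.

(** The difference c + m x - g drops by at least 3 e / 8 over an interval of length at most W, so
    the Cauchy-Schwarz inequality bounds its derivative in L^2 from below. *)
Lemma row_lower (R : realType) (I J : set R) (g : R -> R) (m c a b e W : R) :
  open I -> is_interval I -> cvx1 I g -> measurable J -> is_interval J -> J `<=` I -> J a -> J b -> a <= b ->
  b - a <= W -> 0 < W -> 0 < e -> e / 2 <= c + m * a - g a -> c + m * b - g b <= e / 8 ->
  ((e ^+ 2 / (16 * W))%:E <= \int[@lebesgue_measure R]_(x in J) (2^-1 * (m - rd g x) ^+ 2)%:E)%E.
Proof.
move=> oI iI cg mJ iJ JI Ja Jb ab abW W0 e0 qa qb.
have mrd : measurable_fun J (rd g).
  by apply: (interval_mono_measurable iJ) => x y Jx Jy xy; apply: (rd_mono oI iI cg) => //; exact: JI.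
have oc : `]a, b]%classic `<=` J.
  by move=> x /=; rewrite in_itv /= => /andP[ax xb]; apply: (iJ a b) => //; rewrite xb ltW.
pose F x := 2^-1 * (m - rd g x) ^+ 2.
have mF : measurable_fun J F by apply: measurable_funM => //; apply: measurable_funX; apply: measurable_funB.
have F0 x : 0 <= F x by rewrite /F; nneg.
apply: (@le_trans _ _ (\int[@lebesgue_measure R]_(x in `]a, b]) (F x)%:E)%E); last first.
  apply: ge0_subset_integral => //; [by apply/measurable_EFinP|by move=> x _; rewrite lee_fin; exact: F0].
have [ir Er] := rd_FTC oI iI cg (JI _ Ja) (JI _ Jb) ab.
have cl : cvx1 I (fun x => c + m * x) by move=> x y z _ _ _ _; rewrite le_eqVlt; apply/orP; left; apply/eqP; ring.
have [il El] := rd_FTC oI iI cl (JI _ Ja) (JI _ Jb) ab.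
have [B B0 hB] := rd_bounded_oc oI iI cg (JI _ Ja) (JI _ Jb) ab.
have iF : (@lebesgue_measure R).-integrable `]a, b] (EFin \o F).
  apply: (@bounded_integrable_oc _ _ _ _ (2^-1 * (`|m| + B) ^+ 2)); first exact: measurable_funS mF.
  move=> x xab; rewrite ger0_norm // ler_pM2l ?invr_gt0 //; apply: sqr_le_abs.
  by apply: le_trans (ler_normB _ _) _; rewrite lerD2l; exact: hB.
(* The Cauchy-Schwarz inequality in linearized form, y ^ 2 / 2 >= k y - k ^ 2 / 2, with k the mean
   slope of a drop by 3 e / 8 over the length W. *)
pose k : R := 3 * e / (8 * W).
have k0 : 0 < k by rewrite /k divr_gt0 ?mulr_gt0.
pose G x : R := k * (rd g x - rd (fun y => c + m * y) x) - 2^-1 * k ^+ 2.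
have i1 : (@lebesgue_measure R).-integrable `]a, b] (EFin \o (fun x => rd g x - rd (fun y => c + m * y) x)).
  by apply: eq_integrable (integrableB _ ir il).
have i2 : (@lebesgue_measure R).-integrable `]a, b] (EFin \o (fun x => k * (rd g x - rd (fun y => c + m * y) x))).
  by apply: eq_integrable (integrableZl _ k i1).
have i3 : (@lebesgue_measure R).-integrable `]a, b] (EFin \o cst (2^-1 * k ^+ 2)).
  by apply: (@bounded_integrable_oc _ _ _ _ `|2^-1 * k ^+ 2|) => // x _.
have iG : (@lebesgue_measure R).-integrable `]a, b] (EFin \o G).
  by apply: eq_integrable (integrableB _ i2 i3).
apply: (@le_trans _ _ (\int[@lebesgue_measure R]_(x in `]a, b]) (G x)%:E)%E); last first.
  apply: le_integral => // x _; rewrite lee_fin /G /F rd_aff -subr_ge0.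
  rewrite (_ : _ - _ = 2^-1 * (m - rd g x + k) ^+ 2); last by field.
  by nneg.
rewrite -(fineK (integrable_fin_num _ iG)) // lee_fin.
rewrite (_ : fine _ = \int[@lebesgue_measure R]_(x in `]a, b]) G x) // RintegralB // RintegralZl //.
have Em : (@lebesgue_measure R) `]a, b]%classic = (b - a)%:E.
  rewrite lebesgue_measure_itv /= lte_fin; case: ltP => // ba.
  by rewrite (_ : b = a) ?subrr //; apply/eqP; rewrite eq_le ba.
have Ec : \int[@lebesgue_measure R]_(x in `]a, b]) (2^-1 * k ^+ 2) = 2^-1 * k ^+ 2 * (b - a).
  by rewrite Rintegral_cst //; congr (_ * _); exact: (congr1 fine Em).
rewrite RintegralB // Er El Ec.
have h1 : k * (3 * e / 8) <= k * (g b - g a - (c + m * b - (c + m * a))).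
  by rewrite ler_wpM2l ?(ltW k0) //; plra.
have h2 : 2^-1 * k ^+ 2 * (b - a) <= 2^-1 * k ^+ 2 * W by rewrite ler_wpM2l //; nneg.
have h3 : k * (3 * e / 8) - 2^-1 * k ^+ 2 * W = 9 / 8 * (e ^+ 2 / (16 * W)).
  by rewrite /k; field; rewrite gt_eqF.
have h4 : 0 <= e ^+ 2 / (16 * W) by nneg.
clear - h1 h2 h3 h4; lra.
Qed.

Lemma I2_fin (R : realType) (A S : set (R * R)) (f : R * R -> R) (X c : R) :
  open A -> (forall z, A z -> `|z.1| <= X /\ `|z.2| <= X) -> measurable S -> S `<=` A -> measurable_fun S f ->
  (forall z, S z -> 0 <= f z) -> (forall z, S z -> f z <= c) -> exists2 r : R, 0 <= r & I2 S f = r%:E.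
Proof.
move=> oA hX mS SA mf f0 fc; have mA := open_measurable2 oA.
have hm := I2_1_fin mA hX.
suff h : I2 S f \is a fin_num.
  by exists (fine (I2 S f)); rewrite ?fine_ge0 ?I2_ge0 ?fineK.
rewrite ge0_fin_numE; last exact: I2_ge0.
apply: (@le_lt_trans _ _ (`|c|%:E * I2 S (fun=> 1%R))%E).
  rewrite -I2Z //; apply: I2_le => // z Sz; rewrite mulr1; apply: le_trans (fc _ Sz) (ler_norm _).
apply: (@le_lt_trans _ _ (`|c|%:E * I2 A (fun=> 1%R))%E).
  by apply: lee_wpmul2l; [rewrite lee_fin|apply: I2_subset].
by rewrite -(fineK hm) -EFinM ltry.
Qed.

Lemma cols_chord (R : realType) (A : set (R * R)) (u : R * R -> R) (c m n X Y e : R) (U : set R) :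
  open A -> cset2 A -> inK A u -> (forall z, A z -> `|z.2| <= X) -> (forall z, A z -> `|n - z.2| <= Y) ->
  0 <= Y -> 0 <= e -> (forall z, under A u (aff c m n) z -> aff c m n z - u z <= e) ->
  measurable U -> (forall z, closure (under A u (aff c m n)) z -> ~ U z.1 -> A z) ->
  (I2 (under A u (aff c m n)) (fun z => 2^-1 * (n - z.2) ^+ 2 + 2^-1 * (n - r2 u z) ^+ 2)%R <=
   I2 (under A u (aff c m n)) (fun z => 2^-1 * (r2 u z - z.2) ^+ 2 + (aff c m n z - u z))%R +
    (Y * (2 * e))%:E * (@lebesgue_measure R) U)%E.
Proof.
move=> oA cA Ku hX hY Y0 e0 he mU hU.
have [cu u0] := Ku.
have [oA' cA' [cu' _] _] := En_swap oA cA Ku.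
set S := under A u _ in he hU *.
have oS : open S by exact: under_open.
have cS : cset2 S by exact: under_cset2.
have mS := open_measurable2 oS.
have SA : S `<=` A by move=> z [].
have cuS : cvx2 S u by move=> x y t /SA Ax /SA Ay; exact: cu.
have mA := open_measurable2 oA.
have [_ mr _ _] := partials_measurable oA cA cu.
have mrS : measurable_fun S (r2 u) by exact: measurable_funS mr.
have muS := cvx2_measurable oS cS cuS.
have maS := cvx2_measurable oS cS (@aff_cvx2 R S c m n).
rewrite (I2_swap mS); last 2 first.
- apply: measurable_funD; apply: measurable_funM => //; apply: measurable_funX; apply: measurable_funB => //.
  exact: measurable_funTS.
- by move=> z _; nneg.
rewrite [in X in (_ <= X + _)%E](I2_swap mS); last 2 first.
- apply: measurable_funD; last exact: measurable_funB.
  apply: measurable_funM => //; apply: measurable_funX; apply: measurable_funB => //; exact: measurable_funTS.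
- by move=> z [_ h]; apply: addr_ge0; [nneg|rewrite subr_ge0 ltW].
have affE z : aff c m n (swp z) = aff c n m z by rewrite /aff /swp /=; ring.
have SE : [set z | S (swp z)] = under [set z | A (swp z)] (fun z => u (swp z)) (aff c n m).
  by apply/seteqP; split=> z [h1 h2]; split => //; move: h2; rewrite affE.
have := @rows_chord R [set z | A (swp z)] (fun z => u (swp z)) c n m X Y e U oA' cA' cu'.
rewrite -SE => h; under [X in (_ <= X + _)%E]eq_integral do rewrite affE.
apply: h => //.
- by move=> z /hX.
- by move=> z /hY.
- by move=> z /he; rewrite affE.
move=> z cz nU; apply: (hU (swp z)) => // B /nbhs_ballP[r /= r0 hB].
have [y [Sy [/= y1 y2]]] := cz _ (nbhsx_ballx z _ r0).
by exists (swp y); split => //; apply: hB; split.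
Qed.

(** In the sum of the estimates for rows and columns and the comparison of u with the maximum V of u
    and the affine function, the terms in u and the squares of m - z.1 and n - z.2 cancel. Each of
    the three inequalities contributes one [qI]. *)
Lemma raise_upper (R : realType) (A : set (R * R)) (u : R * R -> R) (c m n X Y e d1 d2 qI : R) (U1 U2 : set R) :
  open A -> cset2 A -> (forall z, A z -> `|z.1| <= X /\ `|z.2| <= X) ->
  inK A u -> En A u \is a fin_num -> (forall f, inK A f -> (En A u <= En A f)%E) ->
  (forall z, A z -> `|m - z.1| <= Y) -> (forall z, A z -> `|n - z.2| <= Y) -> 0 <= Y -> 0 <= e ->
  (forall z, under A u (aff c m n) z -> aff c m n z - u z <= e) ->
  measurable U1 -> (forall z, closure (under A u (aff c m n)) z -> ~ U1 z.2 -> A z) ->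
  measurable U2 -> (forall z, closure (under A u (aff c m n)) z -> ~ U2 z.1 -> A z) ->
  (@lebesgue_measure R) U1 = d1%:E -> (@lebesgue_measure R) U2 = d2%:E ->
  I2 (under A u (aff c m n)) (fun z => aff c m n z - u z) = qI%:E ->
  (I2 (under A u (aff c m n)) (fun z => 2^-1 * (m - r1 u z) ^+ 2)%R <= (3 * qI + Y * (2 * e) * (d1 + d2))%:E)%E.
Proof.
move=> oA cA hX Ku fu mu hY1 hY2 Y0 e0 he mU1 hU1 mU2 hU2 m1 m2 hq.
have [cu u0] := Ku.
have R1 := rows_chord oA cA cu (fun z Az => proj1 (hX z Az)) hY1 Y0 e0 he mU1 hU1.
have R2 := cols_chord oA cA Ku (fun z Az => proj2 (hX z Az)) hY2 Y0 e0 he mU2 hU2.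
set S := under A u _ in he hU1 hU2 hq R1 R2 *.
have oS : open S by exact: under_open.
have cS : cset2 S by exact: under_cset2.
have mS := open_measurable2 oS; have mA := open_measurable2 oA.
have SA : S `<=` A by move=> z [].
have cuS : cvx2 S u by move=> x y t /SA Ax /SA Ay; exact: cu.
have [mr1 mr2 _ _] := partials_measurable oA cA cu.
have mr1S : measurable_fun S (r1 u) by exact: measurable_funS mr1.
have mr2S : measurable_fun S (r2 u) by exact: measurable_funS mr2.
have muS := cvx2_measurable oS cS cuS.
have maS := cvx2_measurable oS cS (@aff_cvx2 R S c m n).
have mf1 : measurable_fun S fst by exact: measurable_funTS.
have mf2 : measurable_fun S snd by exact: measurable_funTS.
have ms (f g : R * R -> R) : measurable_fun S f -> measurable_fun S g ->
    measurable_fun S (fun z => 2^-1 * (f z - g z) ^+ 2).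
  by move=> mf mg; apply: measurable_funM => //; apply: measurable_funX; apply: measurable_funB.
have mc (k : R) : measurable_fun S (cst k) by [].
have mq : measurable_fun S (fun z => aff c m n z - u z) by exact: measurable_funB.
have q0 z : S z -> 0 <= aff c m n z - u z by move=> [_ h]; rewrite subr_ge0 ltW.
have sq0 (x : R) : 0 <= 2^-1 * x ^+ 2 by nneg.
pose V z := Num.max (u z) (aff c m n z).
have cV : cvx2 A V by apply: max_cvx2 => //; exact: aff_cvx2.
have KV : inK A V by split => // z Az; rewrite /V le_max u0.
have uV z : A z -> u z <= V z by move=> _; rewrite /V le_max lexx.
have VS z : S z -> V z = aff c m n z by move=> [_ h]; rewrite /V; case: ltP h => // h1 h2; have := lt_le_trans h2 h1; rewrite ltxx.
have VnS z : A z -> ~ S z -> u z = V z.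
  by move=> Az nS; rewrite /V; case: ltP => // h; exfalso; apply: nS.
have cmp := compare_above oA cA Ku fu mu KV uV mS SA VnS.
have ra z : r1 (aff c m n) z = m /\ r2 (aff c m n) z = n.
  split; rewrite /r1 /r2 /aff /=.
    by rewrite (_ : (fun s => _) = fun s => (c + n * z.2) + m * s) ?rd_aff //; apply/funext => s; ring.
  by rewrite rd_aff.
have dV z : S z -> den V z = (2^-1 * (m - z.1) ^+ 2 + 2^-1 * (n - z.2) ^+ 2) + (u z + (aff c m n z - u z)).
  move=> Sz; have [E1 E2] := r_loc oA cA (@aff_cvx2 R A c m n) (SA _ Sz) oS Sz (fun z _ Sz => VS z Sz).
  by rewrite /den E1 E2 (proj1 (ra z)) (proj2 (ra z)) (VS z Sz); ring.
have du z : S z -> den u z = (2^-1 * (r1 u z - z.1) ^+ 2 + 2^-1 * (r2 u z - z.2) ^+ 2) + u z.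
  by move=> _; rewrite /den; ring.
have u0S z : S z -> 0 <= u z by move=> /SA; exact: u0.
have mdu : measurable_fun S (den u) by apply: measurable_funS (den_measurable oA cA cu).
have fden : (I2 S (den u) < +oo)%E.
  apply: le_lt_trans (_ : (En A u < +oo)%E); last by rewrite -ge0_fin_numE ?En_ge0.
  by apply: I2_subset => //; [exact: den_measurable|move=> z Az; rewrite den_ge0 ?u0].
have fin (f : R * R -> R) : measurable_fun S f -> (forall z, S z -> 0 <= f z) -> (forall z, S z -> f z <= den u z) ->
    exists r : R, I2 S f = r%:E.
  move=> mf f0 fd; exists (fine (I2 S f)); rewrite fineK // ge0_fin_numE ?I2_ge0 //.
  by apply: le_lt_trans fden; exact: I2_le.
have [a1 E1] : exists r : R, I2 S (fun z => 2^-1 * (r1 u z - z.1) ^+ 2) = r%:E.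
  by apply: fin => [||z Sz]; [exact: ms|move=> z _; exact: sq0|rewrite du // -addrA lerDl addr_ge0 ?u0S].
have [a2 E2] : exists r : R, I2 S (fun z => 2^-1 * (r2 u z - z.2) ^+ 2) = r%:E.
  by apply: fin => [||z Sz]; [exact: ms|move=> z _; exact: sq0|rewrite du // addrAC lerDr addr_ge0 ?u0S].
have [a3 E3] : exists r : R, I2 S u = r%:E.
  by apply: fin => // z Sz; rewrite du // lerDr addr_ge0.
have Ysq (x : R) : `|x| <= Y -> 2^-1 * x ^+ 2 <= Y ^+ 2.
  move=> /sqr_le_abs h; apply: le_trans h; rewrite ler_piMl ?sqr_ge0 // invf_le1 // ?ler1n //.
have [b1 _ F1] := @I2_fin R A S (fun z => 2^-1 * (m - z.1) ^+ 2) X (Y ^+ 2) oA hX mS SA (ms _ _ (mc m) mf1)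
  (fun z _ => sq0 _) (fun z Sz => Ysq _ (hY1 _ (SA _ Sz))).
have [b2 _ F2] := @I2_fin R A S (fun z => 2^-1 * (n - z.2) ^+ 2) X (Y ^+ 2) oA hX mS SA (ms _ _ (mc n) mf2)
  (fun z _ => sq0 _) (fun z Sz => Ysq _ (hY2 _ (SA _ Sz))).
have D f g (mf : measurable_fun S f) (mg : measurable_fun S g) f0 g0 := @I2D R S f g mS mf mg f0 g0.
move: R1 R2 cmp; rewrite m1 m2 (I2_ext du) (I2_ext dV).
rewrite (D _ _ (ms _ _ (mc m) mf1) (ms _ _ (mc m) mr1S)); [|by move=> z _; exact: sq0|by move=> z _; exact: sq0].
rewrite (D _ _ (ms _ _ (mc n) mf2) (ms _ _ (mc n) mr2S)); [|by move=> z _; exact: sq0|by move=> z _; exact: sq0].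
rewrite (D _ _ (ms _ _ mr1S mf1) mq); [|by move=> z _; exact: sq0|exact: q0].
rewrite (D _ _ (ms _ _ mr2S mf2) mq); [|by move=> z _; exact: sq0|exact: q0].
have mDu := measurable_funD (ms _ _ mr1S mf1) (ms _ _ mr2S mf2).
have mL := measurable_funD (ms _ _ (mc m) mf1) (ms _ _ (mc n) mf2).
rewrite (D _ _ mDu muS); [|by move=> z _; exact: addr_ge0|exact: u0S].
rewrite (D _ _ (ms _ _ mr1S mf1) (ms _ _ mr2S mf2)); [|by move=> z _; exact: sq0|by move=> z _; exact: sq0].
rewrite (D _ _ mL (measurable_funD muS mq)); [|by move=> z _; exact: addr_ge0|by move=> z Sz; rewrite addr_ge0 ?u0S ?q0].
rewrite (D _ _ (ms _ _ (mc m) mf1) (ms _ _ (mc n) mf2)); [|by move=> z _; exact: sq0|by move=> z _; exact: sq0].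
rewrite (D _ _ muS mq); [|exact: u0S|exact: q0].
rewrite E1 E2 E3 F1 F2 hq.
set k1 := I2 S _; set k2 := I2 S _.
have k10 : (0 <= k1)%E by apply: I2_ge0 => z _; exact: sq0.
have k20 : (0 <= k2)%E by apply: I2_ge0 => z _; exact: sq0.
move: k1 k2 k10 k20 => [k1| |] [k2| |] //; rewrite -?EFinM -?EFinD ?lee_fin //= => *; plra.
Qed.

Lemma width_measure (R : realType) (J : set R) (W : R) :
  measurable J -> (forall s s', J s -> J s' -> s' - s <= W) -> 0 <= W -> ((@lebesgue_measure R) J <= W%:E)%E.
Proof.
move=> mJ hW W0; have [->|/set0P J0] := eqVneq J set0; first by rewrite measure0 lee_fin.
have lJ : has_lbound J by case: J0 => b Jb; exists (b - W) => s /hW/(_ Jb); plra.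
have hJ : has_inf J by [].
apply: (@le_trans _ _ ((@lebesgue_measure R) `[inf J, inf J + W]%classic)).
  apply: le_measure; rewrite ?inE //.
  move=> s Js /=; rewrite in_itv /= ge_inf //= leNgt; apply/negP => h.
  have [j Jj hj] := inf_adherent (eps := s - W - inf J) ltac:(plra) hJ.
  by have := hW _ _ Jj Js; plra.
by rewrite lebesgue_measure_itv /= lte_fin; case: ifP => _; rewrite -?EFinB lee_fin //; plra.
Qed.

Lemma row_right_end (R : realType) (A : set (R * R)) (u : R * R -> R) (c m n X t b kap : R) :
  open A -> cset2 A -> cvx2 A u -> (forall z, A z -> `|z.1| <= X) ->
  (forall z, closure (under A u (aff c m n)) z -> z.2 = t -> A z) ->
  under A u (aff c m n) (b, t) -> 0 < kap ->
  exists b', [/\ under A u (aff c m n) (b', t), b <= b' & aff c m n (b', t) - u (b', t) <= kap].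
Proof.
move=> oA cA cu hX hU Sb k0; set S := under A u _ in hU Sb *.
have oS : open S by exact: under_open.
have cS : cset2 S by exact: under_cset2.
have oJ := row_open (t := t) oS; have iJ := row_itv (t := t) cS.
have sJ : has_sup (row S t).
  by split; [exists b|exists X => s [/hX/ler_normlP[_]]].
have nsup : row S t (sup (row S t)) -> False.
  move=> h; have /nbhs_ballP[r /= r0 hr] := (oJ : open (row S t)) _ h.
  have : row S t (sup (row S t) + r / 2).
    by apply: hr; rewrite /ball /= opprD addrA subrr sub0r normrN gtr0_norm; plra.
  by move/(sup_upper_bound sJ); plra.
have Asup : A (sup (row S t), t).
  apply: hU => // B /nbhs_ballP[r /= r0 hB]; have [s Ss hs] := sup_adherent r0 sJ.
  exists (s, t); split => //; apply: hB; split => //=; last exact: ballxx.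
  by have := sup_upper_bound sJ Ss => h; rewrite /ball /= ger0_norm ?subr_ge0 //; plra.
apply: (@right_end R (row S t) (fun s => aff c m n (s, t) - u (s, t))) => //.
- apply: cvgB; last exact: (cvx1_continuous (row_open oA) (row_itv cA) (row_cvx cu) Asup).
  rewrite /aff /=; apply: cvgD; last exact: cvg_cst.
  by apply: cvgD; [exact: cvg_cst|apply: cvgM; [exact: cvg_cst|exact: cvg_id]].
by rewrite leNgt; apply/negP => h; apply: nsup; split => //; rewrite -subr_gt0.
Qed.

(* [q = aff c m n - u] is concave on the section [S] with maximum [e], so the rows through the middle half of
   the projection of [S] contain points with [e / 2 <= q]; off [U1] they also reach [q = 0]. *)
Lemma section_ineq (R : realType) (A : set (R * R)) (u : R * R -> R) (c m n X Y e d1 d2 W : R)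
    (U1 U2 : set R) (x0 : R * R) :
  open A -> cset2 A -> (forall z, A z -> `|z.1| <= X /\ `|z.2| <= X) ->
  inK A u -> En A u \is a fin_num -> (forall f, inK A f -> (En A u <= En A f)%E) ->
  (forall z, A z -> `|m - z.1| <= Y) -> (forall z, A z -> `|n - z.2| <= Y) -> 0 <= Y -> 0 < e ->
  (forall z, under A u (aff c m n) z -> aff c m n z - u z <= e) ->
  measurable U1 -> (forall z, closure (under A u (aff c m n)) z -> ~ U1 z.2 -> A z) ->
  measurable U2 -> (forall z, closure (under A u (aff c m n)) z -> ~ U2 z.1 -> A z) ->
  (@lebesgue_measure R) U1 = d1%:E -> (@lebesgue_measure R) U2 = d2%:E ->
  0 < W -> (forall s s' t, under A u (aff c m n) (s, t) -> under A u (aff c m n) (s', t) -> s' - s <= W) ->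
  A x0 -> aff c m n x0 - u x0 = e ->
  exists al be, [/\ al < be, forall z, under A u (aff c m n) z -> al <= z.2 <= be &
    e ^+ 2 / (16 * W) * ((be - al) / 2 - d1) <= 3 * (e * W * (be - al)) + Y * (2 * e) * (d1 + d2)].
Proof.
move=> oA cA hX Ku fu mu hY1 hY2 Y0 e0 he mU1 hU1 mU2 hU2 m1 m2 W0 hW A0 q0.
have [cu u0] := Ku.
have RU qI := @raise_upper R A u c m n X Y e d1 d2 qI U1 U2 oA cA hX Ku fu mu hY1 hY2 Y0 (ltW e0) he mU1 hU1 mU2 hU2 m1 m2.
have SA : under A u (aff c m n) `<=` A by move=> z [].
have Sx0 : under A u (aff c m n) x0 by split => //; rewrite -subr_gt0 q0.
have rend b t := @row_right_end R A u c m n X t b (e / 8) oA cA cu (fun z Az => proj1 (hX z Az)).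
set S := under A u _ in RU he hU1 hU2 hW SA Sx0 rend *.
have oS : open S by exact: under_open.
have cS : cset2 S by exact: under_cset2.
have mS := open_measurable2 oS; have mA := open_measurable2 oA.
have cuS : cvx2 S u by move=> x y t /SA Ax /SA Ay; exact: cu.
have muS := cvx2_measurable oS cS cuS.
have maS := cvx2_measurable oS cS (@aff_cvx2 R S c m n).
have [mr1 _ _ _] := partials_measurable oA cA cu.
have mr1S : measurable_fun S (r1 u) by exact: measurable_funS mr1.
have mq : measurable_fun S (fun z => aff c m n z - u z) by exact: measurable_funB.
have qp z : S z -> 0 <= aff c m n z - u z by move=> [_ h]; rewrite subr_ge0 ltW.
pose T : set R := [set t | exists s, S (s, t)].
have Tx0 : T x0.2 by exists x0.1; rewrite -surjective_pairing.
have sT : has_sup T by split; [exists x0.2|exists X => t [s /SA/hX[_ /ler_normlP[_]]]].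
have lT : has_inf T.
  by split; [exists x0.2|exists (- X) => t [s /SA/hX[_ /ler_normlP[]]] /=; rewrite lerNl].
pose al := inf T; pose be := sup T.
have Tal t : T t -> al <= t by move=> Tt; apply: ge_inf => //; exact: (proj2 lT).
have Tbe t : T t -> t <= be by exact: sup_upper_bound.
have iT t t' s : T t -> T t' -> t <= s -> s <= t' -> T s.
  move=> [x Sx] [x' Sx'] ts st'; have [E|tt] := eqVneq t t'.
    by exists x; rewrite (_ : s = t) //; apply/eqP; rewrite eq_le ts andbT E.
  have tt' : t < t' by rewrite lt_neqAle tt; apply: le_trans ts st'.
  have := cS _ _ ((s - t) / (t' - t)) Sx Sx' => /(_ _ _)/=; rewrite divr_ge0; [|plra|plra].
  rewrite ler_pdivrMr ?subr_gt0 // mul1r lerD2r st' => /(_ isT isT) h.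
  by exists (x + (s - t) / (t' - t) * (x' - x)); move: h; rewrite mulfVK ?gt_eqF ?subr_gt0 // (addrC t) subrK.
have alb : al < be.
  have [r r0 hr] := open_square oS Sx0.
  have Tr : T (x0.2 + r).
    by exists x0.1; apply: hr => /=; rewrite ?subrr ?normr0 ?(ltW r0) // addrAC subrr add0r gtr0_norm.
  by have := Tbe _ Tr; have := Tal _ Tx0; plra.
exists al, be; split => // [z Sz|].
  by have Tz : T z.2 by [exists z.1; rewrite -surjective_pairing]; rewrite Tal ?Tbe.
have [qI qI0 EI] := @I2_fin R A S (fun z => aff c m n z - u z) X e oA hX mS SA mq qp he.
have {}RU := RU _ EI.
have mqE : measurable_fun S (fun z => (aff c m n z - u z)%:E) by exact/measurable_EFinP.
have qpE z : S z -> (0 <= (aff c m n z - u z)%:E)%E by move=> Sz; rewrite lee_fin qp.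
have upper : qI <= e * W * (be - al).
  rewrite -lee_fin -EI (I2_rows mS mq qp).
  apply: (@le_trans _ _ (\int[@lebesgue_measure R]_t ((cst (e * W)%:E) \_ `[al, be]) t)%E).
    apply: ge0_le_integral => //.
    - by move=> t _; apply: integral_ge0 => s Ss; exact: (qpE (s, t)).
    - exact: (rows_measurable mS mqE qpE).
    - by apply/(measurable_restrictT _ _).1.
    move=> t _; have [E0|/set0P[s0 Ss0]] := eqVneq (row S t) set0.
      by rewrite E0 integral_set0 patchE; case: ifP => // _; rewrite lee_fin mulr_ge0 // ltW.
    have Tt : T t by exists s0.
    rewrite patchE mem_set /=; last by rewrite in_itv /= Tal ?Tbe.
    have mJ : measurable (row S t) by apply: open_measurable; exact: row_open.
    apply: (@le_trans _ _ (\int[@lebesgue_measure R]_(s in row S t) (cst e%:E s))%E).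
      apply: ge0_le_integral => //.
      + by move=> s Ss; exact: (qpE (s, t)).
      + exact: (@row_measurable_fun R S (fun z => (aff c m n z - u z)%:E) t mS mqE).
      + by move=> s Ss; rewrite lee_fin; exact: he.
    rewrite integral_cst // EFinM; apply: lee_wpmul2l; first by rewrite lee_fin ltW.
    by apply: width_measure => //; [move=> s s' h1 h2; exact: (hW _ _ t)|exact: ltW].
  have Em : (@lebesgue_measure R) `[al, be]%classic = (be - al)%:E.
    by rewrite lebesgue_measure_itv /= lte_fin alb -EFinB.
  apply: (@le_trans _ _ ((e * W)%:E * (@lebesgue_measure R) `[al, be]%classic)%E).
    by rewrite -integral_mkcond integral_cst.
  by rewrite Em -EFinM.
(* Heights halfway from x0.2 to the extreme heights of S, so that the interval between them has half
   the length of the projection. *)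
pose a' := (x0.2 + al) / 2; pose b' := (x0.2 + be) / 2.
pose k := e ^+ 2 / (16 * W).
have k0 : 0 <= k by rewrite /k; nneg.
have mK : measurable_fun S (fun z => 2^-1 * (m - r1 u z) ^+ 2).
  by apply: measurable_funM => //; apply: measurable_funX; apply: measurable_funB.
have mKE : measurable_fun S (fun z => (2^-1 * (m - r1 u z) ^+ 2)%:E) by exact/measurable_EFinP.
have K0 z : S z -> 0 <= 2^-1 * (m - r1 u z) ^+ 2 by move=> _; nneg.
have K0E z : S z -> (0 <= (2^-1 * (m - r1 u z) ^+ 2)%:E)%E by move=> Sz; rewrite lee_fin K0.
have mD : measurable (`]a', b'[%classic `\` U1) by exact: measurableD.
have lower : ((k * ((be - al) / 2 - d1))%:E <= I2 S (fun z => 2^-1 * (m - r1 u z) ^+ 2)%R)%E.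
  apply: (@le_trans _ _ (k%:E * (@lebesgue_measure R) (`]a', b'[%classic `\` U1))%E).
    rewrite EFinM; apply: lee_wpmul2l; first by rewrite lee_fin.
    have h : ((@lebesgue_measure R) `]a', b'[%classic <=
        (@lebesgue_measure R) (`]a', b'[%classic `\` U1) + (@lebesgue_measure R) U1)%E.
      apply: (@le_trans _ _ ((@lebesgue_measure R) ((`]a', b'[%classic `\` U1) `|` U1))); last exact: measureU2.
      apply: le_measure; rewrite ?inE //; first exact: measurableU.
      by move=> x hx; have [h|h] := pselect (U1 x); [right|left].
    rewrite EFinB leeBlDr // -m1; apply: le_trans h; rewrite lebesgue_measure_itv /= lte_fin.
    rewrite (_ : a' < b'); last by rewrite /a' /b' ltr_pM2r ?invr_gt0 // ltrD2l.
    by rewrite -EFinB lee_fin /a' /b' le_eqVlt; apply/orP; left; apply/eqP; field.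
  rewrite (I2_rows mS mK K0) -integral_cst // integral_mkcond.
  apply: ge0_le_integral => //.
  - by move=> t _; rewrite patchE; case: ifP.
  - by apply/(measurable_restrictT _ _).1.
  - exact: (rows_measurable mS mKE K0E).
  move=> t _; rewrite patchE; case: ifP => [|_]; last by apply: integral_ge0 => s Ss; exact: (K0E (s, t)).
  rewrite inE => -[/=]; rewrite in_itv /= => /andP[at1 tb1] nU.
  (* The height t is the mean of x0.2 and 2 t - x0.2, and the latter is still a height of S. The
     midpoint of x0 and a point of S at that height is the point s with half of the maximum e. *)
  have [t1 T1 h1] : exists2 t1, T t1 & t1 < 2 * t - x0.2.
    have [|t1 T1 h] := @inf_adherent R T (2 * t - x0.2 - al) _ lT; first by move: at1; rewrite /a'; plra.
    by exists t1 => //; move: h; rewrite -/al; plra.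
  have [t2 T2 h2] : exists2 t2, T t2 & 2 * t - x0.2 < t2.
    have [|t2 T2 h] := @sup_adherent R T (be - (2 * t - x0.2)) _ sT; first by move: tb1; rewrite /b'; plra.
    by exists t2 => //; move: h; rewrite -/be; plra.
  have [s1 Ss1] := iT _ _ _ T1 T2 (ltW h1) (ltW h2).
  have hh0 : (0 : R) <= 2^-1 by rewrite invr_ge0.
  have hh1 : (2^-1 : R) <= 1 by rewrite invf_le1 // ?ler1n //.
  pose s := x0.1 + 2^-1 * (s1 - x0.1).
  have Et : x0.2 + 2^-1 * (2 * t - x0.2 - x0.2) = t by field.
  have Ss : S (s, t) by have := cS _ _ _ Sx0 Ss1 hh0 hh1; rewrite /= Et.
  have qs : e / 2 <= aff c m n (s, t) - u (s, t).
    have := cu _ _ _ A0 (SA _ Ss1) hh0 hh1; rewrite /= Et -/s.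
    have := qp _ Ss1; move: q0; rewrite /aff /s /=; plra.
  have [b1 [Sb1 sb1 qb1]] : exists b1, [/\ S (b1, t), s <= b1 & aff c m n (b1, t) - u (b1, t) <= e / 8].
    by apply: rend => //; [move=> z cz zt; apply: hU1 => //; rewrite zt|plra].
  apply: (@row_lower R (row A t) (row S t) (fun s => u (s, t)) m (c + n * t) s b1 e W) => //.
  - exact: row_open.
  - exact: row_itv.
  - exact: row_cvx.
  - by apply: open_measurable; exact: row_open.
  - exact: row_itv.
  - by move=> y; exact: SA.
  - exact: (hW _ _ t).
  - by move: qs; rewrite /aff /=; plra.
  - by move: qb1; rewrite /aff /=; plra.
have := le_trans lower RU; rewrite lee_fin => h; apply: le_trans h _.
by rewrite lerD2r ler_pM2l.
Qed.

(** If z' were much farther from the row of x0 than z, then z would lie on the segment from a point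
    of this row near x0 to z', and hence in A. So two boundary points of a strip of width of order
    e, on the same side of x0, are within order e of each other. *)
Lemma bad_points (R : realType) (A : set (R * R)) (X rho del nu e : R) (x0 z z' : R * R) :
  cset2 A -> 0 < rho -> (forall y : R * R, `|y.1 - x0.1| <= rho -> `|y.2 - x0.2| <= rho -> A y) ->
  0 < del -> 0 < e -> `|z'.2 - x0.2| <= X -> closure A z' -> ~ A z ->
  `|del * (z.1 - x0.1) + nu * (z.2 - x0.2)| <= e -> `|del * (z'.1 - x0.1) + nu * (z'.2 - x0.2)| <= e ->
  0 <= (z.2 - x0.2) * (z'.2 - x0.2) -> `|z.2 - x0.2| <= `|z'.2 - x0.2| ->
  `|z.2 - z'.2| <= 4 * X / (del * rho) * e /\ `|z.1 - z'.1| <= (`|nu| * (4 * X / (del * rho)) + 2) / del * e.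
Proof.
move=> cA rho0 hA del0 e0 hX cz' nA sz sz' ss tt.
have dr0 : 0 < del * rho by rewrite mulr_gt0.
suff h : `|z.2 - z'.2| <= 4 * X / (del * rho) * e.
  split => //; rewrite mulrAC ler_pdivlMr // -(gtr0_norm del0) -normrM.
  rewrite (_ : _ * del = (del * (z.1 - x0.1) + nu * (z.2 - x0.2)) - (del * (z'.1 - x0.1) + nu * (z'.2 - x0.2)) -
    nu * (z.2 - z'.2)); last by ring.
  apply: le_trans (ler_normB _ _) _; rewrite normrM.
  have := ler_normB (del * (z.1 - x0.1) + nu * (z.2 - x0.2)) (del * (z'.1 - x0.1) + nu * (z'.2 - x0.2)).
  have : `|nu| * `|z.2 - z'.2| <= `|nu| * (4 * X / (del * rho) * e) by rewrite ler_wpM2l.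
  by move: sz sz'; rewrite (gtr0_norm del0) mulrDl mulrA; plra.
have X0 : 0 <= X by apply: le_trans hX.
have [E|ne] := eqVneq (z.2 - x0.2) (z'.2 - x0.2).
  have -> : z.2 - z'.2 = 0 by move: E; plra.
  by rewrite normr0; nneg.
have t'0 : z'.2 - x0.2 != 0.
  apply/eqP => h; move: tt ne; rewrite h normr0 normr_le0 => /eqP ->; by rewrite eqxx.
pose r := (z.2 - x0.2) / (z'.2 - x0.2).
have rE : z.2 - x0.2 = r * (z'.2 - x0.2) by rewrite /r mulfVK.
have r0 : 0 <= r.
  have -> : r = ((z.2 - x0.2) * (z'.2 - x0.2)) / (z'.2 - x0.2) ^+ 2 by rewrite /r; field.
  by rewrite divr_ge0 // sqr_ge0.
have r1 : r < 1.
  rewrite lt_neqAle; apply/andP; split.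
    by apply/eqP => h; move: ne; rewrite rE h mul1r eqxx.
  by rewrite -(ger0_norm r0) /r normrM normfV ler_pdivrMr ?normr_gt0 // mul1r.
have -> : z.2 - z'.2 = - ((1 - r) * (z'.2 - x0.2)).
  by rewrite (_ : z.2 = r * (z'.2 - x0.2) + x0.2); [ring|rewrite -rE; ring].
have r10 : 0 < 1 - r by plra.
rewrite normrN normrM (gtr0_norm r10).
have [h|h] := leP (1 - r) (4 * e / (del * rho)).
  apply: (@le_trans _ _ (4 * e / (del * rho) * X)); first by apply: ler_pM => //; exact: ltW.
  by rewrite le_eqVlt; apply/orP; left; apply/eqP; field; rewrite !gt_eqF.
exfalso; apply: nA.
pose s := del * (z.1 - x0.1) + nu * (z.2 - x0.2); pose s' := del * (z'.1 - x0.1) + nu * (z'.2 - x0.2).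
(* The line through z' and z meets the row of x0 at abscissa x0.1 + b, and r is the position of z on
   the segment from there to z'. *)
pose b := (s - r * s') / (del * (1 - r)).
have d10 : 0 < del * (1 - r) by rewrite mulr_gt0.
have bb : `|b| <= rho / 2.
  rewrite /b normrM normfV (gtr0_norm d10) ler_pdivrMr //.
  have h1 : 4 * e <= (1 - r) * (del * rho) by move: h; rewrite ltr_pdivrMr // => /ltW.
  have h2 : `|r * s'| <= e.
    rewrite normrM (ger0_norm r0); apply: le_trans (_ : 1 * `|s'| <= _); first by rewrite ler_wpM2r // ltW.
    by rewrite mul1r.
  apply: le_trans (ler_normB _ _) _; move: sz; rewrite -/s.
  rewrite (_ : rho / 2 * (del * (1 - r)) = (1 - r) * (del * rho) / 2); last by field.
  by move: h1 h2; plra.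
have hp (y : R * R) : `|y.1 - (x0.1 + b)| <= rho / 2 -> `|y.2 - x0.2| <= rho / 2 -> A y.
  move=> y1 y2; apply: hA; last by plra.
  by rewrite (_ : y.1 - x0.1 = (y.1 - (x0.1 + b)) + b); [apply: le_trans (ler_normD _ _) _; plra|ring].
have := @closure_ray R A (rho / 2) (x0.1 + b, x0.2) z' r cA ltac:(plra) hp cz' r0 r1.
rewrite /=; have <- : z.2 = x0.2 + r * (z'.2 - x0.2) by rewrite -rE; ring.
rewrite (_ : _ + _ * _ = z.1) -?surjective_pairing //.
have E1 : b * (1 - r) = (z.1 - x0.1) - r * (z'.1 - x0.1).
  have -> : (z.1 - x0.1) - r * (z'.1 - x0.1) = (s - r * s') / del.
    by rewrite /s /s' rE; field; rewrite gt_eqF.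
  by rewrite /b; field; rewrite !gt_eqF.
have -> : x0.1 + b + r * (z'.1 - (x0.1 + b)) = x0.1 + b * (1 - r) + r * (z'.1 - x0.1) by ring.
by rewrite E1; ring.
Qed.

Lemma cover2 (R : realType) (B : set (R * R)) (D : R) :
  0 <= D -> (forall z z', B z -> B z' -> `|z.2 - z'.2| <= D /\ `|z.1 - z'.1| <= D) ->
  exists U1 U2 : set R, [/\ measurable U1, measurable U2, forall z, B z -> U1 z.2 /\ U2 z.1,
    ((@lebesgue_measure R) U1 <= (2 * D)%:E)%E /\ ((@lebesgue_measure R) U2 <= (2 * D)%:E)%E &
    (forall z, ~ B z) -> U1 = set0 /\ U2 = set0].
Proof.
move=> D0 hB; have [[z0 Bz0]|nB] := pselect (exists z, B z); last first.
  exists set0, set0; split => //; first by move=> z Bz; exfalso; apply: nB; exists z.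
  by rewrite measure0 lee_fin mulr_ge0.
have m (x : R) : ((@lebesgue_measure R) `[(x - D)%R, (x + D)%R]%classic <= (2 * D)%:E)%E.
  by rewrite lebesgue_measure_itv /= lte_fin; case: ifP => _; rewrite -?EFinB lee_fin //; plra.
exists `[z0.2 - D, z0.2 + D]%classic, `[z0.1 - D, z0.1 + D]%classic; split => //; last by move=> /(_ z0).
by move=> z Bz; have [h1 h2] := hB _ _ Bz Bz0; rewrite /= !in_itv /= -!ler_distl.
Qed.

(** At a kink u exceeds the mean of two supporting planes by at least the absolute value of the
    linear function [sg], so the section cut off by this mean raised by e has width of order e. The
    left side of [section_ineq] is then of order e (be - al), against e ^ 2 (be - al) plus e times
    the measure of the heights and abscissas at which the section meets the boundary. By
    [bad_points] these measures are of order e, and if there are such points at all then be - al is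
    bounded below; a small e is contradictory. *)
Lemma no_kink1 (R : realType) (A : set (R * R)) (X : R) (u : R * R -> R) (x0 : R * R) :
  open A -> cset2 A -> (forall z, A z -> `|z.1| <= X /\ `|z.2| <= X) ->
  inK A u -> En A u \is a fin_num -> (forall f, inK A f -> (En A u <= En A f)%E) ->
  A x0 -> l1 u x0 = r1 u x0.
Proof.
move=> oA cA hX Ku fu mu A0; have [cu u0] := Ku.
have A0r : row A x0.2 x0.1 by rewrite /row /= -surjective_pairing.
have oI := row_open (t := x0.2) oA; have iI := row_itv (t := x0.2) cA; have cg := row_cvx (t := x0.2) cu.
have Eu : u x0 = u (x0.1, x0.2) by rewrite -surjective_pairing.
have [np hp] : exists n, forall z, A z -> u x0 + r1 u x0 * (z.1 - x0.1) + n * (z.2 - x0.2) <= u z.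
  by apply: plane_ext => // s As; rewrite Eu; exact: (rd_subgrad oI iI cg).
have [nm hm] : exists n, forall z, A z -> u x0 + l1 u x0 * (z.1 - x0.1) + n * (z.2 - x0.2) <= u z.
  by apply: plane_ext => // s As; rewrite Eu; exact: (ld_subgrad oI iI cg).
have := le_ld_rd oI iI cg A0r; rewrite -/(l1 u x0) -/(r1 u x0).
rewrite le_eqVlt => /orP[/eqP //|lt]; exfalso.
move: hp hm lt; move: (r1 u x0) (l1 u x0) => b a hp hm ab.
pose del := (b - a) / 2; pose nu := (np - nm) / 2; pose m := (a + b) / 2; pose n := (np + nm) / 2.
have del0 : 0 < del by rewrite /del; plra.
pose sg (z : R * R) := del * (z.1 - x0.1) + nu * (z.2 - x0.2).
have hu z : A z -> u x0 + m * (z.1 - x0.1) + n * (z.2 - x0.2) + `|sg z| <= u z.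
  move=> Az; have := hp _ Az; have := hm _ Az; rewrite /sg /m /n /del /nu.
  by case: (ger0P (_ + _)); plra.
have [rho rho0 hA] := open_square oA A0.
have X0 : 0 <= X by have [h _] := hX _ A0; apply: le_trans h.
have clX z : closure A z -> `|z.2 - x0.2| <= 2 * X + 1.
  move=> /(_ _ (nbhsx_ballx z _ (ltr01 : 0 < (1:R))))[y [Ay [_ /= zy]]].
  have [_ hy] := hX _ Ay; have [_ h0] := hX _ A0.
  rewrite (_ : z.2 - x0.2 = (z.2 - y.2) + (y.2 - x0.2)); last by ring.
  apply: le_trans (ler_normD _ _) _; have := ler_normB y.2 x0.2; move: zy; rewrite /ball /=; plra.
pose C1 := 4 * (2 * X + 1) / (del * rho).
have dr0 : 0 < del * rho by rewrite mulr_gt0.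
have C10 : 0 <= C1 by rewrite /C1 divr_ge0 ?mulr_ge0 // ?(ltW dr0) //; plra.
pose C := C1 + (`|nu| * C1 + 2) / del.
have C20 : 0 <= (`|nu| * C1 + 2) / del by rewrite divr_ge0 ?(ltW del0) // addr_ge0 // mulr_ge0.
have C0 : 0 <= C by rewrite addr_ge0.
pose Y := X + `|m| + `|n|.
have Y0 : 0 <= Y by rewrite /Y !addr_ge0.
pose K := `|nu| + 1 + del.
have K0 : 0 < K by rewrite /K; have := normr_ge0 nu; plra.
pose c0 := del * rho / (2 * K).
have c00 : 0 < c0 by rewrite divr_gt0 // mulr_gt0.
pose D := (del / 32 + 4 * Y) * (4 * C).
have D0 : 0 <= D by rewrite /D; apply: mulr_ge0; [apply: addr_ge0; [plra|exact: mulr_ge0]|exact: mulr_ge0].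
(* The first upper bound on e absorbs the term 3 e W (be - al) of [section_ineq], the second enters
   the lower bound c0 for be - al, and the third contradicts that bound. *)
have [e [e0 e1 e2 e3]] : exists e : R, [/\ 0 < e, e < del ^+ 2 / 32 / 32, e <= del * rho / 2 & D * e < del / 128 * c0].
  have p1 : 0 < del ^+ 2 / 40 / 40 by rewrite !divr_gt0 ?exprn_gt0.
  have p2 : 0 < del * rho / 2 by rewrite divr_gt0.
  have D1 : 0 < D + 1 by clear - D0; lra.
  have k3 : 0 < del / 128 * c0 by rewrite mulr_gt0 // divr_gt0.
  have p3 : 0 < del / 128 * c0 / (D + 1) by rewrite divr_gt0.
  exists (Num.min (del ^+ 2 / 40 / 40) (Num.min (del * rho / 2) (del / 128 * c0 / (D + 1)))); split.
  - by rewrite !lt_min p1 p2.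
  - rewrite gt_min; apply/orP; left; plra.
  - by rewrite !ge_min lexx !orbT.
  apply: (@le_lt_trans _ _ (D * (del / 128 * c0 / (D + 1)))).
    by rewrite ler_wpM2l // !ge_min lexx !orbT.
  by rewrite mulrA ltr_pdivrMr // mulrC ltr_pM2l // ltrDl.
pose c := u x0 - m * x0.1 - n * x0.2 + e.
have affE z : aff c m n z = u x0 + m * (z.1 - x0.1) + n * (z.2 - x0.2) + e by rewrite /aff /c; ring.
pose S := under A u (aff c m n).
have Ssg z : S z -> `|sg z| < e by move=> [Az]; rewrite affE; have := hu _ Az; plra.
have Sq z : S z -> aff c m n z - u z <= e.
  by move=> [Az _]; rewrite affE; have := hu _ Az; have := normr_ge0 (sg z); plra.
have clsg z : closure S z -> `|sg z| <= e.
  move=> cz; rewrite leNgt; apply/negP => h.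
  have cont : {for z, continuous (fun y => `|sg y|)}.
    apply: cvg_norm; apply: cvgD; apply: cvgM; try exact: cvg_cst.
      by apply: cvgB; [exact: cvg_fst|exact: cvg_cst].
    by apply: cvgB; [exact: cvg_snd|exact: cvg_cst].
  have hn : nbhs z [set y | e < `|sg y|] by exact: (cvgr_gt _ cont).
  have [y [Sy /= hy]] := cz _ hn.
  by have := Ssg _ Sy; plra.
have clSA z : closure S z -> closure A z by apply: closureS => y [].
pose B : set (R * R) := [set z | closure S z /\ ~ A z].
have near z z' : B z -> B z' -> 0 <= (z.2 - x0.2) * (z'.2 - x0.2) -> `|z.2 - z'.2| <= C * e /\ `|z.1 - z'.1| <= C * e.
  move=> [cz nz] [cz' nz'] ss.
  have w z1 z2 : B z1 -> B z2 -> 0 <= (z1.2 - x0.2) * (z2.2 - x0.2) -> `|z1.2 - x0.2| <= `|z2.2 - x0.2| ->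
      `|z1.2 - z2.2| <= C * e /\ `|z1.1 - z2.1| <= C * e.
    move=> [k1 k2] [k3 k4] k5 k6.
    have [h1 h2] := @bad_points R A (2 * X + 1) rho del nu e x0 z1 z2 cA rho0 hA del0 e0 (clX _ (clSA _ k3)) (clSA _ k3) k2
      (clsg _ k1) (clsg _ k3) k5 k6.
    split; [apply: le_trans h1 _|apply: le_trans h2 _]; rewrite ler_pM2r // /C ?lerDl ?lerDr //.
  have [h|h] := leP `|z.2 - x0.2| `|z'.2 - x0.2|; first by apply: w.
  by rewrite distrC (distrC z.1); apply: w => //; [rewrite mulrC|exact: ltW].
have Ce0 : 0 <= C * e by rewrite mulr_ge0 // ltW.
(* [bad_points] compares points on the same side of the row of x0, so the two sides are covered
   separately. *)
pose Bp : set (R * R) := [set z | B z /\ 0 <= z.2 - x0.2]; pose Bm : set (R * R) := [set z | B z /\ z.2 - x0.2 <= 0].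
have [U1 [U2 [mU1 mU2 hU [kU1 kU2] nU]]] := @cover2 R Bp (C * e) Ce0
  (fun z z' h1 h2 => near z z' (proj1 h1) (proj1 h2) (mulr_ge0 (proj2 h1) (proj2 h2))).
have [V1 [V2 [mV1 mV2 hV [kV1 kV2] nV]]] := @cover2 R Bm (C * e) Ce0
  (fun z z' h1 h2 => near z z' (proj1 h1) (proj1 h2) (mulr_le0 (proj2 h1) (proj2 h2))).
have mW1 : measurable (U1 `|` V1) by exact: measurableU.
have mW2 : measurable (U2 `|` V2) by exact: measurableU.
have fW (P Q : set R) : measurable P -> measurable Q -> ((@lebesgue_measure R) P <= (2 * (C * e))%:E)%E ->
    ((@lebesgue_measure R) Q <= (2 * (C * e))%:E)%E ->
    exists d, [/\ (@lebesgue_measure R) (P `|` Q) = d%:E, 0 <= d, d <= 4 * C * e & P = set0 -> Q = set0 -> d = 0].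
  move=> mP mQ hP hQ; have h : ((@lebesgue_measure R) (P `|` Q) <= (2 * (C * e))%:E + (2 * (C * e))%:E)%E.
    by apply: (@le_trans _ _ ((@lebesgue_measure R) P + (@lebesgue_measure R) Q)%E); [exact: measureU2|exact: leeD].
  have f : (@lebesgue_measure R) (P `|` Q) \is a fin_num by rewrite ge0_fin_numE //; apply: le_lt_trans h _; rewrite -EFinD ltry.
  exists (fine ((@lebesgue_measure R) (P `|` Q))); rewrite fineK // fine_ge0 //; split => //.
    by move: h; rewrite -EFinD -lee_fin fineK // => h; apply: le_trans h _; rewrite lee_fin; plra.
  by move=> -> ->; rewrite setU0 measure0.
have [d1 [m1 d10 d1C d1n]] := fW _ _ mU1 mV1 kU1 kV1.
have [d2 [m2 d20 d2C d2n]] := fW _ _ mU2 mV2 kU2 kV2.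
have cov z : closure S z -> ~ A z -> (U1 `|` V1) z.2 /\ (U2 `|` V2) z.1.
  move=> cz nz; have [h|h] := leP 0 (z.2 - x0.2).
    by have [] := hU z (conj (conj cz nz) h); split; left.
  by have [] := hV z (conj (conj cz nz) (ltW h)); split; right.
have hY1 z : A z -> `|m - z.1| <= Y.
  by move=> /hX[h _]; apply: le_trans (ler_normB _ _) _; rewrite /Y; have := normr_ge0 n; plra.
have hY2 z : A z -> `|n - z.2| <= Y.
  by move=> /hX[_ h]; apply: le_trans (ler_normB _ _) _; rewrite /Y; have := normr_ge0 m; plra.
have W0 : 0 < 2 * e / del by rewrite divr_gt0 // mulr_gt0.
have hW s s' t : S (s, t) -> S (s', t) -> s' - s <= 2 * e / del.
  move=> /Ssg h1 /Ssg h2; rewrite ler_pdivlMr //.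
  by move: h1 h2; rewrite /sg /= !ltr_norml; clear; lra.
have q0 : aff c m n x0 - u x0 = e by rewrite affE; ring.
have hbad1 z : closure S z -> ~ (U1 `|` V1) z.2 -> A z.
  by move=> cz nU1; apply: contrapT => nA; apply: nU1; have [] := cov _ cz nA.
have hbad2 z : closure S z -> ~ (U2 `|` V2) z.1 -> A z.
  by move=> cz nU2; apply: contrapT => nA; apply: nU2; have [] := cov _ cz nA.
have [al [be [alb hT ineq]]] := section_ineq oA cA hX Ku fu mu hY1 hY2 Y0 e0 Sq mW1 hbad1 mW2 hbad2 m1 m2 W0 hW A0 q0.
have clT z : closure S z -> al <= z.2 <= be.
  have c2 : (fun y : R * R => y.2) @ z --> z.2 by exact: cvg_snd.
  move=> cz; apply/andP; split; rewrite leNgt; apply/negP => h.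
    have hn : nbhs z [set y : R * R | y.2 < al] by apply: (cvgr_lt _ c2).
    have [y [Sy /= hy]] := cz _ hn.
    by move: (hT _ Sy) hy; clear; lra.
  have hn : nbhs z [set y : R * R | be < y.2] by apply: (cvgr_gt _ c2).
  have [y [Sy /= hy]] := cz _ hn.
  by move: (hT _ Sy) hy; clear; lra.
have S0 : S x0 by split => //; rewrite -subr_gt0 q0.
have T0 := hT _ S0.
have main : (del / 128) * (be - al) <= del / 32 * d1 + 2 * Y * (d1 + d2).
  have E1 : e ^+ 2 / (16 * (2 * e / del)) = e * (del / 32) by field; rewrite !gt_eqF.
  have E2 : 3 * (e * (2 * e / del) * (be - al)) = e * (6 * e / del * (be - al)) by field; rewrite gt_eqF.
  have E3 : Y * (2 * e) * (d1 + d2) = e * (2 * Y * (d1 + d2)) by ring.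
  move: ineq; rewrite E1 E2 E3 -mulrA -mulrDr ler_pM2l // => ineq.
  have h : 6 * e / del <= del / 128.
    by rewrite ler_pdivrMr // mulrAC -expr2; move: e1; plra.
  have : 6 * e / del * (be - al) <= del / 128 * (be - al) by rewrite ler_pM2r ?subr_gt0.
  by move: ineq; plra.
have [[z [cz nz]]|nB] := pselect (exists z, B z); last first.
  have [E1 E2] := nU (fun z h => nB (ex_intro _ z (proj1 h))).
  have [E3 E4] := nV (fun z h => nB (ex_intro _ z (proj1 h))).
  have : 0 < del / 128 * (be - al) by rewrite mulr_gt0 ?subr_gt0 // divr_gt0.
  by move: main; rewrite (d1n E1 E3) (d2n E2 E4) addr0 !mulr0 addr0; plra.
(* The point z lies outside the square of half side rho around x0 but in the closed strip. If it is
   displaced horizontally by more than rho, the smallness of [sg] forces a vertical displacement of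
   at least c0. *)
have far : c0 <= be - al.
  apply: (@le_trans _ _ `|z.2 - x0.2|); last first.
    by move: T0 (clT _ cz); clear; move=> /andP[? ?] /andP[? ?]; rewrite ler_norml; apply/andP; split; plra.
  rewrite /c0 ler_pdivrMr ?mulr_gt0 //.
  have [h|h] := leP `|z.2 - x0.2| rho.
    have h2 : rho < `|z.1 - x0.1| by rewrite ltNge; apply/negP => h2; apply: nz; exact: hA.
    have h3 : del * `|z.1 - x0.1| <= e + `|nu| * `|z.2 - x0.2|.
      rewrite -(gtr0_norm del0) -!normrM (_ : del * _ = sg z - nu * (z.2 - x0.2)); last by rewrite /sg; ring.
      by apply: le_trans (ler_normB _ _) _; rewrite lerD2r; exact: clsg.
    have h4 : del * rho <= del * `|z.1 - x0.1| by rewrite ler_pM2l // ltW.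
    have h5 : 0 <= (1 + del) * `|z.2 - x0.2| by apply: mulr_ge0 => //; move: del0; clear; lra.
    have -> : `|z.2 - x0.2| * (2 * K) = 2 * (`|nu| * `|z.2 - x0.2|) + 2 * ((1 + del) * `|z.2 - x0.2|).
      by rewrite /K; ring.
    by move: e2 h3 h4 h5; plra.
  apply: (@le_trans _ _ (rho * (2 * K))); last by rewrite ler_pM2r ?mulr_gt0 // ltW.
  by rewrite mulrC ler_pM2l // /K; have := normr_ge0 nu; plra.
have h1 : del / 128 * c0 <= del / 128 * (be - al) by apply: ler_wpM2l; [move: del0; clear; lra|exact: far].
have h2 : del / 32 * d1 <= del / 32 * (4 * C * e) by rewrite ler_pM2l // divr_gt0.
have h3 : 2 * Y * (d1 + d2) <= 2 * Y * (4 * C * e + 4 * C * e).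
  by apply: ler_wpM2l; [rewrite mulr_ge0|exact: lerD].
have h4 : D * e = del / 32 * (4 * C * e) + 2 * Y * (4 * C * e + 4 * C * e) by rewrite /D; ring.
by move: main e3 h1 h2 h3; rewrite h4; plra.
Qed.

Lemma no_kink2 (R : realType) (A : set (R * R)) (X : R) (u : R * R -> R) (x0 : R * R) :
  open A -> cset2 A -> (forall z, A z -> `|z.1| <= X /\ `|z.2| <= X) ->
  inK A u -> En A u \is a fin_num -> (forall f, inK A f -> (En A u <= En A f)%E) ->
  A x0 -> l2 u x0 = r2 u x0.
Proof.
move=> oA cA hX Ku fu mu A0; have [oA' cA' Ku' Eu] := En_swap oA cA Ku.
have := @no_kink1 R [set z | A (swp z)] X (fun z => u (swp z)) (swp x0) oA' cA'.
rewrite Eu /l1 /r1 /swp /=; apply => //.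
- by move=> z /hX[].
- move=> f Kf; have [_ _ Kf' Ef] := En_swap oA' cA' Kf; rewrite -Ef.
  have E : [set z | [set z | A (swp z)] (swp z)] = A by apply/seteqP; split => -[].
  by rewrite E in Kf' *; exact: mu.
by rewrite -surjective_pairing.
Qed.

(** * Continuous differentiability of the minimizer *)

Lemma partials_differentiable (R : realType) (A : set (R * R)) (u : R * R -> R) (z : R * R) :
  open A -> cset2 A -> cvx2 A u -> A z -> l1 u z = r1 u z -> l2 u z = r2 u z -> differentiable u z.
Proof.
move=> oA cA cu Az E1 E2.
pose df (h : R * R) : R := r1 u z * h.1 + r2 u z * h.2.
pose g (y : R * R) : R := u y - df y.
have lf : differentiable (df : R * R -> R) z.
  rewrite (_ : df = (r1 u z) \*: (fst : R * R -> R) + (r2 u z) \*: (snd : R * R -> R)); last by apply/funext.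
  apply: differentiableD; apply: differentiableZ; apply: linear_differentiable => y; [exact: cvg_fst|exact: cvg_snd].
have -> : u = g + df by apply/funext => y; rewrite /g fctE subrK.
apply: differentiableD => //.
have dfB y h : df (y + h) = df y + df h by rewrite /df /=; ring.
have H : g \o shift z = cst (g z) + (\0 : R * R -> R) +o_ (0 : R * R) id.
  apply/eqaddoP => e e0; have e20 : 0 < e / 2 by rewrite divr_gt0.
  have [d d0 hd] := partials_diff oA cA cu Az E1 E2 e20.
  apply/nbhs_ballP; exists d => //= h [/= h1 h2].
  move: h1 h2; rewrite /ball /= !sub0r !normrN => h1 h2.
  have [_] := hd h.1 h.2 (ltW h1) (ltW h2).
  rewrite !fctE /= addr0 /g (addrC h z) dfB.
  rewrite (_ : u (z + h) = u (z.1 + h.1, z.2 + h.2)) //.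
  set X := u _; rewrite (_ : X - (df z + df h) - (u z - df z) = X - (u z + r1 u z * h.1 + r2 u z * h.2)); last by rewrite /df; ring.
  move=> hX; apply: le_trans hX _.
  have n1 : `|h.1| <= `|h| by rewrite prod_normE le_max lexx.
  have n2 : `|h.2| <= `|h| by rewrite prod_normE le_max lexx orbT.
  rewrite (_ : e * `|h| = e / 2 * (`|h| + `|h|)); last by field.
  by rewrite ler_pM2l //; exact: lerD.
apply/diff_locallyP.
have -> : ('d g z : R * R -> R) = (\0 : R * R -> R).
  by apply: (diff_unique _ H) => y; exact: cvg_cst.
by split => // y; exact: cvg_cst.
Qed.

(** The slope at a point y near z is squeezed between the difference quotients of fixed step d to
    the left and to the right, and these depend continuously on y. *)
Lemma r1_continuous (R : realType) (A : set (R * R)) (u : R * R -> R) (z : R * R) :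
  open A -> cset2 A -> cvx2 A u -> A z -> l1 u z = r1 u z -> {for z, continuous (r1 u)}.
Proof.
case: z => s t oA cA cu Az E; apply/cvgrPdist_le => e e0.
have e30 : 0 < e / 3 by rewrite divr_gt0.
have [d d0 hd] := smooth_eps (row_open oA) (row_itv cA) (row_cvx cu) (Az : row A t s) E e30.
have [Ap hp] := hd d ltac:(by rewrite gtr0_norm); have [Am hm] := hd (- d) ltac:(by rewrite normrN gtr0_norm).
rewrite gtr0_norm // in hp; rewrite normrN gtr0_norm // in hm.
have cz := cvx2_continuous oA cA cu Az.
have de : 0 < d * (e / 3) by rewrite mulr_gt0.
have sh (k : R) : (fun y : R * R => (y.1 + k, y.2)) @ (s, t) --> (s + k, t).
  have h1 : (fun y : R * R => y.1 + k) @ (s, t) --> s + k by apply: cvgD; [exact: cvg_fst|exact: cvg_cst].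
  have h2 : (fun y : R * R => y.2) @ (s, t) --> t by exact: cvg_snd.
  exact: (cvg_pair h1 h2).
have cp : (fun y : R * R => u (y.1 + d, y.2) - u y) @ (s, t) --> u (s + d, t) - u (s, t).
  apply: cvgB => //; apply: (cvg_comp _ _ (sh d)); exact: (cvx2_continuous oA cA cu Ap).
have cm : (fun y : R * R => u (y.1 - d, y.2) - u y) @ (s, t) --> u (s - d, t) - u (s, t).
  apply: cvgB => //; apply: (cvg_comp _ _ (sh (- d))); exact: (cvx2_continuous oA cA cu Am).
have op k : A (s + k, t) -> \forall y \near (s, t), A (y.1 + k, y.2).
  by move=> Ak; apply: (sh k); exact: open_nbhs_nbhs.
have H1 := op _ Ap; have H2 := op _ Am.
have H3 : \forall y \near (s, t), A y by exact: open_nbhs_nbhs.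
have H4 : \forall y \near (s, t), u (y.1 + d, y.2) - u y < u (s + d, t) - u (s, t) + d * (e / 3).
  by apply: (cvgr_lt _ cp); rewrite ltrDl.
have H5 : \forall y \near (s, t), u (y.1 - d, y.2) - u y < u (s - d, t) - u (s, t) + d * (e / 3).
  by apply: (cvgr_lt _ cm); rewrite ltrDl.
near=> y.
have Ay : A y by near: y.
have Ayr : row A y.2 y.1 by rewrite /row /= -surjective_pairing.
have sg := rd_subgrad (row_open oA) (row_itv cA) (row_cvx cu) Ayr.
have k1 : u (y.1 + d, y.2) - u y < u (s + d, t) - u (s, t) + d * (e / 3) by near: y.
have k2 : u (y.1 - d, y.2) - u y < u (s - d, t) - u (s, t) + d * (e / 3) by near: y.
have A1 : A (y.1 + d, y.2) by near: y.
have A2 : A (y.1 - d, y.2) by near: y.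
have s1 := sg _ (A1 : row A y.2 (y.1 + d)); have s2 := sg _ (A2 : row A y.2 (y.1 - d)).
move: s1 s2; rewrite -surjective_pairing -/(r1 u y) => s1 s2.
move: hp hm; rewrite -/(r1 u (s, t)) => hp hm.
have q1 : d * r1 u y <= d * (r1 u (s, t) + e) by move: s1 k1 hp; plra.
have q2 : d * (r1 u (s, t) - e) <= d * r1 u y by move: s2 k2 hm; plra.
rewrite !ler_pM2l // in q1 q2.
by rewrite ler_norml; apply/andP; split; clear - q1 q2; lra.
Unshelve. all: by end_near. Qed.

Lemma minimizer_C1 (R : realType) (A : set (R * R)) (X : R) (u : R * R -> R) :
  open A -> cset2 A -> (forall z, A z -> `|z.1| <= X /\ `|z.2| <= X) ->
  inK A u -> En A u \is a fin_num -> (forall f, inK A f -> (En A u <= En A f)%E) ->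
  C1_on A u /\ forall z, A z -> [/\ gradient u z = (r1 u z, r2 u z), l1 u z = r1 u z, l2 u z = r2 u z,
    {for z, continuous (r1 u)} & {for z, continuous (r2 u)}].
Proof.
move=> oA cA hX Ku fu mu; have [cu u0] := Ku.
have K1 z : A z -> l1 u z = r1 u z by move=> Az; exact: (no_kink1 oA cA hX Ku fu mu Az).
have K2 z : A z -> l2 u z = r2 u z by move=> Az; exact: (no_kink2 oA cA hX Ku fu mu Az).
have C1 z : A z -> {for z, continuous (r1 u)} by move=> Az; exact: (r1_continuous oA cA cu Az (K1 _ Az)).
have C2 z : A z -> {for z, continuous (r2 u)}.
  move=> Az; have [oA' cA' [cu' _] _] := En_swap oA cA Ku.
  have h : {for swp z, continuous (r1 (fun z => u (swp z)))}.
    by apply: (@r1_continuous R [set z | A (swp z)]) => //; rewrite /swp /= -?surjective_pairing //; exact: K2.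
  have h1 : (fun y : R * R => y.2) @ z --> z.2 by exact: cvg_snd.
  have h2 : (fun y : R * R => y.1) @ z --> z.1 by exact: cvg_fst.
  have sw : @swp R @ z --> swp z by exact: (cvg_pair h1 h2).
  rewrite (_ : r2 u = r1 (fun z => u (swp z)) \o @swp R); last by apply/funext => -[a b].
  exact: (cvg_comp _ _ sw h).
have G z : A z -> gradient u z = (r1 u z, r2 u z).
  move=> Az; rewrite /gradient derive_slice1 derive_slice2.
  rewrite (derive_ld_rd (row_open oA) (row_itv cA) (row_cvx cu) (_ : row A z.2 z.1)); last by rewrite /row /= -surjective_pairing.
  rewrite (derive_ld_rd (col_open oA) (col_itv cA) (col_cvx cu) (_ : col A z.1 z.2)); last by rewrite /col /= -surjective_pairing.
  by have := K1 _ Az; have := K2 _ Az; rewrite /l1 /r1 /l2 /r2 => -> ->; rewrite !eqxx.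
split=> [z Az|z Az]; last by split; [exact: G|exact: K1|exact: K2|exact: C1|exact: C2].
split; first by apply: (partials_differentiable oA cA cu Az); [exact: K1|exact: K2].
rewrite /prop_for /continuous_at (G _ Az).
have cc : (fun y => (r1 u y, r2 u y)) @ z --> (r1 u z, r2 u z) by exact: (cvg_pair (C1 _ Az) (C2 _ Az)).
apply: cvg_trans cc; apply: near_eq_cvg.
have H3 : \forall y \near z, A y by exact: open_nbhs_nbhs.
by apply: filterS H3 => y Ay; rewrite G.
Qed.

(** * The translated domain and the slopes of the minimizer on its axis *)

(** What the estimates use of the domain, with b the half length of the vertical chord. [cd_slab] is
    the strip required for existence; [cd_area] makes the slope [chi] tend to 0 at the left side;
    [b s <= 2^-1] and [1 <= b' s] give the sign of the vertical term in [curve_ineq]; [cd_flat] is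
    where omega enters. *)
Record cap_domain (R : realType) (omega : R -> R) (a L : R) (A : set (R * R)) (b b' : R -> R) : Prop := CapDomain {
  cd_open : open A;
  cd_cvx : cset2 A;
  cd_bd : forall z, A z -> a < z.1 < a + 2 /\ `|z.2| < 1;
  cd_even : forall z, A z -> A (z.1, - z.2);
  cd_diamond : forall z, `|z.1 - a - 1| + `|z.2| < 1 -> A z;
  cd_slab : forall t z, - (L / 2) < t -> t < L / 2 -> A z -> A (z.1, t);
  cd_L : 0 < L <= 1;
  cd_a : 10 ^+ 8 <= a;
  cd_area : I2 A (fun=> 1) = (a * L)%:E;
  cd_left : forall s t, a < s -> s < a + 2 / 5 -> A (s, t) <-> `|t| < b s;
  cd_b : forall s, a < s -> s < a + 2 / 5 -> L / 2 < b s <= 2^-1;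
  cd_mono : forall s s', a < s -> s <= s' -> s' < a + 2 / 5 -> b s <= b s';
  cd_der : forall s, a < s -> s < a + 2 / 5 -> is_derive s 1 b (b' s) /\ 1 <= b' s;
  cd_der_cont : forall s, a < s -> s < a + 2 / 5 -> {for s, continuous b'};
  cd_flat : forall e, 0 < e -> exists s g, [/\ a < s < a + e, 0 < g < e, b s = L / 2 + g & omega (s - a) <= g ^+ 2]
}.

Lemma cd_axis (R : realType) (omega : R -> R) (a L : R) (A : set (R * R)) (b b' : R -> R) s :
  cap_domain omega a L A b b' -> a < s -> s < a + 2 -> A (s, 0).
Proof.
move=> H h1 h2; apply: (cd_diamond H); rewrite /= normr0 addr0 ltr_norml; apply/andP; split; plra.
Qed.

Lemma cd_X (R : realType) (omega : R -> R) (a L : R) (A : set (R * R)) (b b' : R -> R) z :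
  cap_domain omega a L A b b' -> A z -> `|z.1| <= a + 2 /\ `|z.2| <= a + 2.
Proof.
move=> H Az; have [/andP[h1 h2] h3] := cd_bd H Az.
have a0 : 0 <= a by apply: le_trans (cd_a H); rewrite exprn_ge0.
by split; [rewrite ger0_norm; plra|plra].
Qed.

Record cap_min (R : realType) (A : set (R * R)) (u : R * R -> R) : Prop := CapMin {
  cm_K : inK A u;
  cm_fin : En A u \is a fin_num;
  cm_min : forall f, inK A f -> (En A u <= En A f)%E;
  cm_even : forall z, A z -> u (z.1, - z.2) = u z;
  cm_l1 : forall z, A z -> l1 u z = r1 u z;
  cm_l2 : forall z, A z -> l2 u z = r2 u z;
  cm_c1 : forall z, A z -> {for z, continuous (r1 u)};
  cm_c2 : forall z, A z -> {for z, continuous (r2 u)}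
}.

Lemma axis_min (R : realType) (omega : R -> R) (a L : R) (A : set (R * R)) (b b' : R -> R) (u : R * R -> R) z :
  cap_domain omega a L A b b' -> cap_min A u -> A z -> u (z.1, 0) <= u z.
Proof.
move=> H M Az; have [cu _] := cm_K M.
have := cu z (z.1, - z.2) 2^-1 Az (cd_even H Az); rewrite invr_ge0 ler0n invf_le1 // ?ler1n //.
move=> /(_ isT isT) /=; rewrite (cm_even M Az) (_ : z.2 + 2^-1 * (- z.2 - z.2) = 0); last by field.
by rewrite !subrr !mulr0 !addr0.
Qed.

Lemma axis_slope_mono (R : realType) (omega : R -> R) (a L : R) (A : set (R * R)) (b b' : R -> R) (u : R * R -> R) s s' :
  cap_domain omega a L A b b' -> cap_min A u -> a < s -> s' < a + 2 -> s <= s' -> r1 u (s, 0) <= r1 u (s', 0).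
Proof.
move=> H M h1 h2 h3; have [cu _] := cm_K M.
apply: (rd_mono (row_open (cd_open H)) (row_itv (cd_cvx H)) (row_cvx (t := 0) cu)) => //; apply: (cd_axis H) => //; [exact: le_lt_trans h2|exact: lt_le_trans h3].
Qed.

Lemma axis_tangent (R : realType) (omega : R -> R) (a L : R) (A : set (R * R)) (b b' : R -> R) (u : R * R -> R) s s' :
  cap_domain omega a L A b b' -> cap_min A u -> a < s < a + 2 -> a < s' < a + 2 ->
  u (s, 0) + r1 u (s, 0) * (s' - s) <= u (s', 0).
Proof.
move=> H M /andP[h1 h2] /andP[h3 h4]; have [cu _] := cm_K M.
by apply: (rd_subgrad (row_open (cd_open H)) (row_itv (cd_cvx H)) (row_cvx (t := 0) cu)); apply: (cd_axis H).
Qed.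

Lemma cd_finite (R : realType) (omega : R -> R) (a L : R) (A S : set (R * R)) (b b' : R -> R) :
  cap_domain omega a L A b b' -> measurable S -> S `<=` A -> exists2 m : R, 0 <= m & I2 S (fun=> 1) = m%:E.
Proof.
move=> H mS SA; apply: (@I2_fin R A S (fun=> 1) (a + 2) 1) => //; first exact: cd_open H.
by move=> z; exact: cd_X H.
Qed.

Lemma strip_area (R : realType) (omega : R -> R) (a L : R) (A S : set (R * R)) (b b' : R -> R) (s m : R) :
  cap_domain omega a L A b b' -> a < s -> s < a + 2 / 5 -> measurable S ->
  (forall z, S z -> A z /\ z.1 < s) -> I2 S (fun=> 1) = m%:E -> m <= 2 * b s * (s - a).
Proof.
move=> H h1 h2 mS hS hm.
have b0 : 0 < b s by have [/andP[L0 _] /andP[h _]] := (cd_L H, cd_b H h1 h2); plra.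
have := @I2_box R a s (- b s) (b s) ltac:(plra) ltac:(plra); rewrite -lee_fin -hm.
rewrite (_ : (s - a) * (b s - - b s) = 2 * b s * (s - a)); last by ring.
move=> <-; apply: I2_subset => //; first exact: measurableX.
move=> z /hS[Az zs]; have [/andP[az _] _] := cd_bd H Az; have z2 : z.1 < a + 2 / 5 by apply: lt_trans h2.
have : `|z.2| < b z.1 by apply/(cd_left H) => //; rewrite -surjective_pairing.
have := cd_mono H az (ltW zs) h2; move=> k1 k2; have := lt_le_trans k2 k1.
by rewrite ltr_norml => /andP[k3 k4]; split; rewrite /= in_itv /= ?az ?zs ?k3 ?k4.
Qed.

Lemma area_le4 (R : realType) (omega : R -> R) (a L : R) (A : set (R * R)) (b b' : R -> R) :
  cap_domain omega a L A b b' -> a * L <= 4.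
Proof.
move=> H; have := @I2_box R a (a + 2) (-1) 1 ltac:(plra) ltac:(plra); rewrite -lee_fin -(cd_area H).
rewrite (_ : _ * _ = 4 :> R); last by ring.
move=> <-; apply: I2_subset => //; [exact: open_measurable2 (cd_open H)|exact: measurableX|].
by move=> z Az; have [k1 /ltr_normlP[k2 k3]] := cd_bd H Az; split; rewrite /= in_itv /= ?k1 //; apply/andP; split; plra.
Qed.

Lemma rd_shift (R : realType) (g : R -> R) (e x : R) : rd (fun s => g s - e) x = rd g x.
Proof.
rewrite /rd (_ : (fun k => _) = fun k => k.+1%:R * (g (x + k.+1%:R^-1) - g x)) //.
by apply/funext => k; congr (_ * _); ring.
Qed.

Lemma rd_zero_min (R : realType) (I : set R) (g : R -> R) (x : R) :
  open I -> is_interval I -> cvx1 I g -> I x -> (forall y, I y -> g x <= g y) -> ld g x = rd g x -> rd g x = 0.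
Proof.
move=> oI iI cg Ix hg E; have c0 : cvx1 I (fun s => g x + 0 * s) by move=> *; rewrite le_eqVlt; apply/orP; left; apply/eqP; ring.
rewrite -(rd_touch oI iI c0 cg Ix) ?rd_aff //; last 2 first.
- by ring.
- by rewrite /ld (_ : (fun y => _) = fun s => g x + 0 * s) ?rd_aff ?oppr0 //; apply/funext => s; ring.
by move=> y Iy; rewrite mul0r addr0; exact: hg.
Qed.

(* Otherwise [u >= 3/5 a (z.1 - a)], and lowering [u] to [max (u - eps) 0] gains [eps a L] at a cost of about
   [a ^ 2 / 2] on a strip of area [L eps / (3/5 a)]. *)
Lemma axis_slope_small (R : realType) (omega : R -> R) (a L : R) (A : set (R * R)) (b b' : R -> R) (u : R * R -> R) :
  cap_domain omega a L A b b' -> cap_min A u ->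
  exists2 s, a < s < a + 3 / 10 & r1 u (s, 0) < 3 / 5 * a.
Proof.
move=> H M; apply: contrapT => nex.
have a1 : 100 <= a.
  apply: le_trans (cd_a H); rewrite (_ : 10 ^+ 8 = 10 ^+ 2 * 10 ^+ 6); last by rewrite -exprD.
  by rewrite (_ : 100 = 10 ^+ 2 * 1 :> R) ?ler_pM2l ?exprn_gt0 ?exprn_ege1 ?ler1n //; ring.
have a0 : 0 < a by plra.
have [/andP[L0 L1]] := conj (cd_L H) I.
have oA := cd_open H; have cA := cd_cvx H; have [cu u0] := cm_K M.
pose k : R := 3 / 5 * a.
have k0 : 0 < k by rewrite /k mulr_gt0 // divr_gt0.
have sl s : a < s -> s < a + 3 / 10 -> k <= r1 u (s, 0).
  by move=> h1 h2; rewrite leNgt; apply/negP => h; apply: nex; exists s => //; rewrite h1.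
have up z : A z -> k * (z.1 - a) <= u z.
  move=> Az; apply: le_trans (axis_min H M Az); have [/andP[h1 h2] _] := cd_bd H Az.
  apply/ler_addgt0Pr => e e0.
  pose d := Num.min (Num.min (z.1 - a) (1 / 5)) (e / k) / 2.
  have d0 : 0 < d by rewrite divr_gt0 // !lt_min divr_gt0 ?divr_gt0 // subr_gt0 h1.
  have hm : d * 2 = Num.min (Num.min (z.1 - a) (1 / 5)) (e / k) by rewrite /d mulfVK.
  have d1 : d * 2 <= z.1 - a by rewrite hm !ge_min lexx.
  have d2 : d * 2 <= 1 / 5 by rewrite hm !ge_min lexx !orbT.
  have d3 : d * 2 <= e / k by rewrite hm !ge_min lexx !orbT.
  have d4 : k * d <= e by rewrite ler_pdivlMr // in d3; move: (mulr_gt0 d0 k0); plra.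
  have := axis_tangent H M (s := a + d) (s' := z.1); rewrite h1 h2.
  have -> : a < a + d < a + 2 by apply/andP; split; plra.
  move=> /(_ isT isT).
  have := u0 _ (cd_axis H (s := a + d) ltac:(plra) ltac:(plra)).
  have : k * (z.1 - (a + d)) <= r1 u (a + d, 0) * (z.1 - (a + d)).
    by apply: ler_wpM2r; [plra|apply: sl; plra].
  by plra.
have [s [g [/andP[s1 s2] /andP[g0 g1] bs _]]] := cd_flat H (e := L / 100) ltac:(plra).
(* By [up], the set where u <= e lies to the left of s; as g < L / 100, the chords there are shorter
   than 102/100 L. *)
pose e : R := k * (99 / 100 * (s - a)).
have sa : 0 < s - a by rewrite subr_gt0.
have e0 : 0 < e by rewrite !mulr_gt0 // divr_gt0.
pose V z := Num.max (u z - e) 0.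
have c0 : cvx2 A (fun=> 0) by move=> x y t _ _ _ _; rewrite subr0 mulr0 addr0.
have ce : cvx2 A (fun z => u z - e) by move=> x y t Ax Ay t0 t1; have := cu _ _ _ Ax Ay t0 t1; plra.
have cV : cvx2 A V by exact: max_cvx2.
have KV : inK A V by split => // z _; rewrite /V le_max lexx orbT.
have mA := open_measurable2 oA.
have mu := cvx2_measurable oA cA cu.
pose O : set (R * R) := under A (fun=> e) u.
have oO : open O.
  rewrite openE => z [Az uz]; apply: filterI; first exact: open_nbhs_nbhs.
  exact: (cvgr_gt _ (cvx2_continuous oA cA cu Az)).
have mO := open_measurable2 oO.
pose N : set (R * R) := A `\` O.
have mN : measurable N by exact: measurableD.
have Nu z : N z -> u z <= e by move=> [Az nO]; rewrite leNgt; apply/negP => h; apply: nO.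
have Ns z : N z -> A z /\ z.1 < s.
  move=> Nz; split; first by case: Nz.
  have := le_trans (up _ (proj1 Nz)) (Nu _ Nz); rewrite /e ler_pM2l //; plra.
have OA : O `<=` A by move=> z [].
have AO : A `&` O = O by apply/seteqP; split => [z []//|z Oz]; split => //; exact: OA.
have dO z : O z -> den u z = den V z + e.
  move=> Oz; have VO y : A y -> O y -> V y = u y - e.
    by move=> _ [_ h]; rewrite /V; case: leP => //; plra.
  have [E1 E2] := r_loc oA cA ce (OA _ Oz) oO Oz VO.
  by rewrite /den E1 E2 /r1 /r2 !rd_shift (VO _ (OA _ Oz) Oz); ring.
have [N2 [mN2 N20 _ h2]] := nondiff_null oA cA cV.
have mdV := den_measurable oA cA cV; have mdu := den_measurable oA cA cu.
have mdVN : measurable_fun N (den V) by apply: measurable_funS mdV => // z [].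
have dN z : (N `\` N2) z -> den V z <= 2^-1 * (s ^+ 2 + 1).
  move=> [Nz nN]; have [Az zs] := Ns _ Nz; have [q1 q2] := h2 _ Az nN.
  have V0 : V z = 0 by rewrite /V; case: leP => //; have := Nu _ Nz; plra.
  have Vp y : V z <= V y by rewrite V0 /V le_max lexx orbT.
  have Azp : A (z.1, z.2) by rewrite -surjective_pairing.
  have e1 : r1 V z = 0.
    apply: (rd_zero_min (row_open oA) (row_itv cA) (row_cvx cV) (Azp : row A z.2 z.1)) => //.
    by move=> y _; rewrite -surjective_pairing.
  have e2 : r2 V z = 0.
    apply: (rd_zero_min (col_open oA) (col_itv cA) (col_cvx cV) (Azp : col A z.1 z.2)) => //.
    by move=> y _; rewrite -surjective_pairing.
  rewrite /den e1 e2 V0 addr0 !sub0r !sqrrN ler_pM2l ?invr_gt0 //.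
  have [/andP[k1 _] k2] := cd_bd H Az.
  apply: lerD; first by apply: lerXn2r; rewrite ?nnegrE; plra.
  by rewrite -(expr1n _ 2); apply: sqr_le_abs; exact: ltW.
have [mn mn0 En_] := cd_finite H mN (fun z h => proj1 h).
have [mo mo0 Eo] := cd_finite H mO OA.
have areaE : a * L = mo + mn.
  by apply: EFin_inj; rewrite EFinD -Eo -En_ -(cd_area H) (I2_split mA mO) ?AO.
have I1 : (I2 N (den V) <= (2^-1 * (s ^+ 2 + 1) * mn)%:E)%E.
  rewrite -(I2_null mN mN2 N20 mdVN).
  have mNN : measurable (N `\` N2) by exact: measurableD.
  apply: (@le_trans _ _ (I2 (N `\` N2) (fun=> 2^-1 * (s ^+ 2 + 1))%R)).
    apply: I2_le => //; first by apply: measurable_funS mdVN => // z [].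
    by move=> z [[Az _] _]; rewrite den_ge0 // /V le_max lexx orbT.
  apply: (@le_trans _ _ (I2 N (fun=> 2^-1 * (s ^+ 2 + 1))%R)); first by apply: I2_subset => // z _; nneg.
  have cc : 0 <= 2^-1 * (s ^+ 2 + 1) by nneg.
  by apply: I2_le_cst.
have := cm_min M KV; rewrite /En (I2_split mA mO mdu) (I2_split mA mO mdV) AO -/N.
have mdVO : measurable_fun O (den V) by apply: measurable_funS mdV.
have VO0 z : O z -> 0 <= den V z by move=> _; rewrite den_ge0 // /V le_max lexx orbT.
rewrite (I2_ext dO) (@I2D R O (den V) (fun=> e) mO mdVO _ VO0) //; last by move=> z _; exact: ltW.
have -> : I2 O (fun=> e) = (e * mo)%:E.
  by rewrite EFinM -Eo -I2Z ?(ltW e0) //; apply: I2_ext => z _; rewrite mulr1.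
have f1 : (0 <= I2 O (den V))%E by exact: I2_ge0.
have f2 : (I2 O (den V) < +oo)%E.
  apply: le_lt_trans (_ : (I2 A (den u) < +oo)%E); last by rewrite -ge0_fin_numE ?(cm_fin M) ?En_ge0 //; exact: (cm_K M).
  apply: (@le_trans _ _ (I2 O (den u))).
    by apply: I2_le => //; [exact: measurable_funS mdu|move=> z Oz; rewrite dO // lerDl ltW].
  by apply: I2_subset => // z Az; rewrite den_ge0 ?u0.
have f3 : (0 <= I2 N (den u))%E by apply: I2_ge0 => z [Az _]; rewrite den_ge0 ?u0.
have bnd := strip_area H s1 ltac:(plra) mN Ns En_.
have : (I2 O (den V) + (e * mo)%:E + I2 N (den u) <= I2 O (den V) + I2 N (den V))%E ->
   e * mo <= 2^-1 * (s ^+ 2 + 1) * mn.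
  move=> h; rewrite -lee_fin; apply: le_trans I1; move: h f1 f2 f3.
  by case: (I2 O _) => // x; case: (I2 N (den u)) => [y| |]; case: (I2 N _) => [w| |] //=;
     rewrite ?leey // -?EFinD !lee_fin; plra.
move=> /[apply] fin; rewrite bs in bnd.
have m1 : mn <= 102 / 100 * L * (s - a) by apply: le_trans bnd _; apply: ler_wpM2r; plra.
have q1 : s ^+ 2 <= (a + 1 / 100) ^+ 2 by apply: lerXn2r; rewrite ?nnegrE; plra.
have q2 : 2^-1 * (s ^+ 2 + 1) * mn <= 2^-1 * ((a + 1 / 100) ^+ 2 + 1) * (102 / 100 * L * (s - a)).
  apply: ler_pM => //; first by nneg.
  by rewrite ler_pM2l ?invr_gt0 // lerD2r.
have q3 : mn <= 2 / 100 * L.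
  apply: le_trans m1 _; rewrite mulrAC ler_pM2r //; plra.
have q4 : e * (a * L - 2 / 100 * L) <= e * mo by rewrite ler_pM2l //; plra.
(* To leading order this reads 594/1000 a ^ 2 <= 510/1000 a ^ 2. *)
have q5 : k * (99 / 100) * (a - 2 / 100) <= 2^-1 * ((a + 1 / 100) ^+ 2 + 1) * (102 / 100).
  have Ls : 0 < L * (s - a) by rewrite mulr_gt0.
  have E1 : k * (99 / 100) * (a - 2 / 100) * (L * (s - a)) = e * (a * L - 2 / 100 * L) by rewrite /e; ring.
  have E2 : 2^-1 * ((a + 1 / 100) ^+ 2 + 1) * (102 / 100) * (L * (s - a)) =
    2^-1 * ((a + 1 / 100) ^+ 2 + 1) * (102 / 100 * L * (s - a)) by ring.
  rewrite -(ler_pM2r Ls) E1 E2.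
  exact: le_trans q4 (le_trans fin q2).
have q6 : 100 * a <= a * a by rewrite ler_pM2r.
move: q5; rewrite /k expr2 => q5; clear - q5 q6 a1; nra.
Qed.

(* The competitor [a (z.1 - a)] shows that [Du - x] is small compared with [a] somewhere in a small square
   to the left of [(a + 3/10, 0)]. *)
Lemma axis_slope_large (R : realType) (omega : R -> R) (a L : R) (A : set (R * R)) (b b' : R -> R) (u : R * R -> R) :
  cap_domain omega a L A b b' -> cap_min A u -> 9 / 10 * a <= r1 u (a + 3 / 10, 0).
Proof.
move=> H M; have oA := cd_open H; have cA := cd_cvx H; have [cu u0] := cm_K M.
(* This uses the size of a: 4000 a is twice the density found at the point z below, and its being
   less than (a / 100) ^ 2 puts Du - x there below a / 100 in each component. *)
have [a2 aa] : 100 <= a /\ 40 * 100 * a <= (a / 100) ^+ 2.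
  have a1 := cd_a H; have [N EN] : exists N : R, N = 10 ^+ 6 by exists (10 ^+ 6).
  have N1 : 1 <= N by rewrite EN exprn_ege1 // ler1n.
  have N2 : 10 ^+ 2 * 10 ^+ 2 * 10 ^+ 2 = N by rewrite EN -!exprD.
  have a3 : 10 ^+ 2 * N <= a by rewrite EN -exprD.
  have h : (10 : R) ^+ 2 = 100 by rewrite expr2 -natrM.
  rewrite h in N2 a3; have a4 : 100 <= a by clear - N1 a3; lra.
  split => //; have a0 : 0 <= a by clear - a4; lra.
  have k : (100 * N) * a <= a * a by apply: ler_wpM2r.
  rewrite expr_div_n ler_pdivlMr ?exprn_gt0 // !expr2.
  apply: le_trans k; rewrite -N2; have : 0 <= a by []; clear; move=> h.
  rewrite (_ : 40 * 100 * a * (100 * 100) = 100 * 40 * (100 * 100 * a)); last by ring.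
  rewrite (_ : 100 * (100 * 100 * 100) * a = 100 * 100 * (100 * 100 * a)); last by ring.
  by apply: ler_wpM2r; [rewrite !mulr_ge0|rewrite ler_pM2l //; plra].
have mA := open_measurable2 oA.
pose l := aff (- (a * a)) a 0.
have lE z : l z = a * (z.1 - a) by rewrite /l /aff; ring.
have Kl : inK A l.
  split; first exact: aff_cvx2.
  by move=> z Az; rewrite lE; have [/andP[h _] _] := cd_bd H Az; rewrite mulr_ge0; plra.
have rl z : r1 l z = a /\ r2 l z = 0.
  split; rewrite /r1 /r2 /l /aff /=; last by rewrite rd_aff.
  by rewrite (_ : (fun s => _) = fun s => (- (a * a) + 0 * z.2) + a * s) ?rd_aff //; apply/funext => s; ring.
have El : (En A l <= ((3 + 2 * a) * (a * L))%:E)%E.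
  apply: I2_le_cst (cd_area H) => //; [exact: den_measurable (proj1 Kl)|by move=> z Az; rewrite den_ge0 ?(proj2 Kl)| |plra].
  move=> z Az; rewrite /den lE (proj1 (rl z)) (proj2 (rl z)) sub0r sqrrN.
  have [/andP[h1 h2] h3] := cd_bd H Az.
  have k1 : (a - z.1) ^+ 2 <= 2 ^+ 2 by apply: sqr_le_abs; rewrite ler_norml; apply/andP; split; plra.
  have k2 : z.2 ^+ 2 <= 1 ^+ 2 by apply: sqr_le_abs; exact: ltW.
  have k3 : a * (z.1 - a) <= a * 2 by apply: ler_wpM2l; plra.
  by move: k1 k2 k3; rewrite expr1n (_ : 2 ^+ 2 = 4 :> R); [plra|ring].
have Eu : (En A u <= (9 * a)%:E)%E.
  apply: le_trans (cm_min M Kl) (le_trans El _); rewrite lee_fin.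
  apply: (@le_trans _ _ ((3 + 2 * a) * 4)); last by plra.
  by apply: ler_wpM2l; [plra|exact: area_le4 H].
pose Q : set (R * R) := `]a + 1 / 5, a + 1 / 4[%classic `*` `]- (1 / 20), 1 / 20[%classic.
have mQ : measurable Q by exact: measurableX.
have QA : Q `<=` A.
  move=> z [/= ]; rewrite !in_itv /= => /andP[h1 h2] /andP[h3 h4]; apply: (cd_diamond H).
  have k1 : `|z.1 - a - 1| <= 4 / 5 by rewrite ler_norml; apply/andP; split; plra.
  have k2 : `|z.2| <= 1 / 20 by rewrite ler_norml; apply/andP; split; plra.
  by plra.
(* Q has area 1/200 and the energy is at most 9 a, so the density cannot be 2000 a or more
   throughout Q. *)
have [z Qz hz] : exists2 z, Q z & den u z < 20 * 100 * a.
  apply: contrapT => nz.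
  have : (I2 Q (fun=> 20 * 100 * a)%R <= En A u)%E.
    apply: (@le_trans _ _ (I2 Q (den u))); last first.
      by apply: I2_subset => //; [exact: den_measurable|move=> z Az; rewrite den_ge0 ?u0].
    apply: I2_le => //; first by apply: measurable_funS (den_measurable oA cA cu).
      by move=> z _; plra.
    by move=> z Qz; rewrite leNgt; apply/negP => h; apply: nz; exists z.
  move=> /le_trans/(_ Eu).
  rewrite (_ : I2 Q (fun=> 20 * 100 * a)%R = (20 * 100 * a)%:E * I2 Q (fun=> 1%R))%E; last first.
    by rewrite -I2Z //; [apply: I2_ext => z _; rewrite mulr1|plra].
  by rewrite /Q I2_box; [|plra|plra]; rewrite -EFinM lee_fin; plra.
have Az := QA _ Qz; move: Qz => [/= ]; rewrite !in_itv /= => /andP[h1 h2] /andP[h3 h4].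
have small x : x ^+ 2 <= 40 * 100 * a -> `|x| <= a / 100.
  move=> hx; rewrite leNgt; apply/negP => h; have a0 : 0 <= a / 100 by move: a2; clear; lra.
  have := ltr_pM a0 a0 h h; rewrite -!expr2 real_normK ?num_real // => h5.
  by have := lt_le_trans h5 (le_trans hx aa); rewrite ltxx.
have uz := u0 _ Az.
have p1 : `|r1 u z - z.1| <= a / 100.
  by apply: small; move: hz; rewrite /den; have := sqr_ge0 (r2 u z - z.2); plra.
have p2 : `|r2 u z - z.2| <= a / 100.
  by apply: small; move: hz; rewrite /den; have := sqr_ge0 (r1 u z - z.1); plra.
have Ay : A (a + 3 / 10, 0) by apply: (cd_axis H); plra.
have := grad_subgrad oA cA cu Az (cm_l1 M Az) (cm_l2 M Az) Ay; rewrite /= sub0r.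
have := axis_tangent H M (s := a + 3 / 10) (s' := z.1).
have -> : a < a + 3 / 10 < a + 2 by apply/andP; split; plra.
have -> : a < z.1 < a + 2 by apply/andP; split; plra.
move=> /(_ isT isT) t1 t2; have t3 := axis_min H M Az.
pose D := a + 3 / 10 - z.1; have D0 : 1 / 20 <= D by rewrite /D; plra.
have s1 : (99 / 100 * a) * D <= r1 u z * D.
  by apply: ler_wpM2r; [move: D0|move: p1 h1]; clear; [plra|rewrite ler_norml => /andP[? ?] ?; plra].
have s2 : r2 u z * z.2 <= (2 / 100 * a) * D.
  apply: le_trans (ler_norm _) _; rewrite normrM; apply: ler_pM => //.
    by rewrite (_ : r2 u z = (r2 u z - z.2) + z.2); [apply: le_trans (ler_normD _ _) _|ring];
       have : `|z.2| <= 1 / 20 by [rewrite ler_norml; apply/andP; split; move: h3 h4; clear; lra]; move: p2 a2; clear; lra.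
  by apply: le_trans D0; rewrite ler_norml; apply/andP; split; move: h3 h4; clear; lra.
rewrite -(@ler_pM2r _ D); last by plra.
have s3 : r1 u (a + 3 / 10, 0) * (z.1 - (a + 3 / 10)) = - (r1 u (a + 3 / 10, 0) * D) by rewrite /D; ring.
have s4 : 0 <= a * D by apply: mulr_ge0; [move: a2|move: D0]; clear; lra.
rewrite s3 in t1; rewrite -/D mulrN in t2; move: s1 s2 s4 t1 t2 t3; rewrite -!mulrA; plra.
Qed.

Lemma cd_big (R : realType) (omega : R -> R) (a L : R) (A : set (R * R)) (b b' : R -> R) :
  cap_domain omega a L A b b' -> 100 * 100 <= a.
Proof.
move=> H; apply: le_trans (cd_a H); have h : (10 : R) ^+ 2 = 100 by rewrite expr2 -natrM.
rewrite (_ : 10 ^+ 8 = 10 ^+ 2 * 10 ^+ 2 * 10 ^+ 4); last by rewrite -!exprD.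
by rewrite h ler_peMr // exprn_ege1 // ler1n.
Qed.

Lemma cvg_axis (R : realType) (F : R * R -> R) (s t : R) :
  {for (s, t), continuous F} -> {for s, continuous (fun x => F (x, t))}.
Proof.
move=> cF; have h : (fun x : R => (x, t)) @ s --> (s, t) by exact: (cvg_pair cvg_id (cvg_cst _)).
exact: (cvg_comp _ _ h).
Qed.

(** * A vertical chord on which the minimizer is constant *)

(** Since u is smallest on the axis in each vertical chord, the section lies over the interval where
    the affine function exceeds u on the axis, that is between s and s'. If its closure stays in A,
    [section_ineq] holds with empty exceptional sets and W = s' - s and reads e ^ 2 / (32 W) <= 3 e
    W, whence the constant 96. *)
Lemma gap_or_touch (R : realType) (omega : R -> R) (a L : R) (A : set (R * R)) (b b' : R -> R) (u : R * R -> R)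
    (s s' c k : R) :
  cap_domain omega a L A b b' -> cap_min A u -> a < s -> s < s' -> s' < a + 2 ->
  aff c k 0 (s, 0) = u (s, 0) -> aff c k 0 (s', 0) = u (s', 0) ->
  (forall z, under A u (aff c k 0) z -> s <= z.1 <= s') /\
  (closure (under A u (aff c k 0)) `<=` A ->
   forall x, s <= x <= s' -> aff c k 0 (x, 0) - u (x, 0) <= 96 * (s' - s) ^+ 2).
Proof.
move=> H M as_ ss sa Es Es'; have oA := cd_open H; have cA := cd_cvx H; have [cu u0] := cm_K M.
have ax x : a < x -> x < a + 2 -> A (x, 0) by exact: (cd_axis H).
have As := ax s as_ (lt_trans ss sa); have As' := ax s' (lt_trans as_ ss) sa.
pose q (x : R) := aff c k 0 (x, 0) - u (x, 0).
have cg := row_cvx (t := 0) cu.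
have qE x : q x = c + k * x - u (x, 0) by rewrite /q /aff /= mul0r addr0.
have qs : q s = 0 by rewrite /q Es subrr.
have qs' : q s' = 0 by rewrite /q Es' subrr.
have lin x y w : (w - x) * (c + k * y) = (w - y) * (c + k * x) + (y - x) * (c + k * w) by ring.
have S1 z : under A u (aff c k 0) z -> 0 < q z.1.
  move=> [Az hz]; rewrite subr_gt0; apply: le_lt_trans (axis_min H M Az) _.
  by move: hz; rewrite /aff /= !mul0r.
have strip z : under A u (aff c k 0) z -> s <= z.1 <= s'.
  move=> Sz; have qz := S1 z Sz; have [Az _] := Sz; have [/andP[k1 k2] _] := cd_bd H Az.
  have Az1 := ax _ k1 k2; apply/andP; split; rewrite leNgt; apply/negP => h.
    have := cg z.1 s s' Az1 As' h ss.
    have : 0 < (s' - s) * q z.1 by rewrite mulr_gt0 // subr_gt0.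
    have : (s' - z.1) * q s = 0 by rewrite qs mulr0.
    have : (s - z.1) * q s' = 0 by rewrite qs' mulr0.
    by rewrite !qE !mulrBr; have := lin z.1 s s'; plra.
  have := cg s s' z.1 As Az1 ss h.
  have : 0 < (s' - s) * q z.1 by rewrite mulr_gt0 // subr_gt0.
  have : (z.1 - s') * q s = 0 by rewrite qs mulr0.
  have : (z.1 - s) * q s' = 0 by rewrite qs' mulr0.
  by rewrite !qE !mulrBr; have := lin s s' z.1; plra.
split=> // clA x xs; rewrite -/(q x).
have cq : {within `[s, s'], continuous q}.
  apply: continuous_in_subspaceT => y; rewrite inE /= in_itv /= => /andP[y1 y2].
  have Ay := ax y (lt_le_trans as_ y1) (le_lt_trans y2 sa).
  rewrite (_ : q = fun x => c + k * x - u (x, 0)); last by apply/funext => y'; exact: qE.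
  apply: cvgB; last by apply: (cvg_axis (F := u)); exact: (cvx2_continuous oA cA cu Ay).
  by apply: cvgD; [exact: cvg_cst|apply: cvgM; [exact: cvg_cst|exact: cvg_id]].
have [x0 x0s hx0] := EVT_max (ltW ss) cq.
rewrite in_itv /= in x0s; have /andP[x01 x02] := x0s.
have A0 := ax x0 (lt_le_trans as_ x01) (le_lt_trans x02 sa).
apply: le_trans (hx0 x _) _; first by rewrite in_itv.
rewrite leNgt; apply/negP => big.
pose e := q x0; have e0 : 0 < e by apply: le_lt_trans big; nneg.
pose Y : R := `|k| + (a + 2).
have Y0 : 0 <= Y by rewrite /Y addr_ge0 //; have := cd_big H; plra.
have W0 : 0 < s' - s by rewrite subr_gt0.
have Sq z : under A u (aff c k 0) z -> aff c k 0 z - u z <= e.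
  move=> Sz; have [Az _] := Sz; apply: le_trans (hx0 z.1 _); last by rewrite in_itv /=; exact: strip.
  by rewrite /q /aff /= !mul0r lerD2l lerN2; exact: (axis_min H M Az).
have hW y y' t : under A u (aff c k 0) (y, t) -> under A u (aff c k 0) (y', t) -> y' - y <= s' - s.
  by move=> /strip/andP[h1 h2] /strip/andP[h3 h4]; rewrite /= in h1 h2 h3 h4; plra.
have Y1 z : A z -> `|k - z.1| <= Y.
  by move=> Az; have [h1 h2] := cd_X H Az; apply: le_trans (ler_normB _ _) _; rewrite lerD2l.
have Y2 z : A z -> `|0 - z.2| <= Y.
  by move=> Az; have [h1 h2] := cd_X H Az; rewrite sub0r normrN; apply: le_trans h2 _; rewrite lerDr.
have m0 : (@lebesgue_measure R) set0 = 0%:E by exact: measure0.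
have [al [be [alb _ ineq]]] := @section_ineq R A u c k 0 (a + 2) Y e 0 0 (s' - s) set0 set0 (x0, 0) oA cA
   (fun z Az => cd_X H Az) (cm_K M) (cm_fin M) (cm_min M) Y1 Y2 Y0 e0 Sq measurable0 (fun z cz _ => clA z cz)
   measurable0 (fun z cz _ => clA z cz) m0 m0 W0 hW A0 erefl.
move: ineq; rewrite !addr0 subr0 mulr0 addr0 => ineq.
pose D := be - al; have D0 : 0 < D by rewrite subr_gt0.
have E1 : e ^+ 2 / (16 * (s' - s)) * ((be - al) / 2) = (e * D / (32 * (s' - s))) * e.
  by rewrite /D; field; rewrite gt_eqF.
have E2 : 3 * (e * (s' - s) * (be - al)) = (e * D / (32 * (s' - s))) * (96 * (s' - s) ^+ 2).
  by rewrite /D; field; rewrite gt_eqF.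
move: ineq; rewrite E1 E2 ler_pM2l; last by rewrite divr_gt0 ?mulr_gt0.
by move: big; rewrite -/e => h1 h2; have := lt_le_trans h1 h2; rewrite ltxx.
Qed.

(** The tangents at m - h and m + h show that the chord over [m - 2 h, m + 2 h] is above u at m by
    at least h / 2 times the growth of u_1, which exceeds 96 (4 h) ^ 2. By [gap_or_touch] the
    closure of the section leaves A; it can do so only at the top or the bottom of the domain, and y
    is a point of the section close to there. *)
Lemma chord_touch (R : realType) (omega : R -> R) (a L : R) (A : set (R * R)) (b b' : R -> R) (u : R * R -> R)
    (m h d : R) :
  cap_domain omega a L A b b' -> cap_min A u -> 0 < h -> a < m - 2 * h -> m + 2 * h < a + 2 / 5 -> 0 < d ->
  96 * 16 * (2 * h) < r1 u (m + h, 0) - r1 u (m - h, 0) ->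
  exists y, [/\ A y, m - 2 * h <= y.1 <= m + 2 * h, b (m - 2 * h) - d < `|y.2| &
     u y <= Num.max (u (m - 2 * h, 0)) (u (m + 2 * h, 0))].
Proof.
move=> H M h0 am ma d0 growth; have oA := cd_open H; have [cu u0] := cm_K M.
pose s := m - 2 * h; pose s' := m + 2 * h.
have ss : s < s' by rewrite /s /s'; plra.
have a2 : s' < a + 2 by rewrite /s'; plra.
pose k := (u (s', 0) - u (s, 0)) / (s' - s); pose c := u (s, 0) - k * s.
have Es : aff c k 0 (s, 0) = u (s, 0) by rewrite /aff /c /=; ring.
have Es' : aff c k 0 (s', 0) = u (s', 0).
  by rewrite /aff /c /k /=; field; rewrite gt_eqF // subr_gt0.
have [strip gap] := gap_or_touch H M am ss a2 Es Es'.
have [clA|] := pselect (closure (under A u (aff c k 0)) `<=` A).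
  exfalso; have := gap clA m; rewrite /s /s' => /(_ _); have -> : m - 2 * h <= m <= m + 2 * h by apply/andP; split; plra.
  move=> /(_ isT).
  have t x y : s <= x <= s' -> s <= y <= s' -> u (x, 0) + r1 u (x, 0) * (y - x) <= u (y, 0).
    by move=> /andP[x1 x2] /andP[y1 y2]; apply: (axis_tangent H M); apply/andP; split; move: am a2 x1 x2 y1 y2; rewrite /s /s'; plra.
  have in1 : s <= m <= s' by apply/andP; split; rewrite /s /s'; plra.
  have in2 : s <= m + h <= s' by apply/andP; split; rewrite /s /s'; plra.
  have in3 : s <= m - h <= s' by apply/andP; split; rewrite /s /s'; plra.
  have in4 : s <= s <= s' by rewrite lexx ltW.
  have in5 : s <= s' <= s' by rewrite lexx ltW.
  have := t _ _ in2 in5; have := t _ _ in1 in2; have := t _ _ in3 in4; have := t _ _ in1 in3.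
  have E : aff c k 0 (m, 0) = (u (s, 0) + u (s', 0)) / 2.
    by rewrite -Es -Es' /aff /s /s' /=; field.
  rewrite E -/s -/s' (_ : m + h - m = h); last by ring.
  rewrite (_ : s' - (m + h) = h); last by rewrite /s'; ring.
  rewrite (_ : m - h - m = - h); last by ring.
  rewrite (_ : s - (m - h) = - h); last by rewrite /s; ring.
  rewrite (_ : m + 2 * h - (m - 2 * h) = 4 * h); last by ring.
  have : 96 * 16 * (2 * h) * h < (r1 u (m + h, 0) - r1 u (m - h, 0)) * h by rewrite ltr_pM2r.
  rewrite expr2 !mulrN mulrBl; plra.
move=> /existsNP[z /not_implyP[cz nAz]].
have zs : s <= z.1 <= s'.
  have c1 : (fun y : R * R => y.1) @ z --> z.1 by exact: cvg_fst.
  apply/andP; split; rewrite leNgt; apply/negP => hz.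
    have hn : nbhs z [set y : R * R | y.1 < s] by apply: (cvgr_lt _ c1).
    by have [y [/strip/andP[y1 _] /= y2]] := cz _ hn; have := le_lt_trans y1 y2; rewrite ltxx.
  have hn : nbhs z [set y : R * R | s' < y.1] by apply: (cvgr_gt _ c1).
  by have [y [/strip/andP[_ y1] /= y2]] := cz _ hn; have := le_lt_trans y1 y2; rewrite ltxx.
have /andP[z1 z2] := zs.
have bz : b s <= `|z.2|.
  rewrite leNgt; apply/negP => hz; apply: nAz; rewrite (surjective_pairing z).
  apply/(cd_left H); [exact: lt_le_trans z1|exact: le_lt_trans z2 _|].
  by apply: lt_le_trans hz _; apply: (cd_mono H) => //; exact: le_lt_trans z2 _.
have [y [Sy [_ /= yz]]] := cz _ (nbhsx_ballx z _ d0).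
have [Ay uy] := Sy; exists y; split => //; first exact: strip.
  rewrite /ball /= in yz; have := lerB_dist z.2 y.2; move: bz yz; rewrite /s; plra.
have /andP[y1 y2] := strip _ Sy.
apply: ltW; apply: lt_le_trans uy _; rewrite -/s -/s' -Es -Es' /aff /= !mul0r !addr0.
rewrite le_max !lerD2l; have [k0|k0] := leP 0 k.
  by apply/orP; right; apply: ler_wpM2l.
by apply/orP; left; rewrite ler_nM2l.
Qed.

(** The largest x up to which the bound holds from s cannot lie before s', because the local bound
    around x extends it. *)
Lemma local_growth (R : realType) (g : R -> R) (s s' K : R) :
  s <= s' -> (forall x, s <= x <= s' -> exists2 e : R, 0 < e & forall m h, 0 < h -> x - e < m - 2 * h ->
    m + 2 * h < x + e -> g (m + h) - g (m - h) <= K * (2 * h)) ->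
  g s' - g s <= K * (s' - s).
Proof.
move=> ss hl; pose T : set R := [set x | s <= x <= s' /\ g x - g s <= K * (x - s)].
have Ts : T s by split; [rewrite lexx|rewrite !subrr mulr0].
have sT : has_sup T by split; [exists s|exists s' => x [/andP[]]].
have up := sup_upper_bound sT.
set x := sup T in up; have xs : s <= x <= s'.
  by rewrite up //=; apply: ge_sup; [exists s|move=> y [/andP[]]].
have [e e0 he] := hl x xs; have /andP[sx xs'] := xs.
have loc p r : x - e / 4 < p -> p < r -> r < x + e / 4 -> g r - g p <= K * (r - p).
  move=> h1 h2 h3; have := he ((p + r) / 2) ((r - p) / 2) ltac:(plra) ltac:(plra) ltac:(plra).
  rewrite (_ : (p + r) / 2 + (r - p) / 2 = r); last by field.
  rewrite (_ : (p + r) / 2 - (r - p) / 2 = p); last by field.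
  by rewrite (_ : 2 * ((r - p) / 2) = r - p); [|field].
have e4 : 0 < e / 4 by plra.
have [p Tp hp] := sup_adherent e4 sT; rewrite -/x in hp; have [/andP[p1 p2] p3] := Tp.
have px := up _ Tp.
have ext r : p <= r -> r <= s' -> r < x + e / 4 -> T r.
  move=> pr rs rx; split; first by rewrite rs (le_trans p1 pr).
  move: pr; rewrite le_eqVlt => /orP[/eqP <-//|pr].
  have := loc _ _ hp pr rx; rewrite (_ : K * (r - s) = K * (r - p) + K * (p - s)); last by ring.
  by move: p3; plra.
have [h|h] := leP s' (x + e / 8); first by have [] := ext s' (le_trans px xs') (lexx _) ltac:(plra).
have := up _ (ext (x + e / 8) ltac:(plra) (ltW h) ltac:(plra)); plra.
Qed.

(** Between a point with slope 3/5 a and a + 3/10 all slopes on the axis are positive. If no chord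
    there were flat, [chord_touch] would limit the growth rate of the slope to 96 * 16, in total to
    less than 500, whereas it rises by 3/10 a or more. *)
Lemma flat_chord (R : realType) (omega : R -> R) (a L : R) (A : set (R * R)) (b b' : R -> R) (u : R * R -> R) :
  cap_domain omega a L A b b' -> cap_min A u ->
  exists s, [/\ a < s, s < a + 2 / 5, 0 < r1 u (s, 0) & forall t, A (s, t) -> u (s, t) = u (s, 0)].
Proof.
move=> H M; have oA := cd_open H; have cA := cd_cvx H; have [cu u0] := cm_K M.
have abig := cd_big H.
have [s1 /andP[as1 s1a] g1] := axis_slope_small H M.
have g2 := axis_slope_large H M.
pose g x := r1 u (x, 0).
have cg x : a < x -> x < a + 2 -> {for x, continuous g}.
  by move=> h1 h2; apply: (cvg_axis (F := r1 u)); apply: (cm_c1 M); exact: (cd_axis H).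
have [x1 x1in gx1] : exists2 x, x \in `[s1, a + 3 / 10] & g x = 3 / 5 * a.
  apply: IVT; first exact: ltW.
    apply: continuous_in_subspaceT => y; rewrite inE /= in_itv /= => /andP[y1 y2].
    by apply: cg; plra.
  by rewrite ge_min le_max (ltW g1) /= /g (le_trans _ g2) ?orbT //; plra.
rewrite in_itv /= in x1in; have /andP[x11 x12] := x1in.
have ax1 : a < x1 by exact: lt_le_trans x11.
apply: contrapT => nex.
have : g (a + 3 / 10) - g x1 <= 96 * 16 * (a + 3 / 10 - x1).
  apply: local_growth => // x /andP[xx1 xx2].
  have ax : a < x by exact: lt_le_trans xx1.
  have xa : x < a + 2 / 5 by plra.
  have gpos : 0 < g x.
    apply: (@lt_le_trans _ _ (g x1)); first by rewrite gx1; plra.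
    by apply: (axis_slope_mono H M); plra.
  have [t At ut] : exists2 t, A (x, t) & u (x, 0) < u (x, t).
    apply: contrapT => nt; apply: nex; exists x; split => // t At; apply/eqP; rewrite eq_le (axis_min H M At) andbT.
    by rewrite leNgt; apply/negP => h; apply: nt; exists t.
  have tb : `|t| < b x by apply/(cd_left H).
  (* Near x, u is below w on the axis and above w at height t. The point y supplied by [chord_touch]
     is higher than |t| and has u y below w, which convexity and evenness in x_2 exclude. *)
  pose w := (u (x, 0) + u (x, t)) / 2.
  have A0 : A (x, 0) by apply: (cd_axis H); plra.
  have cut : {for x, continuous (fun y => u (y, t))} by apply: cvg_axis; exact: (cvx2_continuous oA cA cu At).
  have cu0 : {for x, continuous (fun y => u (y, 0))} by apply: cvg_axis; exact: (cvx2_continuous oA cA cu A0).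
  have cb : {for x, continuous b}.
    have [[db _] _] := cd_der H ax xa.
    by apply: differentiable_continuous; apply/derivable1_diffP.
  have n1 : \forall y \near x, w < u (y, t) by apply: (cvgr_gt _ cut); rewrite /w; plra.
  have n2 : \forall y \near x, u (y, 0) < w by apply: (cvgr_lt _ cu0); rewrite /w; plra.
  have n3 : \forall y \near x, (`|t| + b x) / 2 < b y by apply: (cvgr_gt _ cb); plra.
  have n4 : \forall y \near x, A (y, t) by have := row_open (t := t) oA; rewrite openE => /(_ _ At).
  have n5 : \forall y \near x, a < y by apply: (cvgr_gt _ cvg_id).
  have n6 : \forall y \near x, y < a + 2 / 5 by apply: (cvgr_lt _ cvg_id).
  have : \forall y \near x, [/\ w < u (y, t), u (y, 0) < w, (`|t| + b x) / 2 < b y, A (y, t) & a < y < a + 2 / 5].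
    apply: filterS (filterI n1 (filterI n2 (filterI n3 (filterI n4 (filterI n5 n6))))).
    by move=> y [k1 [k2 [k3 [k4 [k5 k6]]]]]; split => //; exact/andP.
  move=> /nbhs_ballP[e /= e0 he]; exists e => // m h h0 m1 m2; rewrite leNgt; apply/negP => growth.
  have m3 : m - 2 * h < x + e by clear - m2 h0; lra.
  have m4 : x - e < m + 2 * h by clear - m1 h0; lra.
  have B y : x - e < y -> y < x + e -> ball x e y.
    by move=> y1 y2; rewrite /ball /= ltr_norml; apply/andP; split; clear - y1 y2; lra.
  have [_ w1 b1 _ /andP[a1 _]] := he (m - 2 * h) (B _ m1 m3).
  have [_ w2 _ _ /andP[_ a2]] := he (m + 2 * h) (B _ m4 m2).
  have d0 : 0 < (b x - `|t|) / 2 by clear - tb; lra.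
  have [y [Ay /andP[y1 y2] ty uy]] := chord_touch H M h0 a1 a2 d0 growth.
  have [w3 _ _ _ _] := he y.1 (B _ (lt_le_trans m1 y1) (le_lt_trans y2 m2)).
  have ty' : `|t| < `|y.2| by clear - ty b1 tb; lra.
  have y20 : 0 < `|y.2| by apply: le_lt_trans ty'.
  have lt1 : u (y.1, t) <= u y.
    pose r := (1 - t / y.2) / 2.
    have yn0 : y.2 != 0 by rewrite -normr_gt0.
    have tr : `|t / y.2| <= 1 by rewrite normrM normfV ler_pdivrMr // mul1r ltW.
    move: tr; rewrite ler_norml => /andP[r1 r2].
    have := cu y (y.1, - y.2) r Ay (cd_even H Ay) ltac:(rewrite /r; clear - r1 r2; lra) ltac:(rewrite /r; clear - r1 r2; lra).
    rewrite (cm_even M Ay) /= !subrr !mulr0 !addr0 (_ : y.2 + _ = t) //.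
    by rewrite /r; field.
  have : u y < w by apply: le_lt_trans uy _; rewrite gt_max w1 w2.
  by move=> h1; have := lt_trans w3 (le_lt_trans lt1 h1); rewrite ltxx.
rewrite gx1 => h; have : 96 * 16 * (a + 3 / 10 - x1) <= 96 * 16 * (3 / 10) by rewrite ler_pM2l //; plra.
move: g2 h; rewrite -/(g _); plra.
Unshelve. all: by end_near. Qed.

(** * Derivatives along curves and integrated inequalities *)

Lemma I2_box_oc (R : realType) (a b c d : R) : a <= b -> c <= d ->
  I2 (`]a, b]%classic `*` `]c, d[%classic) (fun=> 1) = ((b - a) * (d - c))%:E.
Proof.
move=> ab cd; have mB : measurable (`]a, b]%classic `*` `]c, d[%classic : set (R * R)) by apply: measurableX.
have E : ((lebesgue_measure \x lebesgue_measure) (`]a, b]%classic `*` `]c, d[%classic) =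
    (@lebesgue_measure R) `]a, b]%classic * (@lebesgue_measure R) `]c, d[%classic)%E.
  by rewrite product_measure1E.
have m1 : (@lebesgue_measure R) `]a, b]%classic = (b - a)%:E.
  by rewrite lebesgue_measure_itv /= lte_fin; case: ltP => // ba; rewrite (_ : b = a) ?subrr //; apply/eqP; rewrite eq_le ba.
have m2 : (@lebesgue_measure R) `]c, d[%classic = (d - c)%:E.
  by rewrite lebesgue_measure_itv /= lte_fin; case: ltP => // ba; rewrite (_ : d = c) ?subrr //; apply/eqP; rewrite eq_le ba.
by rewrite I2_cst // mul1e E m1 m2 EFinM.
Qed.

Lemma squeeze_derive (R : realType) (F f : R -> R) (s e : R) :
  0 < e -> {for s, continuous f} ->
  (forall x y, s - e < x -> x < y -> y < s + e -> f x * (y - x) <= F y - F x <= f y * (y - x)) ->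
  is_derive s 1 F (f s).
Proof.
move=> e0 cf hF.
have c : (fun h => h^-1 *: ((F \o shift s) (h *: 1) - F s)) @ 0^' --> f s.
  apply/cvgrPdist_le => d d0.
  have h0 : \forall h \near (0 : R)^', `|f s - f (h + s)| <= d.
    have cs : f (h + s) @[h --> (0 : R)] --> f s.
      have sh : (fun h : R => h + s) @ (0 : R) --> s.
        by rewrite -[X in _ --> X]add0r; apply: cvgD; [exact: cvg_id|exact: cvg_cst].
      exact: (cvg_comp _ _ sh).
    by apply: nbhs_dnbhs; move/cvgrPdist_le : cs; apply.
  have h1 : \forall h \near (0 : R)^', `|h| < e by apply: dnbhs0_lt.
  near=> h; have hn0 : h != 0 by near: h; exact: nbhs_dnbhs_neq.
  have he : `|h| < e by near: h.
  have hd : `|f s - f (h + s)| <= d by near: h.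
  rewrite /= [h *: 1]mulr1 [_ *: _](_ : _ = (F (h + s) - F s) / h); last by rewrite mulrC.
  move: he; rewrite ltr_norml => /andP[q1 q2].
  apply: le_trans hd; rewrite ler_distl -ler_distl.
  have [hp|hm] := ltP 0 h.
    have /andP[k1 k2] := hF s (h + s) ltac:(clear - e0; lra) ltac:(clear - hp; lra) ltac:(clear - q2; lra).
    rewrite addrK in k1 k2.
    have k3 : f s <= (F (h + s) - F s) / h by rewrite ler_pdivlMr.
    have k4 : (F (h + s) - F s) / h <= f (h + s) by rewrite ler_pdivrMr.
    by rewrite !ler0_norm ?subr_le0 //; [clear - k4; lra|exact: le_trans k4].
  have hm' : h < 0 by rewrite lt_neqAle hn0.
  have /andP[k1 k2] := hF (h + s) s ltac:(clear - q1; lra) ltac:(clear - hm'; lra) ltac:(clear - e0; lra).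
  have E : s - (h + s) = - h by ring.
  rewrite E in k1 k2; have hh : 0 < - h by rewrite oppr_gt0.
  have Eq : (F (h + s) - F s) / h = (F s - F (h + s)) / (- h) by rewrite invrN mulrN -mulNr opprB.
  have k3 : f (h + s) <= (F (h + s) - F s) / h by rewrite Eq ler_pdivlMr.
  have k4 : (F (h + s) - F s) / h <= f s by rewrite Eq ler_pdivrMr.
  by rewrite !ger0_norm ?subr_ge0 //; [clear - k3; lra|exact: le_trans k4].
split; first by apply/cvg_ex; exists (f s).
exact/cvg_lim.
Unshelve. all: by end_near. Qed.

Lemma mono_derive_subgrad (R : realType) (F f : R -> R) (a c x y : R) :
  (forall s, a < s -> s < c -> is_derive s 1 F (f s)) ->
  (forall s s', a < s -> s <= s' -> s' < c -> f s <= f s') ->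
  a < x -> x < c -> a < y -> y < c -> F x + f x * (y - x) <= F y.
Proof.
move=> dF mf ax xc ay yc.
have mvt p r : a < p -> r < c -> p < r -> exists2 s, p < s < r & F r - F p = f s * (r - p).
  move=> ap rc pr.
  have dd s : s \in `]p, r[ -> is_derive s 1 F (f s).
    by rewrite in_itv /= => /andP[h1 h2]; apply: dF; [exact: lt_trans h1|exact: lt_trans rc].
  have cF : {within `[p, r], continuous F}.
    apply: continuous_in_subspaceT => s; rewrite inE /= in_itv /= => /andP[h1 h2].
    have [d _] := dF s (lt_le_trans ap h1) (le_lt_trans h2 rc).
    by apply: differentiable_continuous; apply/derivable1_diffP.
  by have [s sin E] := MVT pr dd cF; exists s => //; move: sin; rewrite in_itv.
have [xy|yx|->] := ltgtP x y; last by rewrite subrr mulr0 addr0.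
  have [s /andP[s1 s2] E] := mvt x y ax yc xy.
  have : f x * (y - x) <= f s * (y - x).
    by apply: ler_wpM2r; [rewrite subr_ge0 ltW|apply: mf => //; [exact: ltW|exact: lt_trans yc]].
  by rewrite -E; plra.
have [s /andP[s1 s2] E] := mvt y x ay xc yx.
have : f s * (x - y) <= f x * (x - y).
  by apply: ler_wpM2r; [rewrite subr_ge0 ltW|apply: mf => //; [exact: lt_trans s1|exact: ltW]].
by rewrite -E; plra.
Qed.

Lemma rd_is_derive (R : realType) (I : set R) (g : R -> R) (x d : R) :
  open I -> is_interval I -> cvx1 I g -> I x -> is_derive x 1 g d -> rd g x = d.
Proof.
move=> oI iI cg Ix [dg E]; have := ld_eq_rd_derive oI iI cg Ix (derivable_ld_eq_rd oI iI cg Ix dg).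
by case=> _ <-.
Qed.

Lemma curve_derive (R : realType) (u : R * R -> R) (gam : R -> R) (s g' p q : R) :
  differentiable u (s, gam s) -> is_derive s 1 gam g' ->
  'D_(1, 0) u (s, gam s) = p -> 'D_(0, 1) u (s, gam s) = q ->
  is_derive s 1 (fun x => u (x, gam x)) (p + q * g').
Proof.
move=> du [dg Eg] Ep Eq.
have dgam : differentiable gam s by apply/derivable1_diffP.
have did : differentiable (id : R -> R) s by apply/derivable1_diffP; exact: derivable_id.
have dpair : differentiable (fun x => (x, gam x)) s by apply: differentiable_pair.
have dc : differentiable (u \o (fun x => (x, gam x))) s by apply: differentiable_comp.
have hd : derivable (u \o (fun x => (x, gam x))) s 1 by apply/derivable1_diffP.
split => //.
have E1 : 'd (id : R -> R) s 1 = 1 by rewrite -deriveE // derive_id.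
have E2 : 'd gam s 1 = g' by rewrite -deriveE.
have E3 : 'D_1 (u \o (fun x => (x, gam x))) s = 'd u (s, gam s) (1, g').
  by rewrite deriveE // diff_comp //= diff_pair //= E1 E2.
rewrite -[LHS]/('D_1 (u \o (fun x => (x, gam x))) s) E3 -Ep -Eq !deriveE //.
have -> : ((1, g') : R * R) = (1, 0) + g' *: (0, 1).
  by congr pair => /=; rewrite ?scaler0 ?addr0 // add0r [_ *: _]mulr1.
by rewrite linearD linearZ /= [X in _ + X]mulrC.
Qed.

(** Used along the curves s -> (s, b s y), where the first variation is controlled only up to the
    total derivative G'. *)
Lemma FTC_ineq (R : realType) (X Y G G' : R -> R) (al be : R) :
  al < be -> (forall s, al <= s <= be -> {for s, continuous X}) -> (forall s, al <= s <= be -> {for s, continuous Y}) ->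
  (forall s, al <= s <= be -> {for s, continuous G'}) -> (forall s, al <= s <= be -> is_derive s 1 G (G' s)) ->
  (forall s, al <= s <= be -> X s + G' s <= Y s) ->
  (\int[@lebesgue_measure R]_(s in `]al, be[) (X s)%:E + (G be - G al)%:E <=
   \int[@lebesgue_measure R]_(s in `]al, be[) (Y s)%:E)%E.
Proof.
move=> ab cX cY cG' dG hXY.
have mI : measurable (`]al, be[%classic : set R) by [].
have within (f : R -> R) : (forall s, al <= s <= be -> {for s, continuous f}) -> {within `[al, be], continuous f}.
  by move=> cf; apply: continuous_in_subspaceT => s; rewrite inE /= in_itv /=; exact: cf.
have int (f : R -> R) : (forall s, al <= s <= be -> {for s, continuous f}) ->
    (@lebesgue_measure R).-integrable `]al, be[ (EFin \o f).
  move=> cf; have h : (@lebesgue_measure R).-integrable `[al, be] (EFin \o f).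
    by apply: continuous_compact_integrable; [exact: segment_compact|exact: within].
  by apply: integrableS h => //; apply: subset_itvW; rewrite // bnd_simp.
have iX := int _ cX; have iY := int _ cY; have iG := int _ cG'.
have cG s : al <= s <= be -> {for s, continuous G}.
  by move=> h; have [d _] := dG s h; apply: differentiable_continuous; apply/derivable1_diffP.
have E : (\int[@lebesgue_measure R]_(s in `]al, be[) (G' s)%:E = (G be - G al)%:E)%E.
  rewrite EFinB -(continuous_FTC2 ab (within _ cG')).
  - apply/esym; apply: (@integral_itv_bndoo R al be (fun x => (G' x)%:E) true false).
    by have := iG => /integrableP[].
  - split.
    + by move=> x; rewrite in_itv /= => /andP[h1 h2]; have [] := dG x ltac:(by rewrite !ltW).
    + by apply: cvg_at_right_filter; apply: cG; rewrite lexx ltW.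
    + by apply: cvg_at_left_filter; apply: cG; rewrite lexx ltW.
  move=> x; rewrite in_itv /= => /andP[h1 h2]; rewrite derive1E; by have [_ ->] := dG x ltac:(by rewrite !ltW).
rewrite -E -integralD //; apply: le_integral => //; first by apply: integrableD.
by move=> s; rewrite inE /= in_itv /= => /andP[h1 h2]; rewrite lee_fin; apply: hXY; rewrite !ltW.
Qed.

Lemma I2_zero_continuous (R : realType) (S : set (R * R)) (f : R * R -> R) (z : R * R) :
  open S -> measurable_fun S f -> (forall z, S z -> 0 <= f z) -> I2 S f = 0%E -> S z -> {for z, continuous f} -> f z = 0.
Proof.
move=> oS mf f0 I0 Sz cf; apply/eqP; rewrite eq_le f0 // andbT leNgt; apply/negP => fz.
have mS := open_measurable2 oS.
have h : \forall y \near z, S y /\ f z / 2 < f y.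
  have h1 : \forall y \near z, S y by exact: open_nbhs_nbhs.
  have h2 : \forall y \near z, f z / 2 < f y by apply: (cvgr_gt _ cf); plra.
  by near=> y; split; near: y.
move: h => /nbhs_ballP[e /= e0 he].
pose Q : set (R * R) := `]z.1 - e, z.1 + e[%classic `*` `]z.2 - e, z.2 + e[%classic.
have mQ : measurable Q by exact: measurableX.
have hQ y : Q y -> S y /\ f z / 2 < f y.
  move=> [/= ]; rewrite !in_itv /= => /andP[h1 h2] /andP[h3 h4]; apply: he; split => /=;
  rewrite /ball /= ltr_norml; apply/andP; split; plra.
have : (I2 Q (fun=> f z / 2)%R <= I2 S f)%E.
  apply: (@le_trans _ _ (I2 Q f)); last by apply: I2_subset => // y /hQ[].
  have QS : Q `<=` S by move=> y /hQ[].
  apply: I2_le => //; first by apply: measurable_funS mf.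
    by move=> y _; plra.
  by move=> y /hQ[_ /ltW].
rewrite I0 (_ : I2 Q (fun=> f z / 2)%R = (f z / 2)%:E * I2 Q (fun=> 1%R))%E; last first.
  by rewrite -I2Z //; [apply: I2_ext => y _; rewrite mulr1|plra].
rewrite /Q I2_box; [|plra|plra]; rewrite -EFinM lee_fin leNgt => /negP; apply.
by rewrite !mulr_gt0 ?invr_gt0 //; plra.
Unshelve. all: by end_near. Qed.

(** * The balanced slope and the glued competitor *)

Definition rarea (R : realType) (A : set (R * R)) (s : R) : R := fine (I2 (A `&` [set z | s < z.1]) (fun=> 1)).

Lemma half_open (R : realType) (s : R) : open [set z : R * R | s < z.1] /\ open [set z : R * R | z.1 < s].
Proof.
split; apply: square_open => z /= zs.
  by exists (z.1 - s) => [|y y1 _]; [rewrite subr_gt0|move: y1; rewrite ltr_norml => /andP[? ?] /=; plra].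
by exists (s - z.1) => [|y y1 _]; [rewrite subr_gt0|move: y1; rewrite ltr_norml => /andP[? ?] /=; plra].
Qed.

Lemma half_measurable (R : realType) (s : R) : measurable [set z : R * R | s < z.1] /\ measurable [set z : R * R | z.1 < s].
Proof. by have [h1 h2] := half_open s; split; apply: open_measurable2. Qed.

Lemma rareaE (R : realType) (omega : R -> R) (a L : R) (A : set (R * R)) (b b' : R -> R) s :
  cap_domain omega a L A b b' -> I2 (A `&` [set z | s < z.1]) (fun=> 1) = (rarea A s)%:E /\ 0 <= rarea A s.
Proof.
move=> H; have mA := open_measurable2 (cd_open H); have [m1 _] := half_measurable s.
have [m m0 E] := cd_finite H (measurableI _ _ mA m1) (fun z h => proj1 h).
by rewrite /rarea E.
Qed.

Lemma rarea_diff (R : realType) (omega : R -> R) (a L : R) (A : set (R * R)) (b b' : R -> R) s s' :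
  cap_domain omega a L A b b' -> a < s -> s < s' -> s' < a + 2 / 5 ->
  2 * b s * (s' - s) <= rarea A s - rarea A s' <= 2 * b s' * (s' - s).
Proof.
move=> H as_ ss sa; have mA := open_measurable2 (cd_open H).
have [E1 _] := rareaE s H; have [E2 _] := rareaE s' H.
have [m1 _] := half_measurable s; have [m2 _] := half_measurable s'.
pose S := (A `&` [set z | s < z.1]) `\` [set z : R * R | s' < z.1].
have mS : measurable S by apply: measurableD => //; exact: measurableI.
have [m m0 Em] := cd_finite H mS (fun z h => proj1 (proj1 h)).
have E : rarea A s - rarea A s' = m.
  apply: (canLR (addrK _)); apply: EFin_inj; rewrite EFinD -E1 -E2 -Em.
  rewrite (@I2_split R _ [set z : R * R | s' < z.1]) //; last exact: measurableI.
  rewrite (_ : A `&` [set z | s < z.1] `&` [set z | s' < z.1] = A `&` [set z | s' < z.1]) 1?addeC //.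
  by apply/seteqP; split => [z [[Az _] h]//|z [Az h]]; do 2!split => //; exact: lt_trans h.
have b0 x : a < x -> x < a + 2 / 5 -> 0 < b x.
  by move=> h1 h2; have [/andP[L0 _] /andP[h _]] := (cd_L H, cd_b H h1 h2); plra.
have as' := lt_trans as_ ss; have sa' := lt_trans ss sa.
rewrite E; have bs := b0 _ as_ sa'; have bs' := b0 _ as' sa.
apply/andP; split.
  rewrite -lee_fin -Em (_ : 2 * b s * (s' - s) = (s' - s) * (b s - - b s)); last by ring.
  rewrite -I2_box_oc; [|exact: ltW|plra].
  apply: I2_subset => //; first exact: measurableX.
  move=> z [/= ]; rewrite !in_itv /= => /andP[k1 k2] k3; split; last by apply/negP; rewrite -leNgt.
  split => //; rewrite (surjective_pairing z); apply/(cd_left H); [exact: lt_trans k1|exact: le_lt_trans k2 _|].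
  have := cd_mono H as_ (ltW k1) (le_lt_trans k2 sa); apply: lt_le_trans.
  by rewrite ltr_norml.
rewrite -lee_fin -Em (_ : 2 * b s' * (s' - s) = (s' - s) * (b s' - - b s')); last by ring.
rewrite -I2_box_oc; [|exact: ltW|plra].
apply: I2_subset => //; first exact: measurableX.
move=> z [[Az /= k1] /negP]; rewrite -leNgt => k2.
have : `|z.2| < b z.1.
  by apply/(cd_left H); [exact: lt_trans k1|exact: le_lt_trans k2 _|rewrite -surjective_pairing].
move=> /lt_le_trans/(_ (cd_mono H (lt_trans as_ k1) k2 sa)); rewrite ltr_norml => k3.
by split; rewrite /= in_itv /= ?k1.
Qed.

Lemma rarea_bounds (R : realType) (omega : R -> R) (a L : R) (A : set (R * R)) (b b' : R -> R) s :
  cap_domain omega a L A b b' -> a < s -> s < a + 2 / 5 ->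
  [/\ 1 <= rarea A s, rarea A s <= a * L & a * L - 2 * b s * (s - a) <= rarea A s].
Proof.
move=> H as_ sa; have mA := open_measurable2 (cd_open H).
have [E1 _] := rareaE s H; have [m1 _] := half_measurable s.
have mI := measurableI _ _ mA m1.
split.
(* The unit square centred at (a + 1, 0) lies in the diamond of [cd_diamond]. *)
- have := @I2_box R (a + 1 / 2) (a + 3 / 2) (- (1 / 2)) (1 / 2) ltac:(plra) ltac:(plra).
  rewrite -lee_fin -E1 (_ : (a + 3 / 2 - (a + 1 / 2)) * (1 / 2 - - (1 / 2)) = 1); last by field.
  move=> <-; apply: I2_subset => //; first exact: measurableX.
  move=> z [/= ]; rewrite !in_itv /= => /andP[h1 h2] /andP[h3 h4]; split => /=; last by plra.
  apply: (cd_diamond H).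
  have k1 : `|z.1 - a - 1| < 1 / 2 by rewrite ltr_norml; apply/andP; split; plra.
  have k2 : `|z.2| < 1 / 2 by rewrite ltr_norml; apply/andP; split; plra.
  by plra.
- by rewrite -lee_fin -E1 -(cd_area H); apply: I2_subset => // z [].
apply/ler_addgt0Pr => e e0.
have /andP[ba _] : 0 < b s <= 2^-1.
  by have [/andP[L0 _] /andP[h ->]] := (cd_L H, cd_b H as_ sa); rewrite andbT; plra.
have mS : measurable ((A `\` [set z : R * R | s < z.1])) by exact: measurableD.
have [m m0 Em] := cd_finite H mS (fun z h => proj1 h).
have E : a * L = rarea A s + m.
  by apply: EFin_inj; rewrite EFinD -E1 -Em -(cd_area H) -I2_split.
suff : m <= 2 * b s * (s - a) + e by rewrite E; plra.
apply: (@le_trans _ _ (2 * b s * (s - a))); last by rewrite lerDl ltW.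
rewrite -lee_fin -Em (_ : 2 * b s * (s - a) = (s - a) * (b s - - b s)); last by ring.
rewrite -I2_box_oc; [|exact: ltW|plra]; apply: I2_subset => //; first exact: measurableX.
move=> z [Az /negP]; rewrite -leNgt => k2; have [/andP[az _] _] := cd_bd H Az.
have : `|z.2| < b z.1.
  by apply/(cd_left H) => //; [exact: le_lt_trans k2 _|rewrite -surjective_pairing].
move=> /lt_le_trans/(_ (cd_mono H az k2 sa)); rewrite ltr_norml => k3.
by split; rewrite /= in_itv /= ?az.
Qed.

Lemma cd_b_cont (R : realType) (omega : R -> R) (a L : R) (A : set (R * R)) (b b' : R -> R) s :
  cap_domain omega a L A b b' -> a < s -> s < a + 2 / 5 -> {for s, continuous b}.
Proof.
move=> H h1 h2; have [[db _] _] := cd_der H h1 h2.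
by apply: differentiable_continuous; apply/derivable1_diffP.
Qed.

Lemma rarea_derive (R : realType) (omega : R -> R) (a L : R) (A : set (R * R)) (b b' : R -> R) s :
  cap_domain omega a L A b b' -> a < s -> s < a + 2 / 5 -> is_derive s 1 (rarea A) (- (2 * b s)).
Proof.
move=> H as_ sa.
have d : is_derive s 1 (fun x => - rarea A x) (2 * b s).
  pose e := Num.min (s - a) (a + 2 / 5 - s).
  have e0 : 0 < e by rewrite lt_min !subr_gt0 as_.
  have e1 : e <= s - a by rewrite ge_min lexx.
  have e2 : e <= a + 2 / 5 - s by rewrite ge_min lexx orbT.
  apply: (@squeeze_derive R (fun x => - rarea A x) (fun x => 2 * b x) s e) => //.
    by apply: cvgM; [exact: cvg_cst|exact: (cd_b_cont H)].
  move=> x y h1 h2 h3; rewrite opprK (addrC (- rarea A y)).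
  by apply: (rarea_diff H) => //; [clear - h1 e1; lra|clear - h3 e2; lra].
rewrite (_ : rarea A = fun x => - - rarea A x); first exact: is_deriveN.
by apply/funext => x; rewrite opprK.
Qed.

(* The slope [chi] balances the mass of [A] to the right of [s] against the length of the
   vertical chord; [cap_slope] truncates it at the chord abscissa [sig] and at the slope [k]. *)
Definition chi (R : realType) (A : set (R * R)) (b : R -> R) (s : R) : R := s - rarea A s / (2 * b s).

Definition cap_slope (R : realType) (A : set (R * R)) (b : R -> R) (sig k s : R) : R :=
  Num.min (chi A b (Num.min s sig)) k.

Lemma chi_spec (R : realType) (omega : R -> R) (a L : R) (A : set (R * R)) (b b' : R -> R) :
  cap_domain omega a L A b b' ->
  [/\ forall s, a < s -> s < a + 2 / 5 -> 0 <= chi A b s /\ {for s, continuous (chi A b)},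
      forall s s', a < s -> s <= s' -> s' < a + 2 / 5 -> chi A b s <= chi A b s' &
      forall s, a < s -> s < a + 2 / 5 ->
        a * (1 - L / (2 * b s)) <= chi A b s <= 2 * (s - a) + a * (1 - L / (2 * b s))].
Proof.
move=> H; have abig := cd_big H; have a0 : 0 <= a by clear - abig; lra.
have /andP[L0 _] := cd_L H.
have b0 s : a < s -> s < a + 2 / 5 -> 0 < 2 * b s by move=> h1 h2; have /andP[k _] := cd_b H h1 h2; plra.
have bnd s : a < s -> s < a + 2 / 5 ->
        a * (1 - L / (2 * b s)) <= chi A b s <= 2 * (s - a) + a * (1 - L / (2 * b s)).
  move=> h1 h2; have [_ k2 k3] := rarea_bounds H h1 h2; have bs := b0 _ h1 h2.
  have q1 : rarea A s / (2 * b s) <= a * L / (2 * b s) by rewrite ler_pM2r ?invr_gt0.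
  have q2 : a * L / (2 * b s) - (s - a) <= rarea A s / (2 * b s).
    by rewrite ler_pdivlMr // mulrBl mulfVK ?gt_eqF //; move: k3; rewrite [(s - a) * _]mulrC.
  have q3 : a * (1 - L / (2 * b s)) = a - a * L / (2 * b s) by ring.
  by rewrite /chi q3; apply/andP; split; clear - q1 q2 h1; lra.
split=> // [s h1 h2|s s' h1 h2 h3].
  split.
    have /andP[k _] := bnd _ h1 h2; apply: le_trans k; apply: mulr_ge0 => //.
    by rewrite subr_ge0 ler_pdivrMr ?b0 // mul1r; have /andP[k _] := cd_b H h1 h2; plra.
  apply: cvgB; first exact: cvg_id.
  apply: cvgM; first by have [d _] := rarea_derive H h1 h2; apply: differentiable_continuous; apply/derivable1_diffP.
  apply: cvgV; first by rewrite gt_eqF ?b0.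
  by apply: cvgM; [exact: cvg_cst|exact: (cd_b_cont H)].
apply: lerB => //.
have as' : a < s' by exact: lt_le_trans h2.
have sa : s < a + 2 / 5 by exact: le_lt_trans h3.
have [r1 _ _] := rarea_bounds H as' h3; have [r2 _ _] := rarea_bounds H h1 sa.
apply: ler_pM.
- by clear - r1; lra.
- by rewrite invr_ge0 ltW ?b0.
- move: h2; rewrite le_eqVlt => /orP[/eqP -> //|h2].
  have /andP[k _] := rarea_diff H h1 h2 h3; rewrite -subr_ge0; apply: le_trans k.
  by rewrite mulr_ge0 ?subr_ge0 ?(ltW h2) // ltW ?b0.
by rewrite lef_pV2 ?posrE ?b0 // ler_pM2l //; exact: (cd_mono H).
Qed.

Lemma cap_slope_spec (R : realType) (omega : R -> R) (a L : R) (A : set (R * R)) (b b' : R -> R) (sig k : R) :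
  cap_domain omega a L A b b' -> a < sig -> sig < a + 2 / 5 -> 0 < k ->
  [/\ forall s, a < s -> 0 <= cap_slope A b sig k s <= k,
      forall s s', a < s -> s <= s' -> cap_slope A b sig k s <= cap_slope A b sig k s' &
      forall s, a < s -> {for s, continuous (cap_slope A b sig k)}].
Proof.
move=> H as_ sa k0; have [c1 c2 _] := chi_spec H.
have mn s : a < s -> a < Num.min s sig by move=> h; rewrite lt_min h.
have mx s : Num.min s sig < a + 2 / 5 by rewrite gt_min sa orbT.
split=> [s h|s s' h1 h2|s h].
- by rewrite /cap_slope le_min (ltW k0) ge_min lexx orbT andbT /=; have [-> _] := c1 _ (mn _ h) (mx s).
- rewrite /cap_slope le_min !ge_min lexx orbT andbT c2 ?mn ?mx //.
  by rewrite le_min !ge_min h2 lexx orbT.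
have cm : {for s, continuous (fun s => Num.min s sig)} by apply: continuous_min; [exact: cvg_id|exact: cvg_cst].
apply: continuous_min; last exact: cvg_cst.
have [_ cc] := c1 _ (mn _ h) (mx s).
exact: (continuous_comp cm cc).
Qed.

Lemma psi_exists (R : realType) (omega : R -> R) (a L : R) (A : set (R * R)) (b b' : R -> R) (sig k : R) :
  cap_domain omega a L A b b' -> a < sig -> sig < a + 2 / 5 -> 0 < k ->
  exists psi : R -> R, (forall s, a < s -> s < a + 1 -> is_derive s 1 psi (cap_slope A b sig k s)) /\
    (forall s, a < s -> s < a + 1 -> 0 <= psi s <= k * (s - a)).
Proof.
move=> H as_ sa k0; have [G1 G2 G3] := cap_slope_spec H as_ sa k0.
set G := cap_slope A b sig k in G1 G2 G3 *.
have mG s : measurable_fun `]a, s]%classic G.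
  apply: interval_mono_measurable; first exact: interval_is_interval.
  by move=> x y /=; rewrite in_itv /= => /andP[ax _] _; exact: G2.
have iG s : (@lebesgue_measure R).-integrable `]a, s] (EFin \o G).
  apply: (@bounded_integrable_oc _ _ _ _ k); first exact: mG.
  by move=> x /andP[ax _]; have /andP[h1 h2] := G1 _ ax; rewrite ger0_norm.
exists (fun s => \int[@lebesgue_measure R]_(t in [set` Interval (BRight a) (BRight s)]) G t); split=> s h1 h2.
  have [d E] := @continuous_FTC1 R G (BRight a) s (a + 1) h2 (iG (a + 1)) ltac:(exact: h1) (G3 _ h1).
  by split; [exact: d|rewrite -derive1E; exact: E].
apply/andP; split.
  by apply: Rintegral_ge0 => x /=; rewrite in_itv /= => /andP[ax _]; have /andP[] := G1 _ ax.
have ic : (@lebesgue_measure R).-integrable `]a, s] (EFin \o cst k).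
  by apply: (@bounded_integrable_oc _ _ _ _ `|k|).
apply: (@le_trans _ _ (\int[@lebesgue_measure R]_(t in `]a, s]) (cst k t))).
  apply: le_Rintegral => // x /=.
  by rewrite in_itv /= => /andP[ax _]; have /andP[] := G1 _ ax.
have m1 : (@lebesgue_measure R) `]a, s]%classic = (s - a)%:E.
  by rewrite lebesgue_measure_itv /= lte_fin h1 -EFinB.
rewrite Rintegral_cst // (_ : fine _ = s - a) //; exact: (congr1 fine m1).
Qed.

(** The segment from x to y crosses the flat chord at q, where u equals its supporting affine
    function. Beyond q, convexity between q and y applies, and the weight r of y there is at most
    t. *)
Lemma glue_half (R : realType) (A : set (R * R)) (u : R * R -> R) (sig k c t : R) (x y : R * R) :
  cset2 A -> cvx2 A u -> (forall z, A z -> c + k * (z.1 - sig) <= u z) -> (forall s, A (sig, s) -> u (sig, s) = c) ->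
  A x -> A y -> x.1 <= sig -> sig < y.1 -> 0 <= t -> t <= 1 -> sig < x.1 + t * (y.1 - x.1) ->
  u (x.1 + t * (y.1 - x.1), x.2 + t * (y.2 - x.2)) - c - k * (x.1 + t * (y.1 - x.1) - sig) <=
  t * (u y - c - k * (y.1 - sig)).
Proof.
move=> cA cu hp hc Ax Ay xs ys t0 t1 ms.
have yx : 0 < y.1 - x.1 by rewrite subr_gt0; exact: le_lt_trans ys.
pose l := (sig - x.1) / (y.1 - x.1).
have l0 : 0 <= l by rewrite divr_ge0 ?(ltW yx) // subr_ge0.
have l1 : l < 1 by rewrite ltr_pdivrMr // mul1r; clear - ys; lra.
have lt : l < t by rewrite ltr_pdivrMr //; clear - ms; lra.
have lE : l * (y.1 - x.1) = sig - x.1 by rewrite /l mulfVK // gt_eqF.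
have h1l : 0 < 1 - l by rewrite subr_gt0.
pose r := (t - l) / (1 - l).
have rE : r * (1 - l) = t - l by rewrite /r mulfVK // gt_eqF.
have r0 : 0 <= r by rewrite divr_ge0 ?subr_ge0 // ltW.
have r1 : r <= 1 by rewrite ler_pdivrMr // mul1r lerD2r.
have rt : r <= t.
  rewrite ler_pdivrMr // mulrBr mulr1 lerD2l lerN2 mulrC.
  by rewrite -{2}[l]mulr1 ler_wpM2l.
pose q : R * R := (sig, x.2 + l * (y.2 - x.2)).
have Aq : A q by have := cA _ _ l Ax Ay l0 (ltW l1); rewrite lE addrC subrK.
have uq : u q = c by exact: hc.
have E1 : x.1 + t * (y.1 - x.1) - sig = r * (y.1 - sig).
  have -> : t = r * (1 - l) + l by rewrite rE subrK.
  by rewrite mulrDl lE -mulrA mulrBl mul1r lE; ring.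
have E2 : x.2 + t * (y.2 - x.2) = q.2 + r * (y.2 - q.2).
  have -> : t = r * (1 - l) + l by rewrite rE subrK.
  by rewrite /q /=; ring.
have := cu q y r Aq Ay r0 r1; rewrite -E2 /= uq -E1 addrC subrK => h.
have v0 : 0 <= u y - c - k * (y.1 - sig) by have := hp _ Ay; clear; lra.
have h2 : r * (u y - c - k * (y.1 - sig)) <= t * (u y - c - k * (y.1 - sig)) by rewrite ler_wpM2r.
apply: le_trans h2; rewrite E1; clear - h; lra.
Qed.

(** The shift [psi sig - c] makes the two pieces match along the flat chord, where u equals c. *)
Definition glue (R : realType) (psi : R -> R) (u : R * R -> R) (sig c : R) (z : R * R) : R :=
  if z.1 <= sig then psi z.1 else u z + (psi sig - c).

(** The glued function is the sum of two convex functions: [ps], which is psi continued beyond sig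
    by a line of slope k, and [w], which is 0 on the left and the excess of u over its supporting
    affine function on the right. *)
Lemma glue_inK (R : realType) (A : set (R * R)) (psi G : R -> R) (u : R * R -> R) (a sig k c : R) :
  cset2 A -> cvx2 A u -> (forall z, A z -> a < z.1) -> 0 <= k -> a < sig ->
  (forall z, A z -> c + k * (z.1 - sig) <= u z) -> (forall s, A (sig, s) -> u (sig, s) = c) ->
  (forall s, a < s -> s <= sig -> 0 <= psi s) -> (forall s, a < s -> G s <= k) ->
  (forall x y, a < x -> x <= sig -> a < y -> y <= sig -> psi x + G x * (y - x) <= psi y) ->
  inK A (glue psi u sig c).
Proof.
move=> cA cu hA k0 as_ hp hc psi0 Gk sub.
pose ps (s : R) := if s <= sig then psi s else psi sig + k * (s - sig).
pose w (z : R * R) := if z.1 <= sig then 0 else u z - c - k * (z.1 - sig).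
have gE z : glue psi u sig c z = ps z.1 + w z.
  by rewrite /glue /ps /w; case: (leP z.1 sig) => _; [rewrite addr0|ring].
have w0 z : A z -> 0 <= w z by move=> Az; rewrite /w; case: (leP z.1 sig) => // _; have := hp _ Az; clear; lra.
have cps x : a < x -> exists g, forall y, a < y -> ps x + g * (y - x) <= ps y.
  move=> ax; rewrite /ps; case: (leP x sig) => [xs|xs].
    exists (G x) => y ay; case: (leP y sig) => [ys|ys]; first exact: sub.
    have := sub x sig ax xs as_ (lexx _).
    have : G x * (y - sig) <= k * (y - sig) by rewrite ler_wpM2r ?subr_ge0 ?(ltW ys) // Gk.
    by clear; lra.
  exists k => y ay; case: (leP y sig) => [ys|ys]; last by clear; lra.
  have := sub sig y as_ (lexx _) ay ys.
  have : k * (y - sig) <= G sig * (y - sig) by rewrite ler_wnM2r ?subr_le0 // Gk.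
  by clear; lra.
split; last first.
  move=> z Az; rewrite /glue; case: (leP z.1 sig) => zs; first by apply: psi0 => //; exact: hA.
  have := hp _ Az; have := psi0 _ as_ (lexx _).
  have : 0 <= k * (z.1 - sig) by rewrite mulr_ge0 // subr_ge0 ltW.
  by clear; lra.
have sw (p q t : R) : p + t * (q - p) = q + (1 - t) * (p - q) by ring.
have half x y t : A x -> A y -> 0 <= t -> t <= 1 -> x.1 <= sig -> sig < y.1 ->
    w (x.1 + t * (y.1 - x.1), x.2 + t * (y.2 - x.2)) <= t * w y.
  move=> Ax Ay t0 t1 xs ys; rewrite {1}/w /=; case: (leP (_ + _) sig) => ms; first by rewrite mulr_ge0 ?w0.
  have ny : (y.1 <= sig) = false by rewrite leNgt ys.
  by rewrite /w ny; exact: (glue_half cA cu hp hc).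
have cw x y t : A x -> A y -> 0 <= t -> t <= 1 ->
    w (x.1 + t * (y.1 - x.1), x.2 + t * (y.2 - x.2)) <= w x + t * (w y - w x).
  move=> Ax Ay t0 t1.
  have t10 : 0 <= 1 - t by rewrite subr_ge0.
  case: (leP x.1 sig) => [xs|xs]; case: (leP y.1 sig) => [ys|ys].
  - rewrite /w /= xs ys subrr mulr0 addr0 ifT //.
    have : t * (y.1 - x.1) <= t * (sig - x.1) by rewrite ler_wpM2l // lerD2r.
    have : t * (sig - x.1) <= 1 * (sig - x.1) by rewrite ler_wpM2r ?subr_ge0.
    by clear; lra.
  - by apply: le_trans (half x y t Ax Ay t0 t1 xs ys) _; rewrite {2 4}/w xs add0r subr0.
  - rewrite (sw x.1) (sw x.2); apply: le_trans (half y x (1 - t) Ay Ax t10 _ ys xs) _; first by rewrite gerBl.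
    by rewrite {3}/w ys sub0r; clear; lra.
  have nx : (x.1 <= sig) = false by rewrite leNgt xs.
  have ny : (y.1 <= sig) = false by rewrite leNgt ys.
  have nm : (x.1 + t * (y.1 - x.1) <= sig) = false.
    apply/negbTE; rewrite -ltNge (_ : x.1 + t * (y.1 - x.1) = - (- x.1 + t * (- y.1 - - x.1))); last by ring.
    by rewrite ltrNr; apply: mul_lt_conv; rewrite ?ltrN2.
  rewrite /w /= nx ny nm; have := cu x y t Ax Ay t0 t1; clear; lra.
move=> x y t Ax Ay t0 t1; rewrite !gE /=.
have am : a < x.1 + t * (y.1 - x.1).
  rewrite (_ : x.1 + t * (y.1 - x.1) = - (- x.1 + t * (- y.1 - - x.1))); last by ring.
  by rewrite ltrNr; apply: mul_lt_conv; rewrite ?ltrN2 ?hA.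
have pm : ps (x.1 + t * (y.1 - x.1)) <= ps x.1 + t * (ps y.1 - ps x.1).
  set m := x.1 + _ in am *; have [g hg] := cps m am.
  have k1 : (1 - t) * (ps m + g * (x.1 - m)) <= (1 - t) * ps x.1 by rewrite ler_wpM2l ?subr_ge0 // hg // hA.
  have k2 : t * (ps m + g * (y.1 - m)) <= t * ps y.1 by rewrite ler_wpM2l // hg // hA.
  have E : (1 - t) * (ps m + g * (x.1 - m)) + t * (ps m + g * (y.1 - m)) = ps m by rewrite /m; ring.
  by move: k1 k2 E; clear; lra.
by have := cw x y t Ax Ay t0 t1; move: pm; clear; lra.
Qed.

(** * Comparison with the glued competitor and the gradient near the left side *)

Definition cyl (R : realType) (s0 sig : R) : set (R * R) := [set w | s0 < w.1 < sig /\ `|w.2| < 1].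

(** The substitution t = b s y on each vertical chord straightens the part of A between s0 and sig;
    rows of the cylinder correspond to the curves s -> (s, b s y), which follow the shape of the
    boundary. *)
Lemma cap_param (R : realType) (omega : R -> R) (a L : R) (A : set (R * R)) (b b' : R -> R) (s0 sig : R) (f : R * R -> R) :
  cap_domain omega a L A b b' -> a < s0 -> sig < a + 2 / 5 ->
  (forall z, A z -> z.1 < a + 2 / 5 -> {for z, continuous f}) -> (forall z, A z -> z.1 < a + 2 / 5 -> 0 <= f z) ->
  [/\ measurable_fun (cyl s0 sig) (fun w => b w.1 * f (w.1, b w.1 * w.2)),
      forall w, (cyl s0 sig) w -> 0 <= b w.1 * f (w.1, b w.1 * w.2) &
  I2 (A `&` [set z | s0 < z.1 < sig]) f =
    I2 (cyl s0 sig) (fun w => b w.1 * f (w.1, b w.1 * w.2))].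
Proof.
move=> H as0 sa cf f0; have oA := cd_open H.
set Q := cyl s0 sig.
have b0 s : s0 < s -> s < sig -> 0 < b s.
  move=> h1 h2; have /andP[h _] := cd_b H (lt_trans as0 h1) (lt_trans h2 sa).
  by have /andP[L0 _] := cd_L H; apply: le_lt_trans h; rewrite divr_ge0 // ltW.
have Qin w : Q w -> [/\ s0 < w.1, w.1 < sig & `|w.2| < 1].
  by move=> [/andP[h1 h2] h3].
have inA s y : s0 < s -> s < sig -> A (s, b s * y) <-> `|y| < 1.
  move=> h1 h2; rewrite (cd_left H) //; [|exact: lt_trans h1|exact: lt_trans h2 sa].
  by rewrite normrM (gtr0_norm (b0 _ h1 h2)) gtr_pMr ?b0.
have QA w : Q w -> A (w.1, b w.1 * w.2) by move=> /Qin[h1 h2 h3]; apply/inA.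
have oQ : open Q.
  apply: square_open => w Qw; have [h1 h2 /ltr_normlP[h3 h4]] := Qin _ Qw.
  pose r := Num.min (Num.min (w.1 - s0) (sig - w.1)) (Num.min (w.2 + 1) (1 - w.2)).
  have r0 : 0 < r by rewrite !lt_min !subr_gt0 h1 h2 /=; apply/andP; split; clear - h3 h4; lra.
  have r1 : r <= w.1 - s0 by rewrite !ge_min lexx.
  have r2 : r <= sig - w.1 by rewrite !ge_min lexx orbT.
  have r3 : r <= w.2 + 1 by rewrite !ge_min lexx !orbT.
  have r4 : r <= 1 - w.2 by rewrite !ge_min lexx !orbT.
  exists r => // y; rewrite !ltr_norml => /andP[y1 y2] /andP[y3 y4].
  split; rewrite /= ?ltr_norml; apply/andP; split.
  - by clear - y1 r1; lra.
  - by clear - y2 r2; lra.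
  - by clear - y3 r3; lra.
  by clear - y4 r4; lra.
have mQ := open_measurable2 oQ.
have cF w : Q w -> {for w, continuous (fun w => b w.1 * f (w.1, b w.1 * w.2))}.
  move=> Qw; have [h1 h2 h3] := Qin _ Qw.
  have cb : (fun w : R * R => b w.1) @ w --> b w.1.
    have c1 : (fun w : R * R => w.1) @ w --> w.1 by exact: cvg_fst.
    by apply: (cvg_comp _ _ c1); apply: (cd_b_cont H); [exact: lt_trans h1|exact: lt_trans h2 sa].
  have c1 : (fun w : R * R => w.1) @ w --> w.1 by exact: cvg_fst.
  have c2 : (fun w : R * R => b w.1 * w.2) @ w --> b w.1 * w.2 by apply: cvgM => //; exact: cvg_snd.
  have c3 : (fun w : R * R => (w.1, b w.1 * w.2)) @ w --> ((w.1, b w.1 * w.2) : R * R) by exact: (cvg_pair c1 c2).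
  have c4 : (fun w : R * R => f (w.1, b w.1 * w.2)) @ w --> f (w.1, b w.1 * w.2).
    by apply: (cvg_comp _ _ c3); apply: cf; [exact: QA|exact: lt_trans h2 sa].
  exact: (cvgM cb c4).
have mF : measurable_fun Q (fun w => b w.1 * f (w.1, b w.1 * w.2)) by apply: open_continuous_measurable2 => // w; exact: cF.
have F0 w : Q w -> 0 <= b w.1 * f (w.1, b w.1 * w.2).
  by move=> Qw; have [h1 h2 h3] := Qin _ Qw; rewrite mulr_ge0 ?f0 ?(ltW (b0 _ h1 h2)) //; [exact: QA|exact: lt_trans h2 sa].
split=> //.
set S := A `&` _.
have oS : open S.
  have [ho1 ho1'] := half_open s0.
  have [ho2' ho2] := half_open sig.
  rewrite (_ : S = A `&` ([set z | s0 < z.1] `&` [set z | z.1 < sig])); first by do 2!apply: openI => //.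
  by apply/seteqP; split => [z [Az /andP[]]|z [Az [/= h1 h2]]]; split => //=; rewrite h1.
have mS := open_measurable2 oS.
have S2 z : S z -> z.1 < a + 2 / 5 by move=> [_ /andP[_ h]]; exact: lt_trans h sa.
have mf : measurable_fun S f by apply: open_continuous_measurable2 => // z Sz; apply: cf; [case: Sz|exact: S2].
have fS0 z : S z -> 0 <= f z by move=> Sz; apply: f0; [case: Sz|exact: S2].
rewrite (I2_cols mS mf fS0) (I2_cols mQ mF F0); apply: eq_integral => s _.
have [/andP[h1 h2]|hn] := boolP (s0 < s < sig); last first.
  have -> : col S s = set0 by rewrite -subset0 => t [_ /= h]; move: hn; rewrite h.
  have -> : col Q s = set0 by rewrite -subset0 => t /Qin[/= k1 k2 _]; move: hn; rewrite k1 k2.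
  by rewrite !integral_set0.
have bs := b0 _ h1 h2.
have mc : measurable (col S s) by apply: open_measurable; exact: col_open.
have mfc : measurable_fun (col S s) (fun t => (f (s, t))%:E).
  by apply: (@col_measurable_fun R S (fun z => (f z)%:E) s mS); exact/measurable_EFinP.
rewrite (@lebesgue_scale R 0 (b s) (col S s) (fun t => (f (s, t))%:E) bs mc mfc); last first.
  by move=> t St; rewrite lee_fin; exact: (fS0 (s, t)).
have -> : [set x | col S s (0 + b s * x)] = col Q s.
  apply/seteqP; split => [x [/= ]|x Qx].
    rewrite add0r => /(inA _ _ h1 h2).
    by move=> hx _; split; rewrite /= ?h1.
  have [_ _ /= h3] := Qin _ Qx.
  by rewrite /= add0r; split; [apply/inA|rewrite /= h1].
rewrite -ge0_integralZl //.
- by apply: eq_integral => t _; rewrite add0r EFinM.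
- by apply: open_measurable; exact: col_open.
- have h : measurable_fun (col Q s) (fun t => (b s)^-1%:E * (b s * f (s, b s * t))%:E)%E.
    apply: measurable_funeM; apply: (@col_measurable_fun R Q (fun w => (b w.1 * f (w.1, b w.1 * w.2))%:E) s mQ).
    exact/measurable_EFinP.
  apply: eq_measurable_fun h => t _.
  by rewrite add0r -EFinM mulKf // gt_eqF.
- move=> t Qt; rewrite add0r lee_fin; have [_ _ /= h3] := Qin _ Qt.
  by apply: f0; [apply/inA|exact: lt_trans h2 sa].
by rewrite lee_fin ltW.
Qed.

(* With [p = u_1], [q = u_2] the integrand of the first variation along the curve [s |-> (s, b s y)] is, up to
   the derivative of [Ar s / 2 (psi s - u)], the sum of [(G - p) (Ar / 2 - b (s - G))] and
   [y q (b ^ 2 - Ar b' / 2)], both nonpositive. *)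
Lemma curve_ineq (R : realType) (Ar b b' G k p q s y ps uu : R) :
  0 < b -> p <= k -> G = s - Ar / (2 * b) \/ (G = k /\ G <= s - Ar / (2 * b)) -> 0 <= q * (b * y) ->
  b <= 2^-1 -> 1 <= Ar -> 1 <= b' ->
  b * (2^-1 * ((p - G) ^+ 2 + q ^+ 2) + (2^-1 * ((G - s) ^+ 2 + (b * y) ^+ 2) + ps)) +
    2^-1 * (- (2 * b) * (ps - uu) + Ar * (G - (p + q * (b' * y)))) <=
  b * (2^-1 * ((p - s) ^+ 2 + (q - b * y) ^+ 2) + uu).
Proof.
move=> b0 pk hG qy bh Ar1 b1; rewrite -subr_le0.
rewrite (_ : _ - _ = (G - p) * (Ar / 2 - b * (s - G)) + q * y * (b ^+ 2 - Ar * b' / 2)); last by field.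
have k1 : (G - p) * (Ar / 2 - b * (s - G)) <= 0.
  have [E|[E hle]] := hG.
    by rewrite E (_ : Ar / 2 - _ = 0) ?mulr0 //; field; rewrite gt_eqF.
  rewrite mulr_ge0_le0 //; first by rewrite E subr_ge0.
  have : b * (Ar / (2 * b)) <= b * (s - G) by rewrite ler_pM2l //; move: hle; clear; lra.
  rewrite (_ : b * (Ar / (2 * b)) = Ar / 2); last by field; rewrite gt_eqF.
  by clear; lra.
have qy0 : 0 <= q * y by move: qy; rewrite mulrCA pmulr_rge0.
have k2 : q * y * (b ^+ 2 - Ar * b' / 2) <= 0.
  rewrite mulr_ge0_le0 // subr_le0.
  apply: (@le_trans _ _ 2^-1).
    apply: (@le_trans _ _ (2^-1 * 1)); last by rewrite mulr1.
    by rewrite expr2; apply: ler_pM; rewrite ?(ltW b0) //; move: bh; clear; lra.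
  rewrite ler_pdivlMr // mulVf //.
  by rewrite -[X in X <= _]mulr1; apply: ler_pM.
by move: k1 k2; clear; lra.
Qed.

(** Minimality against V split into the part T to the right of the chord, where the densities differ
    by the constant kap, the part S under study and the remainder. All integrals but one are turned
    into real numbers so that they can be subtracted. *)
Lemma glue_energy (R : realType) (A S T : set (R * R)) (u V : R * R -> R) (kap A0 st lP : R) (P : R * R -> R) :
  open A -> cset2 A -> inK A u -> En A u \is a fin_num -> inK A V -> (En A u <= En A V)%E ->
  measurable S -> measurable T -> S `<=` A -> T `<=` A -> (forall z, S z -> ~ T z) ->
  (forall z, T z -> den V z = den u z + kap) -> I2 T (fun=> 1) = A0%:E ->
  I2 ((A `\` T) `\` S) (den V) = st%:E -> I2 S (den V) = lP%:E ->
  exists lu, [/\ I2 S (den u) = lu%:E, 0 <= lu & lu <= st + lP + kap * A0].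
Proof.
move=> oA cA [cu u0] fu [cV V0] huV mS mT SA TA dST dT hA0 hst hlP; have mA := open_measurable2 oA.
have mdu := den_measurable oA cA cu; have mdV := den_measurable oA cA cV.
have du0 z : A z -> 0 <= den u z by move=> Az; rewrite den_ge0 ?u0.
have dV0 z : A z -> 0 <= den V z by move=> Az; rewrite den_ge0 ?V0.
have fin X : measurable X -> X `<=` A -> exists2 r : R, 0 <= r & I2 X (den u) = r%:E.
  move=> mX XA; suff h : I2 X (den u) \is a fin_num.
    by exists (fine (I2 X (den u))); rewrite ?fine_ge0 ?fineK // I2_ge0 // => z /XA/du0.
  rewrite ge0_fin_numE; last by apply: I2_ge0 => z /XA/du0.
  apply: le_lt_trans (_ : (En A u < +oo)%E); last by rewrite -ge0_fin_numE ?En_ge0.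
  by apply: I2_subset.
have [ru ru0 Eru] := fin _ mT TA; have [lu lu0 Elu] := fin _ mS SA.
have mAT : measurable (A `\` T) by exact: measurableD.
have mX : measurable ((A `\` T) `\` S) by exact: measurableD.
have [su su0 Esu] := fin _ mX (fun z h => proj1 (proj1 h)).
have AT : A `&` T = T by apply/seteqP; split => [z []//|z Tz]; split => //; exact: TA.
have ATS : (A `\` T) `&` S = S.
  by apply/seteqP; split => [z []//|z Sz]; split => //; split; [exact: SA|exact: dST].
have split3 f : measurable_fun A f -> I2 A f = (I2 T f + (I2 S f + I2 ((A `\` T) `\` S) f))%E.
  move=> mf; rewrite (I2_split mA mT mf) AT (@I2_split R (A `\` T) S) ?ATS //.
  by apply: measurable_funS mf => // z [].
have mdVT : measurable_fun T (den V) by exact: measurable_funS mdV.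
have mduT : measurable_fun T (den u) by exact: measurable_funS mdu.
(* The constant kap may be negative; adding |kap| on both sides keeps all integrands nonnegative. *)
have E1 : (I2 T (den V) + (`|kap| * A0)%:E = ru%:E + ((kap + `|kap|) * A0)%:E)%E.
  have k0 : 0 <= kap + `|kap| by have := ler_norm (- kap); rewrite normrN; clear; lra.
  have c (r : R) : 0 <= r -> (r * A0)%:E = I2 T (fun=> r)%R.
    by move=> r0; rewrite EFinM -hA0 -I2Z //; apply: I2_ext => z _; rewrite mulr1.
  rewrite !c // -Eru -!I2D //; try by move=> z /TA; first [exact: du0|exact: dV0].
  by apply: I2_ext => z Tz; rewrite dT //; ring.
exists lu; split => //.
move: huV; rewrite /En (split3 _ mdu) (split3 _ mdV) Eru Elu Esu hst hlP.
move: E1; case: (I2 T (den V)) => [x| |] //=.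
by rewrite -!EFinD !lee_fin => -[]; move: su0; clear => *; nra.
Qed.

Lemma half_prod_derive (R : realType) (Ar ps w : R -> R) (s dA dp dw : R) :
  is_derive s 1 Ar dA -> is_derive s 1 ps dp -> is_derive s 1 w dw ->
  is_derive s 1 (fun s => 2^-1 * (Ar s * (ps s - w s))) (2^-1 * (dA * (ps s - w s) + Ar s * (dp - dw))).
Proof.
move=> d1 d2 d3; have d8 := is_deriveZ 2^-1 (is_deriveM d1 (is_deriveB d2 d3)).
rewrite (_ : (fun s => _) = 2^-1 \*: (Ar * (ps - w))) //.
apply: is_derive_eq d8 _; rewrite /GRing.scale /= [(ps - w) s](_ : _ = ps s - w s) //.
by rewrite [RHS]mulrDr [LHS]mulrDr [X in X + _]mulrC; ring.
Qed.

(** Integrating [curve_ineq] over the curves bounds the energy of u on the left from below by that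
    of psi plus half the squared distance of Du from (G, 0), plus boundary terms. Minimality against
    the glued function gives the opposite bound. The boundary term at sig cancels the shift of the
    energy on the right, and what is left is proportional to s0 - a, which tends to 0. *)
Lemma left_gradient (R : realType) (omega : R -> R) (a L : R) (A : set (R * R)) (b b' : R -> R) (u : R * R -> R) (sig : R) :
  cap_domain omega a L A b b' -> cap_min A u -> a < sig -> sig < a + 2 / 5 -> 0 < r1 u (sig, 0) ->
  (forall t, A (sig, t) -> u (sig, t) = u (sig, 0)) ->
  forall z, A z -> z.1 < sig -> r1 u z = cap_slope A b sig (r1 u (sig, 0)) z.1.
Proof.
move=> H M as_ sa k0 hc; have oA := cd_open H; have cA := cd_cvx H; have [cu u0] := cm_K M.
have abig := cd_big H; have a0 : 0 < a by clear - abig; lra.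
set k := r1 u (sig, 0) in k0 *; pose c := u (sig, 0).
have mA := open_measurable2 oA.
have As : A (sig, 0) by apply: (cd_axis H); clear - as_ sa; lra.
(* As u is constant on the chord, the supporting plane at (sig, 0) depends on x_1 only, so k is a
   slope of support along the whole chord. *)
have r2s : r2 u (sig, 0) = 0.
  apply: (rd_zero_min (col_open oA) (col_itv cA) (col_cvx cu) (As : col A sig 0)) => //=; last exact: (cm_l2 M As).
  by move=> y Ay; rewrite (hc _ Ay).
have hp z : A z -> c + k * (z.1 - sig) <= u z.
  by move=> Az; have := grad_subgrad oA cA cu As (cm_l1 M As) (cm_l2 M As) Az; rewrite r2s /= mul0r addr0.
have r1s t : A (sig, t) -> r1 u (sig, t) = k.
  move=> At; pose l (s : R) := (c - k * sig) + k * s.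
  have cl : cvx1 (row A t) l by move=> *; rewrite le_eqVlt; apply/orP; left; apply/eqP; rewrite /l; ring.
  rewrite -[RHS](rd_aff (c - k * sig) k sig); apply/esym.
  apply: (rd_touch (row_open oA) (row_itv cA) cl (row_cvx cu) (At : row A t sig)).
  - by move=> y Ay; have := hp _ Ay; rewrite /l /=; clear; lra.
  - by rewrite (hc _ At) /l /c; ring.
  - have E : (fun y => l (- y)) = fun s => (c - k * sig) + (- k) * s by apply/funext => s; rewrite /l; ring.
    by rewrite /ld E rd_aff opprK /l rd_aff.
  exact: (cm_l1 M At).
have u1k z : A z -> z.1 <= sig -> r1 u z <= k.
  move=> Az zs; have [/andP[az _] _] := cd_bd H Az.
  have Azp : A (z.1, z.2) by rewrite -surjective_pairing.
  have Az2 : A (sig, z.2).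
    apply/(cd_left H) => //; apply: lt_le_trans (cd_mono H az zs sa).
    by apply/(cd_left H) => //; exact: le_lt_trans zs sa.
  by rewrite -(r1s _ Az2); apply: (rd_mono (row_open oA) (row_itv cA) (row_cvx cu) (Azp : row A z.2 z.1)).
have [psi [dpsi psib]] := psi_exists H as_ sa k0.
have [G1 G2 G3] := cap_slope_spec H as_ sa k0.
set G := cap_slope A b sig k in dpsi G1 G2 G3 *.
have Gspec s : a < s -> s <= sig -> G s = s - rarea A s / (2 * b s) \/ (G s = k /\ G s <= s - rarea A s / (2 * b s)).
  move=> h1 h2; rewrite /G /cap_slope (min_idPl h2) /chi.
  by case: (leP (s - rarea A s / (2 * b s)) k) => h; [left|right; split => //; exact: ltW].
have psub x y : a < x -> x < a + 1 -> a < y -> y < a + 1 -> psi x + G x * (y - x) <= psi y.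
  move=> h1 h2 h3 h4; apply: (@mono_derive_subgrad R psi G a (a + 1)) => //.
  by move=> s s' k1 k2 _; exact: G2.
have cpsi : cvx1 `]a, a + 1[%classic psi.
  move=> x y z /=; rewrite !in_itv /= => /andP[x1 x2] /andP[z1 z2] xy yz.
  have ay : a < y by exact: lt_trans xy.
  have y1 : y < a + 1 by exact: lt_trans z2.
  have q1 : (z - y) * (psi y + G y * (x - y)) <= (z - y) * psi x by rewrite ler_wpM2l ?subr_ge0 ?(ltW yz) // psub.
  have q2 : (y - x) * (psi y + G y * (z - y)) <= (y - x) * psi z by rewrite ler_wpM2l ?subr_ge0 ?(ltW xy) // psub.
  by move: q1 q2; clear; lra.
have sa1 : sig < a + 1 by clear - sa; lra.
pose V := glue psi u sig c.
have KV : inK A V.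
  apply: (@glue_inK R A psi G u a sig k c) => //.
  - by move=> z Az; have [/andP[]] := cd_bd H Az.
  - exact: ltW.
  - by move=> s h1 h2; have /andP[] := psib s h1 (le_lt_trans h2 sa1).
  - by move=> s h1; have /andP[] := G1 _ h1.
  - by move=> x y h1 h2 h3 h4; apply: psub => //; [exact: le_lt_trans sa1|exact: le_lt_trans sa1].
have [cV V0] := KV.
(* [dP] is the density of the glued function on the left; [dQ] is half the squared distance of Du
   from (G, 0), which is to be shown to vanish. *)
pose dP (z : R * R) : R := 2^-1 * ((G z.1 - z.1) ^+ 2 + z.2 ^+ 2) + psi z.1.
pose dQ (z : R * R) : R := 2^-1 * ((r1 u z - G z.1) ^+ 2 + (r2 u z) ^+ 2).
have [_ oL] := half_open sig; have [oR _] := half_open sig.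
have dVL z : A z -> z.1 < sig -> den V z = dP z.
  move=> Az zs; have [/andP[az _] _] := cd_bd H Az.
  have VL y : A y -> [set z : R * R | z.1 < sig] y -> psi y.1 = V y by move=> _ /= h; rewrite /V /glue (ltW h).
  have [E1 E2] := r_loc (u := fun z => psi z.1) oA cA cV Az oL zs VL.
  rewrite /den -E1 -E2 -(VL _ Az zs) /r1 /r2 /= (_ : (fun=> psi z.1) = fun t => psi z.1 + 0 * t); last first.
    by apply/funext => t; rewrite mul0r addr0.
  have Er : rd psi z.1 = G z.1.
    apply: (@rd_is_derive R `]a, a + 1[%classic psi z.1 (G z.1)) => //.
    - exact: interval_is_interval.
    - by rewrite /= in_itv /= az; exact: lt_trans sa1.
    by apply: dpsi => //; exact: lt_trans sa1.
  by rewrite rd_aff sub0r sqrrN Er.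
have dVR z : A z -> sig < z.1 -> den V z = den u z + (psi sig - c).
  move=> Az zs.
  have ce : cvx2 A (fun z => u z - (c - psi sig)) by move=> x y t Ax Ay t0 t1; have := cu _ _ _ Ax Ay t0 t1; clear; lra.
  have VR y : A y -> [set z : R * R | sig < z.1] y -> V y = u y - (c - psi sig).
    by move=> _ /= h; rewrite /V /glue leNgt h /= opprB.
  have [E1 E2] := r_loc oA cA ce Az oR zs VR.
  by rewrite /den E1 E2 /r1 /r2 !rd_shift (VR _ Az zs); ring.
have contF z : A z -> z.1 < a + 2 / 5 -> [/\ {for z, continuous dP}, {for z, continuous dQ} & {for z, continuous (den u)}].
  move=> Az zs; have [/andP[az _] _] := cd_bd H Az.
  have c1 : (fun y : R * R => y.1) @ z --> z.1 by exact: cvg_fst.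
  have c2 : (fun y : R * R => y.2) @ z --> z.2 by exact: cvg_snd.
  have cG : (fun y : R * R => G y.1) @ z --> G z.1 by exact: (cvg_comp _ _ c1 (G3 _ az)).
  have cp : (fun y : R * R => psi y.1) @ z --> psi z.1.
    have [d _] := dpsi _ az ltac:(clear - zs; lra).
    have cc : {for z.1, continuous psi} by apply: differentiable_continuous; apply/derivable1_diffP.
    exact: (cvg_comp _ _ c1 cc).
  have q1 := cm_c1 M Az; have q2 := cm_c2 M Az; have q3 := cvx2_continuous oA cA cu Az.
  have sq (f : R * R -> R) (l : R) : f @ z --> l -> (fun y => f y ^+ 2) @ z --> l ^+ 2.
    by move=> h; rewrite expr2 (_ : (fun y => _) = fun y => f y * f y); [exact: cvgM|apply/funext => y; rewrite expr2].
  split.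
  - by apply: cvgD => //; apply: cvgM; [exact: cvg_cst|apply: cvgD; apply: sq => //; exact: cvgB].
  - by apply: cvgM; [exact: cvg_cst|apply: cvgD; apply: sq => //; exact: cvgB].
  by apply: cvgD => //; apply: cvgM; [exact: cvg_cst|apply: cvgD; apply: sq; exact: cvgB].
have psi0 z : A z -> z.1 < a + 2 / 5 -> 0 <= psi z.1 <= k.
  move=> Az zs; have [/andP[az _] _] := cd_bd H Az.
  have /andP[-> h] := psib _ az ltac:(clear - zs; lra); apply: le_trans h _.
  by rewrite -[X in _ <= X]mulr1 ler_pM2l //; clear - zs; lra.
have dP0 z : A z -> z.1 < a + 2 / 5 -> 0 <= dP z by move=> Az zs; have /andP[h _] := psi0 _ Az zs; rewrite addr_ge0 //; nneg.
have dQ0 z : 0 <= dQ z by rewrite /dQ; nneg.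
have du0 z : A z -> 0 <= den u z by move=> Az; rewrite den_ge0 ?u0.
pose C1 : R := 2^-1 * ((k + (a + 2)) ^+ 2 + 1) + k.
have C10 : 0 <= C1 by apply: addr_ge0; [nneg|exact: ltW].
have dPC z : A z -> z.1 < a + 2 / 5 -> dP z <= C1.
  move=> Az zs; have [/andP[az za] z2] := cd_bd H Az; have /andP[_ h] := psi0 _ Az zs.
  apply: lerD => //; rewrite ler_pM2l ?invr_gt0 //; apply: lerD.
    by apply: sqr_le_abs; have /andP[g1 g2] := G1 _ az; rewrite ler_norml; apply/andP; split; clear - g1 g2 az za a0 k0; lra.
  by rewrite -(expr1n _ 2); apply: sqr_le_abs; exact: ltW.
pose A0 := rarea A sig; pose kap := psi sig - c.
have [EA0 A00] := rareaE sig H.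
pose T := A `&` [set z : R * R | sig < z.1].
have mT : measurable T by apply: measurableI => //; have [] := half_measurable sig.
pose cst1 : R := C1 + a * L * k.
pose LS s := A `&` [set z : R * R | s < z.1 < sig].
(* The strip a < x_1 <= s0 is set aside, since nothing is assumed on [b'] at the left side itself;
   its contribution has order s0 - a. *)
have key s0 : a < s0 -> s0 < sig -> (I2 (LS s0) dQ <= (cst1 * (s0 - a))%:E)%E.
  move=> as0 s0s; have s0a : s0 < a + 2 / 5 by exact: lt_trans sa.
  rewrite /LS; set S := A `&` _.
  have SA : S `<=` A by move=> z [].
  have S2 z : S z -> z.1 < sig by move=> [_ /andP[]].
  have S3 z : S z -> z.1 < a + 2 / 5 by move=> /S2 h; exact: lt_trans sa.
  have oS : open S.
    rewrite (_ : S = A `&` ([set z | s0 < z.1] `&` [set z | z.1 < sig])).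
      by apply: openI => //; apply: openI; [have [] := half_open s0|].
    by apply/seteqP; split => [z [Az /andP[h1 h2]]|z [Az [/= h1 h2]]]; split => //=; rewrite h1.
  have mS := open_measurable2 oS.
  have mf (f : R * R -> R) : (forall z, A z -> z.1 < a + 2 / 5 -> {for z, continuous f}) -> measurable_fun S f.
    by move=> cf; apply: open_continuous_measurable2 => // z Sz; apply: cf; [exact: SA|exact: S3].
  have mdP : measurable_fun S dP by apply: mf => z Az zs; have [] := contF _ Az zs.
  have mdQ : measurable_fun S dQ by apply: mf => z Az zs; have [] := contF _ Az zs.
  have hX z : A z -> `|z.1| <= a + 2 /\ `|z.2| <= a + 2 by exact: cd_X H.
  have [lP lP0 ElP] := @I2_fin R A S dP (a + 2) C1 oA hX mS SA mdP (fun z Sz => dP0 _ (SA _ Sz) (S3 _ Sz)) (fun z Sz => dPC _ (SA _ Sz) (S3 _ Sz)).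
  have ElV : I2 S (den V) = lP%:E by rewrite -ElP; apply: I2_ext => z Sz; apply: dVL; [exact: SA|exact: S2].
  (* Apart from S and T there remain the thin strip up to s0 and the chord [Nl], which has measure
     zero. *)
  pose W := (A `\` T) `\` S; pose Nl : set (R * R) := [set z | z.1 = sig].
  have mNl : measurable Nl.
    have [h1 _] := half_measurable sig; have [_ h2] := half_measurable sig.
    rewrite (_ : Nl = ~` ([set z : R * R | sig < z.1] `|` [set z : R * R | z.1 < sig])); first by apply: measurableC; exact: measurableU.
    apply/seteqP; split => [z zE|z /= h]; first by case; rewrite /= (zE : z.1 = sig) ltxx.
    by apply/eqP; rewrite eq_le !leNgt; apply/andP; split; apply/negP => h9; apply: h; [left|right].
  have Nl0 : (lebesgue_measure \x lebesgue_measure)%E Nl = 0%E.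
    apply: (@product_measure_null _ _ _ _ R lebesgue_measure lebesgue_measure) => //.
    have E t : [set s | Nl (s, t)] = [set sig] by apply/seteqP; split => s; rewrite /Nl /=.
    by left => t; rewrite E; exact: lebesgue_measure_set1.
  have mW : measurable W by do 2!apply: measurableD => //.
  have WA : W `<=` A by move=> z [[]].
  have mdVW : measurable_fun W (den V) by apply: measurable_funS (den_measurable oA cA cV).
  have W2 z : (W `\` Nl) z -> z.1 <= s0 /\ z.1 < sig.
    move=> [[[Az nT] nS] nN]; have h1 : z.1 < sig.
      by rewrite lt_neqAle; apply/andP; split; [apply/eqP|rewrite leNgt; apply/negP => h; apply: nT].
    by split => //; rewrite leNgt; apply/negP => h; apply: nS; split => //=; rewrite h.
  have mWN : measurable (W `\` Nl) by exact: measurableD.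
  have [mw mw0 Emw] := cd_finite H mWN (fun z h => WA _ (proj1 h)).
  have mwle : mw <= s0 - a.
    apply/ler_addgt0Pr => e e0; pose s1 := Num.min (s0 + e) ((s0 + sig) / 2).
    have s1e : s1 <= s0 + e by rewrite ge_min lexx.
    have s1s : s1 <= (s0 + sig) / 2 by rewrite ge_min lexx orbT.
    have s01 : s0 < s1 by rewrite lt_min; apply/andP; split; [clear - e0|clear - s0s]; lra.
    have s1a : s1 < a + 2 / 5 by clear - s1s s0s sa; lra.
    have as1 : a < s1 by exact: lt_trans s01.
    have := strip_area H as1 s1a mWN (fun z h => conj (WA _ (proj1 h)) (le_lt_trans (proj1 (W2 _ h)) s01)) Emw.
    have /andP[_ b2] := cd_b H as1 s1a; move=> h; apply: le_trans h _.
    apply: (@le_trans _ _ (1 * (s1 - a))); last by rewrite mul1r; clear - s1e; lra.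
    by apply: ler_wpM2r; [rewrite subr_ge0 ltW|clear - b2; lra].
  have stle : (I2 W (den V) <= (C1 * (s0 - a))%:E)%E.
    rewrite -(I2_null mW mNl Nl0 mdVW).
    apply: (@le_trans _ _ (C1 * mw)%:E); last by rewrite lee_fin ler_wpM2l.
    apply: I2_le_cst => //; first by apply: measurable_funS mdVW => // z [].
      by move=> z [Wz _]; rewrite den_ge0 ?V0 //; exact: WA.
    move=> z Wz; have [h1 h2] := W2 _ Wz; rewrite dVL //; last exact: WA (proj1 Wz).
    by apply: dPC; [exact: WA (proj1 Wz)|exact: lt_trans sa].
  have st0 : (0 <= I2 W (den V))%E by apply: I2_ge0 => z /WA/V0 h; rewrite den_ge0.
  have [st Est] : exists st : R, I2 W (den V) = st%:E.
    by exists (fine (I2 W (den V))); rewrite fineK // ge0_fin_numE //; apply: le_lt_trans stle _; rewrite ltry.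
  have dST z : S z -> ~ T z by move=> Sz [_ /= h]; have := lt_trans h (S2 _ Sz); rewrite ltxx.
  have [lu [Elu lu0 lule]] := @glue_energy R A S T u V kap A0 st lP dP oA cA (cm_K M) (cm_fin M) KV (cm_min M KV) mS mT SA
    (fun z h => proj1 h) dST (fun z h => dVR _ (proj1 h) (proj2 h)) EA0 Est ElV.
  have cPQ z : A z -> z.1 < a + 2 / 5 -> {for z, continuous (fun z => dQ z + dP z)}.
    by move=> Az zs; have [h1 h2 _] := contF _ Az zs; exact: cvgD.
  have cU z : A z -> z.1 < a + 2 / 5 -> {for z, continuous (den u)} by move=> Az zs; have [] := contF _ Az zs.
  have [mX X0 EX] := @cap_param R omega a L A b b' s0 sig (fun z => dQ z + dP z) H as0 sa cPQ
    (fun z Az zs => addr_ge0 (dQ0 z) (dP0 _ Az zs)).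
  have [mY Y0 EY] := @cap_param R omega a L A b b' s0 sig (den u) H as0 sa cU (fun z Az _ => du0 z Az).
  pose D : R := rarea A s0 / 2 * psi s0.
  have [ra1 ra2 _] := rarea_bounds H as0 s0a.
  have /andP[ps0 ps1] := psib s0 as0 (lt_trans s0s sa1).
  have D0 : 0 <= D by apply: mulr_ge0 => //; clear - ra1; lra.
  (* Added to both boundary terms so that the constants integrated below are nonnegative. *)
  pose K := `|kap * A0|.
  have K0 : 0 <= K by exact: normr_ge0.
  have cK : 0 <= kap * A0 / 2 + K by have := ler_norm (- (kap * A0)); rewrite normrN -/K; move: K0; clear; lra.
  have mC : measurable (cyl s0 sig).
    apply: open_measurable2; have [h1 _] := half_open s0.
    rewrite (_ : cyl s0 sig = ([set z | s0 < z.1] `&` [set z | z.1 < sig]) `&` ([set z : R * R| -1 < z.2] `&` [set z : R * R | z.2 < 1])).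
      apply: openI; first exact: openI.
      apply: openI; apply: square_open => z /= zs.
        by exists (z.2 + 1) => [|y _]; [clear - zs; lra|rewrite ltr_norml => /andP[y1 y2] /=; clear - y1; lra].
      by exists (1 - z.2) => [|y _]; [clear - zs; lra|rewrite ltr_norml => /andP[y1 y2] /=; clear - y2; lra].
    apply/seteqP; split => [z [/andP[q1 q2]]|z [[/= q1 q2] [/= q3 q4]]].
      by rewrite ltr_norml => /andP[q3 q4].
    by split; rewrite ?q1 // ltr_norml q3.
  have rowy y t : `|t| < 1 -> row (cyl s0 sig) t y <-> s0 < y < sig by move=> ht; split => [[]|].
  (* The inequality along each curve is integrated over the parameter y between - 1 and 1, an
     interval of length 2. *)
  have ineq : (I2 (cyl s0 sig) (fun w => b w.1 * (dQ (w.1, b w.1 * w.2) + dP (w.1, b w.1 * w.2)))%R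
      + (kap * A0 / 2 + K)%:E * (2 : R)%R%:E <=
      I2 (cyl s0 sig) (fun w => b w.1 * den u (w.1, b w.1 * w.2))%R + (D + K)%:E * (2 : R)%R%:E)%E.
    pose I1 : set R := [set` Interval (BRight (-1)) (BLeft 1)].
    have mI1 : measurable I1 by exact: measurable_itv.
    have m2 : (@lebesgue_measure R) I1 = (2 : R)%:E.
      rewrite /I1 lebesgue_measure_itv /= lte_fin (_ : (-1 : R) < 1); last by clear; lra.
      by rewrite -EFinB; congr EFin; ring.
    have cint (r : R) : (r%:E * (2 : R)%R%:E = \int[@lebesgue_measure R]_t ((cst r%:E) \_ I1) t)%E.
      by apply/esym; rewrite -integral_mkcond integral_cst //; congr (_ * _)%E; exact: m2.
    rewrite (I2_rows mC mX X0) (I2_rows mC mY Y0) !cint.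
    have mXE : measurable_fun (cyl s0 sig) (fun w => (b w.1 * (dQ (w.1, b w.1 * w.2) + dP (w.1, b w.1 * w.2)))%:E) by exact/measurable_EFinP.
    have mYE : measurable_fun (cyl s0 sig) (fun w => (b w.1 * den u (w.1, b w.1 * w.2))%:E) by exact/measurable_EFinP.
    have iX := rows_measurable mC mXE (fun z h => X0 z h).
    have iY := rows_measurable mC mYE (fun z h => Y0 z h).
    have mcst (r : R) : measurable_fun setT ((cst r%:E) \_ I1) by apply/(measurable_restrictT _ _).1.
    have pcst (r : R) t : 0 <= r -> (0 <= ((cst r%:E) \_ I1) t)%E by move=> r0; rewrite patchE; case: ifP.
    have DK0 : 0 <= D + K by exact: addr_ge0.
    rewrite -!ge0_integralD //; try exact: mcst; try exact: iX; try exact: iY; try by move=> t _; first [exact: pcst|apply: integral_ge0 => s hs; first [exact: (X0 (s, t))|exact: (Y0 (s, t))]].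
    apply: ge0_le_integral => //.
    - by move=> t _; apply: adde_ge0; [apply: integral_ge0 => s hs; exact: (X0 (s, t))|exact: pcst].
    - exact: (emeasurable_funD iX (mcst _)).
    - exact: (emeasurable_funD iY (mcst _)).
    have I1E t : I1 t <-> `|t| < 1 by rewrite ltr_norml /I1 /= in_itv.
    move=> t _; have [ht|ht] := pselect (I1 t); last first.
      rewrite !patchE memNset // !adde0 (_ : row (cyl s0 sig) t = set0) ?integral_set0 //.
      by rewrite -subset0 => y [_ /= h]; apply: ht; apply/I1E.
    rewrite !patchE mem_set //; move: ht => /I1E ht.
    have Er : row (cyl s0 sig) t = `]s0, sig[%classic.
      by apply/seteqP; split => y; rewrite /= in_itv /= => /(rowy y t ht).
    rewrite !Er.
    have PA s : s0 <= s -> s <= sig -> A (s, b s * t).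
      move=> h1 h2; have as' : a < s by exact: lt_le_trans h1.
      have sa' : s < a + 2 / 5 by exact: le_lt_trans sa.
      apply/(cd_left H) => //; have bs : 0 < b s.
        by have /andP[h _] := cd_b H as' sa'; have /andP[L0 _] := cd_L H; apply: le_lt_trans h; rewrite divr_ge0 // ltW.
      by rewrite normrM (gtr0_norm bs) gtr_pMr.
    have inr s : s0 <= s <= sig -> [/\ a < s, s < a + 2 / 5, s < a + 1 & A (s, b s * t)].
      move=> /andP[h1 h2]; split; [exact: lt_le_trans h1|exact: le_lt_trans sa|exact: le_lt_trans sa1|exact: PA].
    have cgam s : s0 <= s <= sig -> (fun s => (s, b s * t)) @ s --> ((s, b s * t) : R * R).
      move=> /inr[h1 h2 _ _]; have c2 : (fun s => b s * t) @ s --> b s * t.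
        by apply: cvgM; [exact: (cd_b_cont H)|exact: cvg_cst].
      exact: (cvg_pair cvg_id c2).
    have comp (f : R * R -> R) s : s0 <= s <= sig -> {for (s, b s * t), continuous f} -> {for s, continuous (fun s => f (s, b s * t))}.
      by move=> hs cf; exact: (cvg_comp _ _ (cgam s hs) cf).
    pose p s := r1 u (s, b s * t); pose q s := r2 u (s, b s * t).
    pose GG s := 2^-1 * (rarea A s * (psi s - u (s, b s * t))).
    pose GG' s := 2^-1 * (- (2 * b s) * (psi s - u (s, b s * t)) + rarea A s * (G s - (p s + q s * (b' s * t)))).
    have dd (f : R -> R) (s d : R) : is_derive s 1 f d -> {for s, continuous f}.
      by move=> [df _]; apply: differentiable_continuous; apply/derivable1_diffP.
    have cu' s : s0 <= s <= sig -> {for s, continuous (fun s => u (s, b s * t))}.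
      by move=> hs; have [_ _ _ hA] := inr _ hs; apply: comp => //; exact: (cvx2_continuous oA cA cu).
    have FI := @FTC_ineq R (fun s => b s * (dQ (s, b s * t) + dP (s, b s * t))) (fun s => b s * den u (s, b s * t)) GG GG' s0 sig s0s.
    have {}FI : (\int[@lebesgue_measure R]_(s in `]s0, sig[) (b s * (dQ (s, b s * t) + dP (s, b s * t)))%:E + (GG sig - GG s0)%:E <=
       \int[@lebesgue_measure R]_(s in `]s0, sig[) (b s * den u (s, b s * t))%:E)%E.
      apply: FI => s hs; have [h1 h2 h3 hA] := inr _ hs.
      - by apply: cvgM; [exact: (cd_b_cont H)|apply: (comp (fun z => dQ z + dP z)) => //; exact: cPQ].
      - by apply: cvgM; [exact: (cd_b_cont H)|apply: comp => //; exact: cU].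
      - have cb := cd_b_cont H h1 h2.
        have cr := dd _ _ _ (rarea_derive H h1 h2); have cps := dd _ _ _ (dpsi _ h1 h3).
        have cpp : {for s, continuous p} by apply: comp => //; exact: cm_c1 M _ hA.
        have cq : {for s, continuous q} by apply: comp => //; exact: cm_c2 M _ hA.
        have cb' := cd_der_cont H h1 h2.
        apply: cvgM; first exact: cvg_cst.
        apply: cvgD.
          apply: cvgM; first by apply: cvgN; apply: cvgM; [exact: cvg_cst|exact: cb].
          by apply: cvgB; [exact: cps|exact: cu'].
        apply: cvgM; first exact: cr.
        apply: cvgB; first exact: (G3 _ h1).
        apply: cvgD; first exact: cpp.
        by apply: cvgM; [exact: cq|apply: cvgM; [exact: cb'|exact: cvg_cst]].
      - have d1 := rarea_derive H h1 h2; have d2 := dpsi _ h1 h3.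
        have [d3 _] := cd_der H h1 h2.
        have d4 : is_derive s 1 (fun s => b s * t) (b' s * t).
          rewrite (_ : (fun s => b s * t) = t \*: b); last by apply/funext => x; rewrite /= mulrC.
          by rewrite mulrC; exact: is_deriveZ.
        have dif := partials_differentiable oA cA cu hA (cm_l1 M hA) (cm_l2 M hA).
        have D1 : 'D_(1, 0) u (s, b s * t) = p s.
          rewrite derive_slice1 (derive_ld_rd (row_open oA) (row_itv cA) (row_cvx cu) (hA : row A (b s * t) s)).
          by have := cm_l1 M hA; rewrite /l1 /r1 /= => ->; rewrite eqxx.
        have D2 : 'D_(0, 1) u (s, b s * t) = q s.
          rewrite derive_slice2 (derive_ld_rd (col_open oA) (col_itv cA) (col_cvx cu) (hA : col A s (b s * t))).
          by have := cm_l2 M hA; rewrite /l2 /r2 /= => ->; rewrite eqxx.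
        have d5 := @curve_derive R u (fun s => b s * t) s (b' s * t) (p s) (q s) dif d4 D1 D2.
        exact: (half_prod_derive d1 d2 d5).
      have /andP[bl bh] := cd_b H h1 h2; have /andP[L0 _] := cd_L H.
      have [_ b1] := cd_der H h1 h2; have [r11 _ _] := rarea_bounds H h1 h2.
      have /andP[hs1 hs2] := hs.
      have bp : 0 < b s by apply: le_lt_trans bl; rewrite divr_ge0 // ltW.
      have qz : 0 <= q s * (b s * t).
        have hA0 : A (s, 0) by apply: (cd_axis H) => //; clear - h2; lra.
        have := grad_subgrad oA cA cu hA (cm_l1 M hA) (cm_l2 M hA) hA0; have := axis_min H M hA.
        by rewrite /= subrr mulr0 addr0 sub0r mulrN -/(q s); clear; lra.
      have := @curve_ineq R (rarea A s) (b s) (b' s) (G s) k (p s) (q s) s t (psi s) (u (s, b s * t)) bp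
        (u1k _ hA hs2) (Gspec _ h1 hs2) qz bh r11 b1.
      by [].
    have us : u (sig, b sig * t) = c by apply: hc; apply: PA => //; exact: ltW.
    (* Multiplied by the length 2 this is kap A0, exactly the amount by which the energy changes to
       the right of the chord. *)
    have Gs : GG sig = kap * A0 / 2 by rewrite /GG us /kap -/A0; ring.
    have G0 : GG s0 <= D.
      have uz : 0 <= rarea A s0 * u (s0, b s0 * t) by rewrite mulr_ge0 ?u0 //; [clear - ra1; lra|apply: PA => //; exact: ltW].
      by rewrite /GG /D; move: uz; clear; lra.
    rewrite -Gs (_ : GG sig + K = (GG sig - GG s0) + (GG s0 + K)); last by ring.
    by rewrite EFinD addeA; apply: leeD => //; rewrite lee_fin lerD2r.
  move: ineq; rewrite -EX -EY Elu (I2D mS mdQ mdP) //; last by move=> z Sz; apply: dP0; [exact: SA|exact: S3].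
  rewrite ElP -!EFinM -EFinD; case EQ : (I2 S dQ) => [x| |] //=; last first.
    by have := I2_ge0 (f := dQ) (A := S) (fun z _ => dQ0 z); rewrite EQ.
  rewrite -!EFinD !lee_fin => hx.
  have h2D : D * 2 <= a * L * k * (s0 - a).
    rewrite (_ : D * 2 = rarea A s0 * psi s0); last by rewrite /D; field.
    by rewrite -mulrA; apply: ler_pM => //; clear - ra1; lra.
  have hst : st <= C1 * (s0 - a) by rewrite -lee_fin -Est.
  rewrite /cst1 mulrDl; move: hx lule hst h2D; rewrite -/K; clear; lra.
move=> z Az zs; have [/andP[az _] _] := cd_bd H Az.
have c10 : 0 <= cst1 by apply: addr_ge0 => //; have /andP[L0 _] := cd_L H; rewrite !mulr_ge0 ?(ltW a0) ?(ltW L0) ?(ltW k0).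
pose s1 := (a + z.1) / 2; have as1 : a < s1 by rewrite /s1; clear - az; lra.
have s1z : s1 < z.1 by rewrite /s1; clear - az; lra.
pose S := A `&` [set z | s1 < z.1 < sig].
have opn s : open (A `&` [set z | s < z.1 < sig]).
  rewrite (_ : A `&` [set z | s < z.1 < sig] = A `&` ([set z | s < z.1] `&` [set z | z.1 < sig])).
    by apply: openI => //; apply: openI; [have [] := half_open s|].
  by apply/seteqP; split => [y [Ay /andP[h1 h2]]|y [Ay [/= h1 h2]]]; split => //=; rewrite h1.
have mfQ s : measurable_fun (A `&` [set z | s < z.1 < sig]) dQ.
  apply: open_continuous_measurable2 => // y [Ay /andP[_ ys]].
  by have [] := contF _ Ay (lt_trans ys sa).
(* S lies in the strip that starts at s0, and s0 may be taken arbitrarily close to a in [key]. *)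
have S0 : I2 S dQ = 0%E.
  apply/eqP; rewrite eq_le I2_ge0 // andbT; apply/lee_addgt0Pr => e e0; rewrite add0e.
  pose s0 := a + Num.min ((s1 - a) / 2) (e / (cst1 + 1)).
  have c1 : 0 < cst1 + 1 by clear - c10; lra.
  have as0 : a < s0 by rewrite /s0 ltrDl lt_min !divr_gt0 // subr_gt0.
  have m1 : s0 - a <= (s1 - a) / 2 by rewrite /s0 addrAC subrr add0r ge_min lexx.
  have m2 : s0 - a <= e / (cst1 + 1) by rewrite /s0 addrAC subrr add0r ge_min lexx orbT.
  have s01 : s0 < s1 by clear - m1 as1; lra.
  apply: (@le_trans _ _ (I2 (A `&` [set z | s0 < z.1 < sig]) dQ)).
    have mS1 : measurable S by exact: open_measurable2 (opn s1).
    have mS0 := open_measurable2 (opn s0).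
    apply: I2_subset => //.
    by move=> y [Ay /andP[h1 h2]]; split => //=; rewrite h2 (lt_trans s01 h1).
  apply: le_trans (key s0 as0 _) _; first by apply: lt_trans s01 (lt_trans s1z zs).
  rewrite lee_fin; apply: (@le_trans _ _ (cst1 * (e / (cst1 + 1)))); first by rewrite ler_wpM2l.
  by rewrite mulrA ler_pdivrMr // mulrC ler_pM2l //; clear; lra.
have Sz : S z by split => //=; rewrite s1z.
have [_ cQ _] := contF _ Az (lt_trans zs sa).
have := I2_zero_continuous (opn s1) (mfQ s1) (fun y _ => dQ0 y) S0 Sz cQ.
rewrite /dQ => h.
have p1 := sqr_ge0 (r1 u z - G z.1); have p2 := sqr_ge0 (r2 u z).
have : (r1 u z - G z.1) ^+ 2 = 0 by apply/eqP; rewrite eq_le p1 andbT; move: h p2; clear; lra.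
by move=> /eqP; rewrite sqrf_eq0 subr_eq0 => /eqP.
Qed.

(** * Unboundedness of the quotient *)

Lemma flat_ratio (R : realType) (omega : R -> R) (a L : R) (A : set (R * R)) (b b' : R -> R) (u : R * R -> R) (N : R) :
  modulus_of_continuity omega -> cap_domain omega a L A b b' -> cap_min A u ->
  (forall z, A z -> gradient u z = (r1 u z, r2 u z)) -> 0 < N ->
  exists x y, [/\ A x, A y, x != y & N <= enorm (gradient u x - gradient u y) / omega (enorm (x - y))].
Proof.
move=> [_ om2 om3 _] H M hg N0.
have [sig [as_ sa k0 hc]] := flat_chord H M.
have LG := left_gradient H M as_ sa k0 hc; move: k0 LG; set k := r1 u (sig, 0) => k0 LG.
have [c1 c2 c3] := chi_spec H.
have abig := cd_big H; have a0 : 0 < a by clear - abig; lra.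
have /andP[L0 L1] := cd_L H.
(* Two points of the axis at which the vertical chord has length [L + 2 g1] resp. [L + 2 g2], g2 << g1. *)
pose e1 := Num.min (sig - a) (Num.min (k / (4 * a / L + 2)) (Num.min 1 (a / (4 * (L + 2) * (N + 1))))).
have q1 : 0 < 4 * a / L + 2 by have : 0 < 4 * a / L by [rewrite divr_gt0 // mulr_gt0]; clear; lra.
have q2 : 0 < 4 * (L + 2) * (N + 1) by rewrite !mulr_gt0 //; move: L0 N0; clear; lra.
have e10 : 0 < e1 by rewrite !lt_min subr_gt0 as_ ltr01 (divr_gt0 k0 q1) (divr_gt0 a0 q2).
(* Of the bounds in e1, the first puts s1 to the left of sig, the second keeps [chi] below k, so
   that the truncation is inactive up to s1, and the last makes the quotient at least N. *)
have m1 : e1 <= sig - a by rewrite ge_min lexx.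
have m2 : e1 <= k / (4 * a / L + 2) by rewrite !ge_min lexx !orbT.
have m3 : e1 <= 1 by rewrite !ge_min lexx !orbT.
have m4 : e1 <= a / (4 * (L + 2) * (N + 1)) by rewrite !ge_min lexx !orbT.
have [s1 [g1 [/andP[s1a s1e] /andP[g10 g1e] bs1 om1]]] := cd_flat H e10.
pose d1 := a * (2 * g1) / (L + 2 * g1).
have Lg0 : 0 < L + 2 * g1 by move: L0 g10; clear; lra.
have d10 : 0 < d1 by rewrite divr_gt0 // !mulr_gt0.
(* The second point is so close to the left side that [chi] there is at most half of [d1], the lower
   bound for [chi] at s1. *)
pose e2 := Num.min (s1 - a) (d1 / (2 * (2 + 2 * a / L))).
have q3 : 0 < 2 + 2 * a / L by have : 0 < 2 * a / L by [rewrite divr_gt0 // mulr_gt0]; clear; lra.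
have e20 : 0 < e2 by rewrite lt_min subr_gt0 s1a divr_gt0 // mulr_gt0.
have n1 : e2 <= s1 - a by rewrite ge_min lexx.
have n2 : e2 <= d1 / (2 * (2 + 2 * a / L)) by rewrite ge_min lexx orbT.
have [s2 [g2 [/andP[s2a s2e] /andP[g20 g2e] bs2 _]]] := cd_flat H e20.
have s12 : s2 < s1 by move: s2e n1; clear; lra.
have s1s : s1 < sig by move: s1e m1; clear; lra.
have s1h : s1 < a + 2 / 5 by exact: lt_trans sa.
have s2h : s2 < a + 2 / 5 by exact: lt_trans s1h.
have val s g : a < s -> s < a + 2 / 5 -> 0 < g -> b s = L / 2 + g ->
    a * (2 * g) / (L + 2 * g) <= chi A b s <= 2 * (s - a) + 2 * a / L * g.
  move=> h1 h2 g0 E; have /andP[k1 k2] := c3 s h1 h2.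
  have Lg : 0 < L + 2 * g by move: L0 g0; clear; lra.
  have E1 : a * (1 - L / (2 * b s)) = a * (2 * g) / (L + 2 * g).
    by rewrite E; field; rewrite gt_eqF //=; rewrite gt_eqF // (_ : 2 * (L / 2 + g) = L + 2 * g) //; field.
  rewrite E1 in k1 k2; rewrite k1 /=; apply: le_trans k2 _; rewrite lerD2l ler_pdivrMr //.
  rewrite (_ : 2 * a / L * g * (L + 2 * g) = a * (2 * g) + a * (2 * g) * (2 * g / L)); last by field; rewrite gt_eqF.
  by rewrite lerDl !mulr_ge0 // ?invr_ge0 ltW.
have /andP[v1 w1] := val _ _ s1a s1h g10 bs1; have /andP[_ w2] := val _ _ s2a s2h g20 bs2.
have small : 2 * (s1 - a) + 2 * a / L * g1 <= k.
  have h : (4 * a / L + 2) * e1 <= k by rewrite mulrC -ler_pdivlMr.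
  have h2 : 2 * a / L * g1 <= 2 * a / L * e1 by rewrite ler_wpM2l ?(ltW g1e) // divr_ge0 ?mulr_ge0 // ltW.
  have h3 : 2 * a / L * e1 * 2 = 4 * a / L * e1 by ring.
  have h4 : 0 <= 2 * a / L * e1 by rewrite !mulr_ge0 ?invr_ge0 // ltW.
  by move: h h2 h3 h4 s1e; clear; lra.
have slope s : a < s -> s <= s1 -> r1 u (s, 0) = chi A b s.
  move=> h1 h2; have hs : s < sig by exact: le_lt_trans s1s.
  rewrite LG //=; last by apply: (cd_axis H) => //; move: hs sa; clear; lra.
  rewrite /cap_slope (min_idPl (ltW hs)); apply/min_idPl.
  by apply: le_trans (c2 s s1 h1 h2 s1h) (le_trans w1 small).
have A1 : A (s1, 0) by apply: (cd_axis H) => //; move: s1h; clear; lra.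
have A2 : A (s2, 0) by apply: (cd_axis H) => //; move: s2h; clear; lra.
exists (s1, 0), (s2, 0); split => //; first by rewrite xpair_eqE negb_and gt_eqF.
have half : chi A b s2 <= d1 / 2.
  have h : e2 * (2 + 2 * a / L) <= d1 / 2.
    have E : d1 / 2 = d1 / (2 * (2 + 2 * a / L)) * (2 + 2 * a / L).
      by rewrite invfM mulrA mulfVK // gt_eqF.
    by rewrite E ler_pM2r.
  have h2 : 2 * a / L * g2 <= 2 * a / L * e2 by rewrite ler_wpM2l ?(ltW g2e) // divr_ge0 ?mulr_ge0 // ltW.
  by apply: le_trans w2 _; move: h h2 s2e; clear; lra.
have num : d1 / 2 <= enorm (gradient u (s1, 0) - gradient u (s2, 0)).
  rewrite /enorm !hg //=; apply: (@le_trans _ _ (Num.sqrt ((chi A b s1 - chi A b s2) ^+ 2))).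
    by rewrite sqrtr_sqr; apply: le_trans (ler_norm _); move: v1 half; rewrite -/d1; clear; lra.
  by rewrite ler_wsqrtr // !slope // ?(ltW s12) // lerDl sqr_ge0.
have dist : enorm ((s1, 0) - (s2, 0)) = s1 - s2.
  by rewrite /enorm /= subrr expr0n /= addr0 sqrtr_sqr gtr0_norm // subr_gt0.
have om0 : 0 < omega (enorm ((s1, 0) - (s2, 0))) by apply: om3; rewrite dist subr_gt0.
have omle : omega (enorm ((s1, 0) - (s2, 0))) <= g1 ^+ 2.
  apply: le_trans om1; rewrite dist; apply: om2; first by rewrite subr_ge0 ltW.
  by move: s2a; clear; lra.
rewrite ler_pdivlMr //; apply: le_trans num.
apply: (@le_trans _ _ (N * g1 ^+ 2)); first by rewrite ler_wpM2l // ltW.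
rewrite /d1 -mulrA -invfM ler_pdivlMr ?mulr_gt0 //.
have g11 : g1 <= 1 by move: g1e m3; clear; lra.
have h : g1 * (4 * (L + 2) * (N + 1)) <= a.
  by rewrite -ler_pdivlMr //; apply: le_trans (ltW g1e) m4.
have h2 : N * (L + 2 * g1) <= (N + 1) * (L + 2).
  by apply: ler_pM; rewrite ?(ltW N0) ?(ltW Lg0) //; move: g11; clear; lra.
have h3 : g1 * (N * (L + 2 * g1)) <= g1 * ((N + 1) * (L + 2)) by rewrite ler_pM2l.
have h4 : N * g1 ^+ 2 * ((L + 2 * g1) * 2) = 2 * g1 * (g1 * (N * (L + 2 * g1))) by ring.
rewrite h4 (_ : a * (2 * g1) = 2 * g1 * a); last by ring.
rewrite ler_pM2l ?mulr_gt0 //; apply: le_trans h3 _; apply: le_trans h.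
have : 0 <= g1 * ((N + 1) * (L + 2)) by rewrite !mulr_ge0 ?(ltW g10) //; move: N0 L0; clear; lra.
by clear; lra.
Qed.

(** * Smooth functions with prescribed flatness *)

(** Differentiability up to order n with an explicit derivative at each order, a form in which
    closure under sums, products and inverses is a direct induction. *)
Fixpoint sm (R : realType) (n : nat) (f : R -> R) : Prop :=
  if n is n'.+1 then exists2 f' : R -> R, (forall t : R, is_derive t 1 f (f' t)) & sm n' f' else True.

Lemma sm_smooth (R : realType) (f : R -> R) : (forall n, sm n f) -> smooth_function f.
Proof.
move=> hf n; elim: n f hf => [|n IH] f hf t; first by have [f' h _] := hf 1; have [] := h t.
have [f' h _] := hf 1.
have E : derive1 f = f' by apply/funext => x; rewrite derive1E; have [_ ->] := h x.
have -> : derive1n n.+1 f = derive1n n (derive1 f) by elim: n {IH hf} => // n /= ->.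
apply: IH => m; rewrite E; have [f'' h' hm] := hf m.+1.
by rewrite (_ : f' = f'') //; apply/funext => x; have [_ <-] := h x; have [_ <-] := h' x.
Qed.

Lemma sm_pred (R : realType) n (f : R -> R) : sm n.+1 f -> sm n f.
Proof. by elim: n f => [//|n IH] f [f' h hm]; exists f' => //; exact: IH. Qed.

Lemma smD (R : realType) n (f g : R -> R) : sm n f -> sm n g -> sm n (fun t => f t + g t).
Proof.
elim: n f g => [//|n IH] f g [f' df hf] [g' dg hg]; exists (fun t => f' t + g' t); last exact: IH.
by move=> t; exact: is_deriveD.
Qed.

Lemma sm_cst (R : realType) n (c : R) : sm n (fun=> c).
Proof. by elim: n c => [//|n IH] c; exists (fun=> 0) => // t; exact: is_derive_cst. Qed.

Lemma smM (R : realType) n (f g : R -> R) : sm n f -> sm n g -> sm n (fun t => f t * g t).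
Proof.
elim: n f g => [//|n IH] f g hf hg; have [f' df hf'] := hf; have [g' dg hg'] := hg.
exists (fun t => f t * g' t + g t * f' t); first by move=> t; exact: is_deriveM.
by apply: smD; apply: IH => //; exact: sm_pred.
Qed.

Lemma sm_affine (R : realType) n (f : R -> R) (k c : R) : sm n f -> sm n (fun t => f (k * t + c)).
Proof.
elim: n f => [//|n IH] f [f' df hf].
exists (fun t => k * f' (k * t + c)); last by apply: smM; [exact: sm_cst|exact: IH].
move=> t; have d1 : is_derive t 1 (fun t => k * t + c) k.
  have d := is_deriveD (is_deriveZ k (is_derive_id t 1)) (is_derive_cst c t 1).
  by apply: is_derive_eq d _; rewrite addr0 [_ *: _]mulr1.
by have := @is_derive1_comp R f (fun t => k * t + c) t _ _ (df (k * t + c)) d1; rewrite mulrC.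
Qed.

Lemma smV (R : realType) n (f : R -> R) : (forall t, f t != 0) -> sm n f -> sm n (fun t => (f t)^-1).
Proof.
move=> f0; elim: n => [//|n IH] hf; have [f' df hf'] := hf.
exists (fun t => - 1 * ((f t)^-1 * (f t)^-1) * f' t).
  move=> t; have d := is_deriveV (f0 t) (df t).
  by apply: is_derive_eq d _; rewrite /GRing.scale /= mulN1r expr2 invfM.
have h := IH (sm_pred hf); do 2!apply: smM => //; first exact: sm_cst.
exact: smM.
Qed.

(** For p = 1 the classical flat function exp (- 1 / t); the polynomial factor makes the family
    closed under differentiation. *)
Definition expinv (R : realType) (p : {poly R}) (t : R) : R := if 0 < t then p.[t^-1] * expR (- t^-1) else 0.

(** The k-th power of s / k <= exp (s / k) bounds s ^ k exp (- s) by k ^ k. *)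
Lemma poly_exp_bound (R : realType) (p : {poly R}) : exists2 B : R, 0 <= B & forall s, 0 < s -> `|p.[s] * expR (- s)| <= B.
Proof.
have hk (k : nat) (s : R) : 0 < s -> s ^+ k * expR (- s) <= k%:R ^+ k.
  case: k => [|k] s0; first by rewrite !expr0 mul1r -[X in _ <= X]expR0 ler_expR oppr_le0 ltW.
  rewrite expRN ler_pdivrMr ?expR_gt0 //.
  have h : s / k.+1%:R <= expR (s / k.+1%:R) by apply: le_trans (expR_ge1Dx _); rewrite lerDr.
  have {1}-> : s = k.+1%:R * (s / k.+1%:R) by rewrite mulrCA divff ?mulr1.
  rewrite exprMn ler_pM2l ?exprn_gt0 //.
  have -> : expR s = expR (s / k.+1%:R) ^+ k.+1 by rewrite -expRM_natl -mulr_natl mulrCA divff ?mulr1.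
  by apply: lerXn2r; rewrite ?nnegrE ?expR_ge0 // divr_ge0 // ltW.
exists (\sum_(i < size p) `|p`_i| * i%:R ^+ i).
  by apply: sumr_ge0 => i _; rewrite mulr_ge0 // exprn_ge0.
move=> s s0; rewrite horner_coef mulr_suml; apply: le_trans (ler_norm_sum _ _ _) _.
apply: ler_sum => i _; rewrite -mulrA normrM ler_wpM2l //.
by rewrite ger0_norm ?hk // mulr_ge0 ?exprn_ge0 ?expR_ge0 // ltW.
Qed.

Lemma expinv_bound (R : realType) (p : {poly R}) : exists2 B : R, 0 <= B & forall t, `|expinv p t| <= B.
Proof.
have [B B0 h] := poly_exp_bound p; exists B => // t; rewrite /expinv; case: ifP => t0; last by rewrite normr0.
by apply: h; rewrite invr_gt0.
Qed.

Lemma quad_derive (R : realType) (f : R -> R) (t d B : R) :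
  (forall x, `|f (t + x) - f t - x * d| <= B * x ^+ 2) -> is_derive t 1 f d.
Proof.
move=> h; have B0 : 0 <= B.
  by have := h 1; rewrite expr1n mulr1; apply: le_trans.
have c : (fun x => x^-1 *: ((f \o shift t) (x *: 1) - f t)) @ 0^' --> d.
  apply/cvgrPdist_le => e e0; near=> x.
  have x0 : x != 0 by near: x; exact: nbhs_dnbhs_neq.
  have xe : `|x| < e / (B + 1) by near: x; apply: dnbhs0_lt; rewrite divr_gt0 // ltr_wpDl.
  rewrite /= [x *: 1]mulr1 [_ *: _](_ : _ = (f (t + x) - f t) / x); last by rewrite /= (addrC x t) /GRing.scale /= mulrC.
  have -> : d - (f (t + x) - f t) / x = - ((f (t + x) - f t - x * d) / x) by field.
  rewrite normrN normrM normfV ler_pdivrMr ?normr_gt0 //.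
  apply: le_trans (h x) _; rewrite -real_normK ?num_real // expr2 mulrA ler_wpM2r //.
  have : B * `|x| <= (B + 1) * `|x| by rewrite ler_wpM2r // lerDl.
  have : (B + 1) * `|x| <= e by rewrite mulrC -ler_pdivlMr ?ltW // ltr_wpDl.
  by move=> h1 h2; exact: le_trans h1.
split; first by apply/cvg_ex; exists d.
exact/cvg_lim.
Unshelve. all: by end_near. Qed.

(** Away from 0 this is the product rule. At 0, [expinv p t] is t ^ 2 times the bounded function
    [expinv ('X^2 * p) t], so the derivative is 0. *)
Lemma expinv_derive (R : realType) (p : {poly R}) (t : R) :
  is_derive t 1 (expinv p) (expinv ('X^2 * (p - p^`())) t).
Proof.
have [t0|t0|->] := ltgtP t 0.
- have E : expinv ('X^2 * (p - p^`())) t = 0 by rewrite /expinv ltNge (ltW t0).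
  rewrite E; apply: (@near_eq_is_derive _ _ _ (cst 0)).
    have h : \forall y \near t, y < 0 by apply: (cvgr_lt _ cvg_id).
    by apply: filterS h => y y0; rewrite /expinv ltNge (ltW y0).
- rewrite {2}/expinv t0.
  have tn : t != 0 by rewrite gt_eqF.
  have d1 : is_derive t 1 (fun x : R => x^-1) (- t ^- 2).
    by apply: is_derive_eq (is_deriveV tn (is_derive_id t 1)) _; rewrite [_ *: _]mulr1.
  have d2 : is_derive t 1 (fun x : R => p.[x^-1]) (- t ^- 2 * p^`().[t^-1]).
    have dp := is_derive_poly p t^-1.
    by have := @is_derive1_comp R (horner p) (fun x => x^-1) t _ _ dp d1; rewrite mulrC.
  have d3 : is_derive t 1 (fun x : R => expR (- x^-1)) (t ^- 2 * expR (- t^-1)).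
    have := @is_derive1_comp R expR (fun x => - x^-1) t _ _ (is_derive_expR (- t^-1)) (is_deriveN d1).
    by rewrite opprK mulrC.
  apply: (@near_eq_is_derive _ _ _ (fun x : R => p.[x^-1] * expR (- x^-1))).
    have h : \forall y \near t, 0 < y by apply: (cvgr_gt _ cvg_id).
    by apply: filterS h => y y0; rewrite /expinv y0.
  apply: is_derive_eq (is_deriveM d2 d3) _.
  by rewrite hornerM hornerXn hornerD hornerN exprVn /GRing.scale /=; ring.
have E0 q : @expinv R q 0 = 0 by rewrite /expinv ltxx.
have [B B0 hB] := expinv_bound ('X^2 * p).
rewrite E0; apply: (@quad_derive _ _ _ _ B) => x; rewrite add0r E0 mulr0 !subr0.
rewrite /expinv; case: ifP => x0; last by rewrite normr0 mulr_ge0 // sqr_ge0.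
have -> : p.[x^-1] = x ^+ 2 * ('X^2 * p).[x^-1].
  by rewrite hornerM hornerXn exprVn mulrA divff ?mul1r // expf_neq0 // gt_eqF.
rewrite -mulrA normrM ger0_norm ?sqr_ge0 // [X in _ <= X]mulrC ler_wpM2l ?sqr_ge0 //.
by have := hB x; rewrite /expinv x0.
Qed.

(** [expinv (dpoly R n)] is the n-th derivative of the function equal to exp (- 1 / t) for t > 0 and
    to 0 elsewhere. *)
Fixpoint dpoly (R : realType) (n : nat) : {poly R} :=
  if n is n'.+1 then 'X^2 * (dpoly R n' - (dpoly R n')^`()) else 1.

(** The mean value theorem twice, with the global bound on the second derivative. The constant is
    the same for all t, which allows summation over translates. *)
Lemma expinv_taylor (R : realType) n : exists2 B : R, 0 <= B & forall t x : R,
  `|expinv (dpoly R n) (t + x) - expinv (dpoly R n) t - x * expinv (dpoly R n.+1) t| <= B * x ^+ 2.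
Proof.
have [B B0 hB] := expinv_bound (dpoly R n.+2); exists B => // t x.
have mvt m (y z : R) : exists2 c, `|c - y| <= `|z - y| & expinv (dpoly R m) z - expinv (dpoly R m) y = expinv (dpoly R m.+1) c * (z - y).
  have dd (s : R) : is_derive s 1 (expinv (dpoly R m)) (expinv (dpoly R m.+1) s) by exact: expinv_derive.
  have cc (s : R) : {for s, continuous (expinv (dpoly R m))}.
    by have [d _] := dd s; apply: differentiable_continuous; apply/derivable1_diffP.
  have [yz|zy|->] := ltgtP y z; last by exists z => //; rewrite !subrr mulr0.
    have [|c cin E] := MVT yz (fun s _ => dd s); first by apply: continuous_subspaceT => s; exact: cc.
    exists c => //; move: cin; rewrite in_itv /= => /andP[h1 h2].
    by rewrite !ger0_norm ?subr_ge0 ?(ltW h1) ?(ltW yz) // lerD2r ltW.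
  have [|c cin E] := MVT zy (fun s _ => dd s); first by apply: continuous_subspaceT => s; exact: cc.
  exists c; last by rewrite -[LHS]opprB E -mulrN opprB.
  move: cin; rewrite in_itv /= => /andP[h1 h2].
  by rewrite !ler0_norm ?subr_le0 ?(ltW h2) ?(ltW zy) // lerN2 lerD2r ltW.
have [c c1 E] := mvt n t (t + x).
have [c' _ E'] := mvt n.+1 t c.
rewrite addrAC subrr add0r in c1 E; rewrite E mulrC -mulrBr E' normrM normrM.
rewrite -[x ^+ 2]real_normK ?num_real // expr2 mulrCA mulrA.
rewrite [X in X <= _](_ : _ = `|expinv (dpoly R n.+2) c'| * (`|c - t| * `|x|)); last by ring.
by apply: ler_pM => //; exact: ler_wpM2r.
Qed.

(* [h] is a positive superposition of translates of [exp (- 1 / t)], whose derivatives are all bounded, so that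
   the series may be differentiated term by term for every summable [c]. *)
Lemma flat_series (R : realType) (c g : nat -> R) :
  (forall j, 0 <= c j <= 2^-1 ^+ j.+1) -> (forall j, c j > 0) -> (forall j, 0 < g j) ->
  exists h : R -> R, [/\ forall n, sm n h, forall s t, s <= t -> h s <= h t,
    forall t, 0 <= h t, forall t, (exists j, g j < t) -> 0 < h t &
    forall t d, (forall N, \sum_(0 <= j < N) (if g j < t then c j else 0) <= d) -> h t <= d].
Proof.
move=> hc c0 g0.
pose S n N t := \sum_(0 <= j < N) c j * expinv (dpoly R n) (t - g j).
have cge j : 0 <= c j by exact: ltW.
have sumc N : \sum_(0 <= j < N) c j <= 1.
  apply: (@le_trans _ _ (\sum_(0 <= j < N) 2^-1 ^+ j.+1)); first by apply: ler_sum => j _; have /andP[] := hc j.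
  suff -> : \sum_(0 <= j < N) (2^-1 : R) ^+ j.+1 = 1 - 2^-1 ^+ N by rewrite gerBl exprn_ge0.
  elim: N => [|N IH]; first by rewrite big_geq // expr0 subrr.
  by rewrite big_nat_recr //= IH exprS; field.
have cv n t : cvgn (fun N => S n N t).
  have [B B0 hB] := expinv_bound (dpoly R n).
  apply: normed_cvg.
  apply: (@series_le_cvg _ _ (fun j => B * c j)).
  - by move=> j; exact: normr_ge0.
  - by move=> j; rewrite mulr_ge0.
  - by move=> j /=; rewrite normrM ger0_norm // mulrC ler_wpM2r.
  apply: nondecreasing_is_cvgn.
    by apply: nondecreasing_series => j _ _; rewrite mulr_ge0.
  exists B => _ [N _ <-]; rewrite /series /= -mulr_sumr -[X in _ <= X]mulr1.
  by rewrite ler_wpM2l.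
pose h n (t : R) : R := limn (fun N => S n N t).
have hcv n t : (fun N => S n N t) @ \oo --> h n t by exact: cv.
(* The Taylor bounds of the terms have a common B and the weights c j sum to at most 1, so the
   partial sums, and then the limit, satisfy the same bound. *)
have dh n (t : R) : is_derive t 1 (h n) (h n.+1 t).
  have [B B0 hB] := @expinv_taylor R n.
  apply: (@quad_derive _ _ _ _ B) => x.
  have lim : (fun N => `|S n N (t + x) - S n N t - x * S n.+1 N t|) @ \oo --> `|h n (t + x) - h n t - x * h n.+1 t|.
    apply: cvg_norm; apply: cvgB; first by apply: cvgB; exact: hcv.
    by apply: cvgM; [exact: cvg_cst|exact: hcv].
  apply: (cvgr_to_le lim); near=> N.
  rewrite /S mulr_sumr -!sumrB; apply: le_trans (ler_norm_sum _ _ _) _.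
  apply: (@le_trans _ _ (\sum_(0 <= j < N) c j * (B * x ^+ 2))); last first.
    by rewrite -mulr_suml -[X in _ <= X]mul1r ler_wpM2r // mulr_ge0 // sqr_ge0.
  apply: ler_sum => j _.
  rewrite (addrAC t x) (_ : _ - _ - _ = c j * (expinv (dpoly R n) ((t - g j) + x) - expinv (dpoly R n) (t - g j) - x * expinv (dpoly R n.+1) (t - g j))).
    by rewrite normrM ger0_norm // ler_wpM2l.
  by ring.
have smh m n : sm m (h n) by elim: m n => [//|m IH] n; exists (h n.+1).
have E1 t : expinv (dpoly R 0) t = if 0 < t then expR (- t^-1) else 0.
  by rewrite /expinv /= hornerC mul1r.
have E0 t : 0 <= expinv (dpoly R 0) t <= 1.
  rewrite E1; case: ifP => t0; last by rewrite lexx ler01.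
  by rewrite expR_ge0 /= -[X in _ <= X]expR0 ler_expR oppr_le0 invr_ge0 ltW.
have Em s t : s <= t -> expinv (dpoly R 0) s <= expinv (dpoly R 0) t.
  move=> st; have [s0|s0] := ltP 0 s; last by rewrite E1 ltNge s0 /=; have /andP[] := E0 t.
  have t0 : 0 < t by exact: lt_le_trans st.
  by rewrite !E1 s0 t0 ler_expR lerN2 lef_pV2.
have lb t N : S 0 N t <= h 0 t.
  apply: nondecreasing_cvgn_le; last exact: cv.
  by apply: nondecreasing_series => j _ _; have /andP[k _] := E0 (t - g j); rewrite mulr_ge0.
exists (h 0); split.
- by move=> n; exact: smh.
- move=> s t st; apply: ler_lim; [exact: cv|exact: cv|near=> N].
  by apply: ler_sum => j _; rewrite ler_wpM2l // Em // lerD2r.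
- by move=> t; apply: le_trans (lb t 0); rewrite /S big_geq.
- move=> t [j gj]; apply: lt_le_trans (lb t j.+1); rewrite /S big_nat_recr //=.
  have p : 0 < c j * expinv (dpoly R 0) (t - g j) by rewrite mulr_gt0 // E1 subr_gt0 gj expR_gt0.
  by apply: ltr_wpDl => //; apply: sumr_ge0 => i _; have /andP[k _] := E0 (t - g i); rewrite mulr_ge0.
move=> t d hd; apply: limr_le; [exact: cv|near=> N]; apply: le_trans (hd N).
apply: ler_sum => j _; case: ifP => gj.
  by have /andP[_ k] := E0 (t - g j); rewrite ler_piMr.
by rewrite E1 subr_gt0 gj mulr0.
Unshelve. all: by end_near. Qed.

(** The translates start at the points g j = 2 ^ - j. At g j only those of index i > j are present,
    and their weights contain a factor at most [d j], so h (g j) is at most the value [d j] that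
    omega dictates. *)
Lemma flat_function (R : realType) (omega : R -> R) (K : R) :
  modulus_of_continuity omega -> 0 < K ->
  exists h : R -> R, [/\ forall n, sm n h, forall s t, s <= t -> h s <= h t,
    forall t, t <= 0 -> h t = 0, forall t, 0 < t -> 0 < h t &
    forall e, 0 < e -> exists g, 0 < g < e /\ (forall s, 0 <= s -> s <= K * h g -> omega s <= g ^+ 2 /\ s < e)].
Proof.
move=> [om1 om2 om3 om4] K0.
pose g (j : nat) : R := 2^-1 ^+ j.
have g0 j : 0 < g j by rewrite exprn_gt0.
have hd j : exists d : R, 0 < d /\ forall s, 0 <= s -> s <= K * d -> omega s <= g j ^+ 2 /\ s <= g j.
  have : \forall s \near (0 : R)^'+, omega s < g j ^+ 2.
    by apply: (cvgr_lt _ om4); rewrite exprn_gt0.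
  move=> /nbhs_ballP[r /= r0 hr].
  pose m := Num.min (r / 2) (g j); have m0 : 0 < m by rewrite lt_min g0 divr_gt0.
  exists (m / K); split; first by rewrite divr_gt0.
  move=> s s0; rewrite mulrCA divff ?gt_eqF // mulr1 => sm; split; last by apply: le_trans sm _; rewrite ge_min lexx orbT.
  apply: le_trans (om2 _ _ s0 sm) (ltW _); apply: hr => //=.
  rewrite /ball /= sub0r normrN gtr0_norm //; apply: le_lt_trans (_ : r / 2 < r); first by rewrite ge_min lexx.
  by move: r0; clear; lra.
have /choice[d hd'] := hd.
(* The minimum over all earlier indices is taken because the term of index j contributes to h at
   every g i with i < j. *)
pose c j : R := 2^-1 ^+ j.+1 * \big[Num.min/1]_(i < j.+1) d i.
have mpos j : 0 < \big[Num.min/(1:R)]_(i < j.+1) d i <= 1.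
  apply/andP; split; first by apply: (big_ind (fun x : R => 0 < x)) => // [x y x0 y0|i _]; [rewrite lt_min x0|have [] := hd' i].
  suff h (r : seq 'I_j.+1) : \big[Num.min/(1:R)]_(i <- r) d i <= 1 by exact: h.
  by elim: r => [|i r IH]; rewrite ?big_nil // big_cons ge_min IH orbT.
have mle i j : (i <= j)%N -> \big[Num.min/(1:R)]_(i < j.+1) d i <= d i.
  move=> ij; rewrite (bigD1 (Ordinal (ij : (i < j.+1)%N))) //=; by rewrite ge_min lexx.
have c0 j : 0 < c j by have /andP[k _] := mpos j; rewrite mulr_gt0 // exprn_gt0.
have cb j : 0 <= c j <= 2^-1 ^+ j.+1.
  by rewrite ltW //=; have /andP[_ k] := mpos j; rewrite ler_piMr // exprn_ge0.
have [h [h1 h2 h3 h4 h5]] := flat_series cb c0 g0.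
have gdec i j : (i <= j)%N -> g j <= g i.
  by move=> ij; rewrite /g ler_wiXn2l // invf_le1 // ler1n.
have gsm e : 0 < e -> exists j, g j < e.
  move=> e0; have := @cvg_geometric R 1 2^-1; rewrite /geometric /= => /(_ _).
  have -> : `|2^-1 : R| < 1 by rewrite gtr0_norm ?invr_gt0 // invf_lt1 // ltr1n.
  move=> /(_ isT) cv0; have : \forall j \near \oo, 1 * 2^-1 ^+ j < e by apply: (cvgr_lt _ cv0).
  by move=> [j _ hj]; exists j; have := hj j (leqnn j); rewrite /= mul1r.
exists h; split => //.
- move=> t t0; apply/eqP; rewrite eq_le h3 andbT; apply: h5 => N.
  rewrite big1 // => j _; rewrite ifF //; apply/negbTE; rewrite -leNgt; apply: le_trans t0 _; exact: ltW.
- by move=> t /gsm[j gj]; apply: h4; exists j.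
move=> e e0; have [j gj] := gsm _ e0; exists (g j); split; first by rewrite g0.
move=> s s0 sh; have [_ hj] := hd' j.
have hle : h (g j) <= d j.
  apply: h5 => N; have dj0 : 0 < d j by have [] := hd' j.
  apply: (@le_trans _ _ (\sum_(0 <= i < N) 2^-1 ^+ i.+1 * d j)).
    apply: ler_sum => i _; case: ifP => gi; last by rewrite mulr_ge0 ?exprn_ge0 // ltW.
    rewrite ler_wpM2l ?exprn_ge0 //; apply: mle; rewrite leqNgt; apply/negP => ij.
    by have := lt_le_trans gi (gdec _ _ (ltnW ij)); rewrite ltxx.
  rewrite -mulr_suml -[X in _ <= X]mul1r ler_wpM2r ?(ltW dj0) //.
  suff -> : \sum_(0 <= j < N) (2^-1 : R) ^+ j.+1 = 1 - 2^-1 ^+ N by rewrite gerBl exprn_ge0.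
  elim: N => [|N IH]; first by rewrite big_geq // expr0 subrr.
  by rewrite big_nat_recr //= IH exprS; field.
have shd : s <= K * d j by apply: le_trans sh _; rewrite ler_pM2l.
have [k1 k2] := hj s s0 shd.
by split => //; exact: le_lt_trans gj.
Qed.

(** The graph of f describes each side of the domain: flat over |t| <= L / 2, bending away as slowly
    as omega demands, and of slope 1 from L on, so that adjacent sides join along straight
    pieces. *)
Record profile (R : realType) (omega : R -> R) (L : R) (f f' : R -> R) : Prop := Profile {
  pf_sm : forall n, sm n f;
  pf_der : forall t : R, is_derive t 1 f (f' t);
  pf_cont : forall t, {for t, continuous f'};
  pf_even : forall t, f (- t) = f t;
  pf_zero : forall t, `|t| <= L / 2 -> f t = 0;
  pf_mono : forall s t, s <= t -> f' s <= f' t;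
  pf_pos : forall t, L / 2 < t -> 0 < f' t;
  pf_le1 : forall t, f' t <= 1;
  pf_far : forall t, L <= t -> f' t = 1;
  pf_flat : forall e, 0 < e -> exists g, [/\ 0 < g < e, omega (f (L / 2 + g)) <= g ^+ 2 & f (L / 2 + g) < e]
}.

(** The slope is built from the smooth step [st] = x / (x + y), where x is flat at L / 2 to the
    prescribed order and y vanishes from L on. Its primitive F vanishes up to L / 2, so F (t) + F (-
    t) is even and its two summands do not overlap. *)
Lemma profile_exists (R : realType) (omega : R -> R) (L : R) :
  modulus_of_continuity omega -> 0 < L -> exists f f', profile omega L f f'.
Proof.
move=> om L0.
pose E (t : R) := expinv (dpoly R 0) t.
have EE t : E t = if 0 < t then expR (- t^-1) else 0 by rewrite /E /expinv /= hornerC mul1r.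
have Epos t : 0 < t -> 0 < E t by move=> t0; rewrite EE t0 expR_gt0.
have E0 t : 0 <= E t by rewrite EE; case: ifP => // _; exact: expR_ge0.
have Em s t : s <= t -> E s <= E t.
  move=> st; have [s0|s0] := ltP 0 s; last by rewrite EE ltNge s0 /=.
  have t0 : 0 < t by exact: lt_le_trans st.
  by rewrite !EE s0 t0 ler_expR lerN2 lef_pV2.
have Esm m n : sm m (expinv (dpoly R n)).
  by elim: m n => [//|m IH] n; exists (expinv (dpoly R n.+1)) => // t; exact: expinv_derive.
have L4 : 0 < L / 4 by rewrite divr_gt0.
(* For g < L / 4 the denominator at L / 2 + g is at least [E (L / 4)], so the step there is at most
   h g divided by this number; with g <= 1 the same bound holds for f. *)
have K0 : 0 < (E (L / 4))^-1 by rewrite invr_gt0 Epos.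
have [h [hsm hm h0 hp hflat]] := flat_function om K0.
have hge t : 0 <= h t by have [t0|t0] := ltP 0 t; [exact/ltW/hp|rewrite h0].
pose x (t : R) := h (1 * t + - (L / 2)); pose y (t : R) := E ((-1) * t + L).
have xE t : x t = h (t - L / 2) by rewrite /x mul1r.
have yE t : y t = E (L - t) by rewrite /y mulN1r addrC.
have x0 t : 0 <= x t by rewrite xE.
have y0 t : 0 <= y t by rewrite yE.
have xy t : 0 < x t + y t.
  have [t1|t1] := ltP (L / 2) t; first by rewrite ltr_pwDl // xE hp // subr_gt0.
  by rewrite ltr_wpDl // yE Epos //; move: t1 L0; clear; lra.
pose st t := x t * (x t + y t)^-1.
have stsm n : sm n st.
  have s1 : sm n x by exact: sm_affine.
  have s2 : sm n y by apply: sm_affine; exact: Esm.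
  by apply: smM => //; apply: smV; [move=> t; rewrite gt_eqF|exact: smD].
have st0 t : t <= L / 2 -> st t = 0 by move=> t1; rewrite /st xE h0 ?mul0r // subr_le0.
have stp t : L / 2 < t -> 0 < st t by move=> t1; rewrite /st divr_gt0 // xE hp // subr_gt0.
have st1 t : L <= t -> st t = 1.
  move=> t1; rewrite /st (_ : y t = 0); last by rewrite yE EE ifF //; apply/negbTE; rewrite -leNgt subr_le0.
  by rewrite addr0 divff // gt_eqF // xE hp //; move: t1 L0; clear; lra.
have stm s t : s <= t -> st s <= st t.
  move=> hst; rewrite /st ler_pdivrMr // mulrAC ler_pdivlMr //.
  have hx : x s <= x t by rewrite !xE hm // lerD2r.
  have hy : y t <= y s by rewrite !yE Em // lerD2l lerN2.
  by rewrite !mulrDr [x t * x s]mulrC lerD2l; apply: ler_pM.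
have stge t : 0 <= st t by rewrite /st divr_ge0 // ltW.
have stle t : st t <= 1 by rewrite /st ler_pdivrMr // mul1r lerDl.
have stc t : {for t, continuous st}.
  have [f' df _] := stsm 1; have [d _] := df t.
  by apply: differentiable_continuous; apply/derivable1_diffP.
have mst (u : R) : measurable_fun `]0, u]%classic st.
  by apply: interval_mono_measurable; [exact: interval_is_interval|move=> s t _ _; exact: stm].
have ist u : (@lebesgue_measure R).-integrable `]0, u] (EFin \o st).
  apply: (@bounded_integrable_oc _ _ _ _ 1); first exact: mst.
  by move=> s _; rewrite ger0_norm.
pose F (t : R) : R := \int[@lebesgue_measure R]_(s in [set` Interval (BRight 0) (BRight t)]) st s.
have F0 t : t <= L / 2 -> F t = 0.
  move=> t1; transitivity (\int[@lebesgue_measure R]_(s in [set` Interval (BRight 0) (BRight t)]) cst (0 : R) s).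
    by apply: eq_Rintegral => s; rewrite inE /= in_itv /= => /andP[_ s2]; apply: st0; exact: le_trans t1.
  by rewrite Rintegral_cst // mul0r.
have dF (t : R) : is_derive t 1 F (st t).
  have [t1|t1] := ltP 0 t.
    have tu : t < t + 1 by rewrite ltrDl.
    have [d e] := @continuous_FTC1 R st (BRight 0) t (t + 1) tu (ist (t + 1)) ltac:(exact: t1) (stc t).
    by split; [exact: d|rewrite -derive1E; exact: e].
  rewrite st0; last by move: t1 L0; clear; lra.
  apply: (@near_eq_is_derive _ _ _ (cst 0)).
  have hn : \forall y \near t, y < L / 2 by apply: (cvgr_lt _ cvg_id); move: t1 L0; clear; lra.
  by apply: filterS hn => s s1; rewrite F0 // ltW.
have dFN (t : R) : is_derive t 1 (fun t => F (- t)) (- st (- t)).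
  have := @is_derive1_comp R F (fun t => - t) t _ _ (dF (- t)) (is_deriveN (is_derive_id t 1)).
  by rewrite mulrN1.
have sub s t : F s + st s * (t - s) <= F t.
  pose M := `|s| + `|t| + 1.
  have b1 : - M < s /\ s < M by rewrite /M; have := ler_norm s; have := ler_norm (- s); rewrite normrN; have := normr_ge0 t; clear; lra.
  have b2 : - M < t /\ t < M by rewrite /M; have := ler_norm t; have := ler_norm (- t); rewrite normrN; have := normr_ge0 s; clear; lra.
  apply: (@mono_derive_subgrad R F st (- M) M) => //; try by case: b1; try by case: b2.
  by move=> a b _ ab _; exact: stm.
exists (fun t => F t + F (- t)), (fun t => st t - st (- t)); split.
- move=> n; apply: smD.
    by case: n => // n; exists st.
  have h1 : sm n (fun t => F ((-1) * t + 0)) by apply: sm_affine; case: n => // n; exists st.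
  by rewrite (_ : (fun t => F (- t)) = fun t => F ((-1) * t + 0)) //; apply/funext => t; rewrite mulN1r addr0.
- by move=> t; exact: is_deriveD.
- move=> t; apply: cvgB; first exact: (stc t).
  have c1 : (fun t : R => - t) @ t --> - t by apply: cvgN; exact: cvg_id.
  exact: (cvg_comp _ _ c1 (stc (- t))).
- by move=> t; rewrite opprK addrC.
- by move=> t; rewrite ler_norml => /andP[t1 t2]; rewrite !F0 ?addr0 //; move: t1; clear; lra.
- by move=> s t hst; apply: lerB; apply: stm => //; rewrite lerN2.
- move=> t t1; rewrite (st0 (- t)) ?subr0 ?stp //; move: t1 L0; clear; lra.
- by move=> t; have := stle t; have := stge (- t); clear; lra.
- by move=> t t1; rewrite st1 // (st0 (- t)) ?subr0 //; move: t1 L0; clear; lra.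
move=> e e0; pose e' := Num.min e (Num.min 1 (L / 4)).
have e'0 : 0 < e' by rewrite !lt_min e0 ltr01.
have l1 : e' <= e by rewrite ge_min lexx.
have l2 : e' <= 1 by rewrite !ge_min lexx !orbT.
have l3 : e' <= L / 4 by rewrite !ge_min lexx !orbT.
have [g [/andP[g0 ge] hg]] := hflat e' e'0.
have gL : g < L / 4 by exact: lt_le_trans l3.
have bnd : 0 <= F (L / 2 + g) + F (- (L / 2 + g)) <= (E (L / 4))^-1 * h g.
  rewrite (F0 (- _)) ?addr0; last by move: g0 L0; clear; lra.
  apply/andP; split.
    by have := sub (L / 2) (L / 2 + g); rewrite F0 // st0 // mul0r addr0.
  have := sub (L / 2 + g) (L / 2); rewrite (F0 (L / 2)) // (_ : L / 2 - (L / 2 + g) = - g); last by ring.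
  have k1 : st (L / 2 + g) * g <= st (L / 2 + g) * 1 by rewrite ler_wpM2l //; exact: le_trans (ltW ge) l2.
  have k2 : st (L / 2 + g) <= (E (L / 4))^-1 * h g.
    have Eg : L / 2 + g - L / 2 = g by ring.
    have xyg := xy (L / 2 + g); rewrite xE Eg in xyg.
    rewrite /st xE Eg mulrC ler_wpM2r // lef_pV2 ?posrE ?Epos //.
    apply: le_trans (_ : y (L / 2 + g) <= _); last by rewrite lerDr.
    by rewrite yE Em //; move: gL; clear; lra.
  by rewrite mulrN; move: k1 k2; clear; lra.
have /andP[b1 b2] := bnd; have [k1 k2] := hg _ b1 b2.
by exists g; split; [rewrite g0 (lt_le_trans ge l1)| |exact: lt_le_trans l1].
Qed.

(** * The rounded diamond *)

(** The first condition cuts the left and right sides, the second the top and the bottom. Where f is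
    |t| - c in both variables, the two conditions are the same. *)
Definition diamond (R : realType) (f : R -> R) (p : R) : set (R * R) :=
  [set z | `|z.1 - p| + f z.2 < 1 /\ `|z.2| + f (z.1 - p) < 1].

(** From L on the slope is 1, so f is |t| - c there with c = L - f L; since the slope never exceeds
    1, |t| - c is a lower bound everywhere. *)
Lemma profile_facts (R : realType) (omega : R -> R) (L : R) (f f' : R -> R) :
  profile omega L f f' -> 0 < L -> L <= 1 / 100 ->
  [/\ forall s t, f s + f' s * (t - s) <= f t, forall s, 0 <= f s <= `|s|,
      forall s, `|s| - L <= f s, forall s t, `|s| <= `|t| -> f s <= f t &
      exists c, [/\ L / 2 <= c, c <= L & forall s, L <= `|s| -> f s = `|s| - c] /\ forall s, `|s| - c <= f s].
Proof.
move=> pf L0 L1.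
have sub s t : f s + f' s * (t - s) <= f t.
  pose M := `|s| + `|t| + 1.
  have b1 : - M < s /\ s < M by rewrite /M; have := ler_norm s; have := ler_norm (- s); rewrite normrN; have := normr_ge0 t; clear; lra.
  have b2 : - M < t /\ t < M by rewrite /M; have := ler_norm t; have := ler_norm (- t); rewrite normrN; have := normr_ge0 s; clear; lra.
  apply: (@mono_derive_subgrad R f f' (- M) M); try by case: b1; try by case: b2.
  - by move=> x _ _; exact: (pf_der pf).
  - by move=> a b _ ab _; exact: (pf_mono pf).
have f00 : f 0 = 0 by rewrite (pf_zero pf) // normr0 divr_ge0 // ltW.
have fn s : f s = f `|s| by case: (ger0P s) => // _; rewrite (pf_even pf).
have f'0 s : 0 <= s -> 0 <= f' s.
  move=> s0; apply: le_trans (pf_mono pf s0).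
  have h : f' 0 * (- (L / 2)) <= 0 by have := sub 0 (- (L / 2)); rewrite f00 (pf_zero pf) ?sub0r ?normrN ?ger0_norm ?divr_ge0 ?(ltW L0) //; clear; lra.
  by move: h; rewrite mulrN oppr_le0 pmulr_lge0 // divr_gt0.
have mono s t : 0 <= s -> s <= t -> f s <= f t.
  move=> s0 st; have := sub s t; have : 0 <= f' s * (t - s) by rewrite mulr_ge0 ?f'0 ?subr_ge0.
  by clear; lra.
have lip s t : s <= t -> f t - f s <= t - s.
  move=> st; have := sub t s; have : f' t * (t - s) <= 1 * (t - s) by rewrite ler_wpM2r ?subr_ge0 // (pf_le1 pf).
  by clear; lra.
pose c := L - f L.
have far s : L <= s -> f s = s - c.
  move=> Ls; have := sub L s; have := lip _ _ Ls; rewrite (pf_far pf) ?lexx // mul1r /c.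
  by move=> h1 h2; apply/eqP; rewrite eq_le; apply/andP; split; move: h1 h2; clear; lra.
have cL : L / 2 <= c <= L.
  have h1 : f (L / 2) = 0 by rewrite (pf_zero pf) // ger0_norm // divr_ge0 // ltW.
  have h2 := lip (L / 2) L ltac:(move: L0; clear; lra).
  have h3 := mono 0 L (lexx _) (ltW L0); rewrite f00 in h3.
  by rewrite /c; apply/andP; split; move: h1 h2 h3; clear; lra.
have /andP[c1 c2] := cL.
have low s : 0 <= s -> s - c <= f s.
  move=> s0; have [Ls|sL] := leP L s; first by rewrite far.
  have := lip _ _ (ltW sL); rewrite /c; clear; lra.
have up s : 0 <= s -> f s <= s by move=> s0; have := lip _ _ s0; rewrite f00; clear; lra.
split=> //.
- by move=> s; rewrite fn up // andbT -f00 mono.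
- by move=> s; rewrite (fn s); have := low _ (normr_ge0 s); move: c2; clear; lra.
- by move=> s t st; rewrite (fn s) (fn t) mono.
exists c; split; last by move=> s; rewrite (fn s) low.
by split => // s Ls; rewrite (fn s) far.
Qed.

(** If |z.1 - p| >= L, the second condition reads |z.2| + |z.1 - p| - c < 1, which follows from the
    first because f z.2 >= |z.2| - c. If |z.1 - p| < L, it holds because f is at most 1/100 there
    and |z.2| < 9/10. The other case is symmetric. *)
Lemma diamond_facts (R : realType) (omega : R -> R) (L p : R) (f f' : R -> R) :
  profile omega L f f' -> 0 < L -> L <= 1 / 100 ->
  [/\ forall z, `|z.2| < 9 / 10 -> diamond f p z <-> `|z.1 - p| + f z.2 < 1,
      forall z, `|z.1 - p| < 9 / 10 -> diamond f p z <-> `|z.2| + f (z.1 - p) < 1,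
      open (diamond f p), cset2 (diamond f p) &
      forall z, diamond f p z -> `|z.1 - p| < 1 /\ `|z.2| < 1].
Proof.
move=> pf L0 L1; have [sub up low mono [c [[c1 c2 far] lowc]]] := profile_facts pf L0 L1.
have cf (t : R) : {for t, continuous f}.
  by have [d _] := pf_der pf t; apply: differentiable_continuous; apply/derivable1_diffP.
have one s t : `|t| < 9 / 10 -> `|s| + f t < 1 -> `|t| + f s < 1.
  move=> t9 h; have [sL|sL] := leP L `|s|.
    by rewrite (far _ sL); have := lowc t; move: h; clear; lra.
  by have /andP[_ k] := up s; move: t9 sL L1 k; clear; lra.
split.
- by move=> z hz; split => [[]//|h]; split => //; exact: one.
- by move=> z hz; split => [[]//|h]; split => //; exact: one.
- rewrite openE => z [h1 h2].
  have z1 : (fun y : R * R => y.1) @ z --> z.1 by exact: cvg_fst.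
  have z2 : (fun y : R * R => y.2) @ z --> z.2 by exact: cvg_snd.
  have zp : (fun y : R * R => y.1 - p) @ z --> z.1 - p by apply: cvgB => //; exact: cvg_cst.
  have k1 : \forall y \near z, `|y.1 - p| + f y.2 < 1.
    have G : (fun y : R * R => `|y.1 - p| + f y.2) @ z --> `|z.1 - p| + f z.2.
      by apply: cvgD; [exact: cvg_norm|exact: (cvg_comp _ _ z2 (cf z.2))].
    exact: (cvgr_lt _ G).
  have k2 : \forall y \near z, `|y.2| + f (y.1 - p) < 1.
    have G : (fun y : R * R => `|y.2| + f (y.1 - p)) @ z --> `|z.2| + f (z.1 - p).
      by apply: cvgD; [exact: cvg_norm|exact: (cvg_comp _ _ zp (cf (z.1 - p)))].
    exact: (cvgr_lt _ G).
  by near=> y; split; near: y.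
- have fc x y t : 0 <= t -> t <= 1 -> f (x + t * (y - x)) <= f x + t * (f y - f x).
    move=> t0 t1; set m := x + _.
    have q1 : (1 - t) * (f m + f' m * (x - m)) <= (1 - t) * f x by rewrite ler_wpM2l ?subr_ge0.
    have q2 : t * (f m + f' m * (y - m)) <= t * f y by rewrite ler_wpM2l.
    have E : (1 - t) * (f m + f' m * (x - m)) + t * (f m + f' m * (y - m)) = f m by rewrite /m; ring.
    by move: q1 q2 E; clear; lra.
  have nc (x y t : R) : 0 <= t -> t <= 1 -> `|x + t * (y - x)| <= `|x| + t * (`|y| - `|x|).
    move=> t0 t1; rewrite (_ : x + t * (y - x) = (1 - t) * x + t * y); last by ring.
    apply: le_trans (ler_normD _ _) _; rewrite !normrM (ger0_norm t0) ger0_norm ?subr_ge0 //.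
    by clear; lra.
  move=> x y t [x1 x2] [y1 y2] t0 t1; rewrite /diamond /=.
  have E : x.1 + t * (y.1 - x.1) - p = (x.1 - p) + t * ((y.1 - p) - (x.1 - p)) by ring.
  rewrite E; split.
    apply: le_lt_trans (lerD (nc _ _ _ t0 t1) (fc _ _ _ t0 t1)) _.
    by move: (mul_lt_conv x1 y1 t0 t1); clear; lra.
  apply: le_lt_trans (lerD (nc _ _ _ t0 t1) (fc _ _ _ t0 t1)) _.
  by move: (mul_lt_conv x2 y2 t0 t1); clear; lra.
move=> z [h1 h2]; have /andP[k1 _] := up z.2; have /andP[k2 _] := up (z.1 - p).
by split; move: h1 h2 k1 k2; clear; lra.
Unshelve. all: by end_near. Qed.

(** Near a boundary point one of the two conditions describes the domain, and the absolute value
    outside f in it has a constant sign. This gives four cases, in each of which e is the inward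
    direction along a coordinate axis. *)
Lemma diamond_smooth (R : realType) (omega : R -> R) (L p : R) (f f' : R -> R) :
  profile omega L f f' -> 0 < L -> L <= 1 / 100 -> bounded_smooth_convex_domain (diamond f p).
Proof.
move=> pf L0 L1; have [sub up low mono _] := profile_facts pf L0 L1.
have [dia1 dia2 oD cD bD] := diamond_facts p pf L0 L1.
have cf (t : R) : {for t, continuous f}.
  by have [d _] := pf_der pf t; apply: differentiable_continuous; apply/derivable1_diffP.
have sg (k c d : R) : smooth_function (fun t => f (k * t + c) + d).
  by apply: sm_smooth => n; apply: smD; [apply: sm_affine; exact: (pf_sm pf)|exact: sm_cst].
split => //.
- exists (`|p| + 1); split; first exact: num_real.
  move=> M hM z /bD[h1 h2] /=; rewrite prod_normE ge_max; apply/andP; split.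
    have := ler_normD (z.1 - p) p; rewrite subrK => h; apply: ltW; move: h h1 hM; clear; lra.
  by apply: ltW; have := normr_ge0 p; move: h2 hM; clear; lra.
- exact/convex_set_cset2.
move=> q [cq nq].
have nD : ~ diamond f p q by move=> h; apply: nq; exact: open_nbhs_nbhs.
have z1 : (fun y : R * R => y.1 - p) @ q --> q.1 - p by apply: cvgB; [exact: cvg_fst|exact: cvg_cst].
have z2 : (fun y : R * R => y.2) @ q --> q.2 by exact: cvg_snd.
have F1 : (fun y : R * R => `|y.1 - p| + f y.2) @ q --> `|q.1 - p| + f q.2.
  by apply: cvgD; [exact: cvg_norm|exact: (cvg_comp _ _ z2 (cf q.2))].
have cl1 : `|q.1 - p| + f q.2 <= 1.
  rewrite leNgt; apply/negP => h.
  have hn : nbhs q [set y : R * R | 1 < `|y.1 - p| + f y.2] by apply: (cvgr_gt _ F1).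
  by have [y [[k1 _] /= k2]] := cq _ hn; have := lt_trans k1 k2; rewrite ltxx.
have [t9|t9] := ltP `|q.2| (9 / 10).
  have n1 : \forall y \near q, `|y.2| < 9 / 10 by apply: (cvgr_lt _ (cvg_norm z2)).
  have big : 1 / 10 < `|q.1 - p|.
    rewrite ltNge; apply/negP => h; apply: nD; apply/dia1 => //.
    by have /andP[_ k] := up q.2; move: h t9 k; clear; lra.
  have [s0|s0] := ltP 0 (q.1 - p).
    exists (-1, 0), (fun t => f (1 * t + 0) + (- 1 - p)); split => //.
      by rewrite /enorm /= sqrrN expr1n expr0n addr0 sqrtr1.
    have n2 : \forall y \near q, 0 < y.1 - p by apply: (cvgr_gt _ z1).
    near=> y; rewrite dia1; last by near: y.
    have y0 : 0 < y.1 - p by near: y.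
    rewrite (gtr0_norm y0) /= !mulr0 !mulrN1 mul1r !addr0 sub0r opprK.
    by split; clear; lra.
  have s0' : q.1 - p < 0.
    by rewrite lt_neqAle s0 andbT; apply/eqP => h; move: big; rewrite h normr0; clear; lra.
  exists (1, 0), (fun t => f ((-1) * t + 0) + (p - 1)); split => //.
    by rewrite /enorm /= expr1n expr0n addr0 sqrtr1.
  have n2 : \forall y \near q, y.1 - p < 0 by apply: (cvgr_lt _ z1).
  near=> y; rewrite dia1; last by near: y.
  have y0 : y.1 - p < 0 by near: y.
  rewrite (ltr0_norm y0) /= !mulr0 !mulr1 sub0r mulrNN mul1r !addr0.
  by split; clear; lra.
have q9 : `|q.1 - p| < 9 / 10.
  by have := low q.2; move: cl1 t9 L1; clear; lra.
have n1 : \forall y \near q, `|y.1 - p| < 9 / 10 by apply: (cvgr_lt _ (cvg_norm z1)).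
have [s0|s0] := ltP 0 q.2.
  exists (0, -1), (fun t => f ((-1) * t + (- p)) + (- 1)); split => //.
    by rewrite /enorm /= sqrrN expr1n expr0n add0r sqrtr1.
  have n2 : \forall y \near q, 0 < y.2 by apply: (cvgr_gt _ z2).
  near=> y; rewrite dia2; last by near: y.
  have y0 : 0 < y.2 by near: y.
  rewrite (gtr0_norm y0) /= !mulr0 !mulrN1 subr0 mulN1r opprK add0r.
  by split; clear; lra.
have s0' : q.2 < 0.
  by rewrite lt_neqAle s0 andbT; apply/eqP => h; move: t9; rewrite h normr0; clear; lra.
exists (0, 1), (fun t => f (1 * t + (- p)) + (- 1)); split => //.
  by rewrite /enorm /= expr1n expr0n add0r sqrtr1.
have n2 : \forall y \near q, y.2 < 0 by apply: (cvgr_lt _ z2).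
near=> y; rewrite dia2; last by near: y.
have y0 : y.2 < 0 by near: y.
rewrite (ltr0_norm y0) /= !mulr0 !mulr1 subr0 add0r mul1r.
by split; clear; lra.
Unshelve. all: by end_near. Qed.

(** The half length b is the inverse of s = a + f on the values beyond L / 2. Convexity of f gives
    the two-sided difference bounds [step], from which continuity and differentiability of b follow,
    with derivative 1 / f' >= 1. *)
Lemma cap_domain_exists (R : realType) (omega : R -> R) :
  modulus_of_continuity omega ->
  exists (a L : R) (A : set (R * R)) (b b' : R -> R), bounded_smooth_convex_domain A /\ cap_domain omega a L A b b'.
Proof.
move=> om.
(* The witness is 10 ^ - 9; as the area m is at least 1, a = m / L is then at least 10 ^ 8. *)
have [L [L0 L1 L2]] : exists L : R, [/\ 0 < L, L <= 1 / 100 & 10 ^+ 8 <= L^-1].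
  exists (10 ^+ 9)^-1; rewrite invrK invr_gt0 exprn_gt0 //; split => //.
    have h : (10 : R) ^+ 2 = 100 by rewrite expr2 -natrM.
    rewrite mul1r lef_pV2 ?posrE ?exprn_gt0 // -h.
    by apply: ler_weXn2l; rewrite ?ler1n.
  by apply: ler_weXn2l; rewrite ?ler1n.
have [f [f' pf]] := profile_exists om L0.
have [sub up low mono _] := profile_facts pf L0 L1.
have [dia1_ dia2_ oD0 cD0 bD0] := diamond_facts 0 pf L0 L1.
have box : `]-(1/2), 1/2[%classic `*` `]-(1/2), 1/2[%classic `<=` diamond f (0 : R).
  move=> z [/= ]; rewrite !in_itv /= => /andP[h1 h2] /andP[h3 h4].
  have k1 : `|z.1 - 0| < 1 / 2 by rewrite subr0 ltr_norml; apply/andP; split; move: h1 h2; clear; lra.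
  have k2 : `|z.2| < 1 / 2 by rewrite ltr_norml; apply/andP; split; move: h3 h4; clear; lra.
  have /andP[_ k3] := up (z.1 - 0); have /andP[_ k4] := up z.2.
  by split; move: k1 k2 k3 k4; clear; lra.
have mD0 := open_measurable2 oD0.
have [m m0 Em] : exists2 m : R, 1 <= m & I2 (diamond f 0) (fun=> 1) = m%:E.
  have bz z : diamond f 0 z -> `|z.1| <= 1 /\ `|z.2| <= 1.
    by move=> /bD0[h1 h2]; rewrite subr0 in h1; split; exact: ltW.
  have fin := I2_1_fin mD0 bz.
  exists (fine (I2 (diamond f 0) (fun=> 1))); last by rewrite fineK.
  rewrite -lee_fin fineK //.
  have := @I2_box R (- (1 / 2)) (1 / 2) (- (1 / 2)) (1 / 2) ltac:(clear; lra) ltac:(clear; lra).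
  rewrite (_ : (1 / 2 - - (1 / 2)) * (1 / 2 - - (1 / 2)) = 1); last by field.
  by move=> <-; apply: I2_subset => //; exact: measurableX.
(* The area m is computed for the diamond centred at 0 and is invariant under translation, so the
   requirement that the area be a L can be solved for a. *)
pose a := m / L; pose p := a + 1.
have a8 : 10 ^+ 8 <= a by apply: le_trans L2 _; rewrite ler_peMl // invr_ge0 ltW.
have [dia1 dia2 oD cD bD] := diamond_facts p pf L0 L1.
have strict s t : L / 2 < s -> s < t -> f s < f t.
  move=> s0 st; apply: lt_le_trans (sub s t); rewrite ltrDl mulr_gt0 ?subr_gt0 //.
  exact: (pf_pos pf).
have strict' s t : L / 2 < s -> L / 2 < t -> f s = f t -> s = t.
  by move=> s0 t0 E; have [h|h|//] := ltgtP s t; [have := strict _ _ s0 h|have := strict _ _ t0 h]; rewrite E ltxx.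
have cf (t : R) : {for t, continuous f}.
  by have [d _] := pf_der pf t; apply: differentiable_continuous; apply/derivable1_diffP.
have f2 : f (L / 2) = 0 by rewrite (pf_zero pf) // ger0_norm // divr_ge0 // ltW.
have inv s : exists t, a < s -> s < a + 2 / 5 -> [/\ L / 2 < t, t <= 2^-1 & f t = s - a].
  have [sa|sa] := ltP a s; last by exists 0.
  have [sb|sb] := ltP s (a + 2 / 5); last by exists 0.
  have [|||t tin E] := @IVT R f (L / 2) 2^-1 (s - a).
  - by move: L1; clear; lra.
  - by apply: continuous_subspaceT => x; exact: cf.
  - have := low 2^-1; rewrite ger0_norm ?invr_ge0 // => h.
    by rewrite f2 ge_min le_max subr_ge0 (ltW sa) /=; apply/orP; right; move: h sb L1; clear; lra.
  exists t => _ _; move: tin; rewrite in_itv /= => /andP[t1 t2]; split => //.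
  rewrite lt_neqAle t1 andbT; apply/eqP => h; move: E; rewrite -h f2 => /eqP.
  by rewrite eq_sym subr_eq0 => /eqP h2; move: sa; rewrite h2 ltxx.
have /choice[b hb] := inv.
pose b' s := (f' (b s))^-1.
have mb s r : a < s -> s < r -> r < a + 2 / 5 -> b s < b r.
  move=> h1 h2 h3; have [k1 k2 k3] := hb s h1 (lt_trans h2 h3); have [k4 k5 k6] := hb r (lt_trans h1 h2) h3.
  rewrite ltNge; apply/negP; rewrite le_eqVlt => /orP[/eqP h|h].
    by move: k3 k6; rewrite h => -> /eqP; rewrite (inj_eq (addIr _)) lt_eqF.
  by have := strict _ _ k4 h; rewrite k3 k6 ltrD2r => h'; have := lt_trans h' h2; rewrite ltxx.
have fp s : a < s -> s < a + 2 / 5 -> 0 < f' (b s) by move=> h1 h2; have [k1 _ _] := hb s h1 h2; exact: (pf_pos pf).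
have step s r : a < s -> s < r -> r < a + 2 / 5 -> b' r * (r - s) <= b r - b s <= b' s * (r - s).
  move=> h1 h2 h3; have [k1 k2 k3] := hb s h1 (lt_trans h2 h3); have [k4 k5 k6] := hb r (lt_trans h1 h2) h3.
  have q1 := sub (b s) (b r); have q2 := sub (b r) (b s); rewrite k3 k6 in q1 q2.
  have p1 := fp s h1 (lt_trans h2 h3); have p2 := fp r (lt_trans h1 h2) h3.
  apply/andP; split; first by rewrite /b' ler_pdivrMl //; move: q2; clear; lra.
  by rewrite /b' ler_pdivlMl //; move: q1; clear; lra.
have cb s : a < s -> s < a + 2 / 5 -> {for s, continuous b}.
  move=> h1 h2; pose s0 := (a + s) / 2; have as0 : a < s0 by rewrite /s0; move: h1; clear; lra.
  have s0s : s0 < s by rewrite /s0; move: h1; clear; lra.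
  have k0 : 0 < b' s0 by rewrite invr_gt0 fp //; exact: lt_trans h2.
  have bb x : s0 <= x -> x < a + 2 / 5 -> b' x <= b' s0.
    move=> x1 x2; rewrite lef_pV2 ?posrE ?fp //; last 2 first.
    - exact: lt_le_trans x1.
    - exact: lt_trans h2.
    apply: (pf_mono pf); move: x1; rewrite le_eqVlt => /orP[/eqP ->//|x1]; apply/ltW/mb => //.
  apply/cvgrPdist_le => e e0.
  have n1 : \forall y \near s, s0 < y by apply: (cvgr_gt _ cvg_id).
  have n2 : \forall y \near s, y < a + 2 / 5 by apply: (cvgr_lt _ cvg_id).
  have n3 : \forall y \near s, `|s - y| < e / b' s0 by apply: nbhsx_ballx; rewrite divr_gt0.
  near=> y; have y1 : s0 < y by near: y.
  have y2 : y < a + 2 / 5 by near: y.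
  have y3 : `|s - y| < e / b' s0 by near: y.
  rewrite ltr_pdivlMr // in y3; apply: le_trans (ltW y3).
  have ay : a < y by exact: lt_trans y1.
  have [sy|ys|->] := ltgtP s y; last by rewrite subrr normr0 mulr_ge0 // ltW.
    have /andP[_ k] := step _ _ h1 sy y2; have := bb s (ltW s0s) h2 => k2.
    rewrite distrC ger0_norm ?subr_ge0; last by apply/ltW/mb.
    rewrite (distrC s) (gtr0_norm (_ : 0 < y - s)) ?subr_gt0 //; apply: le_trans k _.
    by rewrite mulrC ler_wpM2l // subr_ge0 ltW.
  have /andP[_ k] := step _ _ ay ys h2; have := bb y (ltW y1) y2 => k2.
  rewrite ger0_norm ?subr_ge0; last by apply/ltW/mb.
  rewrite (gtr0_norm (_ : 0 < s - y)) ?subr_gt0 //; apply: le_trans k _.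
  by rewrite mulrC ler_wpM2l // subr_ge0 ltW.
have cb' s : a < s -> s < a + 2 / 5 -> {for s, continuous b'}.
  move=> h1 h2; have q : {for s, continuous (f' \o b)}.
    by apply: continuous_comp; [exact: cb|exact: (pf_cont pf)].
  by apply: (cvgV _ q); rewrite gt_eqF // fp.
exists a, L, (diamond f p), b, b'; split; first exact: (diamond_smooth p pf L0 L1).
split => //.
- move=> z /bD[h1 h2]; split => //; move: h1; rewrite /p ltr_norml => /andP[h3 h4].
  by apply/andP; split; move: h3 h4; clear; lra.
- by move=> z [h1 h2]; split => /=; rewrite ?normrN ?(pf_even pf).
- move=> z; rewrite (_ : z.1 - a - 1 = z.1 - p); last by rewrite /p; ring.
  have /andP[_ k1] := up (z.1 - p); have /andP[_ k2] := up z.2.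
  by move=> h; split; move: h k1 k2; clear; lra.
- move=> t z t1 t2 /bD[h1 h2]; have tL : `|t| < L / 2 by rewrite ltr_norml t1.
  by apply/dia1 => /=; [move: tL L1; clear; lra|rewrite (pf_zero pf) ?addr0 // ltW].
- by rewrite L0 /=; move: L1; clear; lra.
(* The translation by (p, 0) is a scaling of ratio 1. *)
- rewrite (@I2_scale R (p, 0) 1 (diamond f p)) //; last exact: open_measurable2.
  rewrite mulr1 mul1e (_ : [set z | _] = diamond f 0).
    by rewrite Em /a mulfVK // gt_eqF.
  by apply/seteqP; split => z; rewrite /diamond /= add0r !mul1r addrAC subrr add0r subr0.
- move=> s t h1 h2; have [k1 k2 k3] := hb s h1 h2.
  have sp : `|s - p| = 1 - (s - a) by rewrite /p ler0_norm; [ring|move: h2; clear; lra].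
  have [t9|t9] := ltP `|t| (9 / 10).
    rewrite dia1 //= sp (_ : (1 - (s - a) + f t < 1) = (f t < f (b s))); last first.
      by rewrite k3; apply/idP/idP; clear; lra.
    have b0 : 0 <= b s by apply: ltW; apply: lt_trans k1; rewrite divr_gt0.
    split => h.
      by rewrite ltNge; apply/negP => h'; have := mono (b s) t; rewrite (ger0_norm b0) => /(_ h') h''; have := lt_le_trans h h''; rewrite ltxx.
    have [tL|tL] := leP `|t| (L / 2); first by rewrite (pf_zero pf tL) k3 subr_gt0.
    have <- : f `|t| = f t by case: (ger0P t) => // _; rewrite (pf_even pf).
    exact: strict.
  split; last by move=> h; move: h t9 k2; clear; lra.
  by move=> [/= h _]; rewrite sp in h; have := low t; move: h t9 h2 L1; clear; lra.
- by move=> s h1 h2; have [k1 k2 k3] := hb s h1 h2; rewrite k1.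
- by move=> s r h1; rewrite le_eqVlt => /orP[/eqP ->//|h2] h3; apply/ltW/mb.
- move=> s h1 h2; split; last by rewrite /b' -[X in X <= _]invr1 lef_pV2 ?posrE ?fp // (pf_le1 pf).
  have d : is_derive s 1 (fun x => - b x) (- b' s).
    pose e := Num.min (s - a) (a + 2 / 5 - s).
    have e0 : 0 < e by rewrite lt_min !subr_gt0 h1.
    have e1 : e <= s - a by rewrite ge_min lexx.
    have e2 : e <= a + 2 / 5 - s by rewrite ge_min lexx orbT.
    apply: (@squeeze_derive R (fun x => - b x) (fun x => - b' x) s e) => //.
      by apply: cvgN; exact: cb'.
    move=> x y x1 x2 x3; have /andP[q1 q2] := step x y ltac:(move: x1 e1; clear; lra) x2 ltac:(move: x3 e2; clear; lra).
    by apply/andP; split; move: q1 q2; clear; lra.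
  rewrite (_ : b = fun x => - - b x); last by apply/funext => x; rewrite opprK.
  by apply: is_derive_eq (is_deriveN d) _; rewrite opprK.
move=> e e0; have e'0 : 0 < Num.min e (2 / 5) by rewrite lt_min e0 divr_gt0.
have [g [/andP[g0 ge] og fg]] := pf_flat pf e'0.
have m1 : Num.min e (2 / 5) <= e by rewrite ge_min lexx.
have m2 : Num.min e (2 / 5) <= 2 / 5 by rewrite ge_min lexx orbT.
have Lg : L / 2 < L / 2 + g by rewrite ltrDl.
have fpos : 0 < f (L / 2 + g).
  have h1 : L / 2 < L / 2 + g / 2 by rewrite ltrDl divr_gt0.
  have h2 : L / 2 + g / 2 < L / 2 + g by move: g0; clear; lra.
  by apply: le_lt_trans (strict _ _ h1 h2); have /andP[] := up (L / 2 + g / 2).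
have s1 : a < a + f (L / 2 + g) by rewrite ltrDl.
have s2 : a + f (L / 2 + g) < a + 2 / 5 by rewrite ltrD2l; exact: lt_le_trans m2.
exists (a + f (L / 2 + g)), g; rewrite (addrC a) addrK; split => //.
- by rewrite addrC s1 ltrD2l; exact: lt_le_trans m1.
- by rewrite g0; exact: lt_le_trans m1.
rewrite addrC; have [k1 k2 k3] := hb _ s1 s2; apply: strict' => //.
by rewrite k3 addrAC subrr add0r.
Unshelve. all: by end_near. Qed.

Theorem theorem1p3 (R : realType) (omega : R -> R)
    (omega_modulus : modulus_of_continuity omega) :
  exists Omega : set (R * R),
    bounded_smooth_convex_domain Omega /\
    exists u : R * R -> R,
      [/\ is_minimizer Omega u,
          forall v : R * R -> R, is_minimizer Omega v ->
            forall x : R * R, Omega x -> v x = u x,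
          C1_on Omega u
        & ereal_sup [set q : \bar R | exists x y : R * R,
            [/\ Omega x, Omega y, x != y
              & q = (enorm (gradient u x - gradient u y)
                       / omega (enorm (x - y)))%:E]] = +oo%E].
Proof.
have [a [L [A [b [b' [sA H]]]]]] := cap_domain_exists omega_modulus.
exists A; split => //.
have oA := cd_open H; have cA := cd_cvx H; have hX z : A z -> _ := @cd_X R omega a L A b b' z H.
have /andP[L0 _] := cd_L H.
have T01 : - (L / 2) < L / 2 by move: L0; clear; lra.
have hT := cd_slab H.
have hp (y : R * R) : `|y.1 - (a + 1)| <= 1 / 4 -> `|y.2 - 0| <= 1 / 4 -> A y.
  rewrite subr0 => h1 h2; apply: (cd_diamond H).
  rewrite (_ : y.1 - a - 1 = y.1 - (a + 1)); last by ring.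
  by move: h1 h2; clear; lra.
have r0 : (0 : R) < 1 / 4 by clear; lra.
have [u [mu un [Ku fu] mE _]] := @exists_minimizer R A (a + 2) _ _ (1 / 4) (a + 1, 0) oA cA hX T01 hT r0 hp.
have [C1 G] := minimizer_C1 oA cA hX Ku fu mE.
exists u; split => //.
have M : cap_min A u.
  split => // [z Az|z Az|z Az|z Az|z Az]; try by case: (G z Az).
  (* Evenness follows from uniqueness, since the reflected function has the same energy. *)
  have [Kv Ev] := En_flip oA cA (@cd_even _ _ _ _ _ _ _ H) Ku.
  by rewrite (min_unique oA cA hX T01 hT Ku Kv fu mE _ Az) // => f Kf; rewrite Ev; exact: mE.
have hg z : A z -> gradient u z = (r1 u z, r2 u z) by move=> /G[].
apply/eqP; rewrite eq_le leey /= leNgt; apply/negP => h.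
set S := [set q | _] in h.
have key (N : R) : 0 < N -> (N%:E <= ereal_sup S)%E.
  move=> N0; have [x [y [Ax Ay xy hN]]] := flat_ratio omega_modulus H M hg N0.
  by apply: le_trans (ereal_sup_ubound (_ : S _)); last (by exists x, y); rewrite lee_fin.
have s1 := key 1 ltr01.
have sf : ereal_sup S \is a fin_num.
  by rewrite fin_numE -ltey h andbT; apply/eqP => E; move: s1; rewrite E leeNy_eq.
have := key (fine (ereal_sup S) + 1); rewrite -{3}(fineK sf) lee_fin => k.
have f1 : 1 <= fine (ereal_sup S) by rewrite -lee_fin fineK.
have /k : 0 < fine (ereal_sup S) + 1 by move: f1; clear; lra.
by clear; lra.
Qed.
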